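(* Let $q,\gamma,\beta,\alpha$ be real parameters with $\gamma\ne0$, and let $\sigma_\alpha=\sigma_\beta=\sigma_\mu=1$ and $\mu=0$. Let $\overrightarrow{u_0}=(u_0,w_0)\in H^1(\mathbb{T})\times H^1(\mathbb{T})$. Then there exists a unique solution $\overrightarrow{u}=(u,w)$ of the initial value problem $$ \begin{cases} 2i\partial_t u+q\,\partial_x^2u+i\gamma\,\partial_x^3u=-2i\beta(|u|^2+|w|^2)\partial_xu-2\alpha u(|u|^2+|w|^2),\\ 2i\partial_t w+q\,\partial_x^2w+i\gamma\,\partial_x^3w=-2i\beta(|w|^2+|u|^2)\partial_xw-2\alpha w(|w|^2+|u|^2),\\ u(x,0)=u_0(x),\quad w(x,0)=w_0(x), \end{cases}\qquad x\in\mathbb{T}, $$ satisfying $$(u,w)\in C(\mathbb{R};H^1(\mathbb{T})\times H^1(\mathbb{T})).$$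
   Context: $\mathbb{T}=\mathbb{R}/2\pi\mathbb{Z}$, the unknowns $u,w$ are complex valued and $2\pi$-periodic in $x$, and $H^1(\mathbb{T})$ is the usual $L^2$-based periodic Sobolev space. The general system considered in the paper is $2i\partial_tu+q\partial_x^2u+i\gamma\partial_x^3u=F_1(u,w)$, $2i\partial_tw+q\partial_x^2w+i\gamma\partial_x^3w=F_1(w,u)$ with $$F_1(u,w)=-2i\beta(|u|^2+\sigma_\beta|w|^2)\partial_xu-2\alpha u(|u|^2+\sigma_\alpha|w|^2)-2i\mu\,u\,\partial_x(|u|^2+\sigma_\mu|w|^2);$$ the system in the claim is its case $\sigma_\alpha=\sigma_\beta=\sigma_\mu=1$, $\mu=0$. Solutions are understood in the sense of the associated Duhamel integral equation. *)

(* Defs.v *)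
From HB Require Import structures.
From mathcomp Require Import all_boot all_order all_algebra.
From mathcomp Require Import all_classical all_reals all_analysis.
From mathcomp Require Import complex.

Set Implicit Arguments.
Unset Strict Implicit.
Unset Printing Implicit Defensive.

Import Order.TTheory GRing.Theory Num.Theory.
Import numFieldNormedType.Exports.

Local Open Scope classical_set_scope.
Local Open Scope ring_scope.
Local Open Scope complex_scope.

Section PeriodicSobolev.
Context {R : realType}.
Implicit Types (f g h : R -> R[i]) (z : R[i]) (k : int).

Definition sqmod z : R := complex.Re z ^+ 2 + complex.Im z ^+ 2.

Definition cis (x : R) : R[i] := cos x +i* sin x.

Definition cintegrable (A : set R) f : Prop :=
  lebesgue_measure.-integrable A (EFin \o (fun x => complex.Re (f x))) /\
  lebesgue_measure.-integrable A (EFin \o (fun x => complex.Im (f x))).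

Definition cintegral (A : set R) f : R[i] :=
  (\int[lebesgue_measure]_(x in A) complex.Re (f x)) +i*
  (\int[lebesgue_measure]_(x in A) complex.Im (f x)).

(* $\int_a^b$ for a and b in either order. *)
Definition oriented_cintegral (a b : R) f : R[i] :=
  if a <= b then cintegral `[a, b] f else - cintegral `[b, a] f.

Definition period : set R := `[0, 2 * pi].

(* Elements of L^2(T) are represented by 2 pi-periodic functions on R; two
   representatives of the same element are related by [eqae]. *)
Definition eqae f g : Prop := {ae lebesgue_measure, forall x, f x = g x}.

Definition L2T f : Prop :=
  [/\ forall x, f (x + 2 * pi) = f x,
      measurable_fun setT (fun x => complex.Re (f x)),
      measurable_fun setT (fun x => complex.Im (f x)) &
      (\int[lebesgue_measure]_(x in period) (sqmod (f x))%:E < +oo)%E].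

Definition L2inner f g : R[i] := cintegral period (fun x => f x * conjc (g x)).

Definition fourier f k : R[i] :=
  ((2 * pi)^-1)%:C * cintegral period (fun x => f x * cis (- (k%:~R * x))).

(* $\|f\|_{H^1}^2 = \sum_k (1 + k^2) |\hat f(k)|^2$, possibly infinite. *)
Definition H1sqnorm f : \bar R :=
  \esum_(k in [set: int]) ((1 + k%:~R ^+ 2) * sqmod (fourier f k))%:E.

Definition H1T f : Prop := L2T f /\ (H1sqnorm f < +oo)%E.

(* The value at +oo is junk; it is only used on elements of H^1(T). *)
Definition H1norm f : R := Num.sqrt (fine (H1sqnorm f)).

Definition continuous_H1 (u : R -> R -> R[i]) : Prop :=
  (forall t, H1T (u t)) /\
  (forall t0, H1norm (fun x => u t x - u t0 x) @[t --> t0] --> (0 : R)).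

(* A representative of the element of L^2(T) with Fourier coefficients
   $m(k) \hat f(k)$ (junk value 0 if there is none). *)
Definition fourier_multiplier (m : int -> R[i]) f : R -> R[i] :=
  xget (fun=> 0) [set g | L2T g /\ forall k, fourier g k = m k * fourier f k].

Definition deriv_x f : R -> R[i] :=
  fourier_multiplier (fun k => 0 +i* k%:~R) f.

(* $W(t) = \exp(t (\frac{iq}{2} \partial_x^2 - \frac{\gamma}{2} \partial_x^3))$,
   the group of $2i\partial_t v + q\partial_x^2 v + i\gamma\partial_x^3 v = 0$. *)
Definition linear_group (q gamma t : R) f : R -> R[i] :=
  fourier_multiplier
    (fun k => cis (t * ((gamma * k%:~R ^+ 3 - q * k%:~R ^+ 2) / 2))) f.

(* I is the integral of the L^2(T)-valued map G between a and b, in the weak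
   (Pettis) sense; it agrees with the Bochner integral when the latter
   exists, in particular when G is continuous. *)
Definition is_L2integral (G : R -> R -> R[i]) (a b : R) (I : R -> R[i]) : Prop :=
  L2T I /\
  forall h, L2T h ->
    cintegrable `[Num.min a b, Num.max a b] (fun s => L2inner (G s) h) /\
    L2inner I h = oriented_cintegral a b (fun s => L2inner (G s) h).

(* $-2i\beta(|u|^2+|w|^2)\partial_x u - 2\alpha u(|u|^2+|w|^2)$ *)
Definition nonlinearity (alpha beta : R) (u w : R -> R[i]) : R -> R[i] :=
  let u_x := deriv_x u in
  fun x =>
    - 2 * (0 +i* 1) * beta%:C * (sqmod (u x) + sqmod (w x))%:C * u_x x
    - 2 * alpha%:C * u x * (sqmod (u x) + sqmod (w x))%:C.

(* Duhamel form of $2i\partial_t v + q\partial_x^2 v + i\gamma\partial_x^3 v = F$,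
   $v(0) = v_0$:
   $v(t) = W(t)v_0 + \frac{1}{2i}\int_0^t W(t-s)F(s)\,ds$ in L^2(T). *)
Definition duhamel (q gamma : R) (v0 : R -> R[i]) (F v : R -> R -> R[i]) : Prop :=
  forall t, exists I : R -> R[i],
    is_L2integral (fun s => linear_group q gamma (t - s) (F s)) 0 t I /\
    eqae (v t) (fun x => linear_group q gamma t v0 x + I x / (2 * (0 +i* 1))).

Definition is_solution (q gamma beta alpha : R) (u0 w0 : R -> R[i])
    (u w : R -> R -> R[i]) : Prop :=
  duhamel q gamma u0 (fun s => nonlinearity alpha beta (u s) (w s)) u /\
  duhamel q gamma w0 (fun s => nonlinearity alpha beta (w s) (u s)) w.

End PeriodicSobolev.

(* Main.v *)
Require Import Defs.
From mathcomp Require Import all_boot all_order all_algebra.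
From mathcomp Require Import all_classical all_reals all_analysis.
From mathcomp Require Import complex.
From mathcomp Require Import ring lra zify.
From mathcomp Require Import measurable_realfun.

Set Implicit Arguments.
Unset Strict Implicit.
Unset Printing Implicit Defensive.

Import Order.TTheory GRing.Theory Num.Theory.
Import numFieldNormedType.Exports.
Import Normc.

Local Open Scope classical_set_scope.
Local Open Scope ring_scope.
Local Open Scope complex_scope.

(** On the Fourier side a trajectory is a pair of sequences U(t) j n, j marking
    the component, and the system becomes
      U_n' = i phi(n) U_n + sum over n1, n2 of i (alpha - beta n3) rho(n1,n2) U_{n3},
    with n3 = n - n1 + n2, phi(n) = b n^3 - a n^2, a = q/2, b = gamma/2, and
    rho(n1,n2) = u_{n1} conj(u_{n2}) + w_{n1} conj(w_{n2}). The cubic sum loses one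
    derivative, so a contraction in H^1 is not immediately available, and the
    proof has three parts.

    Uniqueness and continuity in time are obtained together by a normal form.
    The resonance function phi(n) - phi(n1) + phi(n2) - phi(n3) factorizes as
    (3 b s - 2 a)(n - n1)(n1 - n2), s = n + n2 ([OmE]). The terms with n1 = n2
    amount to a multiple of the mass, which is conserved ([mass_Ncub]) and is
    therefore removed by phases rotating at a constant rate ([cub_diag]). On the
    remaining terms, either the resonance function is bounded by Lam, and then
    the constraint on the frequencies regains the derivative ([kaR_bound]), or
    it is larger than Lam, and the term is integrated by parts in time: the
    boundary term is small for large Lam ([kaB_small]), and in the other terms
    the division by the resonance function regains the derivative
    ([kaB_deriv]). All these kernel bounds are compared with one master kernel
    [mker]. The reduced equation is a contraction in H^1 for any two bounded
    trajectories ([nf_unique_local]), which gives [wsol_unique]; the same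
    estimates for a single trajectory give [wsol_continuous]. Boundedness in H^1 and
    the equation for each coefficient are all that is assumed.

    Existence is obtained from the Galerkin systems on |n| <= N, which are
    solved for all times by conservation of mass ([galerkin_exists]). A bound
    in H^1 that is uniform in N comes from the modified energy
      sum n^2 |U_n|^2 + sum over s of mu(s) |(u_j u_k)^_s|^2,
      mu(s) = (alpha - beta s / 2) / (3 b s - 2 a),
    where mu is chosen so that the linear evolution of the correction cancels
    the cubic growth of the first sum ([is_derive_energy]). The remaining
    sextic growth is controlled as follows. The weight mu equals a constant up
    to O(1/|s|) ([mu_decay]); the constant contributes the integral of a
    derivative, hence nothing but a truncation error ([SX_diff], [QP1_small]);
    the decaying part contributes at most E log E for an energy E, as a bounded
    summable sequence against 1/|s| only loses a logarithm ([bsum_log]). Since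
    E log E still gives a global bound for each time ([bootstrap],
    [galerkin_apriori]), a limit along an ultrafilter of dimensions N gives a
    global solution bounded in H^1 locally in time ([wsol_exists]).

    The last part returns from coefficients to functions. The exponentials
    are complete ([fourier_complete], by Fejer kernels and Lebesgue
    differentiation) and square-summable coefficients are realized
    ([riesz_fischer]), so the multipliers are well defined on L^2; the Fourier
    coefficients of the nonlinearity are the cubic sums ([nonlinearity_spec]).
    The Duhamel formula tested against exponentials is the integrated equation
    for each coefficient ([ode_of_duhamel]), and conversely the coefficient
    equations give the weak integral by Parseval, uniformly in time on the
    partial sums ([duhamel_of_ode]). *)

Ltac posi := repeat first
  [ assumption | (apply: ltW; assumption) | exact: sqr_ge0 | exact: normr_ge0
  | exact: sqrtr_ge0 | exact: ler0n | exact: ler01 | apply: addr_ge0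
  | apply: mulr_ge0 | apply: exprn_ge0 | rewrite invr_ge0 ].

(** * Complex modulus *)

Section Modulus.
Context {R : realType}.
Implicit Types (z : R[i]) (a b : R).

Lemma ler_sqr_nneg a b : 0 <= a -> a <= b -> a ^+ 2 <= b ^+ 2.
Proof. by move=> a0 ab; rewrite ler_pXn2r ?nnegrE// (le_trans a0). Qed.

Lemma sqmod_normc z : sqmod z = normc z ^+ 2.
Proof. by case: z => a b; rewrite /sqmod/= sqr_sqrtr// addr_ge0 ?sqr_ge0. Qed.

Lemma normc_ge0 z : 0 <= normc z.
Proof. by case: z => a b; exact: sqrtr_ge0. Qed.

Lemma normc_sqrt z : normc z = Num.sqrt (sqmod z).
Proof. by rewrite sqmod_normc sqrtr_sqr ger0_norm ?normc_ge0. Qed.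

Lemma sqmod_ge0 z : 0 <= sqmod z.
Proof. by rewrite sqmod_normc sqr_ge0. Qed.

Lemma sqmodM z z' : sqmod (z * z') = sqmod z * sqmod z'.
Proof. by rewrite !sqmod_normc normcM exprMn. Qed.

Lemma sqmodN z : sqmod (- z) = sqmod z.
Proof. by rewrite !sqmod_normc normcN. Qed.

Lemma sqmod0 : sqmod (0 : R[i]) = 0.
Proof. by rewrite /sqmod/= expr0n/= addr0. Qed.

Lemma sqmodJ z : sqmod (conjc z) = sqmod z.
Proof. by case: z => a b; rewrite /sqmod/= sqrrN. Qed.

Lemma cJM z z' : conjc (z * z') = conjc z * conjc z'.
Proof. exact: rmorphM. Qed.

Lemma normcJ' z : normc (conjc z) = normc z.
Proof. by rewrite !normc_sqrt sqmodJ. Qed.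

Lemma sqmod_real a : sqmod (a%:C : R[i]) = a ^+ 2.
Proof. by rewrite /sqmod/= expr0n/= addr0. Qed.

Lemma normc_real a : normc (a%:C : R[i]) = `|a|.
Proof. by rewrite normc_sqrt sqmod_real sqrtr_sqr. Qed.

Lemma sqmod_cis a : sqmod (cis a) = 1.
Proof. by rewrite /sqmod/= cos2Dsin2. Qed.

Lemma normc_cis a : normc (cis a) = 1.
Proof. by rewrite normc_sqrt sqmod_cis sqrtr1. Qed.

Lemma cisD a b : cis (a + b) = cis a * cis b.
Proof. by rewrite /cis cosD sinD; congr (_ +i* _); ring. Qed.

Lemma cis0 : cis (0 : R) = 1.
Proof. by rewrite /cis cos0 sin0. Qed.

Lemma cisN a : cis (- a) = conjc (cis a).
Proof. by rewrite /cis cosN sinN. Qed.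

Lemma cisVK a z : cis a * (cis (- a) * z) = z.
Proof. by rewrite mulrA -cisD subrr cis0 mul1r. Qed.

Lemma cReD z z' : complex.Re (z + z') = complex.Re z + complex.Re z'.
Proof. by case: z; case: z'. Qed.

Lemma cImD z z' : complex.Im (z + z') = complex.Im z + complex.Im z'.
Proof. by case: z; case: z'. Qed.

Lemma cReN z : complex.Re (- z) = - complex.Re z. Proof. by case: z. Qed.

Lemma cImN z : complex.Im (- z) = - complex.Im z. Proof. by case: z. Qed.

Lemma cReM z z' : complex.Re (z * z') =
  complex.Re z * complex.Re z' - complex.Im z * complex.Im z'.
Proof. by case: z; case: z'. Qed.

Lemma cImM z z' : complex.Im (z * z') =
  complex.Re z * complex.Im z' + complex.Im z * complex.Re z'.
Proof. by case: z => a b; case: z' => c d /=; rewrite addrC mulrC; ring. Qed.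

Lemma cReJ z : complex.Re (conjc z) = complex.Re z. Proof. by case: z. Qed.

Lemma cImJ z : complex.Im (conjc z) = - complex.Im z. Proof. by case: z. Qed.

Lemma cRe_sum I (r : seq I) (P : pred I) (F : I -> R[i]) :
  complex.Re (\sum_(i <- r | P i) F i) = \sum_(i <- r | P i) complex.Re (F i).
Proof. exact: (big_morph _ cReD erefl). Qed.

Lemma normc_Re z : `|complex.Re z| <= normc z.
Proof. by rewrite normc_sqrt -sqrtr_sqr ler_sqrt ?sqmod_ge0// lerDl sqr_ge0. Qed.

Lemma normc_Im z : `|complex.Im z| <= normc z.
Proof. by rewrite normc_sqrt -sqrtr_sqr ler_sqrt ?sqmod_ge0// lerDr sqr_ge0. Qed.

Lemma normc_ReIm z : normc z <= `|complex.Re z| + `|complex.Im z|.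
Proof.
rewrite -(@ler_pXn2r _ 2) ?nnegrE ?normc_ge0 ?addr_ge0//.
rewrite -sqmod_normc /sqmod -(real_normK (num_real (complex.Re z))).
rewrite -(real_normK (num_real (complex.Im z))).
have := mulr_ge0 (normr_ge0 (complex.Re z)) (normr_ge0 (complex.Im z)); nra.
Qed.

Lemma normcB z z' : normc (z - z') = normc (z' - z).
Proof. by rewrite -normcN opprB. Qed.

Lemma le_normcB z z' : normc (z - z') <= normc z + normc z'.
Proof. by rewrite -[normc z']normcN; exact: le_normcD. Qed.

Lemma normc_sum I (r : seq I) (P : pred I) (F : I -> R[i]) :
  normc (\sum_(i <- r | P i) F i) <= \sum_(i <- r | P i) normc (F i).
Proof.
elim/big_ind2 : _ => //; first by rewrite normc0.
by move=> x1 x2 y1 y2 h1 h2; apply: le_trans (le_normcD _ _) _; exact: lerD.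
Qed.

Lemma sqmod_conjM z : z * conjc z = (sqmod z)%:C.
Proof. by case: z => a b; rewrite /sqmod/=; congr (_ +i* _); ring. Qed.

Lemma normc_le_sqmod z a : 0 <= a -> sqmod z <= a ^+ 2 -> normc z <= a.
Proof. by move=> a0; rewrite sqmod_normc ler_pXn2r ?nnegrE ?normc_ge0. Qed.

Lemma normc_eps z : (forall e, 0 < e -> normc z <= e) -> z = 0.
Proof.
move=> h; apply/eq0_normc/eqP; rewrite eq_le normc_ge0 andbT.
by apply/ler_addgt0Pr => e e0; rewrite add0r h.
Qed.

End Modulus.

(** * Unconditional sums over countable index sets *)

Section BoundedSums.
Context {R : realType}.

(** An upper bound on all finite partial sums says, for a nonnegative family,
    that its sum is at most B, in a form that is invariant under reindexing and
    stable under pointwise limits. *)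
Definition bsum {I : eqType} (x : I -> R) (B : R) : Prop :=
  forall r : seq I, uniq r -> \sum_(i <- r) x i <= B.

Lemma bsum_le (I : eqType) (x y : I -> R) B :
  (forall i, x i <= y i) -> bsum y B -> bsum x B.
Proof. by move=> xy h r ur; apply: le_trans (h _ ur); exact: ler_sum. Qed.

Lemma bsumW (I : eqType) (x : I -> R) B B' : B <= B' -> bsum x B -> bsum x B'.
Proof. by move=> BB h r ur; apply: le_trans BB; exact: h. Qed.

Lemma bsum_ge0 (I : eqType) (x : I -> R) B : bsum x B -> 0 <= B.
Proof. by move=> /(_ [::] isT); rewrite big_nil. Qed.

Lemma bsum_term (I : eqType) (x : I -> R) B i : bsum x B -> x i <= B.
Proof. by move=> /(_ [:: i] isT); rewrite big_seq1. Qed.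

Lemma bsumD (I : eqType) (x y : I -> R) A B :
  bsum x A -> bsum y B -> bsum (fun i => x i + y i) (A + B).
Proof. by move=> hx hy r ur; rewrite big_split/=; apply: lerD; [exact: hx|exact: hy]. Qed.

Lemma bsumZ (I : eqType) (x : I -> R) c B :
  0 <= c -> bsum x B -> bsum (fun i => c * x i) (c * B).
Proof. by move=> c0 h r ur; rewrite -big_distrr/= ler_wpM2l// h. Qed.

Lemma bsum_inj (I J : eqType) (f : J -> I) (x : I -> R) B :
  injective f -> bsum x B -> bsum (fun j => x (f j)) B.
Proof.
move=> fi h r ur; rewrite -(big_map f xpredT x); apply: h.
by rewrite map_inj_uniq.
Qed.

Lemma bsum_prod (I J : choiceType) (x : I -> R) (y : J -> R) A B :
  (forall i, 0 <= x i) -> (forall j, 0 <= y j) ->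
  bsum x A -> bsum y B -> bsum (fun p : I * J => x p.1 * y p.2) (A * B).
Proof.
move=> x0 y0 hx hy r ur.
set r1 := undup [seq p.1 | p <- r]; set r2 := undup [seq p.2 | p <- r].
have sub : {subset r <= [seq (i, j) | i <- r1, j <- r2]}.
  case=> i j ij; apply/allpairsP; exists (i, j).
  by rewrite !mem_undup; split=> //; apply/mapP; exists (i, j).
have u12 : uniq [seq (i, j) | i <- r1, j <- r2].
  by apply: allpairs_uniq; rewrite ?undup_uniq// => -[? ?] [? ?].
apply: (@le_trans _ _ (\sum_(p <- [seq (i, j) | i <- r1, j <- r2]) x p.1 * y p.2)).
  rewrite [leRHS](bigID (mem r))/= -[leLHS]addr0 lerD//; last first.
    by apply: sumr_ge0 => p _; rewrite mulr_ge0.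
  rewrite -[leRHS]big_filter le_eqVlt; apply/orP; left; apply/eqP/perm_big.
  apply: uniq_perm; rewrite ?filter_uniq// => p; rewrite mem_filter/=.
  by case: (boolP (p \in r)) => //= /sub ->.
rewrite big_allpairs/=.
under eq_bigr do rewrite -big_distrr/=.
rewrite -big_distrl/= ler_pM ?sumr_ge0//; first by apply: hx; rewrite undup_uniq.
by apply: hy; rewrite undup_uniq.
Qed.

(** Otherwise blocks of sum larger than e could be adjoined to one another
    until their total exceeds B. *)
Lemma bsum_small_tail (I : eqType) (x : I -> R) B e : bsum x B -> 0 < e ->
  exists2 r : seq I, uniq r & forall s, uniq s -> (forall i, i \in s -> i \notin r) ->
    \sum_(i <- s) x i <= e.
Proof.
move=> hB e0; apply: contrapT => hn.
have grow k : exists2 r : seq I, uniq r & k%:R * e <= \sum_(i <- r) x i.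
  elim: k => [|k [r ur hr]]; first by exists [::] => //; rewrite big_nil mul0r.
  have [s [us [rs hs]]] : exists s, uniq s /\ (forall i, i \in s -> i \notin r) /\
      e < \sum_(i <- s) x i.
    apply: contrapT => hs; apply: hn; exists r => // s us rs.
    by rewrite leNgt; apply/negP => h; apply: hs; exists s.
  exists (s ++ r).
    rewrite cat_uniq us ur andbT; apply/hasPn => i ir; apply/negP => /rs.
    by rewrite ir.
  by rewrite big_cat/= -natr1 mulrDl mul1r addrC lerD// ltW.
have B0 := bsum_ge0 hB.
have [r ur hr] := grow (Num.truncn (B / e)).+1.
have : B < (Num.truncn (B / e)).+1%:R * e by rewrite -ltr_pdivrMr// truncnS_gt.
by move=> /lt_le_trans/(_ hr); rewrite ltNge (hB _ ur).
Qed.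

(** Fatou's lemma: every finite sum passes to the limit. *)
Lemma bsum_limit (I : eqType) (T : Type) (F : set_system T) {FF : ProperFilter F}
    (x : T -> I -> R) (y : I -> R) B :
  (forall i, x t i @[t --> F] --> y i) -> (\forall t \near F, bsum (x t) B) ->
  bsum y B.
Proof.
move=> xy hB r ur.
have : \sum_(i <- r) x t i @[t --> F] --> \sum_(i <- r) y i.
  by apply: cvg_big => [|i _]; [exact: add_continuous|exact: xy].
move=> h; apply: (cvgr_to_le h).
by apply: filterS hB => t; exact.
Qed.

Lemma CauchySchwarz_seq (I : Type) (r : seq I) (x y : I -> R) :
  (\sum_(i <- r) x i * y i) ^+ 2 <=
  (\sum_(i <- r) x i ^+ 2) * (\sum_(i <- r) y i ^+ 2).
Proof.
elim: r => [|i r ih]; first by rewrite !big_nil expr0n mulr0.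
rewrite !big_cons; set a := \sum_(_ <- r) _ in ih *; set X := \sum_(_ <- r) _ in ih *.
set Y := \sum_(_ <- r) _ in ih *.
have X0 : 0 <= X by apply: sumr_ge0 => *; exact: sqr_ge0.
have Y0 : 0 <= Y by apply: sumr_ge0 => *; exact: sqr_ge0.
set p := x i; set q := y i.
have ha : `|a| <= Num.sqrt X * Num.sqrt Y.
  by rewrite -sqrtrM// -sqrtr_sqr ler_sqrt// mulr_ge0.
rewrite -[in leRHS](sqr_sqrtr X0) -[in leRHS](sqr_sqrtr Y0).
have := sqrtr_ge0 X; have := sqrtr_ge0 Y.
move: (Num.sqrt X) (Num.sqrt Y) ha => sX sY ha sY0 sX0.
apply: (@le_trans _ _ ((`|p| * `|q| + sX * sY) ^+ 2)).
  rewrite -(real_normK (num_real (p * q + a))) ler_pXn2r ?nnegrE//.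
    by apply: le_trans (ler_normD _ _) _; rewrite normrM lerD2l.
  by rewrite addr_ge0// mulr_ge0.
rewrite -(real_normK (num_real p)) -(real_normK (num_real q)).
have := sqr_ge0 (`|p| * sY - `|q| * sX); move: `|p| `|q| => {ha} p' q'; nra.
Qed.

Lemma CauchySchwarz_bsum (I : eqType) (r : seq I) (x y : I -> R) A B :
  uniq r -> bsum (fun i => x i ^+ 2) A -> bsum (fun i => y i ^+ 2) B ->
  (\sum_(i <- r) x i * y i) ^+ 2 <= A * B.
Proof.
move=> ur hx hy; apply: le_trans (CauchySchwarz_seq _ _ _) _.
by rewrite ler_pM ?sumr_ge0// ?(hx _ ur) ?(hy _ ur)// => *; exact: sqr_ge0.
Qed.

End BoundedSums.

(** * Summation over the integers *)

Section Integers.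
Context {R : realType}.

Fixpoint zbox (K : nat) : seq int :=
  if K is K'.+1 then Posz K :: - Posz K :: zbox K' else [:: 0].

Lemma mem_zbox K n : (n \in zbox K) = (`|n| <= K)%N.
Proof.
elim: K => [|K ih]; first by rewrite inE leqn0 absz_eq0.
by rewrite /= !inE ih; lia.
Qed.

Lemma uniq_zbox K : uniq (zbox K).
Proof. by elim: K => //= K ih; rewrite !inE ih !mem_zbox; lia. Qed.

Lemma sub_zbox (r : seq int) : exists K, {subset r <= zbox K}.
Proof.
elim: r => [|n r [K h]]; first by exists 0%N.
exists (maxn `|n| K) => m; rewrite inE mem_zbox => /predU1P[->|/h].
  by rewrite leq_maxl.
by rewrite mem_zbox => /leq_trans; apply; rewrite leq_maxr.
Qed.

Lemma ler_sum_uniq (I : eqType) (r s : seq I) (x : I -> R) :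
  (forall i, 0 <= x i) -> uniq r -> uniq s -> {subset r <= s} ->
  \sum_(i <- r) x i <= \sum_(i <- s) x i.
Proof.
move=> x0 ur us rs.
rewrite [leRHS](bigID (mem r))/= -[leLHS]addr0 lerD ?sumr_ge0//.
rewrite -[leRHS]big_filter le_eqVlt; apply/orP; left; apply/eqP/perm_big.
apply: uniq_perm; rewrite ?filter_uniq// => p; rewrite mem_filter/=.
by case: (boolP (p \in r)) => //= /rs ->.
Qed.

Lemma bsum_zbox (x : int -> R) B : (forall n, 0 <= x n) ->
  (forall K, \sum_(n <- zbox K) x n <= B) -> bsum x B.
Proof.
move=> x0 h r ur; have [K rK] := sub_zbox r.
by apply: le_trans (h K); apply: ler_sum_uniq => //; exact: uniq_zbox.
Qed.

Definition w (n : int) : R := 1 + n%:~R ^+ 2.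
Definition J (n : int) : R := 1 + `|n%:~R|.
Definition iJ (n : int) : R := (J n)^-1.

Lemma J_ge1 n : 1 <= J n. Proof. by rewrite lerDl. Qed.

Lemma J_gt0 n : 0 < J n. Proof. exact: lt_le_trans (J_ge1 n). Qed.

Lemma iJ_gt0 n : 0 < iJ n. Proof. by rewrite invr_gt0 J_gt0. Qed.

Lemma iJ_ge0 n : 0 <= iJ n. Proof. exact/ltW/iJ_gt0. Qed.

Lemma iJ_le1 n : iJ n <= 1. Proof. by rewrite invf_le1 ?J_gt0 ?J_ge1. Qed.

Lemma iJK n : J n * iJ n = 1. Proof. by rewrite mulfV// gt_eqF ?J_gt0. Qed.

Lemma JN n : J (- n) = J n. Proof. by rewrite /J mulrNz normrN. Qed.

Lemma iJN n : iJ (- n) = iJ n. Proof. by rewrite /iJ JN. Qed.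

Lemma le_JD m n : J (m + n) <= J m + J n.
Proof.
rewrite /J intrD; have := ler_normD (m%:~R : R) n%:~R; have := @ler01 R; lra.
Qed.

Lemma JE n : J n = 1 + `|n|%N%:R.
Proof. by rewrite /J -intr_norm -abszE. Qed.

Lemma w_ge1 n : 1 <= w n. Proof. by rewrite lerDl sqr_ge0. Qed.

Lemma w_gt0 n : 0 < w n. Proof. exact: lt_le_trans (w_ge1 n). Qed.

Lemma w_ge0 n : 0 <= w n. Proof. exact/ltW/w_gt0. Qed.

Lemma w_le_J2 n : w n <= J n ^+ 2.
Proof.
rewrite /w /J sqrrD -(real_normK (num_real n%:~R)) expr1n mul1r.
by have := normr_ge0 (n%:~R : R); lra.
Qed.

Lemma J2_le_w n : J n ^+ 2 <= 2 * w n.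
Proof.
rewrite /w /J sqrrD -[in leRHS](real_normK (num_real n%:~R)) expr1n mul1r.
by have := sqr_ge0 (1 - `|n%:~R : R|); nra.
Qed.

Lemma iw_le n : (w n)^-1 <= 2 * iJ n ^+ 2.
Proof.
rewrite /iJ exprVn -ler_pdivrMl// -invfM lef_pV2 ?posrE ?mulr_gt0 ?w_gt0 ?J_gt0//.
exact: J2_le_w.
Qed.

(** The square of 1/(y + 1) is at most 1/y - 1/(y + 1), and the sum
    telescopes. *)
Lemma sum_iJ_tail (K L : nat) :
  \sum_(n <- zbox (K + L)) (if (K < `|n|)%N then iJ n ^+ 2 else 0) <=
  2 / K.+1%:R - 2 / (K + L).+1%:R.
Proof.
elim: L => [|L ih].
  rewrite addn0 subrr big1_seq// => n; rewrite mem_zbox /= => nK.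
  by rewrite ltnNge nK.
rewrite addnS /= !big_cons abszN absz_nat ltnS leq_addr iJN addrA.
apply: le_trans (lerD (lexx _) ih) _.
rewrite /iJ JE absz_nat exprVn -(natrD _ 1) add1n.
set a := (K + L)%N.
have a0 : (0 : R) < a.+1%:R by rewrite ltr0n.
have e : (a.+2%:R : R) = a.+1%:R + 1 by rewrite natr1.
rewrite e; move: (a.+1%:R) a0 => y y0.
suff : ((y + 1) ^+ 2)^-1 <= y^-1 - (y + 1)^-1 by move: (K.+1%:R^-1) ((y + 1) ^- 2) (y^-1) ((y + 1)^-1) => *; lra.
have -> : y^-1 - (y + 1)^-1 = (y * (y + 1))^-1.
  by field; apply/andP; split; rewrite gt_eqF//; lra.
rewrite lef_pV2 ?posrE; [nra|nra|nra].
Qed.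

Lemma bsum_iJ_tail K :
  bsum (fun n => if (K < `|n|)%N then iJ n ^+ 2 else 0) (2 / K.+1%:R).
Proof.
apply: bsum_zbox => [n|L]; first by case: ifP => // _; exact: sqr_ge0.
apply: (@le_trans _ _ (\sum_(n <- zbox (K + L)) (if (K < `|n|)%N then iJ n ^+ 2 else 0))).
  apply: ler_sum_uniq; rewrite ?uniq_zbox//.
    by move=> n; case: ifP => // _; exact: sqr_ge0.
  by move=> n; rewrite !mem_zbox => h; rewrite (leq_trans h)// leq_addl.
by apply: le_trans (sum_iJ_tail _ _) _; rewrite gerBl divr_ge0.
Qed.

Lemma bsum_iJ : bsum (fun n => iJ n ^+ 2) 3.
Proof.
apply: bsum_zbox => [n|K]; first exact: sqr_ge0.
have := @bsum_iJ_tail 0 _ (uniq_zbox K); rewrite divr1.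
have -> : \sum_(n <- zbox K) iJ n ^+ 2 =
    1 + \sum_(n <- zbox K) (if (0 < `|n|)%N then iJ n ^+ 2 else 0).
  elim: K => [|K ih].
    by rewrite /= !big_seq1 absz0 ltnn /iJ JE absz0 addr0 invr1 expr1n.
  by rewrite /= !big_cons ih abszN absz_nat /= iJN; ring.
lra.
Qed.

End Integers.

(** * Weighted square-summable sequences *)

Section WeightedL2.
Context {R : realType}.
Implicit Types (x y : int -> R[i]) (om : int -> R).

Definition l2b om x (B : R) : Prop :=
  0 <= B /\ bsum (fun n => om n * sqmod (x n)) (B ^+ 2).

Lemma l2b_ge0 om x B : l2b om x B -> 0 <= B. Proof. by case. Qed.

Lemma l2bW om x A B : A <= B -> l2b om x A -> l2b om x B.
Proof.
move=> AB [A0 h]; split; first exact: le_trans AB.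
by apply: bsumW h; rewrite ler_pXn2r ?nnegrE// (le_trans A0).
Qed.

Lemma l2b_le om om' x y B : (forall n, om n * sqmod (x n) <= om' n * sqmod (y n)) ->
  l2b om' y B -> l2b om x B.
Proof. by move=> le [B0 h]; split=> //; exact: bsum_le h. Qed.

Lemma eq_l2b om x y B : x =1 y -> l2b om x B -> l2b om y B.
Proof. by move=> e; apply: l2b_le => n; rewrite e. Qed.

Lemma l2b0 om B : 0 <= B -> l2b om (fun=> 0) B.
Proof.
by move=> B0; split=> // r _; rewrite big1 ?sqr_ge0// => i _; rewrite sqmod0 mulr0.
Qed.

Lemma l2bD om x y A B : (forall n, 0 <= om n) ->
  l2b om x A -> l2b om y B -> l2b om (fun n => x n + y n) (A + B).
Proof.
move=> om0 [A0 hx] [B0 hy]; split; first exact: addr_ge0.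
move=> r ur.
pose a n := Num.sqrt (om n) * normc (x n); pose b n := Num.sqrt (om n) * normc (y n).
have a2 n : a n ^+ 2 = om n * sqmod (x n) by rewrite exprMn sqr_sqrtr// sqmod_normc.
have b2 n : b n ^+ 2 = om n * sqmod (y n) by rewrite exprMn sqr_sqrtr// sqmod_normc.
have hA : \sum_(n <- r) a n ^+ 2 <= A ^+ 2.
  by under eq_bigr do rewrite a2; exact: hx.
have hB : \sum_(n <- r) b n ^+ 2 <= B ^+ 2.
  by under eq_bigr do rewrite b2; exact: hy.
have hAB : \sum_(n <- r) a n * b n <= A * B.
  apply: le_trans (ler_norm _) _.
  rewrite -(@ler_pXn2r _ 2) ?nnegrE ?mulr_ge0//.
  rewrite real_normK ?num_real//; apply: le_trans (CauchySchwarz_seq _ _ _) _.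
  by rewrite exprMn ler_pM// sumr_ge0// => *; exact: sqr_ge0.
apply: (@le_trans _ _ (\sum_(n <- r) (a n ^+ 2 + 2 * (a n * b n) + b n ^+ 2))).
  apply: ler_sum => n _; rewrite a2 b2 sqmod_normc.
  have -> : 2 * (a n * b n) = om n * (2 * (normc (x n) * normc (y n))).
    rewrite /a /b; transitivity (Num.sqrt (om n) ^+ 2 * (2 * (normc (x n) * normc (y n)))); first by ring.
    by rewrite sqr_sqrtr.
  rewrite -!mulrDr ler_wpM2l// !sqmod_normc -mulr_natl.
  rewrite mulr1 (_ : _ + _ + _ = (normc (x n) + normc (y n)) ^+ 2); last by ring.
  by rewrite ler_pXn2r ?nnegrE ?addr_ge0 ?normc_ge0// le_normcD.
rewrite !big_split/= -big_distrr/=; nra.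
Qed.

Lemma l2bN om x B : l2b om x B -> l2b om (fun n => - x n) B.
Proof. by apply: l2b_le => n; rewrite sqmodN. Qed.

Lemma l2bB om x y A B : (forall n, 0 <= om n) ->
  l2b om x A -> l2b om y B -> l2b om (fun n => x n - y n) (A + B).
Proof. by move=> om0 hx /l2bN; exact: l2bD. Qed.

Lemma l2b_sum (I : Type) (r : seq I) om (x : I -> int -> R[i]) (B : I -> R) :
  (forall n, 0 <= om n) -> (forall i, l2b om (x i) (B i)) ->
  l2b om (fun n => \sum_(i <- r) x i n) (\sum_(i <- r) B i).
Proof.
move=> om0 h; elim: r => [|i r ih].
  rewrite big_nil; apply: eq_l2b (l2b0 _ (lexx 0)) => n; by rewrite big_nil.
rewrite big_cons; apply: eq_l2b (l2bD om0 (h i) ih) => n; by rewrite big_cons.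
Qed.

Lemma l2bM om x (c : int -> R[i]) A B : 0 <= A -> (forall n, 0 <= om n) ->
  (forall n, normc (c n) <= A) -> l2b om x B -> l2b om (fun n => c n * x n) (A * B).
Proof.
move=> A0 om0 hc [B0 h]; split; first exact: mulr_ge0.
rewrite exprMn; apply: bsum_le (bsumZ (sqr_ge0 A) h) => n.
rewrite sqmodM mulrCA ler_wpM2r ?mulr_ge0 ?sqmod_ge0//.
by rewrite sqmod_normc ler_pXn2r ?nnegrE ?normc_ge0.
Qed.

Lemma l2b_cis om x (p : int -> R) B :
  l2b om x B -> l2b om (fun n => cis (p n) * x n) B.
Proof. by apply: l2b_le => n; rewrite sqmodM sqmod_cis mul1r. Qed.

Lemma l2b_term1 om x B n : 1 <= om n -> l2b om x B -> normc (x n) <= B.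
Proof.
move=> om1 [B0 h]; apply: normc_le_sqmod => //; apply: le_trans (bsum_term n h).
by rewrite ler_peMl ?sqmod_ge0.
Qed.

Lemma l2b_limit (T : Type) (F : set_system T) {FF : ProperFilter F} om
    (x : T -> int -> R[i]) y B :
  (forall n, sqmod (x t n) @[t --> F] --> sqmod (y n)) -> 0 <= B ->
  (\forall t \near F, l2b om (x t) B) -> l2b om y B.
Proof.
move=> xy B0 hB; split=> //; apply: (@bsum_limit _ _ _ F _ _ _ _ _ _).
  by move=> n; apply: cvgMr; exact: xy.
by apply: filterS hB => t [].
Qed.

(** Estimates that only hold on finitely many frequencies at a time, such as
    the mean value inequality, are stated with such a weight; [l2b_truncP]
    returns to the full norm. *)
Definition trunc om (r : seq int) n : R := if n \in r then om n else 0.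

Lemma trunc_ge0 om r : (forall n, 0 <= om n) -> forall n, 0 <= trunc om r n.
Proof. by move=> h n; rewrite /trunc; case: ifP. Qed.

Lemma l2b_trunc om x B r : (forall n, 0 <= om n) -> l2b om x B -> l2b (trunc om r) x B.
Proof.
move=> om0; apply: l2b_le => n; rewrite /trunc; case: ifP => // _.
by rewrite mul0r mulr_ge0 ?sqmod_ge0.
Qed.

Lemma l2b_truncP om x B : 0 <= B -> (forall r, uniq r -> l2b (trunc om r) x B) -> l2b om x B.
Proof.
move=> B0 h; split=> // r ur; have [_ /(_ _ ur)] := h _ ur.
rewrite big_seq (eq_bigr (fun n => om n * sqmod (x n))) -?big_seq// => n nr.
by rewrite /trunc nr.
Qed.

End WeightedL2.

(** * Trilinear convolution operators *)

Section Trilinear.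
Context {R : realType}.
Implicit Types (a b c x y : int -> R[i]) (om wa wb wc wo : int -> R).
Implicit Types (ka : int -> int -> int -> R[i]) (r : seq (int * int)).

Definition Tr ka a b c r (n : int) : R[i] :=
  \sum_(p <- r) ka n p.1 p.2 * a p.1 * conjc (b p.2) * c (n - p.1 + p.2).

(** Cauchy--Schwarz in the pair (n1,n2), with the square of the kernel on one
    side; the other factor is summed over n first, which removes c, and what
    remains is a product of the two other norms. *)
Lemma l2b_Tr ka wo wa wb wc a b c r S A B C : uniq r ->
  (forall n, 0 <= wo n) -> (forall n, 0 < wa n) -> (forall n, 0 < wb n) ->
  (forall n, 0 < wc n) -> 0 <= S ->
  (forall n, bsum (fun p : int * int => wo n * sqmod (ka n p.1 p.2) /
    (wa p.1 * wb p.2 * wc (n - p.1 + p.2))) (S ^+ 2)) ->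
  l2b wa a A -> l2b wb b B -> l2b wc c C ->
  l2b wo (Tr ka a b c r) (S * A * B * C).
Proof.
move=> ur wo0 wa0 wb0 wc0 S0 hS [A0 hA] [B0 hB] [C0 hC].
split; first by rewrite !mulr_ge0.
move=> s us.
pose f n (p : int * int) := wa p.1 * sqmod (a p.1) * (wb p.2 * sqmod (b p.2)) *
  (wc (n - p.1 + p.2) * sqmod (c (n - p.1 + p.2))).
have step n : wo n * sqmod (Tr ka a b c r n) <= S ^+ 2 * \sum_(p <- r) f n p.
  pose d (p : int * int) := Num.sqrt (wa p.1 * wb p.2 * wc (n - p.1 + p.2)).
  have d0 p : 0 < d p by rewrite sqrtr_gt0 !mulr_gt0.
  have d2 p : d p ^+ 2 = wa p.1 * wb p.2 * wc (n - p.1 + p.2).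
    by rewrite sqr_sqrtr// !mulr_ge0 ?ltW.
  pose X p := Num.sqrt (wo n) * normc (ka n p.1 p.2) / d p.
  pose Y p := d p * (normc (a p.1) * normc (b p.2) * normc (c (n - p.1 + p.2))).
  apply: (@le_trans _ _ ((\sum_(p <- r) X p * Y p) ^+ 2)).
    rewrite sqmod_normc -[X in X * _](sqr_sqrtr (wo0 n)) -exprMn.
    rewrite ler_pXn2r ?nnegrE ?mulr_ge0 ?sqrtr_ge0 ?normc_ge0//; last first.
      apply: sumr_ge0 => p _; rewrite /X /Y.
      by rewrite !mulr_ge0 ?invr_ge0 ?sqrtr_ge0 ?normc_ge0 ?(ltW (d0 _)).
    apply: le_trans (ler_wpM2l (sqrtr_ge0 _) (normc_sum _ _ _)) _.
    rewrite big_distrr/= ler_sum// => p _.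
    rewrite !normcM normcJ' /X /Y le_eqVlt; apply/orP; left; apply/eqP.
    by field; rewrite gt_eqF.
  apply: le_trans (CauchySchwarz_seq _ _ _) _.
  apply: ler_pM; rewrite ?sumr_ge0//; try by move=> *; exact: sqr_ge0.
    apply: le_trans (hS n r ur); apply: ler_sum => p _.
    by rewrite /X exprMn exprVn exprMn sqr_sqrtr// d2 sqmod_normc.
  apply: ler_sum => p _; rewrite /Y /f exprMn d2 !sqmod_normc !exprMn.
  by rewrite le_eqVlt; apply/orP; left; apply/eqP; ring.
apply: le_trans (ler_sum _ (fun n _ => step n)) _.
apply: (@le_trans _ _ (S ^+ 2 * \sum_(n <- s) \sum_(p <- r) f n p)).
  by rewrite mulr_sumr.
have -> : (S * A * B * C) ^+ 2 = S ^+ 2 * (A ^+ 2 * B ^+ 2 * C ^+ 2) by ring.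
apply: ler_wpM2l; first exact: sqr_ge0.
rewrite exchange_big/=.
have hf p : \sum_(n <- s) f n p <=
    wa p.1 * sqmod (a p.1) * (wb p.2 * sqmod (b p.2)) * C ^+ 2.
  rewrite /f -big_distrr/= ler_wpM2l ?mulr_ge0 ?sqmod_ge0 ?(ltW (wa0 _)) ?(ltW (wb0 _))//.
  have inj : injective (fun n : int => n - p.1 + p.2) by move=> m n /addIr/addIr.
  by have := bsum_inj inj hC; apply.
apply: le_trans (ler_sum _ (fun p _ => hf p)) _.
rewrite -mulr_suml ler_wpM2r ?sqr_ge0//.
apply: (bsum_prod (x := fun n => wa n * sqmod (a n)) (y := fun n => wb n * sqmod (b n))) => //.
- by move=> i; rewrite mulr_ge0 ?sqmod_ge0// ltW.
- by move=> i; rewrite mulr_ge0 ?sqmod_ge0// ltW.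
Qed.

Lemma Tr_sub ka a b c a' b' c' r n :
  Tr ka a b c r n - Tr ka a' b' c' r n =
  Tr ka (fun n => a n - a' n) b c r n + Tr ka a' (fun n => b n - b' n) c r n +
  Tr ka a' b' (fun n => c n - c' n) r n.
Proof.
rewrite /Tr -sumrB -!big_split/=; apply: eq_bigr => p _.
rewrite rmorphB/=; ring.
Qed.

(** The difference telescopes into three trilinear terms with one entry
    replaced by a difference. *)
Lemma l2b_Tr_sub ka wo wa wb wc a b c a' b' c' r S A B C dA dB dC : uniq r ->
  (forall n, 0 <= wo n) -> (forall n, 0 < wa n) -> (forall n, 0 < wb n) ->
  (forall n, 0 < wc n) -> 0 <= S ->
  (forall n, bsum (fun p : int * int => wo n * sqmod (ka n p.1 p.2) /
    (wa p.1 * wb p.2 * wc (n - p.1 + p.2))) (S ^+ 2)) ->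
  l2b wb b B -> l2b wc c C -> l2b wa a' A -> l2b wb b' B ->
  l2b wa (fun n => a n - a' n) dA -> l2b wb (fun n => b n - b' n) dB ->
  l2b wc (fun n => c n - c' n) dC ->
  l2b wo (fun n => Tr ka a b c r n - Tr ka a' b' c' r n)
    (S * (dA * B * C + A * dB * C + A * B * dC)).
Proof.
move=> ur wo0 wa0 wb0 wc0 S0 hS hb hc ha' hb' hda hdb hdc.
have h1 := l2b_Tr ur wo0 wa0 wb0 wc0 S0 hS hda hb hc.
have h2 := l2b_Tr ur wo0 wa0 wb0 wc0 S0 hS ha' hdb hc.
have h3 := l2b_Tr ur wo0 wa0 wb0 wc0 S0 hS ha' hb' hdc.
have := l2bD wo0 (l2bD wo0 h1 h2) h3.
rewrite (_ : _ + _ + _ = S * (dA * B * C + A * dB * C + A * B * dC)); last by ring.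
by apply: eq_l2b => n; rewrite Tr_sub.
Qed.

Definition box K : seq (int * int) := [seq (m, n) | m <- zbox K, n <- zbox K].

Lemma mem_box K p : (p \in box K) = (`|p.1| <= K)%N && (`|p.2| <= K)%N.
Proof.
case: p => m n /=; rewrite -!mem_zbox; apply/allpairsP/andP => [[[x y] [? ? [-> ->]]]//|[? ?]].
by exists (m, n).
Qed.

Lemma uniq_box K : uniq (box K).
Proof. by apply: allpairs_uniq; rewrite ?uniq_zbox// => -[? ?] [? ?]. Qed.

Lemma big_box (T : nmodType) K (F : int * int -> T) :
  \sum_(p <- box K) F p = \sum_(m <- zbox K) \sum_(n <- zbox K) F (m, n).
Proof. by rewrite big_allpairs. Qed.

Lemma big_uniq_widen (T : nmodType) (I : eqType) (r s : seq I) (F : I -> T) : uniq r -> uniq s ->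
  {subset r <= s} -> (forall i, i \notin r -> F i = 0) ->
  \sum_(i <- r) F i = \sum_(i <- s) F i.
Proof.
move=> ur us rs h; rewrite [RHS](bigID (mem r))/= [X in _ + X]big1 ?addr0//.
rewrite -[RHS]big_filter; apply: perm_big; apply: uniq_perm; rewrite ?filter_uniq// => i.
by rewrite mem_filter; case: (boolP (i \in r)) => //= /rs ->.
Qed.

(** The master kernel, with which all others are compared: six pairs (x, y) of
    independent linear forms in (n1, n2) for fixed n, for each of which the sum
    of 1/(J x J y)^2 is bounded uniformly in n. *)
Definition mker (n n1 n2 : int) : R :=
  let h := iJ (n - n1) in let k := iJ (n1 - n2) in let s := iJ (n + n2) in
  let p := iJ n1 in let q := iJ n2 in
  (h * k) ^+ 2 + (k * s) ^+ 2 + (k * p) ^+ 2 + (p * q) ^+ 2 + (h * q) ^+ 2 +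
  (s * p) ^+ 2.

Lemma bsum_pair (f : int * int -> int * int) : injective f ->
  bsum (fun p : int * int => (@iJ R (f p).1 * @iJ R (f p).2) ^+ 2) 9.
Proof.
move=> fi; apply: (bsum_inj (x := fun p : int * int => (@iJ R p.1 * @iJ R p.2) ^+ 2) fi).
have -> : (9 : R) = 3 * 3 by rewrite -natrM.
have := bsum_prod (fun i => sqr_ge0 (@iJ R i)) (fun i => sqr_ge0 (@iJ R i)) (@bsum_iJ R) (@bsum_iJ R).
by apply: bsum_le => p; rewrite exprMn.
Qed.

Lemma bsum_mker n : bsum (fun p : int * int => mker n p.1 p.2) 54.
Proof.
have -> : (54 : R) = 9 + 9 + 9 + 9 + 9 + 9 by rewrite -!natrD.
refine (bsumD (bsumD (bsumD (bsumD (bsumD _ _) _) _) _) _).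
- by apply: (@bsum_pair (fun p => (n - p.1, p.1 - p.2))) => -[a b] [a' b'] /= [] ? ?; congr pair; lia.
- by apply: (@bsum_pair (fun p => (p.1 - p.2, n + p.2))) => -[a b] [a' b'] /= [] ? ?; congr pair; lia.
- by apply: (@bsum_pair (fun p => (p.1 - p.2, p.1))) => -[a b] [a' b'] /= [] ? ?; congr pair; lia.
- by apply: (@bsum_pair (fun p => (p.1, p.2))) => -[a b] [a' b'].
- by apply: (@bsum_pair (fun p => (n - p.1, p.2))) => -[a b] [a' b'] /= [] ? ?; congr pair; lia.
- by apply: (@bsum_pair (fun p => (n + p.2, p.1))) => -[a b] [a' b'] /= [] ? ?; congr pair; lia.
Qed.

Lemma mker_ge0 n n1 n2 : 0 <= mker n n1 n2.
Proof. by rewrite !addr_ge0 ?sqr_ge0. Qed.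

Lemma mker_parts (n n1 n2 : int) : [/\ (iJ (n - n1) * iJ (n1 - n2)) ^+ 2 <= mker n n1 n2,
  (iJ (n1 - n2) * iJ (n + n2)) ^+ 2 <= mker n n1 n2,
  (iJ (n1 - n2) * iJ n1) ^+ 2 <= mker n n1 n2,
  (iJ (n - n1) * iJ n2) ^+ 2 <= mker n n1 n2 &
  (iJ (n + n2) * iJ n1) ^+ 2 <= mker n n1 n2].
Proof.
rewrite /mker; set A := (_ ^+ 2); set B := ((_ * iJ (n + n2)) ^+ 2).
set C := ((_ * iJ n1) ^+ 2); set D := ((iJ n1 * _) ^+ 2).
set E := ((iJ (n - n1) * iJ n2) ^+ 2); set F := ((_ * iJ n1) ^+ 2).
have : 0 <= A by exact: sqr_ge0.
have : 0 <= B by exact: sqr_ge0.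
have : 0 <= C by exact: sqr_ge0.
have : 0 <= D by exact: sqr_ge0.
have : 0 <= E by exact: sqr_ge0.
have : 0 <= F by exact: sqr_ge0.
by move: A B C D E F => *; split; lra.
Qed.

End Trilinear.

(** * Componentwise convergence and differentiation of complex functions *)

Section ComplexLimits.
Context {R : realType}.

Definition ccvg {T : Type} (F : set_system T) (f : T -> R[i]) (z : R[i]) : Prop :=
  (complex.Re (f t) @[t --> F] --> complex.Re z) /\
  (complex.Im (f t) @[t --> F] --> complex.Im z).

Lemma ccvg_normc T (F : set_system T) {FF : Filter F} (f : T -> R[i]) z :
  ccvg F f z -> normc (f t - z) @[t --> F] --> (0 : R).
Proof.
move=> [h1 h2]; apply: (@squeeze_cvgr _ _ _ _ (fun=> 0) (fun t =>
  `|complex.Re (f t) - complex.Re z| + `|complex.Im (f t) - complex.Im z|)).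
- near=> t; rewrite normc_ge0/=; apply: le_trans (normc_ReIm _) _.
  by rewrite !cReD !cImD !cReN !cImN.
- exact: cvg_cst.
- rewrite [X in _ --> X](_ : 0 = `|complex.Re z - complex.Re z| +
    `|complex.Im z - complex.Im z|); last by rewrite !subrr !normr0 addr0.
  by apply: cvgD; apply: cvg_norm; apply: cvgB => //; exact: cvg_cst.
Unshelve. all: by end_near. Qed.

Lemma ccvgP T (F : set_system T) {FF : Filter F} (f : T -> R[i]) z :
  (forall e, 0 < e -> \forall t \near F, normc (f t - z) <= e) -> ccvg F f z.
Proof.
move=> h; split; apply/cvgrPdist_le => e e0; have := h _ e0; apply: filterS => t ht.
  by apply: le_trans ht; rewrite distrC -cReN -cReD; exact: normc_Re.
by apply: le_trans ht; rewrite distrC -cImN -cImD; exact: normc_Im.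
Qed.

Lemma ccvg_near T (F : set_system T) {FF : Filter F} (f : T -> R[i]) z e :
  ccvg F f z -> 0 < e -> \forall t \near F, normc (f t - z) <= e.
Proof.
move=> /ccvg_normc/cvgrPdist_le h e0; have := h _ e0.
by apply: filterS => t; rewrite sub0r normrN ger0_norm ?normc_ge0.
Qed.

Lemma ccvgD T (F : set_system T) {FF : Filter F} (f g : T -> R[i]) y z :
  ccvg F f y -> ccvg F g z -> ccvg F (fun t => f t + g t) (y + z).
Proof.
move=> [h1 h2] [h3 h4]; split.
  by rewrite cReD; under eq_fun do rewrite cReD; exact: cvgD.
by rewrite cImD; under eq_fun do rewrite cImD; exact: cvgD.
Qed.

Lemma ccvgM T (F : set_system T) {FF : Filter F} (f g : T -> R[i]) y z :
  ccvg F f y -> ccvg F g z -> ccvg F (fun t => f t * g t) (y * z).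
Proof.
move=> [h1 h2] [h3 h4]; split.
  rewrite cReM; under eq_fun do rewrite cReM.
  by apply: cvgB; apply: cvgM.
rewrite cImM; under eq_fun do rewrite cImM.
by apply: cvgD; apply: cvgM.
Qed.

Lemma ccvg_cst T (F : set_system T) {FF : Filter F} z : ccvg F (fun=> z) z.
Proof. by split; exact: cvg_cst. Qed.

Lemma ccvgJ T (F : set_system T) {FF : Filter F} (f : T -> R[i]) z :
  ccvg F f z -> ccvg F (fun t => conjc (f t)) (conjc z).
Proof.
move=> [h1 h2]; split.
  by rewrite cReJ; under eq_fun do rewrite cReJ.
by rewrite cImJ; under eq_fun do rewrite cImJ; exact: cvgN.
Qed.

Lemma ccvg_sum T (F : set_system T) {FF : Filter F} (I : Type) (r : seq I)
    (f : I -> T -> R[i]) (z : I -> R[i]) : (forall i, ccvg F (f i) (z i)) ->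
  ccvg F (fun t => \sum_(i <- r) f i t) (\sum_(i <- r) z i).
Proof.
move=> h; elim: r => [|i r ih].
  by rewrite big_nil; under eq_fun do rewrite big_nil; exact: ccvg_cst.
by rewrite big_cons; under eq_fun do rewrite big_cons; exact: ccvgD.
Qed.

Lemma ccvg_sqmod T (F : set_system T) {FF : Filter F} (f : T -> R[i]) z :
  ccvg F f z -> sqmod (f t) @[t --> F] --> sqmod z.
Proof. by move=> [h1 h2]; apply: cvgD; rewrite /=; under eq_fun do rewrite expr2; rewrite expr2; exact: cvgM. Qed.

Lemma ccvg_normc_le T (F : set_system T) {FF : ProperFilter F} (f : T -> R[i]) z B :
  ccvg F f z -> (\forall t \near F, normc (f t) <= B) -> normc z <= B.
Proof.
move=> h hB; apply/ler_addgt0Pr => e e0.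
have [t [ht1 ht2]] : exists t, normc (f t) <= B /\ normc (f t - z) <= e.
  by apply: (@filter_ex _ F); near=> t; split; near: t => //; exact: ccvg_near.
have -> : z = f t - (f t - z) by rewrite opprB addrC subrK.
by apply: le_trans (le_normcB _ _) _; exact: lerD.
Unshelve. all: by end_near. Qed.

Lemma ccvg_unique T (F : set_system T) {FF : ProperFilter F} (f : T -> R[i]) y z :
  ccvg F f y -> ccvg F f z -> y = z.
Proof.
move=> [h1 h2] [h3 h4]; apply/eqP; rewrite eq_complex.
by rewrite (cvg_unique _ h1 h3)// (cvg_unique _ h2 h4)// !eqxx.
Qed.

Lemma cauchy_tail (x e : nat -> R) :
  (forall K L, (K <= L)%N -> `|x L - x K| <= e K) -> e K @[K --> \oo] --> 0 ->
  cvgn x.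
Proof.
move=> h e0; apply/cauchy_cvgP/cauchy_exP => eps eps0.
have /cvgrPdist_lt/(_ _ eps0)[K _ hK] := e0.
exists (x K), K => // L /= KL; rewrite /ball/= distrC; apply: le_lt_trans (h _ _ KL) _.
by apply: le_lt_trans (ler_norm _) _; rewrite -normrN -sub0r; exact: hK (leqnn K).
Qed.

Definition climn (x : nat -> R[i]) : R[i] :=
  limn (fun K => complex.Re (x K)) +i* limn (fun K => complex.Im (x K)).

Lemma climnP (x : nat -> R[i]) (e : nat -> R) :
  (forall K L, (K <= L)%N -> normc (x L - x K) <= e K) -> e K @[K --> \oo] --> 0 ->
  ccvg \oo x (climn x).
Proof.
move=> h e0; split.
  apply: (@cauchy_tail _ e) => // K L KL; apply: le_trans (h _ _ KL).
  by rewrite -cReN -cReD normc_Re.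
apply: (@cauchy_tail _ e) => // K L KL; apply: le_trans (h _ _ KL).
by rewrite -cImN -cImD normc_Im.
Qed.

Definition cder (f : R -> R[i]) (t : R) (z : R[i]) : Prop :=
  is_derive t (1 : R) (fun s => complex.Re (f s) : R) (complex.Re z) /\
  is_derive t (1 : R) (fun s => complex.Im (f s) : R) (complex.Im z).

Lemma cder_eq f t y z : cder f t y -> y = z -> cder f t z.
Proof. by move=> ? <-. Qed.

Lemma cderD f g t y z : cder f t y -> cder g t z -> cder (fun s => f s + g s) t (y + z).
Proof.
move=> [h1 h2] [h3 h4]; split.
  by rewrite cReD; under eq_fun do rewrite cReD; exact: is_deriveD.
by rewrite cImD; under eq_fun do rewrite cImD; exact: is_deriveD.
Qed.

Lemma cderM f g t y z : cder f t y -> cder g t z ->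
  cder (fun s => f s * g s) t (y * g t + f t * z).
Proof.
move=> [h1 h2] [h3 h4]; split.
  under eq_fun do rewrite cReM.
  apply: is_derive_eq; rewrite cReD !cReM /GRing.scale/=; ring.
under eq_fun do rewrite cImM.
apply: is_derive_eq; rewrite cImD !cImM /GRing.scale/=; ring.
Qed.

Lemma cder_cst z t : cder (fun=> z) t 0.
Proof. by split; exact: is_derive_cst. Qed.

Lemma cderN f t y : cder f t y -> cder (fun s => - f s) t (- y).
Proof.
move=> [h1 h2]; split.
  by rewrite cReN; under eq_fun do rewrite cReN; exact: is_deriveN.
by rewrite cImN; under eq_fun do rewrite cImN; exact: is_deriveN.
Qed.

Lemma cderB f g t y z : cder f t y -> cder g t z -> cder (fun s => f s - g s) t (y - z).
Proof. by move=> h1 /cderN h2; exact: cderD. Qed.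

Lemma cderZ c f t y : cder f t y -> cder (fun s => c * f s) t (c * y).
Proof. by move=> h; apply: cder_eq (cderM (cder_cst c t) h) _; rewrite mul0r add0r. Qed.

Lemma cderJ f t y : cder f t y -> cder (fun s => conjc (f s)) t (conjc y).
Proof.
move=> [h1 h2]; split.
  by rewrite cReJ; under eq_fun do rewrite cReJ.
by rewrite cImJ; under eq_fun do rewrite cImJ; exact: is_deriveN.
Qed.

Lemma cder_sum (I : Type) (r : seq I) (f : I -> R -> R[i]) t (z : I -> R[i]) :
  (forall i, cder (f i) t (z i)) ->
  cder (fun s => \sum_(i <- r) f i s) t (\sum_(i <- r) z i).
Proof.
move=> h; elim: r => [|i r ih].
  by rewrite big_nil; under eq_fun do rewrite big_nil; exact: cder_cst.
by rewrite big_cons; under eq_fun do rewrite big_cons; exact: cderD.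
Qed.

Lemma cder_cis c t : cder (fun s => cis (c * s)) t ((0 +i* c) * cis (c * t)).
Proof.
split=> /=.
  apply: is_derive_eq; rewrite /GRing.scale/=; ring.
apply: is_derive_eq; rewrite /GRing.scale/=; ring.
Qed.

Lemma cder_ccvg f t z : cder f t z -> ccvg (nbhs t) f (f t).
Proof.
move=> [h1 h2]; split; apply: differentiable_continuous; apply/derivable1_diffP.
  exact: (@ex_derive _ _ _ _ _ _ _ h1).
exact: (@ex_derive _ _ _ _ _ _ _ h2).
Qed.

Lemma mean_value_le (f df : R -> R) (t0 t B : R) :
  (forall s, `|s - t0| <= `|t - t0| -> is_derive s (1 : R) f (df s)) ->
  (forall s, `|s - t0| <= `|t - t0| -> `|df s| <= B) ->
  `|f t - f t0| <= `|t - t0| * B.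
Proof.
move=> hd hB.
have cf s : `|s - t0| <= `|t - t0| -> {for s, continuous f}.
  move=> hs; apply: differentiable_continuous; apply/derivable1_diffP.
  exact: (@ex_derive _ _ _ _ _ _ _ (hd s hs)).
have [tt|/ltW tt] := leP t0 t.
  have sub s : s \in `[t0, t] -> `|s - t0| <= `|t - t0|.
    by rewrite in_itv/= => /andP[? ?]; rewrite !ger0_norm ?subr_ge0// lerD2r.
  have [||c hc ->] := @MVT_segment _ f df t0 t tt.
  - by move=> s hs; apply/hd/sub; move: hs; rewrite !in_itv/= => /andP[/ltW -> /ltW ->].
  - by apply: derivable_within_continuous => s hs; exact: (@ex_derive _ _ _ _ _ _ _ (hd s (sub _ hs))).
  by rewrite normrM mulrC ler_wpM2l// hB// sub.
have sub s : s \in `[t, t0] -> `|s - t0| <= `|t - t0|.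
  rewrite in_itv/= => /andP[? ?]; rewrite ![`|_ - t0|]distrC.
  by rewrite !ger0_norm ?subr_ge0// lerD2l lerN2.
have [||c hc e] := @MVT_segment _ f df t t0 tt.
- by move=> s hs; apply/hd/sub; move: hs; rewrite !in_itv/= => /andP[/ltW -> /ltW ->].
- by apply: derivable_within_continuous => s hs; exact: (@ex_derive _ _ _ _ _ _ _ (hd s (sub _ hs))).
by rewrite distrC e normrM mulrC [`|t0 - t|]distrC ler_wpM2l// hB// sub.
Qed.

Lemma sqmod_cisB (x y : R) : sqmod (cis x - cis y) <= 2 * `|x - y|.
Proof.
have e : sqmod (cis x - cis y) = 2 * (1 - cos (x - y)).
  rewrite /sqmod/= cosB; have := cos2Dsin2 x; have := cos2Dsin2 y; lra.
rewrite e ler_wpM2l//.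
have : `|cos (x - y) - cos 0| <= `|x - y - 0| * 1.
  apply: (@mean_value_le (cos : R -> R) (fun z => - sin z) 0 (x - y) 1).
  by move=> z _; rewrite normrN ler_norml sin_geN1 sin_le1.
by rewrite cos0 subr0 mulr1 distrC; apply: le_trans; exact: ler_norm.
Qed.

Lemma is_derive_sum_seq (I : eqType) (r : seq I) (f : I -> R -> R) (df : I -> R) (t : R) :
  (forall i, i \in r -> is_derive t (1 : R) (f i) (df i)) ->
  is_derive t (1 : R) (fun s => \sum_(i <- r) f i s) (\sum_(i <- r) df i).
Proof.
elim: r => [|i r ih] h.
  by rewrite big_nil; under eq_fun do rewrite big_nil; exact: is_derive_cst.
rewrite big_cons; under eq_fun do rewrite big_cons.
apply: is_deriveD; first by apply: h; rewrite mem_head.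
by apply: ih => j jr; apply: h; rewrite inE jr orbT.
Qed.

(** The mean value inequality in a weighted l^2 norm, obtained by testing
    against the increment itself. *)
Lemma l2b_mean_value (om : int -> R) (r : seq int) (f g : R -> int -> R[i]) (t0 t B : R) :
  (forall n, 0 <= om n) -> uniq r ->
  (forall s n, `|s - t0| <= `|t - t0| -> n \in r -> cder (fun s => f s n) s (g s n)) ->
  (forall s, `|s - t0| <= `|t - t0| -> l2b (trunc om r) (g s) B) ->
  l2b (trunc om r) (fun n => f t n - f t0 n) (`|t - t0| * B).
Proof.
move=> om0 ur hd hB.
have B0 : 0 <= B by apply: (l2b_ge0 (hB t0 _)); rewrite subrr normr0.
pose Z n := f t n - f t0 n.
pose Q := \sum_(n <- r) om n * sqmod (Z n).
have Q0 : 0 <= Q by apply: sumr_ge0 => n _; rewrite mulr_ge0 ?sqmod_ge0.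
suff hQ : Q <= (`|t - t0| * B) ^+ 2.
  split; first by rewrite mulr_ge0.
  move=> s us; apply: le_trans hQ.
  rewrite [leLHS](bigID (mem r))/= [X in _ + X]big1 => [|n nr]; last first.
    by rewrite /trunc (negbTE nr) mul0r.
  rewrite addr0 -big_filter.
  apply: (@le_trans _ _ (\sum_(n <- [seq n <- s | n \in r]) om n * sqmod (Z n))).
    rewrite big_seq [leRHS]big_seq; apply: ler_sum => n; rewrite mem_filter => /andP[nr _].
    by rewrite /trunc nr.
  apply: ler_sum_uniq => //; first by move=> n; rewrite mulr_ge0 ?sqmod_ge0.
    exact: filter_uniq.
  by move=> n; rewrite mem_filter => /andP[].
pose F s := \sum_(n <- r) om n * (complex.Re (Z n) * complex.Re (f s n) +
   complex.Im (Z n) * complex.Im (f s n)).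
pose G s := \sum_(n <- r) om n * (complex.Re (Z n) * complex.Re (g s n) +
   complex.Im (Z n) * complex.Im (g s n)).
have dF s : `|s - t0| <= `|t - t0| -> is_derive s (1 : R) F (G s).
  move=> hs; apply: is_derive_sum_seq => n nr.
  have [d1 d2] := hd s n hs nr.
  by apply: is_derive_eq; rewrite /GRing.scale/=; ring.
have hG s : `|s - t0| <= `|t - t0| -> `|G s| <= Num.sqrt Q * B.
  move=> hs; have [_ hgs] := hB s hs.
  rewrite -(@ler_pXn2r _ 2) ?nnegrE ?mulr_ge0 ?sqrtr_ge0// exprMn sqr_sqrtr//.
  rewrite real_normK ?num_real//.
  pose X n := Num.sqrt (om n) * normc (Z n); pose Y n := Num.sqrt (om n) * normc (g s n).
  apply: (@le_trans _ _ ((\sum_(n <- r) X n * Y n) ^+ 2)).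
    rewrite -(real_normK (num_real (G s))) ler_pXn2r ?nnegrE//; last first.
      by apply: sumr_ge0 => n _; rewrite !mulr_ge0 ?sqrtr_ge0 ?normc_ge0.
    apply: le_trans (ler_norm_sum _ _ _) _; apply: ler_sum => n _.
    rewrite /X /Y normrM ger0_norm// mulrACA -expr2 sqr_sqrtr// ler_wpM2l//.
    rewrite -normcJ' -normcM (le_trans _ (normc_Re _))// cReM cReJ cImJ.
    by rewrite mulNr opprK.
  apply: le_trans (CauchySchwarz_seq _ _ _) _.
  apply: ler_pM; rewrite ?sumr_ge0//; try by move=> *; exact: sqr_ge0.
    by apply: ler_sum => n _; rewrite exprMn sqr_sqrtr// sqmod_normc.
  apply: le_trans (hgs r ur); rewrite big_seq [leRHS]big_seq; apply: ler_sum => n nr.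
  by rewrite exprMn sqr_sqrtr// sqmod_normc /trunc nr.
have FQ : F t - F t0 = Q.
  rewrite /F -sumrB; apply: eq_bigr => n _; rewrite /sqmod /Z !cReD !cImD !cReN !cImN; ring.
have : Q <= `|t - t0| * (Num.sqrt Q * B).
  by rewrite -{1}FQ; apply: le_trans (ler_norm _) (mean_value_le dF hG).
have := sqr_sqrtr Q0; have := sqrtr_ge0 Q; set x := Num.sqrt Q; move: (`|t - t0|) => d.
have [->|x0] := eqVneq x 0; first by rewrite expr0n/= => _ <- _; exact: sqr_ge0.
move=> xge <-; rewrite mulrCA expr2 ler_pM2l ?lt0r ?x0// => xdB.
by rewrite -expr2 ler_pXn2r ?nnegrE ?(le_trans xge).
Qed.

End ComplexLimits.

(** * The cubic nonlinearity on Fourier coefficients *)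

Section Cubic.
Context {R : realType}.
Implicit Types (U V W : bool -> int -> R[i]) (r : seq (int * int)) (j k : bool).
Implicit Types (ka : int -> int -> int -> R[i]) (wa wb wc wo : int -> R).

(** The component j of the vector valued trilinear form (U . conj V) W. *)
Definition cub ka U V W j r n : R[i] :=
  Tr ka (U false) (V false) (W j) r n + Tr ka (U true) (V true) (W j) r n.

Lemma l2b_cub ka wo wa wb wc U V W j r S A B C : uniq r ->
  (forall n, 0 <= wo n) -> (forall n, 0 < wa n) -> (forall n, 0 < wb n) ->
  (forall n, 0 < wc n) -> 0 <= S ->
  (forall n, bsum (fun p : int * int => wo n * sqmod (ka n p.1 p.2) /
    (wa p.1 * wb p.2 * wc (n - p.1 + p.2))) (S ^+ 2)) ->
  (forall k, l2b wa (U k) A) -> (forall k, l2b wb (V k) B) -> l2b wc (W j) C ->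
  l2b wo (cub ka U V W j r) (2 * (S * A * B * C)).
Proof.
move=> ur wo0 wa0 wb0 wc0 S0 hS hU hV hW.
rewrite mulr_natl mulr2n; apply: (l2bD wo0).
  exact: (l2b_Tr ur wo0 wa0 wb0 wc0 S0 hS (hU _) (hV _) hW).
exact: (l2b_Tr ur wo0 wa0 wb0 wc0 S0 hS (hU _) (hV _) hW).
Qed.

Lemma l2b_cub_sub ka wo wa wb wc U V W U' V' W' j r S A B C dA dB dC : uniq r ->
  (forall n, 0 <= wo n) -> (forall n, 0 < wa n) -> (forall n, 0 < wb n) ->
  (forall n, 0 < wc n) -> 0 <= S ->
  (forall n, bsum (fun p : int * int => wo n * sqmod (ka n p.1 p.2) /
    (wa p.1 * wb p.2 * wc (n - p.1 + p.2))) (S ^+ 2)) ->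
  (forall k, l2b wb (V k) B) -> l2b wc (W j) C ->
  (forall k, l2b wa (U' k) A) -> (forall k, l2b wb (V' k) B) ->
  (forall k, l2b wa (fun n => U k n - U' k n) dA) ->
  (forall k, l2b wb (fun n => V k n - V' k n) dB) ->
  l2b wc (fun n => W j n - W' j n) dC ->
  l2b wo (fun n => cub ka U V W j r n - cub ka U' V' W' j r n)
    (2 * (S * (dA * B * C + A * dB * C + A * B * dC))).
Proof.
move=> ur wo0 wa0 wb0 wc0 S0 hS hV hW hU' hV' hdU hdV hdW.
have h k := l2b_Tr_sub ur wo0 wa0 wb0 wc0 S0 hS (hV k) hW (hU' k) (hV' k) (hdU k) (hdV k) hdW.
rewrite mulr_natl mulr2n.
by apply: eq_l2b (l2bD wo0 (h false) (h true)) => n; rewrite /cub; ring.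
Qed.

Definition kacut ka K (n n1 n2 : int) : R[i] :=
  if (n1, n2) \in box K then 0 else ka n n1 n2.

Lemma cub_tail ka K L U V W j n : (K <= L)%N ->
  cub ka U V W j (box L) n - cub ka U V W j (box K) n =
  cub (kacut ka K) U V W j (box L) n.
Proof.
move=> KL.
have tl a b c : Tr ka a b c (box L) n - Tr ka a b c (box K) n =
    Tr (kacut ka K) a b c (box L) n.
  rewrite /Tr (bigID (mem (box K)) xpredT)/=.
  rewrite [X in X + _ - _](_ : _ = \sum_(p <- box K)
     ka n p.1 p.2 * a p.1 * conjc (b p.2) * c (n - p.1 + p.2)); last first.
    rewrite -big_filter; apply: perm_big; apply: uniq_perm; rewrite ?filter_uniq ?uniq_box// => p.
    rewrite mem_filter; case: (boolP (p \in box K)) => //= pK.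
    move: pK; rewrite !mem_box => /andP[p1 p2].
    by rewrite (leq_trans p1)// (leq_trans p2).
  rewrite addrAC subrr add0r [RHS](bigID (mem (box K)) xpredT)/=.
  rewrite [X in _ = X + _]big1 ?add0r => [|[p q] pK]; last by rewrite /kacut/= pK !mul0r.
  by apply: eq_bigr => -[p q] pK; rewrite /kacut/= (negbTE pK).
by rewrite /cub -!tl; ring.
Qed.

Lemma iw2_le (m n : int) : (w m * w n : R)^-1 <= 4 * (iJ m * iJ n) ^+ 2.
Proof.
rewrite invfM (_ : 4 * _ = (2 * iJ m ^+ 2) * (2 * iJ n ^+ 2)); last by ring.
by rewrite ler_pM ?invr_ge0 ?w_ge0 ?iw_le.
Qed.

Lemma bsum_box_tail K : bsum (fun p : int * int =>
  if p \in box K then 0 else (@iJ R p.1 * iJ p.2) ^+ 2) (12 / K.+1%:R).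
Proof.
have -> : (12 / K.+1%:R : R) = 2 / K.+1%:R * 3 + 3 * (2 / K.+1%:R) by field.
pose t (n : int) : R := if (K < `|n|)%N then iJ n ^+ 2 else 0.
have t0 n : 0 <= t n by rewrite /t; case: ifP => // _; exact: sqr_ge0.
have i0 (n : int) : 0 <= (iJ n ^+ 2 : R) by exact: sqr_ge0.
have := bsumD (bsum_prod t0 i0 (@bsum_iJ_tail R K) (@bsum_iJ R))
  (bsum_prod i0 t0 (@bsum_iJ R) (@bsum_iJ_tail R K)).
apply: bsum_le => -[m n]; rewrite mem_box/= exprMn.
have i2 := i0 m; have i3 := i0 n; have t2 := t0 m; have t3 := t0 n.
case: ifP => [_|]; first exact: addr_ge0 (mulr_ge0 t2 i3) (mulr_ge0 i2 t3).
move=> /negbT; rewrite negb_and -!ltnNge /t => /orP[->|->].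
  by rewrite lerDl mulr_ge0//; exact: t0.
by rewrite lerDr mulr_ge0//; exact: t0.
Qed.

Variables (alpha beta : R).

Definition symb (n : int) : R[i] := 0 +i* (alpha - beta * n%:~R).

Definition cm : R := 2 * (alpha ^+ 2 + beta ^+ 2).

Lemma cm_ge0 : 0 <= cm. Proof. by rewrite mulr_ge0 ?addr_ge0 ?sqr_ge0. Qed.

Lemma sqmod_symb n : sqmod (symb n) <= cm * w n.
Proof.
rewrite /sqmod/= expr0n/= add0r /cm /w; set x := n%:~R.
have := sqr_ge0 (alpha + beta * x); have := sqr_ge0 (alpha * x); have := sqr_ge0 beta.
nra.
Qed.

Definition ka0 (n n1 n2 : int) : R[i] := symb (n - n1 + n2).

Lemma ka0_le n n1 n2 :
  sqmod (ka0 n n1 n2) / (w n1 * w n2 * w (n - n1 + n2)) <=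
  4 * cm * (iJ n1 * iJ n2) ^+ 2.
Proof.
rewrite ler_pdivrMr ?mulr_gt0 ?w_gt0//.
apply: le_trans (sqmod_symb _) _.
have h := iw2_le n1 n2; have w12 : 0 < (w n1 * w n2 : R) by rewrite mulr_gt0 ?w_gt0.
rewrite (_ : 4 * cm * (iJ n1 * iJ n2) ^+ 2 * _ = (4 * (iJ n1 * iJ n2) ^+ 2) * (w n1 * w n2) * (cm * w (n - n1 + n2))); last by ring.
rewrite ler_peMl//; first exact: mulr_ge0 cm_ge0 (w_ge0 _).
by rewrite -ler_pdivrMr// mul1r.
Qed.

Definition w1 (n : int) : R := 1.

(** The sum over (n1, n2) converges absolutely on H^1; boxes are the partial
    sums that appear in the Galerkin systems. *)
Definition Ncub U j n : R[i] := climn (fun K => cub ka0 U U U j (box K) n).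

Definition hb U (B : R) : Prop := forall k, l2b w (U k) B.

Lemma hb_ge0 U B : hb U B -> 0 <= B. Proof. by move=> /(_ true); exact: l2b_ge0. Qed.

Definition S0 : R := Num.sqrt (36 * cm).

Lemma ka0_bsum n : bsum (fun p : int * int => w1 n * sqmod (ka0 n p.1 p.2) /
    (w p.1 * w p.2 * w (n - p.1 + p.2))) (S0 ^+ 2).
Proof.
rewrite /S0 sqr_sqrtr; last by apply: mulr_ge0 => //; exact: cm_ge0.
have h := @bsum_pair R (fun p => p) (fun _ _ => id).
have := bsumZ (mulr_ge0 (ler0n R 4) cm_ge0) h.
rewrite (_ : _ * 9 = 36 * cm); last by ring.
by apply: bsum_le => p; rewrite mul1r ka0_le.
Qed.

Definition etail (K : nat) : R := Num.sqrt (48 * cm / K.+1%:R).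

Lemma etail_ge0 K : 0 <= etail K. Proof. exact: sqrtr_ge0. Qed.

Lemma sqrt_div_cvg0 (c : R) : Num.sqrt (c / K.+1%:R) @[K --> \oo] --> (0 : R).
Proof.
rewrite -[X in _ --> X](sqrtr0 R).
apply: (@cvg_comp _ _ _ (fun K : nat => c / K.+1%:R) (@Num.sqrt R) \oo (nbhs (0 : R))); last exact: sqrt_continuous.
rewrite -(mulr0 c); apply: cvgMr; exact: cvg_harmonic.
Qed.

Lemma ka0_tail_bsum K n : bsum (fun p : int * int =>
    w1 n * sqmod (kacut ka0 K n p.1 p.2) /
    (w p.1 * w p.2 * w (n - p.1 + p.2))) (etail K ^+ 2).
Proof.
rewrite /etail sqr_sqrtr; last first.
  by apply: divr_ge0 => //; apply: mulr_ge0 => //; exact: cm_ge0.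
have := bsumZ (mulr_ge0 (ler0n R 4) cm_ge0) (bsum_box_tail K).
rewrite (_ : _ * (12 / _) = 48 * cm / K.+1%:R); last by ring.
apply: bsum_le => -[m k] /=; rewrite /kacut; case: ifP => _; first by rewrite sqmod0 !(mulr0, mul0r).
by rewrite mul1r ka0_le.
Qed.

Lemma w1_ge0 n : 0 <= w1 n. Proof. by rewrite /w1. Qed.

Lemma l2b_cub_tail U j B K L : hb U B -> (K <= L)%N ->
  l2b w1 (fun n => cub ka0 U U U j (box L) n - cub ka0 U U U j (box K) n)
    (2 * (etail K * B * B * B)).
Proof.
move=> hU KL.
have := l2b_cub (uniq_box L) w1_ge0 (@w_gt0 R) (@w_gt0 R) (@w_gt0 R)
  (etail_ge0 K) (ka0_tail_bsum K) hU hU (hU j).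
by apply: eq_l2b => n; rewrite (cub_tail _ _ _ _ _ _ KL).
Qed.

Lemma etail_cvg0 (c : R) : c * etail K @[K --> \oo] --> (0 : R).
Proof. by rewrite -(mulr0 c); apply: cvgMr; exact: sqrt_div_cvg0. Qed.

Lemma Ncub_cvg U j B n : hb U B ->
  ccvg \oo (fun K => cub ka0 U U U j (box K) n) (Ncub U j n).
Proof.
move=> hU; apply: (@climnP _ _ (fun K => 2 * B ^+ 3 * etail K)); last exact: etail_cvg0.
move=> K L KL; rewrite (_ : _ * etail K = 2 * (etail K * B * B * B)); last by ring.
by apply: (l2b_term1 _ (l2b_cub_tail j hU KL)).
Qed.

Lemma l2b_ccvg (T : Type) (F : set_system T) {FF : ProperFilter F} om
    (x : T -> int -> R[i]) y B :
  (forall n, ccvg F (fun t => x t n) (y n)) -> 0 <= B ->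
  (\forall t \near F, l2b om (x t) B) -> l2b om y B.
Proof. by move=> h; apply: l2b_limit => n; exact: ccvg_sqmod. Qed.

Lemma Ncub_tail U j B K : hb U B ->
  l2b w1 (fun n => Ncub U j n - cub ka0 U U U j (box K) n) (2 * B ^+ 3 * etail K).
Proof.
move=> hU; have B0 := hb_ge0 hU.
apply: (@l2b_ccvg _ \oo _ _ (fun L n => cub ka0 U U U j (box L) n - cub ka0 U U U j (box K) n)).
- by move=> n; apply: ccvgD; [exact: Ncub_cvg hU|exact: ccvg_cst].
- by rewrite !mulr_ge0 ?exprn_ge0 ?sqrtr_ge0.
- exists K => // L /= KL; have := l2b_cub_tail j hU KL.
  by rewrite (_ : 2 * (_ * _ * _ * _) = 2 * B ^+ 3 * etail K); last by ring.
Qed.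

Lemma S0_ge0 : 0 <= S0. Proof. exact: sqrtr_ge0. Qed.

Lemma Ncub_bound U j B : hb U B -> l2b w1 (Ncub U j) (2 * S0 * B ^+ 3).
Proof.
move=> hU; have B0 := hb_ge0 hU.
apply: (@l2b_ccvg _ \oo _ _ (fun L n => cub ka0 U U U j (box L) n)).
- by move=> n; exact: Ncub_cvg hU.
- by rewrite !mulr_ge0 ?exprn_ge0 ?S0_ge0.
- near=> L; rewrite (_ : _ * _ * _ = 2 * (S0 * B * B * B)); last by ring.
  exact: (l2b_cub (uniq_box L) w1_ge0 (@w_gt0 R) (@w_gt0 R) (@w_gt0 R) S0_ge0
    ka0_bsum hU hU (hU _)).
Unshelve. all: by end_near. Qed.

(** The cubic term is locally Lipschitz from H^1 to L^2: the loss of one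
    derivative. *)
Lemma Ncub_sub U V j B d : hb U B -> hb V B -> hb (fun k n => U k n - V k n) d ->
  l2b w1 (fun n => Ncub U j n - Ncub V j n) (6 * S0 * B ^+ 2 * d).
Proof.
move=> hU hV hd; have B0 := hb_ge0 hU; have d0 := hb_ge0 hd.
apply: (@l2b_ccvg _ \oo _ _ (fun L n => cub ka0 U U U j (box L) n - cub ka0 V V V j (box L) n)).
- move=> n; apply: ccvgD; first exact: Ncub_cvg hU.
  rewrite -mulN1r; under eq_fun do rewrite -mulN1r.
  by apply: ccvgM; [exact: ccvg_cst|exact: Ncub_cvg hV].
- by rewrite !mulr_ge0 ?exprn_ge0 ?S0_ge0.
- near=> L.
  rewrite (_ : _ * _ * _ * _ = 2 * (S0 * (d * B * B + B * d * B + B * B * d))); last by ring.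
  exact: (l2b_cub_sub (uniq_box L) w1_ge0 (@w_gt0 R) (@w_gt0 R) (@w_gt0 R) S0_ge0
    ka0_bsum hU (hU _) hV hV hd hd (hd _)).
Unshelve. all: by end_near. Qed.

End Cubic.

(** * Symmetries of the quartic forms and conservation of mass *)

Section Quartic.
Context {R : realType}.
Implicit Types (U V W : bool -> int -> R[i]) (j k : bool).

Definition rr U V m n : R[i] :=
  U false m * conjc (V false n) + U true m * conjc (V true n).

Lemma cubE ka U V W j r n : cub ka U V W j r n =
  \sum_(p <- r) ka n p.1 p.2 * rr U V p.1 p.2 * W j (n - p.1 + p.2).
Proof. by rewrite /cub /Tr -big_split/=; apply: eq_bigr => p _; rewrite /rr; ring. Qed.

(** On n1 + n3 = n2 + n4: the form of the rates of change of mass and energy,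
    where Y is symmetric and f is the weight. *)
Definition QR K (Y f : int -> int -> int -> int -> R) : R :=
  \sum_(p <- box K) \sum_(q <- box K)
    if p.1 + q.1 == p.2 + q.2 then f p.1 p.2 q.1 q.2 * Y p.1 p.2 q.1 q.2 else 0.

Lemma eq_QR K Y f g :
  (forall n1 n2 n3 n4 : int, n1 + n3 = n2 + n4 -> f n1 n2 n3 n4 = g n1 n2 n3 n4) ->
  QR K Y f = QR K Y g.
Proof.
move=> h; apply: eq_bigr => p _; apply: eq_bigr => q _.
by case: ifP => // /eqP /h ->.
Qed.

Lemma QR_swap K Y f : (forall n1 n2 n3 n4, Y n3 n4 n1 n2 = Y n1 n2 n3 n4) ->
  QR K Y f = QR K Y (fun n1 n2 n3 n4 => f n3 n4 n1 n2).
Proof.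
move=> hY; rewrite /QR exchange_big/=; apply: eq_bigr => p _; apply: eq_bigr => q _.
by rewrite (addrC q.1) (addrC q.2) hY.
Qed.

Lemma QR_flip K Y f : (forall n1 n2 n3 n4, Y n2 n1 n4 n3 = - Y n1 n2 n3 n4) ->
  QR K Y f = - QR K Y (fun n1 n2 n3 n4 => f n2 n1 n4 n3).
Proof.
have fl (F : int * int -> R) : \sum_(p <- box K) F p = \sum_(p <- box K) F (p.2, p.1).
  by rewrite !big_box exchange_big.
move=> hY; rewrite /QR fl -sumrN; apply: eq_bigr => p _; rewrite fl -sumrN.
apply: eq_bigr => q _ /=; rewrite eq_sym hY.
by case: ifP => // _; rewrite ?mulrN ?oppr0.
Qed.

Lemma QRD K Y f g : QR K Y f + QR K Y g =
  QR K Y (fun n1 n2 n3 n4 => f n1 n2 n3 n4 + g n1 n2 n3 n4).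
Proof.
rewrite /QR -big_split/=; apply: eq_bigr => p _; rewrite -big_split/=.
by apply: eq_bigr => q _; case: ifP => _; rewrite ?addr0// mulrDl.
Qed.

Lemma QRZ K Y f c : c * QR K Y f = QR K Y (fun n1 n2 n3 n4 => c * f n1 n2 n3 n4).
Proof.
rewrite /QR big_distrr/=; apply: eq_bigr => p _; rewrite big_distrr/=.
by apply: eq_bigr => q _; case: ifP => _; rewrite ?mulr0// mulrA.
Qed.

(** Only the part of the weight that has the symmetries of Y contributes. *)
Lemma QR_sym K Y f g : (forall n1 n2 n3 n4, Y n3 n4 n1 n2 = Y n1 n2 n3 n4) ->
  (forall n1 n2 n3 n4, Y n2 n1 n4 n3 = - Y n1 n2 n3 n4) ->
  (forall n1 n2 n3 n4 : int, n1 + n3 = n2 + n4 ->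
    f n1 n2 n3 n4 + f n3 n4 n1 n2 - f n2 n1 n4 n3 - f n4 n3 n2 n1 =
    4 * g n1 n2 n3 n4) ->
  QR K Y f = QR K Y g.
Proof.
move=> h1 h2 h.
have e1 := QR_swap K f h1; have e2 := QR_flip K f h2.
have e3 := QR_flip K (fun n1 n2 n3 n4 => f n3 n4 n1 n2) h2.
have e : 4 * QR K Y f = 4 * QR K Y g.
  rewrite [RHS]QRZ -(eq_QR K Y h).
  transitivity (QR K Y f + QR K Y (fun n1 n2 n3 n4 => f n3 n4 n1 n2) +
    (-1) * QR K Y (fun n1 n2 n3 n4 => f n2 n1 n4 n3) +
    (-1) * QR K Y (fun n1 n2 n3 n4 => f n4 n3 n2 n1)); first by lra.
  by rewrite !QRZ !QRD; apply: eq_QR => n1 n2 n3 n4 _; ring.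
by lra.
Qed.

(** The antisymmetry [YY_flip] under exchange of the entries and their
    conjugates is what lets the weights symmetrize. *)
Definition YY U n1 n2 n3 n4 : R := - complex.Im (rr U U n1 n2 * rr U U n3 n4).

Lemma YY_swap U n1 n2 n3 n4 : YY U n3 n4 n1 n2 = YY U n1 n2 n3 n4.
Proof. by rewrite /YY mulrC. Qed.

Lemma rrJ U V m n : conjc (rr U V m n) = rr V U n m.
Proof. by rewrite /rr rmorphD !rmorphM/= !conjcK; ring. Qed.

Lemma YY_flip U n1 n2 n3 n4 : YY U n2 n1 n4 n3 = - YY U n1 n2 n3 n4.
Proof. by rewrite /YY -(rrJ U U n1) -(rrJ U U n3) -rmorphM/= cImJ. Qed.

Lemma big_pick (T : nmodType) (r : seq int) (x : int) (F : int -> T) : uniq r ->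
  \sum_(m <- r) (if m == x then F m else 0) = if x \in r then F x else 0.
Proof.
move=> ur; case: ifP => xr; last first.
  rewrite big_seq big1// => m mr; case: eqP => // mx; by rewrite -mx mr in xr.
rewrite (bigD1_seq x)//= eqxx big1 ?addr0// => m /negbTE mx.
by rewrite mx.
Qed.

Variables (alpha beta : R).
Local Notation symb := (symb alpha beta).
Local Notation ka0 := (ka0 alpha beta).

Definition kain (K : nat) (n n1 n2 : int) : R[i] :=
  if (absz (n - n1 + n2)%R <= K)%N then ka0 n n1 n2 else 0.

Lemma pair_QR K U (g : int -> R) :
  complex.Re (\sum_(n <- zbox K) (g n)%:C *
    (conjc (U false n) * cub (kain K) U U U false (box K) n +
     conjc (U true n) * cub (kain K) U U U true (box K) n)) =
  QR K (YY U) (fun n1 n2 n3 n4 => g n4 * (alpha - beta * n3%:~R)).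
Proof.
have step n : (g n)%:C * (conjc (U false n) * cub (kain K) U U U false (box K) n +
     conjc (U true n) * cub (kain K) U U U true (box K) n) =
   \sum_(p <- box K) (g n)%:C * kain K n p.1 p.2 * (rr U U p.1 p.2 * rr U U (n - p.1 + p.2) n).
  rewrite !cubE !mulr_sumr -big_split/= mulr_sumr; apply: eq_bigr => p _; rewrite /rr; ring.
rewrite cRe_sum; under eq_bigr do rewrite step cRe_sum.
rewrite exchange_big/= /QR; apply: eq_bigr => p _; rewrite big_box exchange_big/=.
apply: eq_bigr => n _.
rewrite (eq_bigr (fun m => if m == n - p.1 + p.2 then
    g n * (alpha - beta * m%:~R) * YY U p.1 p.2 m n else 0)); last first.
  by move=> m _; rewrite (_ : (_ == _) = (m == n - p.1 + p.2))//; apply/eqP/eqP; lia.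
rewrite big_pick ?uniq_zbox// mem_zbox /kain; case: ifP => _.
  by rewrite /YY /ka0 /symb !cReM !cImM /=; ring.
by rewrite mulr0 mul0r.
Qed.

(** The weight alpha - beta n3 symmetrizes to a multiple of
    n1 + n3 - n2 - n4, which vanishes. *)
Lemma mass_QR K U : complex.Re (\sum_(n <- zbox K)
    (conjc (U false n) * cub (kain K) U U U false (box K) n +
     conjc (U true n) * cub (kain K) U U U true (box K) n)) = 0.
Proof.
have := pair_QR K U (fun=> 1).
under eq_bigr do rewrite mul1r; move=> ->.
rewrite (@QR_sym _ _ _ (fun _ _ _ _ => 0)); first last.
- move=> n1 n2 n3 n4 e; have := congr1 (fun z : int => z%:~R : R) e.
  rewrite !intrD => e'; rewrite (_ : n3%:~R = n2%:~R + n4%:~R - n1%:~R); first by ring.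
  by rewrite -e'; ring.
- exact: YY_flip.
- exact: YY_swap.
by rewrite /QR big1// => p _; rewrite big1// => q _; rewrite mul0r if_same.
Qed.

(** When n3 leaves the box, one of the three other frequencies is comparable
    to K, so this part is small. *)
Definition kaout (K : nat) (n n1 n2 : int) : R[i] :=
  if [&& (`|n| <= K)%N, (`|n1| <= K)%N, (`|n2| <= K)%N & (K < absz (n - n1 + n2)%R)%N]
  then ka0 n n1 n2 else 0.

Definition eout (K : nat) : R := Num.sqrt (120 * cm alpha beta / (K %/ 3).+1%:R).

Lemma kaout_bsum K n : bsum (fun p : int * int =>
    (w n)^-1 * sqmod (kaout K n p.1 p.2) / (w p.1 * w p.2 * w (n - p.1 + p.2)))
  (eout K ^+ 2).
Proof.
set L := (K %/ 3)%N.
have c0 := cm_ge0 alpha beta; have L0 : (0 : R) < L.+1%:R by rewrite ltr0n.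
have cL : 0 <= 4 * cm alpha beta * (2 / L.+1%:R).
  by apply: mulr_ge0; [apply: mulr_ge0|apply: divr_ge0].
have c4 : 0 <= 4 * cm alpha beta by apply: mulr_ge0.
rewrite /eout sqr_sqrtr; last first.
  by apply: divr_ge0 => //; apply: mulr_ge0.
have h := bsumD (bsumZ cL (@bsum_pair R (fun p => p) (fun _ _ => id)))
  (bsumZ c4 (@bsum_box_tail R L)).
apply: bsumW (bsum_le _ h).
  rewrite le_eqVlt; apply/orP; left; apply/eqP; field.
  by rewrite -/L; lra.
move=> [n1 n2] /=; rewrite /kaout; set P := [&& _, _, _ & _].
have sq0 := sqr_ge0 (@iJ R n1 * iJ n2).
case: ifP => hP; last first.
  rewrite sqmod0 mulr0 mul0r; apply: addr_ge0; first exact: mulr_ge0.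
  by case: ifP => _; rewrite ?mulr0//; exact: mulr_ge0.
have hka := ka0_le alpha beta n n1 n2.
rewrite -mulrA; apply: le_trans (ler_wpM2l _ hka) _; first by rewrite invr_ge0 w_ge0.
have iwn1 : (w n : R)^-1 <= 1 by rewrite invf_le1 ?w_gt0 ?w_ge1.
rewrite mulrCA -[X in _ <= X + _]mulrA -mulrDr; apply: ler_wpM2l => //.
case: ifP => [nb|_]; last first.
  apply: (@le_trans _ _ ((iJ n1 * iJ n2) ^+ 2)); first by rewrite ler_piMl.
  by rewrite lerDr mulr_ge0// divr_ge0.
rewrite addr0; apply: ler_wpM2r => //.
apply: le_trans (iw_le _) _; apply: ler_wpM2l => //.
have nL : (L < `|n|)%N.
  move: hP nb; rewrite /P mem_box/= => /and4P[_ _ _ h3] /andP[h1 h2].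
  by move: h1 h2 h3; rewrite /L; lia.
apply: (@le_trans _ _ (iJ n)); first by rewrite expr2 ler_piMl ?iJ_ge0 ?iJ_le1.
rewrite /iJ lef_pV2 ?posrE ?J_gt0// JE -(natrD _ 1) add1n ler_nat.
exact: leqW.
Qed.

Lemma l2b_pairing (x y : int -> R[i]) om A B (r : seq int) : uniq r ->
  (forall n, 0 < om n) -> l2b om x A -> l2b (fun n => (om n)^-1) y B ->
  `|complex.Re (\sum_(n <- r) conjc (x n) * y n)| <= A * B.
Proof.
move=> ur om0 [A0 hA] [B0 hB].
apply: le_trans (normc_Re _) _; apply: le_trans (normc_sum _ _ _) _.
rewrite -(@ler_pXn2r _ 2) ?nnegrE ?mulr_ge0// ?sumr_ge0//; last by move=> *; exact: normc_ge0.
pose X n := Num.sqrt (om n) * normc (x n); pose Y n := Num.sqrt (om n)^-1 * normc (y n).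
rewrite (eq_bigr (fun n => X n * Y n)); last first.
  move=> n _; rewrite normcM normcJ' /X /Y mulrACA -sqrtrM ?(ltW (om0 n))//.
  by rewrite mulfV ?gt_eqF// sqrtr1 mul1r.
apply: le_trans (CauchySchwarz_seq _ _ _) _; rewrite exprMn.
apply: ler_pM; rewrite ?sumr_ge0//; try by move=> *; exact: sqr_ge0.
  apply: le_trans (hA r ur); apply: ler_sum => n _.
  by rewrite exprMn sqr_sqrtr ?(ltW (om0 n))// sqmod_normc.
apply: le_trans (hB r ur); apply: ler_sum => n _.
by rewrite exprMn sqr_sqrtr ?invr_ge0 ?(ltW (om0 n))// sqmod_normc.
Qed.

Definition emass (K : nat) (B : R) : R :=
  2 * (B * (2 * B ^+ 3 * etail alpha beta K)) + 2 * (B * (2 * (eout K * B * B * B))).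

(** By [mass_QR] the symmetric truncation contributes nothing. What is left
    has a frequency comparable to K, and a negative power of K is gained. *)
Lemma mass_Ncub K U B : hb U B ->
  `|complex.Re (\sum_(n <- zbox K) (conjc (U false n) * Ncub alpha beta U false n +
     conjc (U true n) * Ncub alpha beta U true n))| <= emass K B.
Proof.
move=> hU; have B0 := hb_ge0 hU.
have w1b k : l2b w1 (U k) B.
  by apply: l2b_le (hU k) => n; rewrite ler_wpM2r ?sqmod_ge0// w_ge1.
have iw n : 0 < (w n : R) by exact: w_gt0.
have split j n : n \in zbox K -> Ncub alpha beta U j n =
    (Ncub alpha beta U j n - cub ka0 U U U j (box K) n) +
    cub (kaout K) U U U j (box K) n + cub (kain K) U U U j (box K) n.
  rewrite mem_zbox => nK; rewrite -addrA.
  suff -> : cub ka0 U U U j (box K) n =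
      cub (kaout K) U U U j (box K) n + cub (kain K) U U U j (box K) n by ring.
  rewrite !cubE -big_split/= big_seq [RHS]big_seq; apply: eq_bigr => p.
  rewrite mem_box => /andP[p1 p2]; rewrite /kaout /kain nK p1 p2/= ltnNge.
  by case: leqP => _ /=; rewrite !mul0r ?addr0 ?add0r.
have dec : \sum_(n <- zbox K) (conjc (U false n) * Ncub alpha beta U false n +
     conjc (U true n) * Ncub alpha beta U true n) =
  (\sum_(n <- zbox K) conjc (U false n) * (Ncub alpha beta U false n - cub ka0 U U U false (box K) n) +
   \sum_(n <- zbox K) conjc (U true n) * (Ncub alpha beta U true n - cub ka0 U U U true (box K) n)) +
  (\sum_(n <- zbox K) conjc (U false n) * cub (kaout K) U U U false (box K) n +
   \sum_(n <- zbox K) conjc (U true n) * cub (kaout K) U U U true (box K) n) +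
  \sum_(n <- zbox K) (conjc (U false n) * cub (kain K) U U U false (box K) n +
     conjc (U true n) * cub (kain K) U U U true (box K) n).
  rewrite -!big_split/= big_seq [RHS]big_seq; apply: eq_bigr => n nK.
  by rewrite {1}(split false n nK) {1}(split true n nK); ring.
rewrite dec !cReD mass_QR addr0 /emass.
have iww1 (y : int -> R[i]) C : l2b w1 y C -> l2b (fun n => (w1 n : R)^-1) y C.
  by apply: l2b_le => n; rewrite /w1 invr1.
have hout j : l2b (fun n => (w n)^-1) (cub (kaout K) U U U j (box K)) (2 * (eout K * B * B * B)).
  apply: (l2b_cub (uniq_box K) _ iw iw iw (sqrtr_ge0 _) (kaout_bsum K) hU hU (hU j)).
  by move=> n; rewrite invr_ge0 ltW.
have pos1 n : 0 < (w1 n : R) by rewrite /w1.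
have P1 j := l2b_pairing (uniq_zbox K) pos1 (w1b j) (iww1 _ _ (Ncub_tail alpha beta j K hU)).
have P2 j := l2b_pairing (uniq_zbox K) iw (hU j) (hout j).
apply: le_trans (ler_normD _ _) _; apply: lerD.
  apply: le_trans (ler_normD _ _) _; rewrite mulr_natl mulr2n.
  exact: lerD (P1 false) (P1 true).
apply: le_trans (ler_normD _ _) _; rewrite [leRHS]mulr_natl mulr2n.
exact: lerD (P2 false) (P2 true).
Qed.

Lemma emass_cvg0 B : emass K B @[K --> \oo] --> (0 : R).
Proof.
rewrite -[X in _ --> X](addr0 (0 : R)); apply: cvgD.
  rewrite (_ : (fun K => _) = fun K => (4 * B ^+ 4) * etail alpha beta K); first exact: etail_cvg0.
  by apply/funext => K; ring.
rewrite (_ : (fun K => _) = fun K => (4 * B ^+ 4) * eout K); last by apply/funext => K; ring.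
rewrite -(mulr0 (4 * B ^+ 4)); apply: cvgMr.
apply: (@cvg_comp _ _ _ (fun K : nat => (K %/ 3)%N)
  (fun L : nat => Num.sqrt (120 * cm alpha beta / L.+1%:R)) \oo \oo); last exact: sqrt_div_cvg0.
move=> A [M _ MA]; exists (3 * M)%N => // K /= MK; apply: MA => /=.
by rewrite leq_divRL// mulnC.
Qed.

End Quartic.

(** * Nonresonance and kernel bounds *)

Section Resonance.
Context {R : realType}.
Variables (alpha beta a b : R).
Hypothesis b0 : b != 0.
Local Notation symb := (symb alpha beta).
Local Notation ka0 := (ka0 alpha beta).
Local Notation cm := (cm alpha beta).

Definition phi (n : int) : R := b * n%:~R ^+ 3 - a * n%:~R ^+ 2.

Definition DD (s : int) : R := 3 * b * s%:~R - 2 * a.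

Definition Om (n n1 n2 : int) : R :=
  DD (n + n2) * (n%:~R - n1%:~R) * (n1%:~R - n2%:~R).

(** The resonance function of the third order dispersion factorizes. *)
Lemma OmE n n1 n2 : Om n n1 n2 = phi n - phi n1 + phi n2 - phi (n - n1 + n2).
Proof. by rewrite /Om /DD /phi !intrD !intrN; ring. Qed.

(** Immediate for large s; a minimum is taken over the finitely many others. *)
Lemma DD_lower : exists2 c : R, 0 < c & forall s, DD s != 0 -> c * J s <= `|DD s|.
Proof.
have b3 : 0 < 3 * `|b| by rewrite mulr_gt0 ?normr_gt0.
have fin (r : seq int) : exists2 c : R, 0 < c &
    forall s, s \in r -> DD s != 0 -> c * J s <= `|DD s|.
  elim: r => [|s r [c c0 hc]]; first by exists 1.
  have [d0|d0] := eqVneq (DD s) 0.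
    by exists c => // x; rewrite inE => /predU1P[->|/hc//]; rewrite d0 eqxx.
  exists (Num.min c (`|DD s| * iJ s)).
    by rewrite lt_min c0 mulr_gt0 ?normr_gt0 ?iJ_gt0.
  move=> x; rewrite inE => /predU1P[->|xr] h.
    by rewrite -ler_pdivlMr ?J_gt0// ge_min lexx orbT.
  by apply: le_trans (hc _ xr h); rewrite ler_wpM2r ?(ltW (J_gt0 _))// ge_min lexx.
(* Beyond X the term 3 b s dominates. *)
pose X : R := 1 + (2 * `|a| + 1 + 3 * `|b|) / `|b|.
have [c c0 hc] := fin (zbox (Num.truncn X).+1).
exists (Num.min c `|b|); first by rewrite lt_min c0 normr_gt0.
move=> s h; case: (boolP (s \in zbox (Num.truncn X).+1)) => [sr|].
  by apply: le_trans (hc _ sr h); rewrite ler_wpM2r ?(ltW (J_gt0 _))// ge_min lexx.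
rewrite mem_zbox -ltnNge => hs.
have Xs : X <= `|s|%N%:R.
  apply: (@le_trans _ _ (Num.truncn X).+1%:R); first exact/ltW/truncnS_gt.
  by rewrite ler_nat ltnW.
apply: (@le_trans _ _ (`|b| * J s)).
  by rewrite ler_wpM2r ?(ltW (J_gt0 _))// ge_min lexx orbT.
have hD : 3 * `|b| * `|s|%N%:R - 2 * `|a| <= `|DD s|.
  have -> : (`|s|%N%:R : R) = `|s%:~R| by rewrite -intr_norm -abszE.
  rewrite /DD; apply: le_trans (lerB_dist _ _).
  by rewrite !normrM (ger0_norm (ler0n R 3)) (ger0_norm (ler0n R 2)).
apply: le_trans hD; rewrite JE.
have bb : 0 < `|b| by rewrite normr_gt0.
have : `|b| * X <= `|b| * `|s|%N%:R by rewrite ler_wpM2l// ltW.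
rewrite /X mulrDr mulr1 [X in _ + X]mulrC divfK ?gt_eqF//.
by move: (`|s|%N%:R : R) (normr_ge0 a) => x; nra.
Qed.

Lemma DD_zero : exists2 C : R, 1 <= C & forall s, DD s = 0 -> J s <= C.
Proof.
exists (1 + `|2 * a / (3 * b)|) => [|s h]; first by rewrite lerDl.
rewrite /J lerD2l (_ : s%:~R = 2 * a / (3 * b))//.
apply: (@mulfI _ (3 * b)); first by rewrite mulf_neq0.
rewrite [RHS]mulrC divfK ?mulf_neq0//; move/eqP: h.
by rewrite subr_eq0 => /eqP ->.
Qed.

Lemma int_J_half (m : int) : m != 0 -> J m <= 2 * `|m%:~R : R|.
Proof.
move=> m0; rewrite /J; suff : 1 <= `|m%:~R : R| by lra.
by rewrite -intr_norm -abszE -[1]/(1%:R : R) ler_nat absz_gt0.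
Qed.

Lemma Om_neq0 n n1 n2 : Om n n1 n2 != 0 ->
  [/\ n - n1 != 0, n1 - n2 != 0 & DD (n + n2) != 0].
Proof.
rewrite /Om !mulf_eq0 !negb_or => /andP[/andP[h1 h2] h3]; split=> //.
- by apply: contra h2; rewrite subr_eq0 => /eqP ->; rewrite subrr.
- by apply: contra h3; rewrite subr_eq0 => /eqP ->; rewrite subrr.
Qed.

Lemma Om_lower : exists2 c : R, 0 < c & forall n n1 n2, Om n n1 n2 != 0 ->
  `|Om n n1 n2|^-1 <= c * (iJ (n - n1) * iJ (n1 - n2) * iJ (n + n2)).
Proof.
have [c c0 hc] := DD_lower.
exists (4 / c); first by rewrite divr_gt0.
move=> n n1 n2 h; have [h1 h2 h3] := Om_neq0 h.
have e : c / 4 * (J (n - n1) * J (n1 - n2) * J (n + n2)) <= `|Om n n1 n2|.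
  rewrite /Om -!intrB !normrM.
  have := hc _ h3; have := int_J_half h1; have := int_J_half h2.
  have := J_gt0 (n - n1) : 0 < (_ : R); have := J_gt0 (n1 - n2) : 0 < (_ : R).
  have := J_gt0 (n + n2) : 0 < (_ : R).
  set x := J (n - n1); set y := J (n1 - n2); set z := J (n + n2).
  set d := `|DD _|; set p := `|(n - n1)%:~R|; set q := `|(n1 - n2)%:~R|.
  move=> z0 y0 x0 hq hp hd.
  rewrite (_ : _ * (x * y * z) = (c * z) * (x / 2) * (y / 2)); last by field.
  have cz : 0 <= c * z by rewrite mulr_ge0 ?ltW.
  have x2 : 0 <= x / 2 by rewrite divr_ge0 ?ltW.
  have y2 : 0 <= y / 2 by rewrite divr_ge0 ?ltW.
  apply: ler_pM => //; first exact: mulr_ge0; last by lra.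
  by apply: ler_pM => //; lra.
have -> : 4 / c * (iJ (n - n1) * iJ (n1 - n2) * iJ (n + n2)) =
    (c / 4 * (J (n - n1) * J (n1 - n2) * J (n + n2)))^-1.
  by rewrite /iJ; field; rewrite !gt_eqF ?J_gt0.
rewrite lef_pV2 ?posrE ?normr_gt0//.
by rewrite !mulr_gt0 ?divr_gt0 ?J_gt0.
Qed.

Lemma J_triangle (m n p : int) : p = m + n -> @J R p * iJ m * iJ n <= iJ m + iJ n.
Proof.
move=> ->; have hm := iJ_gt0 m : 0 < (_ : R); have hn := iJ_gt0 n : 0 < (_ : R).
apply: (@le_trans _ _ ((J m + J n) * iJ m * iJ n)).
  by rewrite -!mulrA ler_wpM2r ?mulr_ge0 ?(ltW hm) ?(ltW hn)// le_JD.
have em := iJK m : _ = (1 : R); have en := iJK n : _ = (1 : R).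
rewrite (_ : (J m + J n) * iJ m * iJ n = (J m * iJ m) * iJ n + (J n * iJ n) * iJ m); last by ring.
by rewrite em en !mul1r addrC.
Qed.

Lemma J_triangleB (m n p : int) : p = m - n -> @J R p * iJ m * iJ n <= iJ m + iJ n.
Proof. by move=> e; rewrite -(iJN n); exact: J_triangle. Qed.

Lemma ka0_w_le n n1 n2 :
  w n * (sqmod (ka0 n n1 n2) / (w n1 * w n2 * w (n - n1 + n2))) <=
  4 * cm * (J n * iJ n1 * iJ n2) ^+ 2.
Proof.
rewrite (_ : 4 * cm * _ = J n ^+ 2 * (4 * cm * (iJ n1 * iJ n2) ^+ 2)); last by ring.
apply: ler_pM; rewrite ?w_ge0 ?w_le_J2 ?ka0_le//.
by rewrite divr_ge0 ?sqmod_ge0// !mulr_ge0 ?w_ge0.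
Qed.

Let unit01 (x : R) := 0 <= x /\ x <= 1.

Let iJ01 (n : int) : unit01 (iJ n).
Proof. by split; [exact: iJ_ge0|exact: iJ_le1]. Qed.

Let prod_le (x y : R) : x * y <= (x ^+ 2 + y ^+ 2) / 2.
Proof. by have := sqr_ge0 (x - y); nra. Qed.

(** A single factor 1/Om pays for the weight of the output. With h, k, s, p, q
    the inverse weights of n - n1, n1 - n2, n + n2, n1 and n2, the triangle
    inequality gives J n s q <= s + q and J n h p <= h + p. *)
Lemma kernel_bound1 n n1 n2 :
  (J n * iJ n1 * iJ n2) ^+ 2 * (iJ (n - n1) * iJ (n1 - n2) * iJ (n + n2)) <=
  2 * (mker n n1 n2 : R).
Proof.
rewrite /mker.
have t1 : @J R n * iJ (n + n2) * iJ n2 <= iJ (n + n2) + iJ n2.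
  by apply: J_triangleB; ring.
have t2 : @J R n * iJ (n - n1) * iJ n1 <= iJ (n - n1) + iJ n1.
  by apply: J_triangle; ring.
have [Jn0 _] : 0 < (J n : R) /\ True by split=> //; exact: J_gt0.
move: t1 t2 (iJ01 (n - n1)) (iJ01 (n1 - n2)) (iJ01 (n + n2)) (iJ01 n1) (iJ01 n2).
set h := iJ (n - n1); set k := iJ (n1 - n2); set s := iJ (n + n2).
set p := iJ n1; set q := iJ n2; set Jn := J n in Jn0 *.
move=> t1 t2 [h0 h1] [k0 k1] [s0 s1] [p0 p1] [q0 q1].
have m1 : (Jn * s * q) * (Jn * h * p) * (k * p * q) <= (s + q) * (h + p) * (k * p * q).
  by rewrite ler_wpM2r ?mulr_ge0// ler_pM ?mulr_ge0// ltW.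
rewrite (_ : (Jn * p * q) ^+ 2 * (h * k * s) = (Jn * s * q) * (Jn * h * p) * (k * p * q)); last by ring.
apply: le_trans m1 _.
have e1 : s * h * k * p * q <= ((h * k) ^+ 2 + (p * q) ^+ 2) / 2.
  apply: le_trans (prod_le (h * k) (p * q)).
  rewrite (_ : s * h * k * p * q = s * (h * k * (p * q))); last by ring.
  by rewrite ler_piMl ?mulr_ge0.
have e2 : s * p * k * p * q <= ((k * p) ^+ 2 + (s * p) ^+ 2) / 2.
  apply: le_trans (prod_le (k * p) (s * p)).
  rewrite (_ : s * p * k * p * q = q * (k * p * (s * p))); last by ring.
  by rewrite ler_piMl ?mulr_ge0.
have e3 : q * h * k * p * q <= ((h * q) ^+ 2 + (p * q) ^+ 2) / 2.
  apply: le_trans (prod_le (h * q) (p * q)).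
  rewrite (_ : q * h * k * p * q = k * (h * q * (p * q))); last by ring.
  by rewrite ler_piMl ?mulr_ge0.
have e4 : q * p * k * p * q <= (p * q) ^+ 2.
  rewrite (_ : q * p * k * p * q = k * (p * q) ^+ 2); last by ring.
  by rewrite ler_piMl ?sqr_ge0.
have := sqr_ge0 (h * k); have := sqr_ge0 (k * s); have := sqr_ge0 (k * p).
have := sqr_ge0 (p * q); have := sqr_ge0 (h * q); have := sqr_ge0 (s * p).
rewrite (_ : (s + q) * (h + p) * (k * p * q) = s * h * k * p * q + s * p * k * p * q
  + q * h * k * p * q + q * p * k * p * q); last by ring.
move: e1 e2 e3 e4.
move: (s * h * k * p * q) (s * p * k * p * q) (q * h * k * p * q) (q * p * k * p * q).
move: ((h * k) ^+ 2) ((k * s) ^+ 2) ((k * p) ^+ 2) ((p * q) ^+ 2) ((h * q) ^+ 2) ((s * p) ^+ 2).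
move=> *; lra.
Qed.

(** In this bound and the next two the entry of frequency n3, n1, n2
    respectively is only measured in l^2: the derivative of the normal form
    puts the time derivative there. The whole decay of 1/Om is used. *)
Lemma kernel_bound_c n n1 n2 :
  (J n * J (n - n1 + n2) * iJ n1 * iJ n2 * (iJ (n - n1) * iJ (n1 - n2) * iJ (n + n2))) ^+ 2 <=
  20 * (mker n n1 n2 : R).
Proof.
have [P1 P2 P3 P4 P5] := @mker_parts R n n1 n2.
have t1 : @J R n * iJ (n + n2) * iJ n2 <= iJ (n + n2) + iJ n2.
  by apply: J_triangleB; ring.
have t2 : @J R (n - n1 + n2) * iJ (n - n1) * iJ n2 <= iJ (n - n1) + iJ n2.
  by apply: J_triangle; ring.
have t3 : @J R (n - n1 + n2) * iJ (n + n2) * iJ n1 <= iJ (n + n2) + iJ n1.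
  by apply: J_triangleB; ring.
have [Jn0 J30] : 0 < (J n : R) /\ 0 < (J (n - n1 + n2) : R) by split; exact: J_gt0.
move: (mker n n1 n2) P1 P2 P3 P4 P5 (iJ01 (n - n1)) (iJ01 (n1 - n2)) (iJ01 (n + n2)) (iJ01 n1) (iJ01 n2).
move=> m; move: t1 t2 t3.
set h := iJ (n - n1); set k := iJ (n1 - n2); set s := iJ (n + n2).
set p := iJ n1; set q := iJ n2; set Jn := J n in Jn0 *; set J3 := J (n - n1 + n2) in J30 *.
move=> t1 t2 t3 P1 P2 P3 P4 P5 [h0 h1] [k0 k1] [s0 s1] [p0 p1] [q0 q1].
have m1 : Jn * J3 * p * q * (h * k * s) <= 3 * (h * k) + k * p.
  rewrite (_ : _ * (h * k * s) = (Jn * s * q) * (J3 * h * k * p)); last by ring.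
  apply: (@le_trans _ _ ((s + q) * (J3 * h * k * p))).
    by rewrite ler_wpM2r//; posi.
  rewrite (_ : (s + q) * _ = (J3 * s * p) * (h * k) + (J3 * h * q) * (k * p)); last by ring.
  apply: (@le_trans _ _ ((s + p) * (h * k) + (h + q) * (k * p))).
    by rewrite lerD// ler_wpM2r ?mulr_ge0.
  have : s * (h * k) <= h * k by rewrite ler_piMl ?mulr_ge0.
  have : p * (h * k) <= h * k by rewrite ler_piMl ?mulr_ge0.
  have : q * (k * p) <= k * p by rewrite ler_piMl ?mulr_ge0.
  have : h * (k * p) <= h * k by rewrite mulrA ler_piMr ?mulr_ge0.
  by lra.
apply: (@le_trans _ _ ((3 * (h * k) + k * p) ^+ 2)).
  by apply: ler_sqr_nneg => //; posi.
have := sqr_ge0 (3 * (h * k) - k * p); move: P1 P3.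
move: (h * k) (k * p) => x y.
rewrite (_ : (3 * x - y) ^+ 2 = 9 * x ^+ 2 - 6 * (x * y) + y ^+ 2); last by ring.
rewrite (_ : (3 * x + y) ^+ 2 = 9 * x ^+ 2 + 6 * (x * y) + y ^+ 2); last by ring.
by move: (x ^+ 2) (y ^+ 2) (x * y) => *; lra.
Qed.

Lemma kernel_bound_a n n1 n2 :
  (J n * iJ n2 * (iJ (n - n1) * iJ (n1 - n2) * iJ (n + n2))) ^+ 2 <=
  20 * (mker n n1 n2 : R).
Proof.
have [P1 P2 P3 P4 P5] := @mker_parts R n n1 n2.
have t1 : @J R n * iJ (n + n2) * iJ n2 <= iJ (n + n2) + iJ n2.
  by apply: J_triangleB; ring.
have [Jn0 J30] : 0 < (J n : R) /\ 0 < (J (n - n1 + n2) : R) by split; exact: J_gt0.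
move: (mker n n1 n2) P1 P2 P3 P4 P5 (iJ01 (n - n1)) (iJ01 (n1 - n2)) (iJ01 (n + n2)) (iJ01 n1) (iJ01 n2).
move=> m; move: t1.
set h := iJ (n - n1); set k := iJ (n1 - n2); set s := iJ (n + n2).
set p := iJ n1; set q := iJ n2; set Jn := J n in Jn0 *.
move=> t1 P1 P2 P3 P4 P5 [h0 h1] [k0 k1] [s0 s1] [p0 p1] [q0 q1].
have m1 : Jn * q * (h * k * s) <= 2 * (h * k).
  rewrite (_ : _ * (h * k * s) = (Jn * s * q) * (h * k)); last by ring.
  by rewrite ler_wpM2r ?mulr_ge0//; lra.
apply: (@le_trans _ _ ((2 * (h * k)) ^+ 2)).
  by apply: ler_sqr_nneg => //; posi.
by have := sqr_ge0 (h * k); rewrite exprMn; lra.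
Qed.

Lemma kernel_bound_b n n1 n2 :
  (J n * iJ n1 * (iJ (n - n1) * iJ (n1 - n2) * iJ (n + n2))) ^+ 2 <=
  20 * (mker n n1 n2 : R).
Proof.
have [P1 P2 P3 P4 P5] := @mker_parts R n n1 n2.
have t1 : @J R n * iJ (n - n1) * iJ n1 <= iJ (n - n1) + iJ n1.
  by apply: J_triangle; ring.
have [Jn0 J30] : 0 < (J n : R) /\ 0 < (J (n - n1 + n2) : R) by split; exact: J_gt0.
move: (mker n n1 n2) P1 P2 P3 P4 P5 (iJ01 (n - n1)) (iJ01 (n1 - n2)) (iJ01 (n + n2)) (iJ01 n1) (iJ01 n2).
move=> m; move: t1.
set h := iJ (n - n1); set k := iJ (n1 - n2); set s := iJ (n + n2).
set p := iJ n1; set q := iJ n2; set Jn := J n in Jn0 *.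
move=> t1 P1 P2 P3 P4 P5 [h0 h1] [k0 k1] [s0 s1] [p0 p1] [q0 q1].
have m1 : Jn * p * (h * k * s) <= 2 * (k * s).
  rewrite (_ : _ * (h * k * s) = (Jn * h * p) * (k * s)); last by ring.
  by rewrite ler_wpM2r ?mulr_ge0//; lra.
apply: (@le_trans _ _ ((2 * (k * s)) ^+ 2)).
  by apply: ler_sqr_nneg => //; posi.
by have := sqr_ge0 (k * s); rewrite exprMn; lra.
Qed.

(** ** The kernels of the normal form *)

(** The nearly resonant part, the strongly nonresonant part, and the latter
    divided by the derivative of its oscillation. The diagonal n1 = n2 is
    excluded from the first, and removed by a change of phase. *)
Definition kaR (Lam : R) (n n1 n2 : int) : R[i] :=
  if (n1 != n2) && (`|Om n n1 n2| <= Lam) then ka0 n n1 n2 else 0.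

Definition kaH (Lam : R) (n n1 n2 : int) : R[i] :=
  if Lam < `|Om n n1 n2| then ka0 n n1 n2 else 0.

Definition kaB (Lam : R) (n n1 n2 : int) : R[i] :=
  if Lam < `|Om n n1 n2| then (0 +i* (Om n n1 n2)^-1) * ka0 n n1 n2 else 0.

(** One factor 1/|Om| compensates the loss of derivative. *)
Lemma ka0_invOm : exists2 C : R, 0 < C & forall n n1 n2, Om n n1 n2 != 0 ->
  w n * (sqmod (ka0 n n1 n2) / (w n1 * w n2 * w (n - n1 + n2))) * `|Om n n1 n2|^-1 <=
  C * mker n n1 n2.
Proof.
have [c c0 hc] := Om_lower; have cm0 := cm_ge0 alpha beta.
exists (8 * cm * c + 1) => [|n n1 n2 h]; first by rewrite ltr_wpDl//; posi.
have h1 := ka0_w_le n n1 n2; have h2 := hc _ _ _ h; have h3 := kernel_bound1 n n1 n2.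
have k0 := @mker_ge0 R n n1 n2.
apply: (@le_trans _ _ (4 * cm * (J n * iJ n1 * iJ n2) ^+ 2 *
    (c * (iJ (n - n1) * iJ (n1 - n2) * iJ (n + n2))))).
  apply: ler_pM => //.
  by rewrite mulr_ge0 ?w_ge0// divr_ge0 ?sqmod_ge0// !mulr_ge0 ?w_ge0.
rewrite (_ : _ * _ * (c * _) = 4 * cm * c * ((J n * iJ n1 * iJ n2) ^+ 2 * (iJ (n - n1) * iJ (n1 - n2) * iJ (n + n2)))); last by ring.
apply: (@le_trans _ _ (4 * cm * c * (2 * mker n n1 n2))).
  by rewrite ler_wpM2l//; posi.
by move: (mker n n1 n2) k0 => x x0; nra.
Qed.

(** One factor 1/Om is traded for the size, and the other is summed. *)
Lemma kaB_small : exists2 C : R, 0 < C & forall Lam n, 0 < Lam ->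
  bsum (fun p : int * int => w n * sqmod (kaB Lam n p.1 p.2) /
    (w p.1 * w p.2 * w (n - p.1 + p.2))) (C / Lam).
Proof.
have [C C0 hC] := ka0_invOm; exists (C * 54) => [|Lam n L0]; first by rewrite mulr_gt0.
have CL : 0 <= C / Lam by posi.
rewrite mulrAC; apply: bsum_le (bsumZ CL (@bsum_mker R n)) => -[n1 n2] /=.
have k0 := @mker_ge0 R n n1 n2.
rewrite /kaB; case: ifP => h; last by rewrite sqmod0 mulr0 mul0r; posi.
have Oz : 0 < `|Om n n1 n2| by exact: lt_trans h.
have On0 : Om n n1 n2 != 0 by rewrite -normr_gt0.
have h1 := hC _ _ _ On0.
rewrite sqmodM (_ : sqmod _ = `|Om n n1 n2|^-1 * `|Om n n1 n2|^-1); last first.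
  by rewrite /sqmod/= expr0n/= add0r -normfV -expr2 real_normK ?num_real.
rewrite (_ : _ / _ = w n * (sqmod (ka0 n n1 n2) / (w n1 * w n2 * w (n - n1 + n2))) *
   `|Om n n1 n2|^-1 * `|Om n n1 n2|^-1); last by ring.
rewrite -mulrA [leRHS]mulrAC mulrA; apply: ler_pM => //.
- rewrite mulr_ge0 ?invr_ge0// mulr_ge0 ?w_ge0// divr_ge0 ?sqmod_ge0// !mulr_ge0 ?w_ge0//.
by rewrite lef_pV2 ?posrE// ltW.
Qed.

(** The oscillating factors of two nearby times differ little on the kernel of
    the normal form: half of the decay of 1/Om is traded for this. *)
Lemma kaB_time : exists2 C : R, 0 < C & forall Lam n s t, 0 < Lam ->
  bsum (fun p : int * int => w n * sqmod ((cis (- Om n p.1 p.2 * t) - cis (- Om n p.1 p.2 * s)) *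
    kaB Lam n p.1 p.2) / (w p.1 * w p.2 * w (n - p.1 + p.2))) (C * `|t - s|).
Proof.
have [C C0 hC] := ka0_invOm; exists (2 * C * 54) => [|Lam n s t L0]; first by rewrite !mulr_gt0.
have CL : 0 <= 2 * C * `|t - s| by posi.
rewrite mulrAC; apply: bsum_le (bsumZ CL (@bsum_mker R n)) => -[n1 n2] /=.
have k0 := @mker_ge0 R n n1 n2.
rewrite /kaB; case: ifP => h; last by rewrite mulr0 sqmod0 mulr0 mul0r; posi.
have Oz : 0 < `|Om n n1 n2| by exact: lt_trans h.
have On0 : Om n n1 n2 != 0 by rewrite -normr_gt0.
have h1 := hC _ _ _ On0.
rewrite !sqmodM (_ : sqmod (0 +i* _) = `|Om n n1 n2|^-1 * `|Om n n1 n2|^-1); last first.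
  by rewrite /sqmod/= expr0n/= add0r -normfV -expr2 real_normK ?num_real.
set q := sqmod (cis _ - _).
have hq : q <= 2 * (`|Om n n1 n2| * `|t - s|).
  apply: le_trans (sqmod_cisB _ _) _; rewrite -normrM (_ : - _ * t - _ = - (Om n n1 n2 * (t - s))); last by ring.
  by rewrite normrN.
rewrite (_ : _ / _ = q * (w n * (sqmod (ka0 n n1 n2) / (w n1 * w n2 * w (n - n1 + n2))) *
   `|Om n n1 n2|^-1 * `|Om n n1 n2|^-1)); last by ring.
set X := w n * _ in h1 *.
have X0 : 0 <= X by rewrite mulr_ge0 ?w_ge0// divr_ge0 ?sqmod_ge0// !mulr_ge0 ?w_ge0.
apply: (@le_trans _ _ (2 * (`|Om n n1 n2| * `|t - s|) * (X * `|Om n n1 n2|^-1 * `|Om n n1 n2|^-1))).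
  by rewrite ler_wpM2r//; posi.
rewrite (_ : _ * _ = 2 * `|t - s| * (X * `|Om n n1 n2|^-1)); last by field; rewrite gt_eqF.
rewrite (_ : 2 * C * _ * _ = 2 * `|t - s| * (C * mker n n1 n2)); last by ring.
by apply: ler_wpM2l => //; posi.
Qed.

(** If Om does not vanish, then [ka0_invOm] applies at the price of a factor
    Lam. If it vanishes off the diagonal, then n = n1, where the weights cancel, or s is the resonant
    value, where n + n2 is bounded. *)
Lemma kaR_bound (Lam : R) : 0 < Lam -> exists2 C : R, 0 < C & forall n,
  bsum (fun p : int * int => w n * sqmod (kaR Lam n p.1 p.2) /
    (w p.1 * w p.2 * w (n - p.1 + p.2))) C.
Proof.
move=> L0; have [C C0 hC] := ka0_invOm; have [D D1 hD] := DD_zero.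
have cm0 := cm_ge0 alpha beta; have D0 : 0 <= D by exact: le_trans D1.
pose E := C * Lam + 4 * cm + 16 * cm * D ^+ 2 * D ^+ 2.
have E0 : 0 < E by rewrite /E -addrA ltr_pwDl ?mulr_gt0//; posi.
exists (E * 54) => [|n]; first by rewrite mulr_gt0.
apply: bsum_le (bsumZ (ltW E0) (@bsum_mker R n)) => -[n1 n2] /=.
have k0 := @mker_ge0 R n n1 n2.
rewrite /kaR; case: ifP => [/andP[n12 hO]|_]; last by rewrite sqmod0 mulr0 mul0r; posi.
rewrite -mulrA; set X := w n * _.
have hX : X <= 4 * cm * (J n * iJ n1 * iJ n2) ^+ 2 by exact: ka0_w_le.
have X0 : 0 <= X by rewrite mulr_ge0 ?w_ge0// divr_ge0 ?sqmod_ge0// !mulr_ge0 ?w_ge0.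
have t1 : 0 <= 4 * cm * mker n n1 n2 by posi.
have t2 : 0 <= C * Lam * mker n n1 n2 by posi.
have t3 : 0 <= 16 * cm * D ^+ 2 * D ^+ 2 * mker n n1 n2 by posi.
have jn1 := iJ_ge0 n1 : 0 <= (_ : R); have jn2 := iJ_ge0 n2 : 0 <= (_ : R).
have jn := J_gt0 n : 0 < (_ : R).
have [_ _ _ mk1 mk2] := @mker_parts R n n1 n2.
rewrite /E (mulrDl (_ + _)) (mulrDl (C * Lam)).
have [Oz|Oz] := eqVneq (Om n n1 n2) 0; last first.
  have := hC _ _ _ Oz; rewrite -/X ler_pdivrMr ?normr_gt0// => h.
  have : C * mker n n1 n2 * `|Om n n1 n2| <= C * Lam * mker n n1 n2.
    by rewrite -!mulrA ler_pM2l// mulrC ler_wpM2r.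
  by lra.
move/eqP: Oz; rewrite /Om !mulf_eq0 -!intrB !intr_eq0 [n1 - n2 == 0]subr_eq0 (negbTE n12) orbF.
move=> /orP[/eqP Ds|nn1]; last first.
  have h1 : iJ (n - n1) = 1 :> R by rewrite (eqP nn1) /iJ /J normr0 addr0 invr1.
  have e : J n * iJ n1 = 1 :> R by move: nn1; rewrite subr_eq0 => /eqP <-; rewrite iJK.
  move: hX mk1; rewrite e h1 !mul1r => hX mk1.
  by have : 4 * cm * iJ n2 ^+ 2 <= 4 * cm * mker n n1 n2; [rewrite ler_wpM2l//; posi|lra].
have tr : @J R n * iJ (n + n2) * iJ n2 <= iJ (n + n2) + iJ n2.
  by apply: J_triangleB; ring.
have js := iJ_gt0 (n + n2) : 0 < (_ : R).
have e1 : 1 <= D * iJ (n + n2) by rewrite -(iJK (n + n2)) ler_wpM2r ?iJ_ge0// hD.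
have e2 : J n * iJ n2 <= 2 * D.
  have t4 : @J R n * iJ (n + n2) * iJ n2 <= 2.
    by apply: le_trans tr _; have := @iJ_le1 R (n + n2); have := @iJ_le1 R n2; lra.
  have : J n * iJ n2 * 1 <= J n * iJ n2 * (D * iJ (n + n2)) by rewrite ler_wpM2l//; posi.
  have : (J n * iJ (n + n2) * iJ n2) * D <= 2 * D by rewrite ler_wpM2r.
  rewrite mulr1 (_ : J n * iJ n2 * (D * _) = J n * iJ (n + n2) * iJ n2 * D); last by ring.
  lra.
have e3 : J n * iJ n1 * iJ n2 <= 2 * D * (D * (iJ (n + n2) * iJ n1)).
  rewrite (_ : J n * iJ n1 * iJ n2 = (J n * iJ n2) * iJ n1); last by ring.
  apply: ler_pM => //; first by posi.
  by rewrite mulrA ler_peMl.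
have e4 : (J n * iJ n1 * iJ n2) ^+ 2 <= (2 * D * (D * (iJ (n + n2) * iJ n1))) ^+ 2.
  by apply: ler_sqr_nneg => //; posi.
have : 4 * cm * (J n * iJ n1 * iJ n2) ^+ 2 <= 16 * cm * D ^+ 2 * D ^+ 2 * mker n n1 n2.
  apply: (@le_trans _ _ (16 * cm * D ^+ 2 * D ^+ 2 * (iJ (n + n2) * iJ n1) ^+ 2)).
    rewrite (_ : 16 * cm * _ * _ * _ = 4 * cm * (2 * D * (D * (iJ (n + n2) * iJ n1))) ^+ 2); last by ring.
    by rewrite ler_wpM2l//; posi.
  by rewrite ler_wpM2l//; posi.
lra.
Qed.

Lemma ka0_split (wt ir : R) n n1 n2 : 0 < wt -> 0 <= ir ->
  w (n - n1 + n2) <= 4 * ir ^+ 2 * wt ->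
  sqmod (ka0 n n1 n2) / wt <= 4 * cm * ir ^+ 2.
Proof.
move=> wt0 ir0 h; rewrite ler_pdivrMr//; apply: le_trans (sqmod_symb _ _ _) _.
rewrite (_ : _ * wt = cm * (4 * ir ^+ 2 * wt)); last by ring.
by rewrite ler_wpM2l ?cm_ge0.
Qed.

Lemma one_le_iJ2w (n : int) : 1 <= 2 * iJ n ^+ 2 * w n :> R.
Proof. by rewrite -ler_pdivrMr ?w_gt0// mul1r iw_le. Qed.

(** The same comparison with the master kernel, using both factors 1/Om. *)
Lemma kaB_deriv (Lam : R) : 0 < Lam -> exists2 C : R, 0 < C & forall n,
  [/\ bsum (fun p : int * int => w n * sqmod (kaB Lam n p.1 p.2) /
        (w1 p.1 * w p.2 * w (n - p.1 + p.2))) C,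
      bsum (fun p : int * int => w n * sqmod (kaB Lam n p.1 p.2) /
        (w p.1 * w1 p.2 * w (n - p.1 + p.2))) C &
      bsum (fun p : int * int => w n * sqmod (kaB Lam n p.1 p.2) /
        (w p.1 * w p.2 * w1 (n - p.1 + p.2))) C].
Proof.
move=> L0; have [c c0 hc] := Om_lower.
have cm0 := cm_ge0 alpha beta.
pose E := 80 * cm * c ^+ 2 + 1.
have E0 : 0 < E by rewrite /E ltr_wpDl//; posi.
have pt n n1 n2 (wt ir : R) : 0 <= wt -> sqmod (ka0 n n1 n2) / wt <= 4 * cm * ir ^+ 2 -> 0 <= ir ->
    (J n * ir * (iJ (n - n1) * iJ (n1 - n2) * iJ (n + n2))) ^+ 2 <= 20 * mker n n1 n2 ->
    w n * sqmod (kaB Lam n n1 n2) / wt <= E * mker n n1 n2.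
  move=> wt0 hwt ir0 hk; have k0 := @mker_ge0 R n n1 n2.
  rewrite /kaB; case: ifP => h; last by rewrite sqmod0 mulr0 mul0r; posi.
  have Oz : 0 < `|Om n n1 n2| by exact: lt_trans h.
  have On0 : Om n n1 n2 != 0 by rewrite -normr_gt0.
  have hO := hc _ _ _ On0.
  rewrite sqmodM (_ : sqmod (0 +i* _) = `|Om n n1 n2|^-1 ^+ 2); last first.
    by rewrite /sqmod/= expr0n/= add0r -normfV real_normK ?num_real.
  set g := iJ _ * _ * _ in hk hO.
  rewrite (_ : _ / _ = w n * `|Om n n1 n2|^-1 ^+ 2 * (sqmod (ka0 n n1 n2) / wt)); last by ring.
  apply: (@le_trans _ _ (J n ^+ 2 * (c * g) ^+ 2 * (4 * cm * ir ^+ 2))).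
    apply: ler_pM => //; first by rewrite mulr_ge0 ?w_ge0 ?sqr_ge0.
      by rewrite divr_ge0 ?sqmod_ge0.
    apply: ler_pM; rewrite ?w_ge0 ?sqr_ge0 ?w_le_J2//.
    by apply: ler_sqr_nneg; rewrite ?invr_ge0.
  rewrite (_ : _ * _ * _ = 4 * cm * c ^+ 2 * (J n * ir * g) ^+ 2); last by ring.
  apply: (@le_trans _ _ (4 * cm * c ^+ 2 * (20 * mker n n1 n2))).
    by apply: ler_wpM2l => //; posi.
  rewrite /E; move: (mker n n1 n2) k0 => m m0; lra.
exists (E * 54) => [|n]; first by rewrite mulr_gt0.
split; apply: bsum_le (bsumZ (ltW E0) (@bsum_mker R n)) => -[n1 n2] /=.
- apply: (pt _ _ _ _ (iJ n2)).
  + by rewrite /w1 mul1r; apply: mulr_ge0; exact: w_ge0.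
  + apply: ka0_split; rewrite ?iJ_ge0 /w1 ?mul1r ?mulr_gt0 ?w_gt0// mulrA.
    by rewrite ler_peMl ?w_ge0//; have := one_le_iJ2w n2; lra.
  + exact: iJ_ge0.
  + exact: kernel_bound_a.
- apply: (pt _ _ _ _ (iJ n1)).
  + by rewrite /w1 mulr1; apply: mulr_ge0; exact: w_ge0.
  + apply: ka0_split; rewrite ?iJ_ge0 /w1 ?mulr1 ?mulr_gt0 ?w_gt0// mulrA.
    by rewrite ler_peMl ?w_ge0//; have := one_le_iJ2w n1; lra.
  + exact: iJ_ge0.
  + exact: kernel_bound_b.
apply: (pt _ _ _ _ (J (n - n1 + n2) * iJ n1 * iJ n2)).
+ by rewrite /w1 mulr1; apply: mulr_ge0; exact: w_ge0.
+ apply: ka0_split; first by rewrite /w1 mulr1 mulr_gt0 ?w_gt0.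
    by have := iJ_ge0 n1 : 0 <= (_ : R); have := iJ_ge0 n2 : 0 <= (_ : R); have := J_gt0 (n - n1 + n2) : 0 < (_ : R); move=> *; posi.
  rewrite /w1 mulr1 (_ : _ * (w n1 * w n2) = J (n - n1 + n2) ^+ 2 *
    ((2 * iJ n1 ^+ 2 * w n1) * (2 * iJ n2 ^+ 2 * w n2))); last by ring.
  apply: le_trans (w_le_J2 _) _; rewrite ler_peMr ?sqr_ge0//.
  by rewrite -[X in X <= _]mulr1; apply: ler_pM => //; exact: one_le_iJ2w.
+ by have := iJ_ge0 n1 : 0 <= (_ : R); have := iJ_ge0 n2 : 0 <= (_ : R); have := J_gt0 (n - n1 + n2) : 0 < (_ : R); move=> *; posi.
+ by have := @kernel_bound_c n n1 n2; rewrite !mulrA.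
Qed.

End Resonance.

(** * Normal form reduction: uniqueness and strong continuity *)

Section NormalForm.
Context {R : realType}.
Variables (alpha beta a b : R).
Hypothesis b0 : b != 0.
Local Notation symb := (symb alpha beta).
Local Notation ka0 := (ka0 alpha beta).
Local Notation cm := (cm alpha beta).
Local Notation phi := (phi a b).
Local Notation Om := (Om a b).
Local Notation kaR := (kaR alpha beta a b).
Local Notation kaH := (kaH alpha beta a b).
Local Notation kaB := (kaB alpha beta a b).
Local Notation state := (bool -> int -> R[i]).
Implicit Types (v g : R -> state) (U : state).

Definition cisk (t : R) (ka : int -> int -> int -> R[i]) (n n1 n2 : int) : R[i] :=
  cis (- Om n n1 n2 * t) * ka n n1 n2.

Lemma cisk_bsum t ka (wo wa wb wc : int -> R) n B :
  bsum (fun p : int * int => wo n * sqmod (ka n p.1 p.2) /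
    (wa p.1 * wb p.2 * wc (n - p.1 + p.2))) B ->
  bsum (fun p : int * int => wo n * sqmod (cisk t ka n p.1 p.2) /
    (wa p.1 * wb p.2 * wc (n - p.1 + p.2))) B.
Proof. by apply: bsum_le => p; rewrite /cisk sqmodM sqmod_cis mul1r. Qed.

Definition Bop Lam K (t : R) U j n : R[i] := cub (cisk t (kaB Lam)) U U U j (box K) n.

(** Differentiation by parts: the derivative of the oscillating factor gives
    back the high resonance part of the cubic term. *)
Lemma cder_Bop Lam K v g j n t : 0 < Lam ->
  (forall j n, cder (fun s => v s j n) t (g t j n)) ->
  cder (fun s => Bop Lam K s (v s) j n) t
    (cub (cisk t (kaH Lam)) (v t) (v t) (v t) j (box K) n +
     (cub (cisk t (kaB Lam)) (g t) (v t) (v t) j (box K) n +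
      cub (cisk t (kaB Lam)) (v t) (g t) (v t) j (box K) n +
      cub (cisk t (kaB Lam)) (v t) (v t) (g t) j (box K) n)).
Proof.
move=> L0 hd.
have hT k : cder (fun s => Tr (cisk s (kaB Lam)) (v s k) (v s k) (v s j) (box K) n) t
    (Tr (cisk t (kaH Lam)) (v t k) (v t k) (v t j) (box K) n +
     (Tr (cisk t (kaB Lam)) (g t k) (v t k) (v t j) (box K) n +
      Tr (cisk t (kaB Lam)) (v t k) (g t k) (v t j) (box K) n +
      Tr (cisk t (kaB Lam)) (v t k) (v t k) (g t j) (box K) n)).
  rewrite /Tr -!big_split/=; apply: cder_sum => -[n1 n2] /=.
  have h1 := hd k n1; have h2 := cderJ (hd k n2); have h3 := hd j (n - n1 + n2).
  have h0 : cder (fun s => cisk s (kaB Lam) n n1 n2) t (cisk t (kaH Lam) n n1 n2).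
    rewrite /cisk; have := cder_cis (- Om n n1 n2) t => /cderM /(_ (cder_cst (kaB Lam n n1 n2) t)).
    move/cder_eq; apply; rewrite mulr0 addr0 /kaB /kaH; case: ifP => hO; last by rewrite !mulr0.
    have On0 : Om n n1 n2 != 0 by rewrite -normr_gt0 (lt_trans L0).
    set x := 0 +i* - Om n n1 n2; set y := 0 +i* (Om n n1 n2)^-1.
    have xy : x * y = 1.
      by apply/eqP; rewrite eq_complex /= !mul0r mulr0 addr0 sub0r mulNr opprK mulfV// !eqxx.
    rewrite (_ : x * _ * _ = (x * y) * (cis (- Om n n1 n2 * t) * ka0 n n1 n2)); last by ring.
    by rewrite xy mul1r.
  apply: cder_eq (cderM (cderM (cderM h0 h1) h2) h3) _; ring.
rewrite /Bop /cub; apply: cder_eq (cderD (hT false) (hT true)) _; rewrite /cub; ring.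
Qed.

(** What the reduction uses of a solution in the interaction representation:
    its derivative g is only in l^2, and g is the resonant part plus the high
    resonance part of the truncated cubic term, up to an error which tends to
    0 on every finite set of frequencies. *)
Definition nfsol (T B Bg : R) v g : Prop :=
  [/\ forall t, `|t| <= T -> hb (v t) B,
      forall t, `|t| <= T -> forall j, l2b w1 (g t j) Bg,
      forall t j n, cder (fun s => v s j n) t (g t j n) &
      forall Lam, 0 < Lam -> forall (r : seq int) eta, uniq r -> 0 < eta ->
        exists K0, forall K, (K0 <= K)%N -> forall t, `|t| <= T -> forall j,
        l2b (trunc w r) (fun n => g t j n -
          (cub (cisk t (kaR Lam)) (v t) (v t) (v t) j (box K) n +
           cub (cisk t (kaH Lam)) (v t) (v t) (v t) j (box K) n)) eta].

(** The difference of two trajectories after the correction. *)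
Definition nfD Lam K v v' j s n : R[i] :=
  v s j n - v' s j n - (Bop Lam K s (v s) j n - Bop Lam K s (v' s) j n).

(** The corrected difference has a derivative in which the strongly
    nonresonant terms have cancelled: only the nearly resonant ones, bounded
    by SR, and those with a time derivative in the correction, bounded by SB,
    remain. The mean value inequality is applied to it. *)
Lemma nf_step T B Bg v g v' g' Lam SR SB t0 t d c :
  nfsol T B Bg v g -> nfsol T B Bg v' g' -> 0 < Lam -> 0 <= SR -> 0 <= SB ->
  (forall n, bsum (fun p : int * int => w n * sqmod (kaR Lam n p.1 p.2) /
    (w p.1 * w p.2 * w (n - p.1 + p.2))) (SR ^+ 2)) ->
  (forall n,
  [/\ bsum (fun p : int * int => w n * sqmod (kaB Lam n p.1 p.2) /
        (w1 p.1 * w p.2 * w (n - p.1 + p.2))) (SB ^+ 2),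
      bsum (fun p : int * int => w n * sqmod (kaB Lam n p.1 p.2) /
        (w p.1 * w1 p.2 * w (n - p.1 + p.2))) (SB ^+ 2) &
      bsum (fun p : int * int => w n * sqmod (kaB Lam n p.1 p.2) /
        (w p.1 * w p.2 * w1 (n - p.1 + p.2))) (SB ^+ 2)]) ->
  `|t0| + `|t - t0| <= T ->
  (forall s, `|s - t0| <= `|t - t0| ->
     hb (fun j n => v s j n - v' s j n) d /\
     forall j, l2b w1 (fun n => g s j n - g' s j n) c) ->
  forall r eta, uniq r -> 0 < eta -> exists K, forall j,
    l2b (trunc w r) (fun n => nfD Lam K v v' j t n - nfD Lam K v v' j t0 n)
      (`|t - t0| * (6 * SR * B ^+ 2 * d + 6 * SB * (c * B ^+ 2 + 2 * Bg * B * d) + eta)).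
Proof.
move=> [hv hg hd he] [hv' hg' hd' he'] L0 SR0 SB0 hR hB tT hdiff r eta ur eta0.
have eta2 : 0 < eta / 2 by rewrite divr_gt0.
have [K1 hK1] := he _ L0 r _ ur eta2; have [K2 hK2] := he' _ L0 r _ ur eta2.
pose K := maxn K1 K2; exists K => j.
have sT s : `|s - t0| <= `|t - t0| -> `|s| <= T.
  move=> hs; apply: le_trans tT; rewrite -[s](subrK t0) addrC.
  by apply: le_trans (ler_normD _ _) _; rewrite lerD2l.
pose Bd s U G k n := cub (cisk s (kaB Lam)) G U U k (box K) n +
      cub (cisk s (kaB Lam)) U G U k (box K) n + cub (cisk s (kaB Lam)) U U G k (box K) n.
pose E s n := (g s j n - g' s j n) -
  ((cub (cisk s (kaH Lam)) (v s) (v s) (v s) j (box K) n + Bd s (v s) (g s) j n) -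
   (cub (cisk s (kaH Lam)) (v' s) (v' s) (v' s) j (box K) n + Bd s (v' s) (g' s) j n)).
have w0 := @w_gt0 R; have w0' n := ltW (w0 n); have w10 n : 0 < (w1 n : R) by exact: ltr01.
have tr0 : forall n, 0 <= trunc w r n :> R by apply: trunc_ge0.
apply: (@l2b_mean_value _ _ _ (fun s n => nfD Lam K v v' j s n) E) => //.
  move=> s n _ _; apply: cderB; first by apply: cderB; [exact: hd|exact: hd'].
  by apply: cderB; apply: cder_Bop.
move=> s hs; have sT' := sT _ hs; have [hdv hdg] := hdiff _ hs.
have hvs := hv _ sT'; have hvs' := hv' _ sT'; have hgs := hg _ sT'; have hgs' := hg' _ sT'.
have R1 := l2b_cub_sub (uniq_box K) w0' w0 w0 w0 SR0 (fun n => cisk_bsum s (hR n))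
  hvs (hvs j) hvs' hvs' hdv hdv (hdv j).
have ba n : bsum _ _ := let: And3 h _ _ := hB n in cisk_bsum s h.
have bb n : bsum _ _ := let: And3 _ h _ := hB n in cisk_bsum s h.
have bc n : bsum _ _ := let: And3 _ _ h := hB n in cisk_bsum s h.
have B1 := l2b_cub_sub (uniq_box K) w0' w10 w0 w0 SB0 ba hvs (hvs j) hgs' hvs' hdg hdv (hdv j).
have B2 := l2b_cub_sub (uniq_box K) w0' w0 w10 w0 SB0 bb hgs (hvs j) hvs' hgs' hdv hdg (hdv j).
have B3 := l2b_cub_sub (uniq_box K) w0' w0 w0 w10 SB0 bc hvs (hgs j) hvs' hvs' hdv hdv (hdg j).
have e1 := hK1 K (leq_maxl _ _) s sT' j; have e2 := hK2 K (leq_maxr _ _) s sT' j.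
have := l2bB tr0 (l2bD tr0 (l2b_trunc r w0' R1) (l2bB tr0 e1 e2))
  (l2b_trunc r w0' (l2bD w0' (l2bD w0' B1 B2) B3)).
rewrite (_ : _ + _ + _ = 6 * SR * B ^+ 2 * d + 6 * SB * (c * B ^+ 2 + 2 * Bg * B * d) + eta); last by field.
by apply: eq_l2b => n; rewrite /E /Bd; ring.
Qed.

Lemma Bop_diff Lam K S1 B d t U U' j : 0 <= S1 ->
  (forall n, bsum (fun p : int * int => w n * sqmod (kaB Lam n p.1 p.2) /
    (w p.1 * w p.2 * w (n - p.1 + p.2))) (S1 ^+ 2)) ->
  hb U B -> hb U' B -> hb (fun j n => U j n - U' j n) d ->
  l2b w (fun n => Bop Lam K t U j n - Bop Lam K t U' j n) (6 * S1 * B ^+ 2 * d).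
Proof.
move=> S10 h1 hU hU' hd; have w0 := @w_gt0 R.
have := l2b_cub_sub (uniq_box K) (fun n => ltW (w0 n)) w0 w0 w0 S10 (fun n => cisk_bsum t (h1 n))
  hU (hU j) hU' hU' hd hd (hd j).
by rewrite (_ : 2 * _ = 6 * S1 * B ^+ 2 * d); last by ring.
Qed.

(** Lam is chosen first, so large that the correction is a contraction with
    factor 1/4 on the ball of radius B; the other bounds depend on Lam. *)
Lemma nf_constants B : 0 <= B -> exists Lam SR SB S1, [/\ 0 < Lam,
  [/\ 0 <= SR, 0 <= SB & 0 <= S1],
  (forall n, bsum (fun p : int * int => w n * sqmod (kaR Lam n p.1 p.2) /
    (w p.1 * w p.2 * w (n - p.1 + p.2))) (SR ^+ 2)),
  (forall n,
  [/\ bsum (fun p : int * int => w n * sqmod (kaB Lam n p.1 p.2) /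
        (w1 p.1 * w p.2 * w (n - p.1 + p.2))) (SB ^+ 2),
      bsum (fun p : int * int => w n * sqmod (kaB Lam n p.1 p.2) /
        (w p.1 * w1 p.2 * w (n - p.1 + p.2))) (SB ^+ 2) &
      bsum (fun p : int * int => w n * sqmod (kaB Lam n p.1 p.2) /
        (w p.1 * w p.2 * w1 (n - p.1 + p.2))) (SB ^+ 2)]) &
  6 * S1 * B ^+ 2 <= 1 / 4 /\
  (forall n, bsum (fun p : int * int => w n * sqmod (kaB Lam n p.1 p.2) /
    (w p.1 * w p.2 * w (n - p.1 + p.2))) (S1 ^+ 2))].
Proof.
move=> B0; have [C C0 hC] := kaB_small alpha beta a b0.
pose e := (24 * (B ^+ 2 + 1))^-1.
have B2 : 0 < B ^+ 2 + 1 by rewrite ltr_wpDl ?sqr_ge0.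
have e0 : 0 < e by rewrite invr_gt0 mulr_gt0.
pose Lam := C / e ^+ 2; have L0 : 0 < Lam by rewrite divr_gt0// exprn_gt0.
have [CR CR0 hCR] := kaR_bound alpha beta a b0 L0.
have [CB CB0 hCB] := kaB_deriv alpha beta a b0 L0.
exists Lam, (Num.sqrt CR), (Num.sqrt CB), e; split=> //.
- by split; rewrite ?sqrtr_ge0// ltW.
- by move=> n; rewrite sqr_sqrtr ?ltW.
- by move=> n; rewrite sqr_sqrtr ?ltW.
split.
  rewrite /e invfM (_ : _ * _ * _ = (B ^+ 2 / (B ^+ 2 + 1)) / 4); last first.
    by field; rewrite gt_eqF.
  by rewrite ler_pM2r ?invr_gt0// ler_pdivrMr// mul1r lerDl.
move=> n; have := hC Lam n L0; rewrite /Lam (_ : C / (C / e ^+ 2) = e ^+ 2)//.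
by field; rewrite !gt_eqF.
Qed.

Lemma hb_diff U U' B : hb U B -> hb U' B -> hb (fun j n => U j n - U' j n) (2 * B).
Proof. by move=> h h' j; rewrite mulr_natl mulr2n; apply: l2bB => //; exact: w_ge0. Qed.

Lemma geo_cvg0 (q x e : R) : 0 <= q -> q < 1 -> 0 <= x -> 0 < e -> exists k, q ^+ k * x < e.
Proof.
move=> q0 q1 x0 e0.
have /cvgrPdist_lt/(_ _ e0)[k _ hk] : q ^+ k * x @[k --> \oo] --> (0 : R).
  by rewrite -[X in _ --> X](mul0r x); apply: cvgMl; apply: cvg_expr; rewrite ger0_norm.
exists k; have := hk k (leqnn k); rewrite sub0r normrN; apply: le_lt_trans.
exact: ler_norm.
Qed.

(** Let d bound the H^1 distance near t0. The correction and, over a short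
    time, the integrated derivative contribute at most d/4 each; so 3d/4 is a
    bound as well, and the distance vanishes. *)
Lemma nf_unique_local T B Bg Cg v g v' g' :
  nfsol T B Bg v g -> nfsol T B Bg v' g' -> 0 <= B -> 0 <= Bg -> 0 <= Cg ->
  (forall t d, `|t| <= T -> hb (fun j n => v t j n - v' t j n) d ->
     forall j, l2b w1 (fun n => g t j n - g' t j n) (Cg * d)) ->
  exists2 tau0 : R, 0 < tau0 & forall tau t0 t, 0 < tau -> tau <= tau0 ->
    `|t0| + tau <= T -> `|t - t0| <= tau -> v t0 = v' t0 -> v t = v' t.
Proof.
move=> hn hn' B0 Bg0 Cg0 hgd.
have [Lam [SR [SB [S1 [L0 [SR0 SB0 S10] hR hB [hS1 hB1]]]]]] := nf_constants B0.
pose C := 6 * SR * B ^+ 2 + 6 * SB * (Cg * B ^+ 2 + 2 * Bg * B).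
have C0 : 0 <= C by rewrite /C; posi.
pose tau1 := (8 * (C + 1))^-1.
have tau10 : 0 < tau1 by rewrite invr_gt0 mulr_gt0// ltr_wpDl.
exists tau1 => // tau t0 t tau0 tau01 tT ttau vt0.
have hv s : `|s| <= T -> hb (v s) B by case: hn => h _ _ _; exact: h.
have hv' s : `|s| <= T -> hb (v' s) B by case: hn' => h _ _ _; exact: h.
have sT s : `|s - t0| <= tau -> `|s| <= T.
  move=> hs; apply: le_trans tT; rewrite -[s](subrK t0) addrC.
  by apply: le_trans (ler_normD _ _) _; rewrite lerD2l.
have contr d : 0 < d -> (forall s, `|s - t0| <= tau -> hb (fun j n => v s j n - v' s j n) d) ->
    forall s, `|s - t0| <= tau -> hb (fun j n => v s j n - v' s j n) (3 / 4 * d).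
  move=> d0 hd s hs j; apply: l2b_truncP; first by posi.
  move=> r ur; have d4 : 0 < 2 * d by rewrite mulr_gt0.
  have [|x hx|K /(_ j) hK] := nf_step hn hn' L0 SR0 SB0 hR hB (t0 := t0) (t := s) (d := d) (c := Cg * d) _ _ ur d4.
  - by apply: le_trans tT; rewrite lerD2l.
  - have hx' : `|x - t0| <= tau by exact: le_trans hs.
    by split; [exact: hd|apply: hgd; [exact: sT|exact: hd]].
  have hb1 := Bop_diff K s j S10 hB1 (hv _ (sT _ hs)) (hv' _ (sT _ hs)) (hd _ hs).
  have := l2bD (trunc_ge0 r (@w_ge0 R)) hK (l2b_trunc r (@w_ge0 R) hb1).
  move/(eq_l2b (y := fun n => v s j n - v' s j n)) => /(_ _)/l2bW; apply; last first.
    by move=> n; rewrite /nfD vt0; ring.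
  have e1 : 6 * S1 * B ^+ 2 * d <= 1 / 4 * d by rewrite ler_wpM2r// ltW.
  have e2 : `|s - t0| * (C * d + 2 * d) <= d / 4.
    apply: (@le_trans _ _ (tau1 * (C * d + 2 * d))).
      by apply: ler_wpM2r; [posi|rewrite (le_trans hs)].
    rewrite /tau1 ler_pdivrMl ?mulr_gt0 ?ltr_wpDl//.
    by have := mulr_ge0 C0 (ltW d0); lra.
  have -> : 6 * SR * B ^+ 2 * d + 6 * SB * (Cg * d * B ^+ 2 + 2 * Bg * B * d) + 2 * d = C * d + 2 * d.
    by rewrite /C; ring.
  by move: e1 e2; move: (6 * S1 * B ^+ 2 * d) (`|s - t0| * _) => *; lra.
(* The a priori distance from which the contraction is iterated. *)
pose d0 := 2 * B + 1; have d00 : 0 < d0 by rewrite ltr_wpDl// mulr_ge0.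
have it k s : `|s - t0| <= tau -> hb (fun j n => v s j n - v' s j n) ((3 / 4) ^+ k * d0).
  elim: k s => [|k ih] s hs.
    rewrite expr0 mul1r => j; apply: l2bW (hb_diff (hv _ (sT _ hs)) (hv' _ (sT _ hs)) j).
    by rewrite lerDl.
  rewrite exprS -mulrA; apply: contr => //.
  by rewrite mulr_gt0// exprn_gt0// divr_gt0.
apply/funext => j; apply/funext => n; apply/eqP; rewrite -subr_eq0; apply/eqP.
apply: normc_eps => e e0.
have [||k hk] := @geo_cvg0 (3 / 4) d0 e _ _ (ltW d00) e0; [lra|lra|].
apply: le_trans (ltW hk); apply: (l2b_term1 _ (it k t ttau j)); exact: w_ge1.
Qed.

(** The short time does not depend on the starting point, so finitely many
    steps reach t. *)
Lemma nf_unique (T B Bg Cg : R) v g v' g' t :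
  nfsol T B Bg v g -> nfsol T B Bg v' g' -> 0 <= B -> 0 <= Bg -> 0 <= Cg ->
  (forall t d, `|t| <= T -> hb (fun j n => v t j n - v' t j n) d ->
     forall j, l2b w1 (fun n => g t j n - g' t j n) (Cg * d)) ->
  v 0 = v' 0 -> `|t| < T -> v t = v' t.
Proof.
move=> hn hn' B0 Bg0 Cg0 hgd v0 tT.
have [tau tau0 h] := nf_unique_local hn hn' B0 Bg0 Cg0 hgd.
pose m := Num.min tau (T - `|t|); pose N := (Num.truncn (`|t| / m)).+1.
have m0 : 0 < m by rewrite lt_min tau0 subr_gt0.
have N0 : (0 : R) < N%:R by rewrite ltr0n.
have st : `|t| / N%:R <= m.
  rewrite ler_pdivrMr// mulrC -ler_pdivrMr//; exact/ltW/truncnS_gt.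
have ind k : (k <= N)%N -> v (k%:R * (t / N%:R)) = v' (k%:R * (t / N%:R)).
  elim: k => [|k ih] kN; first by rewrite mul0r.
  apply: (h m (k%:R * (t / N%:R))) => //; last by apply: ih; exact: ltnW.
  - by rewrite ge_min lexx.
  - have hm : m <= T - `|t| by rewrite ge_min lexx orbT.
    have : `|k%:R * (t / N%:R)| <= `|t|.
      rewrite !normrM normfV (ger0_norm (ltW N0)) (ger0_norm (ler0n _ _)).
      rewrite mulrCA ler_piMr// ler_pdivrMr// mul1r ler_nat; exact: ltnW.
    by lra.
  - by rewrite -mulrBl -natrB// subSnn mul1r normrM normfV (ger0_norm (ltW N0)).
by have := ind N (leqnn N); rewrite mulrC divfK ?gt_eqF.
Qed.

Lemma nfsol0 T B Bg : 0 <= B -> 0 <= Bg -> nfsol T B Bg (fun _ _ _ => 0) (fun _ _ _ => 0).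
Proof.
move=> B0 Bg0.
have Tr0 ka r n : Tr ka (fun=> 0 : R[i]) (fun=> 0) (fun=> 0) r n = 0.
  by rewrite /Tr big1// => p _; rewrite mulr0.
split=> //.
- by move=> t _ k; exact: l2b0.
- by move=> t _ k; exact: l2b0.
- by move=> t j n; exact: cder_cst.
move=> Lam L0 r eta _ eta0; exists 0%N => K _ t _ j.
apply: eq_l2b (l2b0 _ (ltW eta0)) => n; by rewrite /cub !Tr0 !addr0 subr0.
Qed.

(** In the interaction representation the solution minus its correction is
    Lipschitz with values in H^1, and the correction is Hoelder continuous in
    time and a contraction in the state; hence the solution is continuous with
    values in H^1. *)
Lemma nf_continuous T B Bg v g : nfsol T B Bg v g -> 0 <= B -> 0 <= Bg ->
  forall e, 0 < e -> exists2 dl : R, 0 < dl &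
  forall t0 t, `|t0| + `|t - t0| <= T -> `|t - t0| <= dl ->
    hb (fun j n => v t j n - v t0 j n) e.
Proof.
move=> hn B0 Bg0 e e0.
have hn0 : nfsol T B Bg (fun _ _ _ => 0) (fun _ _ _ => 0) by exact: nfsol0.
have [Lam [SR [SB [S1 [L0 [SR0 SB0 S10] hR hB [hS1 hB1]]]]]] := nf_constants B0.
have [Ct Ct0 hCt] := kaB_time alpha beta a b0.
pose C := 6 * SR * B ^+ 2 * B + 6 * SB * (Bg * B ^+ 2 + 2 * Bg * B * B) + 1.
have C0 : 0 < C by rewrite /C ltr_wpDl//; posi.
pose D := 2 * B ^+ 3 + 1; have D0 : 0 < D by rewrite /D ltr_wpDl//; posi.
pose dl := Num.min (e / (8 * C)) ((e / (8 * D)) ^+ 2 / Ct).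
have dl0 : 0 < dl.
  have p1 : 0 < e / (8 * C) by rewrite divr_gt0 ?mulr_gt0.
  have p2 : 0 < e / (8 * D) by rewrite divr_gt0 ?mulr_gt0.
  by rewrite lt_min p1 divr_gt0// exprn_gt0.
exists dl => // t0 t tT htt.
have hT x : `|x - t0| <= `|t - t0| -> `|x| <= T.
  move=> hx; apply: le_trans tT; rewrite -[x](subrK t0) addrC.
  by apply: le_trans (ler_normD _ _) _; rewrite lerD2l.
have hvT s : `|s| <= T -> hb (v s) B by case: hn => h _ _ _; exact: h.
have hgT s : `|s| <= T -> forall j, l2b w1 (g s j) Bg by case: hn => _ h _ _; exact: h.
have ht : hb (v t) B by apply/hvT/hT.
have ht0 : hb (v t0) B by apply/hvT/hT; rewrite subrr normr0.
have s1 : `|t - t0| * C <= e / 8.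
  apply: (@le_trans _ _ (e / (8 * C) * C)).
    by rewrite ler_pM2r//; apply: le_trans htt _; rewrite ge_min lexx.
  by rewrite invfM mulrA divfK ?gt_eqF.
pose St := Num.sqrt (Ct * `|t - t0|).
have s2 : 2 * (St * B * B * B) <= e / 8.
  apply: (@le_trans _ _ (St * D)).
    rewrite (_ : 2 * _ = St * (2 * B ^+ 3)); last by ring.
    by rewrite ler_wpM2l ?sqrtr_ge0// lerDl.
  apply: (@le_trans _ _ (e / (8 * D) * D)); last by rewrite invfM mulrA divfK ?gt_eqF.
  have ed : 0 <= e / (8 * D) by posi.
  rewrite ler_pM2r// -(ger0_norm ed) -sqrtr_sqr ler_sqrt ?sqr_ge0//.
  rewrite mulrC -ler_pdivlMr//; apply: le_trans htt _; by rewrite ge_min lexx orbT.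
have w0 := @w_gt0 R; have tr0 (r : seq int) := trunc_ge0 r (@w_ge0 R).
have contr x : 0 < x -> hb (fun j n => v t j n - v t0 j n) x ->
    hb (fun j n => v t j n - v t0 j n) (1 / 4 * x + e / 4).
  move=> x0 hx j; apply: l2b_truncP; first by posi.
  move=> r ur.
  have [|s hs|K /(_ j) hK] := nf_step hn hn0 L0 SR0 SB0 hR hB (t0 := t0) (t := t) (d := B) (c := Bg) _ _ ur ltr01.
  - exact: tT.
  - split=> j'; first by apply: eq_l2b (hvT _ (hT _ hs) j') => n; rewrite subr0.
    by apply: eq_l2b (hgT _ (hT _ hs) j') => n; rewrite subr0.
  have hb1 := Bop_diff K t j S10 hB1 ht ht0 hx.
  have hb2 : l2b w (cub (fun n n1 n2 => (cis (- Om n n1 n2 * t) - cis (- Om n n1 n2 * t0)) *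
      kaB Lam n n1 n2) (v t0) (v t0) (v t0) j (box K)) (2 * (St * B * B * B)).
    apply: (l2b_cub (uniq_box K) (fun n => ltW (w0 n)) w0 w0 w0 (sqrtr_ge0 _) _ ht0 ht0 (ht0 j)) => n.
    by rewrite sqr_sqrtr; [exact: hCt|posi].
  have := l2bD (tr0 r) (l2bD (tr0 r) hK (l2b_trunc r (@w_ge0 R) hb1)) (l2b_trunc r (@w_ge0 R) hb2).
  have hBop s n : Bop Lam K s (fun _ _ => 0) j n = 0.
    by rewrite /Bop /cub /Tr !big1 ?addr0// => p _; rewrite mulr0.
  have Bt n : cub (fun n n1 n2 => (cis (- Om n n1 n2 * t) - cis (- Om n n1 n2 * t0)) *
      kaB Lam n n1 n2) (v t0) (v t0) (v t0) j (box K) n =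
      Bop Lam K t (v t0) j n - Bop Lam K t0 (v t0) j n.
    rewrite /Bop !cubE -sumrB; apply: eq_bigr => p _; rewrite /cisk; ring.
  move/(eq_l2b (y := fun n => v t j n - v t0 j n)) => /(_ _)/l2bW; apply; last first.
    by move=> n; rewrite Bt /nfD !hBop; ring.
  have e1 : 6 * S1 * B ^+ 2 * x <= 1 / 4 * x by rewrite ler_wpM2r// ltW.
  rewrite -/C; move: s1 s2 e1; move: (`|t - t0| * C) (6 * S1 * B ^+ 2 * x) (2 * (St * B * B * B)).
  by move=> *; lra.
pose x0 := 2 * B + 1; have x00 : 0 < x0 by rewrite ltr_wpDl// mulr_ge0.
have it k : hb (fun j n => v t j n - v t0 j n) ((1 / 4) ^+ k * x0 + e / 2).
  elim: k => [|k ih].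
    rewrite expr0 mul1r => j; apply: l2bW (hb_diff ht ht0 j).
    by rewrite -addrA lerDl; lra.
  have p0 : 0 < (1 / 4) ^+ k * x0 + e / 2.
    by rewrite ltr_wpDl ?divr_gt0// mulr_ge0 ?exprn_ge0 ?ltW//; lra.
  move=> j; apply: l2bW (contr _ p0 ih j).
  by rewrite exprS; lra.
have e2 : 0 < e / 2 by rewrite divr_gt0.
have [||k hk] := @geo_cvg0 (1 / 4) x0 (e / 2) _ _ (ltW x00) e2; [lra|lra|].
by move=> j; apply: l2bW (it k j); lra.
Qed.

(** ** Bounded weak solutions *)

Definition massK K U : R := \sum_(n <- zbox K) (sqmod (U false n) + sqmod (U true n)).

Definition mass U : R := limn (fun K => massK K U).

Lemma massK_tail U B K L : hb U B -> (K <= L)%N ->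
  `|massK L U - massK K U| <= 2 * B ^+ 2 / K.+1%:R.
Proof.
move=> hU KL; pose f j (n : int) : R := if (K < `|n|)%N then sqmod (U j n) else 0.
have f0 j n : 0 <= f j n by rewrite /f; case: ifP => // _; exact: sqmod_ge0.
have K0 : (0 : R) < K.+1%:R by rewrite ltr0n.
have fb j : \sum_(n <- zbox L) f j n <= B ^+ 2 / K.+1%:R.
  rewrite ler_pdivlMr// mulr_suml; have [_ /(_ _ (uniq_zbox L))] := hU j.
  apply: le_trans; apply: ler_sum => n _; rewrite /f mulrC.
  case: ifP => [Kn|_]; last by rewrite mulr0 mulr_ge0 ?sqmod_ge0 ?w_ge0.
  rewrite ler_wpM2r ?sqmod_ge0// /w -(real_normK (num_real n%:~R)) -intr_norm -abszE.
  have : (K.+1%:R : R) <= `|n|%N%:R by rewrite ler_nat.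
  by rewrite -[(_%:~R)]/(`|n|%N%:R : R); move: (K.+1%:R) (`|n|%N%:R) => x y; nra.
have -> : massK L U - massK K U = \sum_(n <- zbox L) (f false n + f true n).
  rewrite /massK [X in X - _](bigID (fun n => n \in zbox K))/=.
  rewrite [X in X + _ - _](_ : _ = \sum_(n <- zbox K) (sqmod (U false n) + sqmod (U true n))).
    rewrite addrAC subrr add0r big_mkcond/=; apply: eq_bigr => n _.
    by rewrite mem_zbox /f -ltnNge; case: ifP => //; rewrite addr0.
  rewrite -big_filter; apply: perm_big; apply: uniq_perm; rewrite ?filter_uniq ?uniq_zbox// => n.
  by rewrite mem_filter !mem_zbox; case: leqP => //= h; rewrite (leq_trans h).
rewrite ger0_norm ?sumr_ge0// => [|n _]; last by rewrite addr_ge0.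
by rewrite big_split/= (_ : 2 * _ / _ = B ^+ 2 / K.+1%:R + B ^+ 2 / K.+1%:R) ?lerD//; ring.
Qed.

Lemma div_cvg0 (c : R) : c / K.+1%:R @[K --> \oo] --> (0 : R).
Proof. by rewrite -(mulr0 c); apply: cvgMr; exact: cvg_harmonic. Qed.

Lemma massK_cvg U B : hb U B -> massK K U @[K --> \oo] --> mass U.
Proof.
move=> hU; apply: (@cauchy_tail _ _ (fun K => 2 * B ^+ 2 / K.+1%:R)).
  by move=> K L; exact: massK_tail.
exact: div_cvg0.
Qed.

Lemma mass_dist U B K : hb U B -> `|massK K U - mass U| <= 2 * B ^+ 2 / K.+1%:R.
Proof.
move=> hU; have h : `|massK L U - massK K U| @[L --> \oo] --> `|mass U - massK K U|.
  by apply: cvg_norm; apply: cvgB; [exact: massK_cvg hU|exact: cvg_cst].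
rewrite distrC; apply: (cvgr_to_le h); exists K => // L /= KL; exact: massK_tail.
Qed.

(** The equation holds for each coefficient; no continuity in H^1 is part of
    the notion. *)
Definition wsol (U : R -> state) : Prop := forall t j n,
  cder (fun s => U s j n) t ((0 +i* phi n) * U t j n + Ncub alpha beta (U t) j n).

Lemma is_derive_sqmod (f : R -> R[i]) t z : cder f t z ->
  is_derive t (1 : R) (fun s => sqmod (f s) : R) (2 * complex.Re (conjc (f t) * z)).
Proof.
move=> [h1 h2]; rewrite /sqmod; apply: is_derive_eq.
rewrite cReM cReJ cImJ /GRing.scale/=; ring.
Qed.

(** Mass is conserved in the limit of large K. *)
Lemma massK_drift (U : R -> state) B K t : wsol U -> (forall s, `|s| <= `|t| -> hb (U s) B) ->
  `|massK K (U t) - massK K (U 0)| <= `|t| * (2 * emass alpha beta K B).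
Proof.
move=> hs hU; rewrite -[X in `|X| * _](subr0 t).
pose F s := complex.Re (\sum_(n <- zbox K) (conjc (U s false n) * Ncub alpha beta (U s) false n +
     conjc (U s true n) * Ncub alpha beta (U s) true n)).
apply: (@mean_value_le _ (fun s => massK K (U s)) (fun s => 2 * F s)).
  move=> s _; rewrite /F cRe_sum big_distrr/=; apply: is_derive_sum_seq => n _.
  have h j := is_derive_sqmod (hs s j n).
  have e j : 2 * complex.Re (conjc (U s j n) * ((0 +i* phi n) * U s j n + Ncub alpha beta (U s) j n)) =
      2 * complex.Re (conjc (U s j n) * Ncub alpha beta (U s) j n).
    congr (_ * _); rewrite mulrDr cReD (_ : complex.Re _ = 0) ?add0r//.
    rewrite mulrCA [_ * U s j n]mulrC sqmod_conjM cReM /=; ring.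
  rewrite cReD mulrDr -!e; apply: is_deriveD; exact: h.
move=> s; rewrite !subr0 => /hU h; rewrite normrM ger0_norm// ler_wpM2l//.
exact: mass_Ncub.
Qed.

Section Interaction.
Variables (M : R).

(** The phase i M (alpha - beta n) compensates the diagonal terms n1 = n2 of
    the cubic sum, M being the mass. *)
Definition psi (n : int) : R := phi n + M * (alpha - beta * n%:~R).

Definition vv (U : R -> state) : R -> state := fun t j n => cis (- psi n * t) * U t j n.

Definition gg (U : R -> state) : R -> state := fun t j n =>
  cis (- psi n * t) * (Ncub alpha beta (U t) j n - M%:C * symb n * U t j n).

Lemma cder_vv (U : R -> state) t j n : wsol U -> cder (fun s => vv U s j n) t (gg U t j n).
Proof.
move=> hs; apply: cder_eq (cderM (cder_cis _ t) (hs t j n)) _.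
rewrite /gg (_ : 0 +i* - psi n = - (0 +i* phi n) - M%:C * symb n); first by ring.
by apply/eqP; rewrite eq_complex /= /psi; apply/andP; split; apply/eqP; ring.
Qed.

Lemma sqmod_vv (U : R -> state) t j n : sqmod (vv U t j n) = sqmod (U t j n).
Proof. by rewrite sqmodM sqmod_cis mul1r. Qed.

Lemma l2b_symb (x : int -> R[i]) B : l2b w x B ->
  l2b w1 (fun n => M%:C * symb n * x n) (`|M| * (Num.sqrt cm * B)).
Proof.
move=> [B0 h]; split; first by rewrite !mulr_ge0 ?sqrtr_ge0.
rewrite !exprMn sqr_sqrtr ?cm_ge0// mulrA.
have c0 : 0 <= `|M| ^+ 2 * cm by apply: mulr_ge0; [exact: sqr_ge0|exact: cm_ge0].
apply: bsum_le (bsumZ c0 h) => n; rewrite mul1r !sqmodM sqmod_real.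
rewrite -(real_normK (num_real M)) [leRHS]mulrA; apply: ler_wpM2r; first exact: sqmod_ge0.
rewrite -[leRHS]mulrA; apply: ler_wpM2l; first exact: sqr_ge0.
exact: sqmod_symb.
Qed.

Definition Bgg B : R := 2 * S0 alpha beta * B ^+ 3 + `|M| * (Num.sqrt cm * B).

Lemma l2b_gg (U : R -> state) t B j : hb (U t) B -> l2b w1 (gg U t j) (Bgg B).
Proof.
move=> hU; apply: l2b_cis; apply: l2bB; [exact: w1_ge0|exact: Ncub_bound|exact: l2b_symb].
Qed.

Lemma l2b_gg_sub (U U' : R -> state) t B d j : hb (U t) B -> hb (U' t) B ->
  hb (fun j n => vv U t j n - vv U' t j n) d ->
  l2b w1 (fun n => gg U t j n - gg U' t j n) ((6 * S0 alpha beta * B ^+ 2 + `|M| * Num.sqrt cm) * d).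
Proof.
move=> hU hU' hd.
have hd' : hb (fun j n => U t j n - U' t j n) d.
  by move=> k; apply: l2b_le (hd k) => n; rewrite /vv -mulrBr sqmodM sqmod_cis mul1r.
have h1 := Ncub_sub alpha beta j hU hU' hd'; have h2 := l2b_symb (hd' j).
have := l2b_cis (fun n => - psi n * t) (l2bB (@w1_ge0 R) h1 h2).
rewrite (_ : _ + `|M| * _ = (6 * S0 alpha beta * B ^+ 2 + `|M| * Num.sqrt cm) * d); last by ring.
by apply: eq_l2b => n; rewrite /gg; ring.
Qed.

(** Multiplying by the phases turns the cubic term into its interaction
    form; the multiples of M drop out of the phase difference. *)
Lemma cub_vv ka (U : R -> state) t j r n : cub (cisk t ka) (vv U t) (vv U t) (vv U t) j r n =
  cis (- psi n * t) * cub ka (U t) (U t) (U t) j r n.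
Proof.
rewrite /cub mulrDr; congr (_ + _); rewrite /Tr mulr_sumr; apply: eq_bigr => -[n1 n2] _ /=.
all: rewrite /cisk /vv cJM -cisN.
all: rewrite (_ : - psi n * t = - Om n n1 n2 * t + - psi n1 * t + (- (- psi n2 * t)) + - psi (n - n1 + n2) * t).
all: try by rewrite !cisD; ring.
all: by rewrite OmE /psi !intrD !intrN; ring.
Qed.

End Interaction.

(** The diagonal n1 = n2 sums to the truncated mass times the multiplier. *)
Lemma cub_diag K U j n Lam : 0 < Lam -> cub ka0 U U U j (box K) n =
  cub (kaR Lam) U U U j (box K) n + cub (kaH Lam) U U U j (box K) n +
  (massK K U)%:C * symb n * U j n.
Proof.
move=> L0.
have -> : (massK K U)%:C * symb n * U j n = \sum_(p <- box K)
    (if p.1 == p.2 then ka0 n p.1 p.2 * rr U U p.1 p.2 * U j (n - p.1 + p.2) else 0).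
  rewrite big_box /massK rmorph_sum/= !mulr_suml.
  rewrite big_seq [RHS]big_seq; apply: eq_bigr => m mK.
  under eq_bigr do rewrite /= eq_sym.
  rewrite big_pick ?uniq_zbox// mK /ka0 subrK rmorphD/= -!sqmod_conjM /rr; ring.
rewrite !cubE -!big_split/=; apply: eq_bigr => -[n1 n2] _ /=.
rewrite /kaR /kaH; case: eqVneq => [<-|n12] /=.
  by rewrite (_ : Om n n1 n1 = 0) ?normr0 ?ltNge ?(ltW L0) ?mul0r ?add0r// /Om subrr mulr0.
by rewrite ltNge; case: (_ <= _); rewrite /= !mul0r ?addr0 ?add0r.
Qed.

(** The truncated mass differs from its initial limit M by the drift, which
    tends to 0, so the phases remove the diagonal up to a small error. *)
Lemma wsol_nfsol (U : R -> state) T B : wsol U -> 0 <= T -> (forall t, `|t| <= T -> hb (U t) B) ->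
  nfsol T B (Bgg (mass (U 0)) B) (vv (mass (U 0)) U) (gg (mass (U 0)) U).
Proof.
move=> hs T0 hU; set M := mass (U 0).
have h0 : hb (U 0) B by apply: hU; rewrite normr0.
have B0 := hb_ge0 h0.
split.
- by move=> t /hU h k; apply: l2b_le (h k) => n; rewrite sqmod_vv.
- by move=> t /hU h j; exact: l2b_gg.
- by move=> t j n; exact: cder_vv.
move=> Lam L0 r eta ur eta0.
pose em K := T * (2 * emass alpha beta K B) + 2 * B ^+ 2 / K.+1%:R.
have emb K t : `|t| <= T -> `|massK K (U t) - M| <= em K.
  move=> tT; rewrite -(subrK (massK K (U 0)) (massK K (U t))) -addrA.
  apply: le_trans (ler_normD _ _) _; apply: lerD; last exact: mass_dist.
  have hd : `|massK K (U t) - massK K (U 0)| <= `|t| * (2 * emass alpha beta K B).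
    by apply: massK_drift => // s st; apply: hU; exact: le_trans tT.
  apply: le_trans hd _; rewrite ler_wpM2r// mulr_ge0//.
  by apply: le_trans (mass_Ncub alpha beta K h0).
have [W W1 hW] : exists2 W : R, 0 < W & forall n, n \in r -> w n <= W ^+ 2.
  elim: (r) => [|n s [W W1 ih]]; first by exists 1.
  exists (W + J n) => [|m]; first by rewrite addr_gt0 ?J_gt0.
  have Jn := J_gt0 n : 0 < (_ : R).
  rewrite inE => /predU1P[->|/ih h]; [apply: le_trans (w_le_J2 _) _|apply: le_trans h _].
    by apply: ler_sqr_nneg; [exact: ltW|rewrite lerDr ltW].
  by apply: ler_sqr_nneg; [exact: ltW|rewrite lerDl ltW].
have tw x C : l2b w1 x C -> l2b (trunc w r) x (W * C).
  move=> [C0 h]; split; first by rewrite mulr_ge0// ltW.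
  rewrite exprMn; apply: bsum_le (bsumZ (sqr_ge0 W) h) => n; rewrite /trunc /w1 mul1r.
  case: ifP => [/hW h1|_]; last by rewrite mul0r mulr_ge0 ?sqr_ge0 ?sqmod_ge0.
  by rewrite ler_wpM2r ?sqmod_ge0.
pose err K := W * (2 * B ^+ 3 * etail alpha beta K + em K * (Num.sqrt cm * B)).
have err0 : err K @[K --> \oo] --> (0 : R).
  rewrite -(mulr0 W); apply: cvgMr; rewrite -[X in _ --> X](addr0 (0 : R)).
  apply: cvgD; first exact: etail_cvg0.
  rewrite -(mul0r (Num.sqrt cm * B)); apply: cvgMl; rewrite -[X in _ --> X](addr0 (0 : R)).
  apply: cvgD; last exact: div_cvg0.
  rewrite (_ : (fun K => _) = fun K => (T * 2) * emass alpha beta K B); last by apply/funext => K; ring.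
  by rewrite -(mulr0 (T * 2)); apply: cvgMr; exact: emass_cvg0.
have /cvgrPdist_lt/(_ _ eta0)[K0 _ hK0] := err0.
exists K0 => K KK t tT j; have hUt := hU t tT.
have hK : err K <= eta.
  by apply/ltW; apply: le_lt_trans (ler_norm _) _; rewrite -normrN -sub0r; exact: hK0.
have h1 := Ncub_tail alpha beta j K hUt; have h2 := l2b_symb (massK K (U t) - M) (hUt j).
have h2' : l2b w1 (fun n => (massK K (U t) - M)%:C * symb n * U t j n) (em K * (Num.sqrt cm * B)).
  by apply: l2bW h2; rewrite ler_wpM2r ?emb// mulr_ge0 ?sqrtr_ge0.
have := tw _ _ (l2b_cis (fun n => - psi M n * t) (l2bD (@w1_ge0 R) h1 h2')).
move/(l2bW hK); apply: eq_l2b => n.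
by rewrite !cub_vv /gg (cub_diag K (U t) j n L0) rmorphB/=; ring.
Qed.

(** Both trajectories have the same mass, hence the same phases, and their
    interaction representations both satisfy the hypotheses of [nf_unique]. *)
Theorem wsol_unique (U U' : R -> state) : wsol U -> wsol U' ->
  (forall T, exists B, forall t, `|t| <= T -> hb (U t) B) ->
  (forall T, exists B, forall t, `|t| <= T -> hb (U' t) B) ->
  U 0 = U' 0 -> forall t, U t = U' t.
Proof.
move=> hs hs' hU hU' U0 t.
pose T := `|t| + 1; have T0 : 0 <= T by rewrite addr_ge0.
have [B1 hB1] := hU T; have [B2 hB2] := hU' T.
have B10 : 0 <= B1 by apply: hb_ge0 (hB1 0 _); rewrite normr0.
have B20 : 0 <= B2 by apply: hb_ge0 (hB2 0 _); rewrite normr0.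
pose B := B1 + B2; have B0 : 0 <= B by rewrite addr_ge0.
have h1 s : `|s| <= T -> hb (U s) B by move=> /hB1 h k; apply: l2bW (h k); rewrite lerDl.
have h2 s : `|s| <= T -> hb (U' s) B by move=> /hB2 h k; apply: l2bW (h k); rewrite lerDr.
have n1 := wsol_nfsol hs T0 h1; have n2 := wsol_nfsol hs' T0 h2.
rewrite -U0 in n2; move: n1 n2; set M := mass (U 0) => n1 n2.
have p1 : 0 <= Bgg M B.
  by rewrite /Bgg; have := S0_ge0 alpha beta => ?; posi.
have p2 : 0 <= 6 * S0 alpha beta * B ^+ 2 + `|M| * Num.sqrt cm.
  by have := S0_ge0 alpha beta => ?; posi.
have e : vv M U t = vv M U' t.
  apply: (nf_unique n1 n2 B0 p1 p2).
  - by move=> s d sT hd j; apply: l2b_gg_sub => //; [exact: h1|exact: h2].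
  - by apply/funext => j; apply/funext => n; rewrite /vv U0.
  - by rewrite /T ltrDl.
apply/funext => j; apply/funext => n.
have := congr1 (fun f => f j n) e; rewrite /vv => /(congr1 (fun z => cis (psi M n * t) * z)).
by rewrite mulNr !cisVK.
Qed.

(** The phases vary slowly on a finite set carrying most of the norm. *)
Lemma l2b_phase (p : int -> R) (x : int -> R[i]) B e : l2b w x B -> 0 < e ->
  exists2 dl : R, 0 < dl & forall t t0, `|t - t0| <= dl ->
    l2b w (fun n => (cis (p n * t) - cis (p n * t0)) * x n) e.
Proof.
move=> [B0 h] e0; have e8 : 0 < e ^+ 2 / 8 by rewrite divr_gt0// exprn_gt0.
have [r ur hr] := bsum_small_tail h e8.
pose P := \sum_(n <- r) `|p n|; have P0 : 0 <= P by apply: sumr_ge0.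
pose D := 4 * (P + 1) * (B ^+ 2 + 1).
have D0 : 0 < D by rewrite !mulr_gt0// ltr_wpDl ?sqr_ge0.
exists (e ^+ 2 / D) => [|t t0 tt]; first by rewrite divr_gt0 ?exprn_gt0.
split; [exact: ltW|move=> s us].
have wx0 n : 0 <= w n * sqmod (x n) by rewrite mulr_ge0 ?w_ge0 ?sqmod_ge0.
rewrite (bigID (fun n => n \in r))/=.
have h1 : \sum_(n <- s | n \in r) w n * sqmod ((cis (p n * t) - cis (p n * t0)) * x n) <= e ^+ 2 / 2.
  apply: (@le_trans _ _ (\sum_(n <- s | n \in r) (2 * P * `|t - t0|) * (w n * sqmod (x n)))).
    apply: ler_sum => n nr; rewrite sqmodM mulrCA; apply: ler_wpM2r => //.
    apply: le_trans (sqmod_cisB _ _) _; rewrite -mulrBr normrM -mulrA ler_wpM2l// ler_wpM2r//.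
    by rewrite /P (bigD1_seq n)//= lerDl sumr_ge0.
  rewrite -mulr_sumr; apply: (@le_trans _ _ (2 * P * `|t - t0| * B ^+ 2)).
    by rewrite ler_wpM2l; [|posi|rewrite -big_filter h// filter_uniq].
  apply: (@le_trans _ _ (2 * P * (e ^+ 2 / D) * B ^+ 2)).
    by rewrite ler_wpM2r ?sqr_ge0// ler_wpM2l//; posi.
  rewrite /D (_ : _ * _ * _ = (e ^+ 2 / 2) * ((P * B ^+ 2) / ((P + 1) * (B ^+ 2 + 1)))); last first.
    by field; rewrite !gt_eqF// ltr_wpDl// sqr_ge0.
  rewrite ler_piMr ?divr_ge0 ?sqr_ge0// ler_pdivrMr ?mul1r; last first.
    by rewrite mulr_gt0// ltr_wpDl// sqr_ge0.
  by have := sqr_ge0 B; move: (B ^+ 2) => y y0; nra.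
have h2 : \sum_(n <- s | n \notin r) w n * sqmod ((cis (p n * t) - cis (p n * t0)) * x n) <= e ^+ 2 / 2.
  apply: (@le_trans _ _ (\sum_(n <- s | n \notin r) 4 * (w n * sqmod (x n)))).
    apply: ler_sum => n nr; rewrite sqmodM mulrCA; apply: ler_wpM2r => //.
    rewrite sqmod_normc (_ : 4 = 2 ^+ 2) ?ler_sqr_nneg ?normc_ge0//; last by ring.
    by apply: le_trans (le_normcB _ _) _; rewrite !normc_cis.
  rewrite -mulr_sumr -big_filter.
  have := hr [seq n <- s | n \notin r] (filter_uniq _ us).
  move=> /(_ _)/le_trans -/(_ _) h2.
  have h3 : \sum_(n <- [seq n <- s | n \notin r]) w n * sqmod (x n) <= e ^+ 2 / 8.
    by apply: hr; rewrite ?filter_uniq// => n; rewrite mem_filter => /andP[].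
  by lra.
by lra.
Qed.

(** By [nf_continuous] for the interaction representation, and because
    multiplication by phases is strongly continuous in H^1. *)
Theorem wsol_continuous (U : R -> state) : wsol U ->
  (forall T, exists B, forall t, `|t| <= T -> hb (U t) B) ->
  forall t0 e, 0 < e -> exists2 dl : R, 0 < dl & forall t, `|t - t0| <= dl ->
    hb (fun j n => U t j n - U t0 j n) e.
Proof.
move=> hs hU t0 e e0; pose T := `|t0| + 1; have T0 : 0 <= T by rewrite addr_ge0.
have [B hB] := hU T; have B0 : 0 <= B by apply: hb_ge0 (hB 0 _); rewrite normr0.
have := wsol_nfsol hs T0 hB; set M := mass (U 0) => hn.
have p1 : 0 <= Bgg M B by rewrite /Bgg; have := S0_ge0 alpha beta => ?; posi.
have e2 : 0 < e / 2 by rewrite divr_gt0.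
have [dl dl0 hdl] := nf_continuous hn B0 p1 e2.
have hB0 : hb (vv M U t0) B.
  by move=> k; apply: l2b_le (hB t0 _ k) => [n|]; rewrite ?sqmod_vv ?lerDl.
have [d1 d10 hd1] := l2b_phase (psi M) (hB0 false) e2.
have [d2 d20 hd2] := l2b_phase (psi M) (hB0 true) e2.
exists (Num.min (Num.min dl 1) (Num.min d1 d2)); first by rewrite !lt_min dl0 d10 d20 ltr01.
move=> t; rewrite !le_min => /andP[/andP[tdl t1] /andP[td1 td2]] j.
have h1 : hb (fun j n => vv M U t j n - vv M U t0 j n) (e / 2) by apply: hdl; rewrite // lerD2l.
have h2 : l2b w (fun n => (cis (psi M n * t) - cis (psi M n * t0)) * vv M U t0 j n) (e / 2).
  by case: j; [exact: hd2|exact: hd1].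
have := l2bD (@w_ge0 R) (l2b_cis (fun n => psi M n * t) (h1 j)) h2.
rewrite -splitr; apply: eq_l2b => n; rewrite mulrBr mulrBl addrA subrK.
by rewrite /vv !mulNr !cisVK.
Qed.

End NormalForm.

(** * Ordinary differential equations: Euler's method along an ultrafilter *)

Section UltraLimit.
Context {R : realType}.

Lemma ultra_image (T U : Type) (f : T -> U) (F : set_system T) :
  UltraFilter F -> UltraFilter (f @ F).
Proof.
move=> UF; split; first exact: fmap_proper_filter.
move=> G PG sub; apply/seteqP; split=> // A GA.
have [//|h] := in_ultra_setVsetC (f @^-1` A) UF.
have GnA : G (~` A) by apply: sub.
have G0 : G set0 by rewrite -(setICr A); exact: filterI.
by case: (@filter_not_empty _ G _ G0).
Qed.

Lemma ultra_bounded_cvg (F : set_system nat) (x : nat -> R) B : UltraFilter F ->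
  (\forall K \near F, `|x K| <= B) -> exists l : R, x K @[K --> F] --> l.
Proof.
move=> UF hB.
have := @segment_compact R (- B) B; rewrite compact_ultra => /(_ (x @ F)) h.
have UF' := ultra_image x UF.
have hx : (x @ F) `[- B, B]%classic.
  by apply: filterS hB => K; rewrite /= in_itv/= ler_norml.
by have [l [_ hl]] := h UF' hx; exists l.
Qed.

Definition ulim (F : set_system nat) (x : nat -> R[i]) : R[i] :=
  lim (complex.Re (x K) @[K --> F]) +i* lim (complex.Im (x K) @[K --> F]).

Lemma ulimP (F : set_system nat) (x : nat -> R[i]) B : UltraFilter F ->
  (\forall K \near F, normc (x K) <= B) -> ccvg F x (ulim F x).
Proof.
move=> UF hB; split.
  have [|l hl] := @ultra_bounded_cvg F (fun K => complex.Re (x K)) B UF.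
    by apply: filterS hB => K; apply: le_trans; exact: normc_Re.
  by apply/cvg_ex; exists l.
have [|l hl] := @ultra_bounded_cvg F (fun K => complex.Im (x K)) B UF.
  by apply: filterS hB => K; apply: le_trans; exact: normc_Im.
by apply/cvg_ex; exists l.
Qed.

Lemma ex_ultra : exists2 F : set_system nat, UltraFilter F & \oo `<=` F.
Proof. by have [F [UF sub]] := ultraFilterLemma (@eventually_filter); exists F. Qed.

Lemma ccvg_normc_cvg T (F : set_system T) {FF : Filter F} (f : T -> R[i]) z :
  ccvg F f z -> normc (f t) @[t --> F] --> normc z.
Proof.
move=> h; rewrite normc_sqrt; under eq_fun do rewrite normc_sqrt.
apply: (@cvg_comp _ _ _ (fun t => sqmod (f t)) (@Num.sqrt R) F (nbhs (sqmod z))).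
  exact: ccvg_sqmod.
exact: sqrt_continuous.
Qed.

Lemma cder_expansion (f : R -> R[i]) t z :
  (forall e, 0 < e -> exists2 d : R, 0 < d & forall s, `|s - t| <= d ->
    normc (f s - f t - (s - t)%:C * z) <= e * `|s - t|) -> cder f t z.
Proof.
move=> h.
have real (g : R -> R) (y : R) : (forall e, 0 < e -> exists2 d : R, 0 < d &
    forall s, `|s - t| <= d -> `|g s - g t - (s - t) * y| <= e * `|s - t|) ->
    is_derive t (1 : R) g y.
  move=> hg; have hc : (fun k : R => k^-1 *: ((g \o shift t) (k *: (1 : R)) - g t)) @ 0^' --> y.
    apply/cvgrPdist_le => e e0; have [d d0 hd] := hg e e0.
    exists d => // k /= kd k0; rewrite sub0r normrN in kd.
    have := hd (k + t); rewrite addrK => /(_ (ltW kd)) hk.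
    rewrite /GRing.scale/= mulr1 distrC.
    rewrite (_ : _ - y = k^-1 * (g (k + t) - g t - k * y)); last first.
      by rewrite [in RHS]mulrBr [in RHS]mulrA mulVf// mul1r.
    by rewrite normrM normfV ler_pdivrMl ?normr_gt0// [leRHS]mulrC.
  split; first by apply/cvg_ex; exists y.
  by apply: cvg_lim hc; exact: Rhausdorff.
split; apply: real => e e0; have [d d0 hd] := h e e0; exists d => // s sd; apply: le_trans (hd s sd).
  by rewrite -[leLHS](_ : `|complex.Re (f s - f t - (s - t)%:C * z)| = _) ?normc_Re// !(cReD, cReN) cReM /= mul0r subr0.
by rewrite -[leLHS](_ : `|complex.Im (f s - f t - (s - t)%:C * z)| = _) ?normc_Im// !(cImD, cImN) cImM /= mul0r addr0.
Qed.

End UltraLimit.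

Section Euler.
Context {R : realType} (I : eqType) (r : seq I).
Implicit Types (x y : I -> R[i]).
Variables (F : (I -> R[i]) -> (I -> R[i])) (B L : R).
Hypothesis B0 : 0 <= B.
Hypothesis L0 : 0 <= L.
Hypothesis F_bounded : forall x i, normc (F x i) <= B.
Hypothesis F_lip : forall x y d, (forall i, i \in r -> normc (x i - y i) <= d) ->
  forall i, normc (F x i - F y i) <= L * d.

Lemma F_ccvg (G : set_system nat) {FG : Filter G} (X : nat -> I -> R[i]) x i :
  (forall i, ccvg G (fun k => X k i) (x i)) -> ccvg G (fun k => F (X k) i) (F x i).
Proof.
move=> h; apply: ccvgP => e e0.
have d0 : 0 < e / (L + 1) by rewrite divr_gt0// ltr_wpDl.
have : \forall k \near G, forall i, i \in r -> normc (X k i - x i) <= e / (L + 1).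
  elim: (r) => [|j s ih]; first by near=> k.
  near=> k => i'; rewrite inE => /predU1P[->|]; first by near: k; exact: ccvg_near.
  by move: i'; near: k.
apply: filterS => k hk; apply: le_trans (F_lip hk i) _.
rewrite mulrCA ler_piMr ?(ltW e0)// ler_pdivrMr ?ltr_wpDl//; lra.
Unshelve. all: by end_near. Qed.

Fixpoint euler (h : R) x (m : nat) : I -> R[i] :=
  if m is m'.+1 then fun i => euler h x m' i + h%:C * F (euler h x m') i else x.

Lemma euler_lip h x m l i : 0 <= h ->
  normc (euler h x (m + l) i - euler h x m i) <= l%:R * h * B.
Proof.
move=> h0; elim: l => [|l ih]; first by rewrite addn0 subrr normc0 !mul0r.
rewrite addnS /= addrAC; apply: le_trans (le_normcD _ _) _.
rewrite -natr1 !mulrDl mul1r; apply: lerD => //.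
by rewrite normcM normc_real ger0_norm// ler_wpM2l.
Qed.

Lemma euler_expand h x m l i : 0 <= h ->
  normc (euler h x (m + l) i - euler h x m i - (l%:R * h)%:C * F (euler h x m) i) <=
  L * B * (l%:R * h) ^+ 2.
Proof.
move=> h0; elim: l => [|l ih].
  by rewrite addn0 subrr !mul0r sub0r normcN normc0 expr0n/= mulr0.
rewrite addnS /= -natr1 (mulrDl _ 1) mul1r.
rewrite (_ : _ - _ - _ = (euler h x (m + l) i - euler h x m i - (l%:R * h)%:C * F (euler h x m) i) +
   h%:C * (F (euler h x (m + l)) i - F (euler h x m) i)); last by rewrite rmorphD/=; ring.
apply: le_trans (le_normcD _ _) _; apply: le_trans (lerD ih (lexx _)) _.
have hF := @F_lip (euler h x (m + l)) (euler h x m) (l%:R * h * B) (fun i _ => euler_lip x m l i h0) i.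
rewrite normcM normc_real ger0_norm//.
apply: (@le_trans _ _ (L * B * (l%:R * h) ^+ 2 + h * (L * (l%:R * h * B)))).
  by rewrite lerD2l ler_wpM2l.
have := ler0n R l; move: (l%:R : R) => y y0.
have : 0 <= L * B * (y * h * h + h * h) by posi.
by rewrite (_ : L * B * (y * h + h) ^+ 2 = L * B * (y * h) ^+ 2 + h * (L * (y * h * B)) +
  L * B * (y * h * h + h * h)); [lra|ring].
Qed.

(** An expansion around the later of two times, so that the limit is
    differentiable from both sides. *)
Lemma euler_expand_back h x m l i : 0 <= h ->
  normc (euler h x m i - euler h x (m + l) i + (l%:R * h)%:C * F (euler h x (m + l)) i) <=
  2 * (L * B) * (l%:R * h) ^+ 2.
Proof.
move=> h0; have h1 := euler_expand x m l i h0.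
have hF := @F_lip (euler h x (m + l)) (euler h x m) (l%:R * h * B) (fun i _ => euler_lip x m l i h0) i.
rewrite (_ : _ - _ + _ = - (euler h x (m + l) i - euler h x m i - (l%:R * h)%:C * F (euler h x m) i) +
   (l%:R * h)%:C * (F (euler h x (m + l)) i - F (euler h x m) i)); last by ring.
apply: le_trans (le_normcD _ _) _; rewrite normcN.
apply: le_trans (lerD h1 (lexx _)) _.
have lh : 0 <= l%:R * h by posi.
rewrite normcM normc_real ger0_norm//.
have : l%:R * h * normc (F (euler h x (m + l)) i - F (euler h x m) i) <= l%:R * h * (L * (l%:R * h * B)).
  by rewrite ler_wpM2l.
by rewrite (_ : l%:R * h * (L * _) = L * B * (l%:R * h) ^+ 2); [lra|ring].
Qed.

(** The solution is the limit of the Euler polygons along an ultrafilter, so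
    that no subsequence has to be extracted; the expansion of the polygons
    passes to the limit and yields the equation. *)
Lemma euler_limit x0 : exists X : R -> I -> R[i], X 0 = x0 /\
  forall s t i, 0 <= s -> 0 <= t ->
    normc (X t i - X s i - (t - s)%:C * F (X s) i) <= 2 * (L * B) * (t - s) ^+ 2.
Proof.
have [G UG ooG] := ex_ultra.
pose h (k : nat) : R := k.+1%:R^-1.
have h0 k : 0 <= h k by rewrite invr_ge0.
pose st (t : R) (k : nat) := Num.truncn (t * k.+1%:R).
pose P t k i := euler (h k) x0 (st t k) i.
pose X t i := ulim G (fun k => P t k i).
have sth t k : 0 <= t -> (st t k)%:R * h k <= t /\ t <= (st t k)%:R * h k + h k.
  move=> t0; have tk : 0 <= t * k.+1%:R by rewrite mulr_ge0.
  have k0 : (0 : R) < k.+1%:R by rewrite ltr0n.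
  rewrite /h; split; first by rewrite ler_pdivrMr// truncn_le.
  by rewrite -[X in _ + X]mul1r -mulrDl natr1 ler_pdivlMr//; apply/ltW; exact: truncnS_gt.
have sg_cvg t : 0 <= t -> (st t k)%:R * h k @[k --> G] --> t.
  move=> t0; apply: cvg_trans (_ : (st t k)%:R * h k @[k --> \oo] --> t).
    by move=> A; exact: ooG.
  apply: (@squeeze_cvgr _ _ _ _ (fun k => t - h k) (fun=> t)); last exact: cvg_cst.
    by near=> k; have [h1 h2] := sth t k t0; apply/andP; split=> //; lra.
  rewrite -[X in _ --> X](subr0 t); apply: cvgB; first exact: cvg_cst.
  exact: cvg_harmonic.
have PX t i : 0 <= t -> ccvg G (fun k => P t k i) (X t i).
  move=> t0; apply: (@ulimP _ _ _ (normc (x0 i) + t * B)); near=> k.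
  rewrite -(subrK (x0 i) (P t k i)) addrC; apply: le_trans (le_normcD _ _) _.
  rewrite lerD2l; have := @euler_lip (h k) x0 0 (st t k) i (h0 k); rewrite add0n.
  move=> /le_trans; apply; apply: ler_wpM2r => //; by have [] := sth t k t0.
exists X; split.
  apply/funext => i; have h1 := PX 0 i (lexx 0).
  apply: (ccvg_unique h1); apply: ccvgP => e e0; near=> k.
  by rewrite /P /st mul0r truncn0 /= subrr normc0 ltW.
move=> s t i s0 t0.
have key k : normc (P t k i - P s k i - ((st t k)%:R * h k - (st s k)%:R * h k)%:C * F (P s k) i) <=
    2 * (L * B) * ((st t k)%:R * h k - (st s k)%:R * h k) ^+ 2.
  have LB : 0 <= L * B by posi.
  have [ts|ts] := leqP (st s k) (st t k).
    have := euler_expand x0 (st s k) (st t k - st s k) i (h0 k).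
    rewrite subnKC// natrB// mulrBl => /le_trans; apply.
    by rewrite ler_wpM2r ?sqr_ge0//; lra.
  have := euler_expand_back x0 (st t k) (st s k - st t k) i (h0 k).
  rewrite subnKC ?(ltnW ts)// natrB ?(ltnW ts)// mulrBl.
  rewrite -[X in _ * X ^+ 2]opprB sqrrN => /(le_trans _); apply; rewrite le_eqVlt; apply/orP; left.
  by apply/eqP; congr normc; rewrite -[X in _ + X%:C * _]opprB rmorphN/= mulNr.
have sub := cvgB (sg_cvg t t0) (sg_cvg s s0).
have h1 : ccvg G (fun k => P t k i - P s k i - ((st t k)%:R * h k - (st s k)%:R * h k)%:C * F (P s k) i)
    (X t i - X s i - (t - s)%:C * F (X s) i).
  have cN (f : nat -> R[i]) z : ccvg G f z -> ccvg G (fun k => - f k) (- z).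
    move=> hf; rewrite -mulN1r; under eq_fun do rewrite -mulN1r.
    by apply: ccvgM => //; exact: ccvg_cst.
  apply: ccvgD; first by apply: ccvgD; [exact: PX|apply: cN; exact: PX].
  apply: cN; apply: ccvgM; last by apply: F_ccvg => j; exact: PX.
  by split=> /=; [exact: sub|exact: cvg_cst].
apply: (@ler_cvg_to _ _ _ _ _ _ _ _ (ccvg_normc_cvg h1)
  (_ : 2 * (L * B) * ((st t k)%:R * h k - (st s k)%:R * h k) ^+ 2 @[k --> G] --> _)).
  by apply: cvgMr; rewrite expr2; under eq_fun do rewrite expr2; apply: cvgM; exact: sub.
by near=> k; exact: key.
Unshelve. all: by end_near. Qed.

End Euler.

(** The solutions for F and for - F, run forward, fit together at time 0. *)
Theorem ode_exists {R : realType} (I : eqType) (r : seq I) (F : (I -> R[i]) -> (I -> R[i])) (B L : R)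
    (x0 : I -> R[i]) : 0 <= B -> 0 <= L ->
  (forall x i, normc (F x i) <= B) ->
  (forall x y d, (forall i, i \in r -> normc (x i - y i) <= d) ->
    forall i, normc (F x i - F y i) <= L * d) ->
  exists X : R -> I -> R[i], X 0 = x0 /\
    forall t i, cder (fun s => X s i) t (F (X t) i).
Proof.
move=> B0 L0 FB FL.
have [X [X0 hX]] := euler_limit B0 L0 FB FL x0.
pose G x i := - F x i.
have GB x i : normc (G x i) <= B by rewrite normcN.
have GL x y d : (forall i, i \in r -> normc (x i - y i) <= d) ->
    forall i, normc (G x i - G y i) <= L * d.
  by move=> h i; rewrite -opprD normcN; exact: FL.
have [Y [Y0 hY]] := euler_limit B0 L0 GB GL x0.
pose Z t := if 0 <= t then X t else Y (- t).
exists Z; split; first by rewrite /Z lexx.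
have Yex s t i : s <= 0 -> t <= 0 ->
    normc (Y (- t) i - Y (- s) i - (t - s)%:C * F (Y (- s)) i) <= 2 * (L * B) * (t - s) ^+ 2.
  move=> s0 t0; have := hY (- s) (- t) i; rewrite !oppr_ge0 => /(_ s0 t0).
  have -> : - t - - s = - (t - s) by ring.
  by rewrite sqrrN rmorphN/= /G mulNr mulrN opprK.
have C0 : 0 <= 2 * (L * B) by posi.
have ZY s : s <= 0 -> Z s = Y (- s).
  move=> s0; rewrite /Z; case: ifP => // s0'.
  have -> : s = 0 by apply/eqP; rewrite eq_le s0 s0'.
  by rewrite oppr0 X0 Y0.
have ZX s : 0 <= s -> Z s = X s by rewrite /Z => ->.
have loc t i : exists2 d : R, 0 < d & forall s, `|s - t| <= d ->
    normc (Z s i - Z t i - (s - t)%:C * F (Z t) i) <= 2 * (L * B) * (s - t) ^+ 2.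
  have [t0|t0|t0] := ltgtP t 0.
  - exists (- t) => [|s]; first by rewrite oppr_gt0.
    rewrite ler_norml => /andP[_ st]; rewrite !ZY ?(ltW t0)//; last by lra.
    by apply: Yex; [exact: ltW|lra].
  - exists t => // s; rewrite ler_norml => /andP[st _]; rewrite !ZX ?(ltW t0)//; last by lra.
    by apply: hX; [exact: ltW|lra].
  exists 1 => // s _; have [s0|/ltW s0] := leP 0 s.
    by rewrite !ZX ?t0//; apply: hX.
  by rewrite !ZY ?t0//; apply: Yex.
move=> t i; have [d d0 hd] := loc t i; apply: cder_expansion => e e0.
exists (Num.min d (e / (2 * (L * B) + 1))).
  by rewrite lt_min d0 divr_gt0// ltr_wpDl.
move=> s; rewrite le_min => /andP[sd se]; apply: le_trans (hd _ sd) _.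
have -> : 2 * (L * B) * (s - t) ^+ 2 = 2 * (L * B) * `|s - t| * `|s - t|.
  by rewrite -(real_normK (num_real (s - t))); ring.
apply: ler_wpM2r => //.
apply: (@le_trans _ _ (2 * (L * B) * (e / (2 * (L * B) + 1)))); first by rewrite ler_wpM2l.
rewrite mulrCA ler_piMr ?(ltW e0)// ler_pdivrMr ?ltr_wpDl//; lra.
Qed.

(** * The Galerkin system *)

Section BoundedLipschitz.
Context {R : realType} (I : eqType) (r : seq I).
Implicit Types (f g : (I -> R[i]) -> R[i]).

(** Bounded functions that are Lipschitz in finitely many coordinates: this
    class is stable under polynomial expressions. *)
Definition BL f : Prop := exists B L : R, [/\ 0 <= B, 0 <= L,
  forall x, normc (f x) <= B &
  forall x y d, 0 <= d -> (forall i, i \in r -> normc (x i - y i) <= d) ->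
    normc (f x - f y) <= L * d].

Lemma BL_cst c : BL (fun=> c).
Proof.
exists (normc c), 0; split=> // [|x y d d0 _]; first exact: normc_ge0.
by rewrite subrr normc0 mul0r.
Qed.

Lemma BLD f g : BL f -> BL g -> BL (fun x => f x + g x).
Proof.
move=> [B [L [B0 L0 hB hL]]] [B' [L' [B0' L0' hB' hL']]].
exists (B + B'), (L + L'); split; rewrite ?addr_ge0//.
  by move=> x; apply: le_trans (le_normcD _ _) _; exact: lerD.
move=> x y d d0 h; rewrite opprD addrACA mulrDl.
by apply: le_trans (le_normcD _ _) _; apply: lerD; [exact: hL|exact: hL'].
Qed.

Lemma BLM f g : BL f -> BL g -> BL (fun x => f x * g x).
Proof.
move=> [B [L [B0 L0 hB hL]]] [B' [L' [B0' L0' hB' hL']]].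
exists (B * B'), (L * B' + B * L'); split; rewrite ?addr_ge0 ?mulr_ge0//.
  by move=> x; rewrite normcM ler_pM ?normc_ge0.
move=> x y d d0 h.
rewrite (_ : _ - _ = (f x - f y) * g x + f y * (g x - g y)); last by ring.
apply: le_trans (le_normcD _ _) _; rewrite [leRHS]mulrDl !normcM; apply: lerD.
  by rewrite mulrAC ler_pM ?normc_ge0// hL.
by rewrite -mulrA ler_pM ?normc_ge0// hL'.
Qed.

Lemma BLJ f : BL f -> BL (fun x => conjc (f x)).
Proof.
move=> [B [L [B0 L0 hB hL]]]; exists B, L; split=> // [x|x y d d0 h].
  by rewrite normcJ'.
by rewrite -rmorphB/= normcJ'; exact: hL.
Qed.

Lemma BL_sum (J : Type) (s : seq J) (F : J -> (I -> R[i]) -> R[i]) :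
  (forall j, BL (F j)) -> BL (fun x => \sum_(j <- s) F j x).
Proof.
move=> h; elim: s => [|j s ih].
  by under eq_fun do rewrite big_nil; exact: BL_cst.
by under eq_fun do rewrite big_cons; exact: BLD.
Qed.

Lemma BL_Re (th : R -> R) c f : 0 <= c -> (forall x, `|th x| <= 1) ->
  (forall x y, `|th x - th y| <= c * `|x - y|) -> BL f ->
  BL (fun x => (th (complex.Re (f x)))%:C).
Proof.
move=> c0 h1 hc [B [L [B0 L0 hB hL]]]; exists 1, (c * L); split; rewrite ?mulr_ge0//.
  by move=> x; rewrite normc_real.
move=> x y d d0 h; have -> : (th (complex.Re (f x)))%:C - (th (complex.Re (f y)))%:C =
    (th (complex.Re (f x)) - th (complex.Re (f y)))%:C :> R[i] by rewrite rmorphB.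
rewrite normc_real; apply: le_trans (hc _ _) _.
rewrite -mulrA ler_wpM2l// -cReN -cReD; apply: le_trans (normc_Re _) _; exact: hL.
Qed.

End BoundedLipschitz.

Section Clamp.
Context {R : realType}.
Implicit Types (A x y : R) (z : R[i]).

Definition clampR A x : R := if x < - A then - A else if A < x then A else x.

Lemma clampR_lip A x y : 0 <= A -> `|clampR A x - clampR A y| <= `|x - y|.
Proof.
move=> A0; have h1 := ler_norm (x - y); have h2 := ler_norm (y - x).
have h0 := normr_ge0 (x - y); rewrite distrC in h2.
rewrite ler_norml /clampR; move: (`|x - y|) h0 h1 h2 => D h0 h1 h2.
by case: (ltP x (- A)) => ?; case: (ltP y (- A)) => ?; case: (ltP A x) => ?;
  case: (ltP A y) => ?; apply/andP; split; lra.
Qed.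

Lemma clampR_bound A x : 0 <= A -> `|clampR A x| <= A.
Proof.
move=> A0; rewrite /clampR ler_norml.
by case: (ltP x (- A)) => ?; case: (ltP A x) => ?; apply/andP; split; lra.
Qed.

Lemma clampR_id A x : `|x| <= A -> clampR A x = x.
Proof.
rewrite ler_norml => /andP[h1 h2]; rewrite /clampR.
by rewrite ltNge h1/= ltNge h2.
Qed.

Lemma clampR_inv A x : 0 <= A -> `|clampR A x| < A -> clampR A x = x.
Proof.
move=> A0; rewrite /clampR; case: (ltP x (- A)) => _.
  by rewrite normrN ger0_norm ?ltxx.
by case: (ltP A x) => // _; rewrite ger0_norm ?ltxx.
Qed.

(** Componentwise, so that strict inequality of the result with the level
    shows that nothing was changed. *)
Definition clamp A z : R[i] := clampR A (complex.Re z) +i* clampR A (complex.Im z).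

Lemma clamp_lip A z z' : 0 <= A -> normc (clamp A z - clamp A z') <= 2 * normc (z - z').
Proof.
move=> A0; apply: le_trans (normc_ReIm _) _; rewrite mulr_natl mulr2n; apply: lerD.
  rewrite cReD cReN /=; apply: le_trans (clampR_lip _ _ A0) _.
  by rewrite -cReN -cReD normc_Re.
rewrite cImD cImN /=; apply: le_trans (clampR_lip _ _ A0) _.
by rewrite -cImN -cImD normc_Im.
Qed.

Lemma clamp_bound A z : 0 <= A -> normc (clamp A z) <= 2 * A.
Proof.
move=> A0; apply: le_trans (normc_ReIm _) _; rewrite mulr_natl mulr2n /=.
by apply: lerD; exact: clampR_bound.
Qed.

Lemma clamp_id A z : normc z <= A -> clamp A z = z.
Proof.
case: z => x y h; rewrite /clamp /= !clampR_id//.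
  by apply: le_trans h; exact: (normc_Im (x +i* y)).
by apply: le_trans h; exact: (normc_Re (x +i* y)).
Qed.

Lemma clamp_inv A z : 0 <= A -> normc (clamp A z) < A -> clamp A z = z.
Proof.
case: z => x y A0 h; rewrite /clamp /=; congr (_ +i* _); apply: clampR_inv => //.
  by apply: le_lt_trans h; exact: (normc_Re (clamp A (x +i* y))).
by apply: le_lt_trans h; exact: (normc_Im (clamp A (x +i* y))).
Qed.

Definition cutoff (m x : R) : R := if x < m then 1 else if x < 2 * m then 2 - x / m else 0.

Lemma cutoff_bound m x : 0 < m -> `|cutoff m x| <= 1.
Proof.
move=> m0; rewrite /cutoff; case: ltP => h; first by rewrite normr1.
case: ltP => h'; last by rewrite normr0.
rewrite ler_norml; have : 1 <= x / m by rewrite ler_pdivlMr// mul1r.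
by have : x / m <= 2 by [rewrite ler_pdivrMr// ltW]; move=> *; apply/andP; split; lra.
Qed.

Lemma cutoff_lip m x y : 0 < m -> `|cutoff m x - cutoff m y| <= m^-1 * `|x - y|.
Proof.
move=> m0; have h1 := ler_norm (x - y); have h2 := ler_norm (y - x).
have h0 := normr_ge0 (x - y); rewrite distrC in h2.
have mi : 0 < m^-1 by rewrite invr_gt0.
have mx : m * m^-1 = 1 by rewrite mulfV// gt_eqF.
have cE (z : R) : cutoff m z = if z / m < 1 then 1 else if z / m < 2 then 2 - z / m else 0.
  by rewrite /cutoff !ltr_pdivrMr// mul1r.
pose X := x / m; pose Y := y / m.
have XY : `|X - Y| = m^-1 * `|x - y|.
  by rewrite /X /Y -mulrBl normrM (gtr0_norm mi) mulrC.
rewrite !cE -XY -/X -/Y; have g1 := ler_norm (X - Y); have g2 := ler_norm (Y - X).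
have g0 := normr_ge0 (X - Y); rewrite distrC in g2.
rewrite ler_norml; move: (`|X - Y|) g0 g1 g2 => D g0 g1 g2.
by case: (ltP X 1) => ?; case: (ltP Y 1) => ?; case: (ltP X 2) => ?;
  case: (ltP Y 2) => ?; apply/andP; split; lra.
Qed.

End Clamp.

Section Galerkin.
Context {R : realType}.
Variables (alpha beta a b : R) (N : nat).
Local Notation ka0 := (ka0 alpha beta).
Local Notation phi := (phi a b).
Local Notation state := (bool -> int -> R[i]).
Local Notation I := (bool * int)%type.
Implicit Types (x : I -> R[i]) (U : state).

Definition galF U j n : R[i] :=
  if (`|n| <= N)%N then (0 +i* phi n) * U j n + cub ka0 U U U j (box N) n else 0.

Definition modes : seq I := [seq (j, n) | j <- [:: false; true], n <- zbox N].

Lemma mem_modes j n : ((j, n) \in modes) = (`|n| <= N)%N.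
Proof.
rewrite -mem_zbox; apply/allpairsP/idP => [[[j' n'] [_ h [_ ->]]]//|h].
by exists (j, n); split=> //; case: j.
Qed.

Definition clampU (A : R) x : state := fun j n =>
  if (`|n| <= N)%N then clamp A (x (j, n)) else 0.

(** The vector field modified for large amplitudes and large mass, so as to be
    globally Lipschitz and still orthogonal to the state. *)
Definition modF (A m : R) x (i : I) : R[i] :=
  (cutoff m (complex.Re (\sum_(n <- zbox N) (clampU A x false n * conjc (clampU A x false n) +
    clampU A x true n * conjc (clampU A x true n)))))%:C * galF (clampU A x) i.1 i.2.

Lemma BL_clampU A j n : 0 <= A -> BL modes (fun x => clampU A x j n).
Proof.
move=> A0; rewrite /clampU; have [h|h] := boolP (`|n| <= N)%N; last exact: BL_cst.
exists (2 * A), 2; split=> // [|x|x y d d0 hd]; first by rewrite mulr_ge0.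
  exact: clamp_bound.
by apply: le_trans (clamp_lip _ _ A0) _; rewrite ler_wpM2l// hd// mem_modes.
Qed.

Lemma BL_modF A m i : 0 <= A -> 0 < m -> BL modes (fun x => modF A m x i).
Proof.
move=> A0 m0; rewrite /modF /galF; apply: BLM.
  apply: (@BL_Re _ _ _ (cutoff m) m^-1); first by rewrite invr_ge0 ltW.
  - by move=> y; exact: cutoff_bound.
  - by move=> y z; exact: cutoff_lip.
  apply: BL_sum => n; apply: BLD; apply: BLM; try apply: BLJ; exact: BL_clampU.
have [_|_] := boolP (`|i.2| <= N)%N; last exact: BL_cst.
apply: BLD; first by apply: BLM; [exact: BL_cst|exact: BL_clampU].
rewrite /cub /Tr; apply: BLD; apply: BL_sum => p.
- by apply: BLM; [apply: BLM; [apply: BLM; [exact: BL_cst|]|apply: BLJ]|]; exact: BL_clampU.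
- by apply: BLM; [apply: BLM; [apply: BLM; [exact: BL_cst|]|apply: BLJ]|]; exact: BL_clampU.
Qed.

Lemma modF_out A m x j n : (N < `|n|)%N -> modF A m x (j, n) = 0.
Proof. by move=> h; rewrite /modF /galF/= leqNgt h mulr0. Qed.

Lemma modF_ode A m x0 : 0 <= A -> 0 < m -> exists X : R -> I -> R[i], X 0 = x0 /\
  forall t i, cder (fun s => X s i) t (modF A m (X t) i).
Proof.
move=> A0 m0.
have unif (s : seq I) : exists B L : R, [/\ 0 <= B, 0 <= L,
    forall x i, i \in s -> normc (modF A m x i) <= B &
    forall x y d, 0 <= d -> (forall i, i \in modes -> normc (x i - y i) <= d) ->
    forall i, i \in s -> normc (modF A m x i - modF A m y i) <= L * d].
  elim: s => [|i s [B [L [B0 L0 hB hL]]]]; first by exists 0, 0.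
  have [B' [L' [B0' L0' hB' hL']]] := BL_modF i A0 m0.
  exists (B + B'), (L + L'); split; rewrite ?addr_ge0//.
    move=> x k; rewrite inE => /predU1P[->|/hB h]; first by apply: le_trans (hB' x) _; rewrite lerDr.
    by apply: le_trans (h x) _; rewrite lerDl.
  move=> x y d d0 hd k; rewrite inE mulrDl => /predU1P[->|ks].
    by apply: le_trans (hL' x y d d0 hd) _; rewrite lerDr mulr_ge0.
  by apply: le_trans (hL x y d d0 hd k ks) _; rewrite lerDl mulr_ge0.
have [B [L [B0 L0 hB hL]]] := unif modes.
apply: (@ode_exists _ _ modes _ B L x0 B0 L0).
  move=> x [j n]; have [h|h] := boolP ((j, n) \in modes); first exact: hB.
  by rewrite modF_out ?normc0// ltnNge -(mem_modes j).
move=> x y d hd [j n].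
have d0 : 0 <= d.
  by apply: le_trans (normc_ge0 _) (hd (false, 0) _); rewrite mem_modes absz0.
have [h|h] := boolP ((j, n) \in modes); first exact: hL.
have nN : (N < `|n|)%N by rewrite ltnNge -(mem_modes j).
by rewrite !modF_out// subrr normc0 mulr_ge0.
Qed.

Definition supp U : Prop := forall j n, (N < `|n|)%N -> U j n = 0.

Lemma cub_kain U j n : supp U ->
  cub ka0 U U U j (box N) n = cub (kain alpha beta N) U U U j (box N) n.
Proof.
move=> hU; rewrite !cubE; apply: eq_bigr => p _; rewrite /kain.
by case: leqP => // h; rewrite (hU j _ h) !mulr0.
Qed.

Lemma galF_mass U : supp U ->
  complex.Re (\sum_(n <- zbox N) (conjc (U false n) * galF U false n + conjc (U true n) * galF U true n)) = 0.
Proof.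
move=> hU; rewrite big_seq (eq_bigr (fun n =>
  (0 +i* phi n) * (U false n * conjc (U false n) + U true n * conjc (U true n)) +
  (conjc (U false n) * cub (kain alpha beta N) U U U false (box N) n +
   conjc (U true n) * cub (kain alpha beta N) U U U true (box N) n))); last first.
  by move=> n; rewrite mem_zbox /galF => ->; rewrite !cub_kain//; ring.
rewrite -big_seq big_split/= cReD mass_QR addr0 cRe_sum big1// => n _.
by rewrite !sqmod_conjM -rmorphD cReM /= mul0r mulr0 subr0.
Qed.

(** The modified field is globally Lipschitz, so it has a global solution.
    Wherever the cutoff does not vanish the clamp is inactive, so the field is
    everywhere a real multiple of the original one and conserves the mass;
    therefore neither modification is ever active. *)
Theorem galerkin_exists U0 : supp U0 -> exists U : R -> state, [/\ U 0 = U0,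
  forall t, supp (U t), forall t, massK N (U t) = massK N U0 &
  forall t j n, cder (fun s => U s j n) t (galF (U t) j n)].
Proof.
(* The level A exceeds every coefficient of a state of mass at most 2 m. *)
move=> hU0; pose m := massK N U0 + 1; pose A := 2 * m.
have m00 : 0 <= massK N U0 by apply: sumr_ge0 => n _; rewrite addr_ge0 ?sqmod_ge0.
have m0 : 0 < m by rewrite ltr_wpDl.
have m1 : 1 <= m by rewrite lerDr.
have A0 : 0 < A by rewrite mulr_gt0.
have [X [X0 hX]] := modF_ode (fun i => U0 i.1 i.2) (ltW A0) m0.
pose U t j n := X t (j, n).
have U00 : U 0 = U0 by apply/funext => j; apply/funext => n; rewrite /U X0.
have mt U' j n : (`|n| <= N)%N -> sqmod (U' j n) <= massK N U'.
  move=> nN; rewrite /massK (bigD1_seq n) ?mem_zbox ?uniq_zbox//=.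
  have s0 : 0 <= \sum_(i <- zbox N | i != n) (sqmod (U' false i) + sqmod (U' true i)).
    by apply: sumr_ge0 => i _; rewrite addr_ge0 ?sqmod_ge0.
  by have := sqmod_ge0 (U' false n); have := sqmod_ge0 (U' true n); case: j; lra.
have out t j n : (N < `|n|)%N -> U t j n = 0.
  move=> nN; apply: normc_eps => e e0.
  have hb' : l2b (trunc w1 [:: n]) (fun n => U t j n - U 0 j n) (`|t - 0| * 0).
    apply: (@l2b_mean_value _ _ _ (fun s n => U s j n) (fun s n => modF A m (X s) (j, n))) => //.
      by move=> s k _ _; exact: hX.
    move=> s _; split=> // r' ur; rewrite big1 ?expr0n// => k _; rewrite /trunc inE.
    by case: eqP => [->|_]; rewrite ?mul0r// modF_out// sqmod0 mulr0.
  have := @l2b_term1 _ _ _ _ n _ hb'; rewrite /trunc mem_head mulr0 U00 hU0// subr0.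
  by move=> h; apply: le_trans (h _) (ltW e0).
have cl_id U' : massK N U' <= 2 * m -> (forall j n, (N < `|n|)%N -> U' j n = 0) ->
    clampU A (fun i => U' i.1 i.2) = U'.
  move=> hm ho; apply/funext => j; apply/funext => n; rewrite /clampU.
  case: leqP => nN; last by rewrite ho.
  apply: clamp_id; apply: normc_le_sqmod; first exact: ltW.
  apply: le_trans (mt _ _ _ nN) _; apply: le_trans hm _; rewrite /A expr2.
  by rewrite ler_peMr//; lra.
have massC U' : complex.Re (\sum_(n <- zbox N) (U' false n * conjc (U' false n) +
    U' true n * conjc (U' true n))) = massK N U'.
  rewrite cRe_sum; apply: eq_bigr => n _; by rewrite !sqmod_conjM -rmorphD.
have orth t : complex.Re (\sum_(n <- zbox N) (conjc (U t false n) * modF A m (X t) (false, n) +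
    conjc (U t true n) * modF A m (X t) (true, n))) = 0.
  rewrite /modF /= massC; set V := clampU A (X t).
  have [hm|hm] := ltP (massK N V) (2 * m); last first.
    rewrite (_ : cutoff m _ = 0) ?mul0r; last first.
      by rewrite /cutoff ltNge (le_trans _ hm)/= ?ltNge ?hm// ; lra.
    by rewrite big1// => n _; rewrite !mul0r !mulr0 addr0.
  have VU : V = U t.
    apply/funext => j; apply/funext => n; rewrite /V /clampU; case: leqP => nN; last by rewrite out.
    apply: clamp_inv; first exact: ltW.
    have h : sqmod (clamp A (X t (j, n))) <= massK N V.
      by have := mt V j n nN; rewrite /V /clampU nN.
    rewrite -(@ltr_pXn2r _ 2) ?nnegrE ?normc_ge0 ?(ltW A0)// -sqmod_normc.
    by apply: le_lt_trans h _; apply: lt_le_trans hm _; rewrite /A expr2 ler_peMr//; lra.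
  rewrite VU (eq_bigr (fun n => (cutoff m (massK N (U t)))%:C *
    (conjc (U t false n) * galF (U t) false n + conjc (U t true n) * galF (U t) true n))); last first.
    by move=> n _; ring.
  rewrite -mulr_sumr cReM galF_mass /= ?mulr0 ?mul0r ?subr0//.
  by move=> j n; exact: out.
have cons t : massK N (U t) = massK N U0.
  apply/eqP; rewrite -subr_eq0 -normr_le0 -U00.
  rewrite [leRHS](_ : 0 = `|t - 0| * 0); last by rewrite mulr0.
  apply: (@mean_value_le _ (fun s => massK N (U s)) (fun s => 0)) => [s _|s _]; last by rewrite normr0.
  rewrite (_ : 0 = \sum_(n <- zbox N) (2 * complex.Re (conjc (U s false n) * modF A m (X s) (false, n)) +
    2 * complex.Re (conjc (U s true n) * modF A m (X s) (true, n)))); last first.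
    transitivity (2 * complex.Re (\sum_(n <- zbox N) (conjc (U s false n) * modF A m (X s) (false, n) +
      conjc (U s true n) * modF A m (X s) (true, n)))); first by rewrite orth mulr0.
    by rewrite cRe_sum big_distrr/=; apply: eq_bigr => n _; rewrite cReD mulrDr.
  apply: is_derive_sum_seq => n _; apply: is_deriveD; apply: is_derive_sqmod; exact: hX.
exists U; split=> // t j n.
have := hX t (j, n); rewrite /modF /= massC.
rewrite (_ : X t = fun i => U t i.1 i.2); last by apply/funext => -[].
have mU : massK N (U t) < m by rewrite cons /m ltrDl.
rewrite (cl_id (U t)) ?mU//; last 2 first.
- by apply: le_trans (ltW mU) _; lra.
- by move=> *; exact: out.
by rewrite /cutoff mU mul1r.
Qed.

End Galerkin.

(** * Elementary multilinear bounds *)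

Section Convolution.
Context {R : realType}.
Implicit Types (x y z t ka : int -> R) (K L : nat) (s : int).

(** Convolution, the first factor being cut to the box. *)
Definition zconv K y t s : R := \sum_(n <- zbox K) y n * t (s - n).

Lemma zconv_ge0 K y t s : (forall n, 0 <= y n) -> (forall n, 0 <= t n) -> 0 <= zconv K y t s.
Proof. by move=> y0 t0; apply: sumr_ge0 => n _; rewrite mulr_ge0. Qed.

Lemma bsum_shift t B m : bsum t B -> bsum (fun n => t (n - m)) B.
Proof. by apply: bsum_inj; exact: addIr. Qed.

Lemma bsum_reflect t B m : bsum t B -> bsum (fun n => t (m - n)) B.
Proof. by apply: bsum_inj => n n' /addrI/oppr_inj. Qed.

Lemma zconv_CS K y t s Y T : 0 <= Y -> 0 <= T ->
  bsum (fun n => y n ^+ 2) (Y ^+ 2) -> bsum (fun n => t n ^+ 2) (T ^+ 2) ->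
  zconv K y t s <= Y * T.
Proof.
move=> Y0 T0 hy ht.
have h := CauchySchwarz_bsum (uniq_zbox K) hy (bsum_reflect s ht).
apply: le_trans (ler_norm _) _; rewrite -(@ler_pXn2r _ 2) ?nnegrE ?mulr_ge0//.
by rewrite real_normK ?num_real// exprMn.
Qed.

Lemma bsum_zconv K y t T : (forall n, 0 <= y n) -> bsum t T ->
  bsum (zconv K y t) ((\sum_(n <- zbox K) y n) * T).
Proof.
move=> y0 ht r ur; rewrite /zconv exchange_big/= mulr_suml; apply: ler_sum => n _.
by rewrite -big_distrr/= ler_wpM2l//; exact: (bsum_shift n ht).
Qed.

Definition BQ K ka x y z t : R :=
  \sum_(p <- box K) \sum_(q <- box K)
    if p.1 + q.1 == p.2 + q.2 then ka (p.1 + q.1) * (x p.1 * y p.2 * z q.1 * t q.2) else 0.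

Lemma BQ_flip K ka x y z t : BQ K ka x y z t = BQ K ka y x t z.
Proof.
have fl (F : int * int -> R) : \sum_(p <- box K) F p = \sum_(p <- box K) F (p.2, p.1).
  by rewrite !big_box exchange_big.
rewrite /BQ fl; apply: eq_bigr => p _; rewrite fl; apply: eq_bigr => q _ /=.
by rewrite eq_sym; case: eqP => // ->; congr (_ * _); ring.
Qed.

Lemma BQ_le K ka x y z t X Z S : (forall s, 0 <= ka s) -> (forall n, 0 <= x n) ->
  (forall n, 0 <= y n) -> (forall n, 0 <= z n) -> (forall n, 0 <= t n) ->
  0 <= X -> 0 <= Z ->
  bsum (fun n => x n ^+ 2) (X ^+ 2) -> bsum (fun n => z n ^+ 2) (Z ^+ 2) ->
  bsum (fun s => ka s * zconv K y t s) S -> BQ K ka x y z t <= X * Z * S.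
Proof.
move=> k0 x0 y0 z0 t0 X0 Z0 hx hz hS.
have h0 s : 0 <= ka s * zconv K y t s by rewrite mulr_ge0// zconv_ge0.
apply: (@le_trans _ _ (\sum_(m <- zbox K) \sum_(n <- zbox K)
    x m * z n * (ka (m + n) * zconv K y t (m + n)))).
  rewrite /BQ big_box; apply: ler_sum => m _; rewrite exchange_big big_box/=.
  apply: ler_sum => n _; rewrite exchange_big/= /zconv !big_distrr/=.
  apply: ler_sum => l _.
  rewrite (eq_bigr (fun q => if q == m + n - l then
      ka (m + n) * (x m * y l * z n * t (m + n - l)) else 0)); last first.
    move=> q _; rewrite (_ : (_ == _) = (q == m + n - l)); last by apply/eqP/eqP; lia.
    by case: eqP => [->|].
  rewrite big_pick ?uniq_zbox//; case: ifP => _; last by rewrite !mulr_ge0.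
  by rewrite le_eqVlt; apply/orP; left; apply/eqP; ring.
apply: (@le_trans _ _ (\sum_(m <- zbox K) \sum_(s <- zbox (K + K))
    x m * z (s - m) * (ka s * zconv K y t s))).
  rewrite big_seq [leRHS]big_seq; apply: ler_sum => m; rewrite mem_zbox => mK.
  rewrite (eq_bigr (fun n => (fun s => x m * z (s - m) * (ka s * zconv K y t s)) (m + n))); last first.
    by move=> n _ /=; rewrite (_ : m + n - m = n)//; ring.
  rewrite -(big_map (fun n => m + n) xpredT (fun s => x m * z (s - m) * (ka s * zconv K y t s))).
  apply: ler_sum_uniq.
  - by move=> s; rewrite mulr_ge0// mulr_ge0.
  - by rewrite map_inj_uniq ?uniq_zbox//; exact: addrI.
  - exact: uniq_zbox.
  - by move=> s /mapP[n]; rewrite !mem_zbox => nK ->; lia.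
rewrite exchange_big/=.
apply: (@le_trans _ _ (\sum_(s <- zbox (K + K)) X * Z * (ka s * zconv K y t s))).
  apply: ler_sum => s _; rewrite -big_distrl/= ler_wpM2r//.
  exact: (zconv_CS K s X0 Z0 hx hz).
by rewrite -big_distrr/= ler_wpM2l ?mulr_ge0//; apply: hS; exact: uniq_zbox.
Qed.

Lemma bsum_finite (I : eqType) (r : seq I) (x : I -> R) : uniq r -> (forall i, 0 <= x i) ->
  bsum (fun i => if i \in r then x i else 0) (\sum_(i <- r) x i).
Proof.
move=> ur x0 s us; rewrite -big_mkcond -big_filter; apply: ler_sum_uniq => //.
  exact: filter_uniq.
by move=> i; rewrite mem_filter => /andP[].
Qed.

Lemma size_zbox K : size (zbox K) = (2 * K).+1.
Proof. by elim: K => //= K ->; rewrite mulnS. Qed.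

(** Cauchy--Schwarz against the weight A + n^2/A, whose inverse has a sum
    bounded independently of A: the Fourier form of the Gagliardo--Nirenberg
    inequality for the sup norm, with the scale A left free. *)
Lemma sum_interp K (A : nat) x (m y : R) : (forall n, 0 <= x n) -> bsum (fun n => x n ^+ 2) m ->
  bsum (fun n => n%:~R ^+ 2 * x n ^+ 2) y ->
  (\sum_(n <- zbox K) x n) ^+ 2 <= 10 * (A.+1%:R * m + y / A.+1%:R).
Proof.
move=> x0 hm hy; have A0 : (0 : R) < A.+1%:R by rewrite ltr0n.
pose th (n : int) : R := A.+1%:R + n%:~R ^+ 2 / A.+1%:R.
have th0 n : 0 < th n by rewrite ltr_wpDr// mulr_ge0 ?sqr_ge0 ?invr_ge0 ?ltW.
have hth : bsum (fun n => (th n)^-1) 10.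
  have h1 := @bsum_finite _ (zbox A) (fun=> A.+1%:R^-1) (uniq_zbox A) (fun=> ltW (etrans (invr_gt0 _) A0)).
  have h2 := bsumZ (mulr_ge0 (ler0n _ 4) (ltW A0)) (@bsum_iJ_tail R A).
  apply: bsumW (bsum_le _ (bsumD h1 h2)).
    rewrite big_const_seq count_predT size_zbox iter_addr addr0.
    rewrite (_ : 4 * A.+1%:R * (2 / A.+1%:R) = 8); last by field.
    rewrite (_ : 10 = 2 + 8 :> R) ?lerD2r; last by ring.
    by rewrite -[_ *+ _]mulr_natl ler_pdivrMr// -natrM ler_nat; lia.
  move=> n /=; rewrite mem_zbox; case: leqP => h /=.
    rewrite mulr0 addr0 lef_pV2 ?posrE// /th lerDl mulr_ge0 ?sqr_ge0 ?invr_ge0 ?ltW//.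
  have n1 : (1 : R) <= `|n|%N%:R by rewrite ler1n (leq_ltn_trans _ h).
  have e : (n%:~R ^+ 2 : R) = `|n|%N%:R ^+ 2 by rewrite natr_absz intr_norm real_normK ?num_real.
  rewrite add0r /iJ JE exprVn; move: n1 e; set u := `|n|%N%:R => n1 e.
  have u0 : 0 < (1 + u) ^+ 2 by rewrite exprn_gt0//; lra.
  rewrite ler_pdivlMr// mulrC ler_pdivrMr// /th e.
  rewrite (_ : 4 * A.+1%:R * _ = 4 * A.+1%:R ^+ 2 + 4 * u ^+ 2); last first.
    by field; rewrite addrC natr1 gt_eqF.
  have := sqr_ge0 (A.+1%:R : R); have := sqr_ge0 (u - 1); nra.
have hw : bsum (fun n => (Num.sqrt (th n) * x n) ^+ 2) (A.+1%:R * m + y / A.+1%:R).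
  have iA : 0 <= A.+1%:R^-1 :> R by rewrite invr_ge0 ltW.
  have := bsumD (bsumZ (ltW A0) hm) (bsumZ iA hy); rewrite [_^-1 * _]mulrC.
  apply: bsum_le => n; rewrite exprMn sqr_sqrtr ?(ltW (th0 n))// /th mulrDl.
  by rewrite lerD2l [leRHS]mulrCA mulrA [_ / _]mulrC -mulrA [_ * x n ^+ 2]mulrC mulrC.
have hi : bsum (fun n => (Num.sqrt (th n))^-1 ^+ 2) 10.
  by apply: bsum_le hth => n; rewrite exprVn sqr_sqrtr// ltW.
apply: le_trans (CauchySchwarz_bsum (uniq_zbox K) hi hw).
rewrite le_eqVlt; apply/orP; left; apply/eqP; congr (_ ^+ 2); apply: eq_bigr => n _.
by rewrite mulKf// gt_eqF ?sqrtr_gt0.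
Qed.

Lemma sum_iJ_ln L : \sum_(n <- zbox L) iJ n <= 1 + 2 * ln L.+1%:R :> R.
Proof.
elim: L => [|L ih]; first by rewrite big_seq1 ln1 mulr0 addr0 iJ_le1.
rewrite !big_cons iJN addrA -mulr2n -[X in X + _]mulr_natl.
have L0 : (0 : R) < L.+1%:R by rewrite ltr0n.
have L1 : (0 : R) < L.+2%:R by rewrite ltr0n.
suff : iJ (Posz L.+1) <= ln L.+2%:R - ln L.+1%:R :> R by lra.
have q0 : (0 : R) < L.+1%:R / L.+2%:R by rewrite divr_gt0.
have e : L.+1%:R / L.+2%:R = 1 + - iJ (Posz L.+1) :> R.
  rewrite /iJ JE absz_nat (_ : L.+2%:R = 1 + L.+1%:R); last by rewrite -natr1 addrC.
  by field; rewrite gt_eqF// ltr_wpDr// ltW.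
have h : - 1 < - iJ (Posz L.+1) :> R by rewrite e in q0; lra.
have := le_ln1Dx h; rewrite -e ln_div ?posrE//; lra.
Qed.

(** Low frequencies are estimated by the bound A and the harmonic sum, high
    frequencies by the sum D, the separation being at D. *)
Lemma bsum_log x A D : 0 <= A -> (forall n, 0 <= x n) -> (forall n, x n <= A) -> bsum x D ->
  bsum (fun n => iJ n * x n) (A * (1 + 2 * ln (1 + D)) + 1).
Proof.
move=> A0 x0 xA hx; have D0 := bsum_ge0 hx.
have /andP[L1 L2] := truncn_itv D0; set L := Num.truncn D in L1 L2.
have Lp : (0 : R) < L.+1%:R by rewrite ltr0n.
have h1 := bsumZ A0 (@bsum_finite _ (zbox L) (@iJ R) (uniq_zbox L) (@iJ_ge0 R)).
have Li : 0 <= L.+1%:R^-1 :> R by rewrite invr_ge0 ltW.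
have h2 := bsumZ Li hx.
apply: bsumW (bsum_le _ (bsumD h1 h2)).
  apply: lerD; last by rewrite mulrC ler_pdivrMr// mul1r ltW.
  apply: ler_wpM2l => //; apply: le_trans (sum_iJ_ln L) _.
  rewrite lerD2l ler_wpM2l// ler_ln ?posrE//; last by rewrite ltr_wpDr.
  by rewrite -natr1 addrC lerD2l.
move=> n /=; rewrite mem_zbox; case: leqP => h.
  apply: (@le_trans _ _ (A * iJ n)); first by rewrite mulrC ler_wpM2r ?iJ_ge0.
  by rewrite lerDl mulr_ge0.
rewrite mulr0 add0r ler_wpM2r// lef_pV2 ?posrE ?J_gt0// JE -(natrD _ 1) add1n ler_nat.
exact: leqW.
Qed.

End Convolution.

(** * The modified energy *)

Section Energy.
Context {R : realType}.
Local Notation state := (bool -> int -> R[i]).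
Implicit Types (U V : state) (ka mu : int -> R) (K : nat).

Definition amp U n : R := normc (U false n) + normc (U true n).

Lemma amp_ge0 U n : 0 <= amp U n. Proof. by rewrite addr_ge0 ?normc_ge0. Qed.

Lemma normc_rr U V m n : normc (rr U V m n) <= amp U m * amp V n.
Proof.
apply: le_trans (le_normcD _ _) _; rewrite !normcM !normcJ' /amp.
have := normc_ge0 (U false m); have := normc_ge0 (U true m).
have := normc_ge0 (V false n); have := normc_ge0 (V true n); nra.
Qed.

(** The polarized quartic form on n1 + n3 = n2 + n4 with weight ka(n1 + n3);
    on the diagonal it is the ka-weighted l^2 norm of the Fourier coefficients
    of the products u_j u_k. *)
Definition QP K ka V U : R := \sum_(p <- box K) \sum_(q <- box K)
  if p.1 + q.1 == p.2 + q.2 then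
    ka (p.1 + q.1) * complex.Re (rr V U p.1 p.2 * rr U U q.1 q.2) else 0.

Lemma QP_le K ka V U : `|QP K ka V U| <=
  BQ K (fun s => `|ka s|) (amp V) (amp U) (amp U) (amp U).
Proof.
apply: le_trans (ler_norm_sum _ _ _) _; apply: ler_sum => p _.
apply: le_trans (ler_norm_sum _ _ _) _; apply: ler_sum => q _.
case: ifP => _; last by rewrite normr0.
rewrite normrM ler_wpM2l//; apply: le_trans (normc_Re _) _; rewrite normcM -mulrA.
by rewrite ler_pM ?normc_ge0 ?normc_rr.
Qed.

Lemma QP_split K ka ka' c V U : (forall s, ka s = ka' s + c) ->
  QP K ka V U = QP K ka' V U + c * QP K (fun=> 1) V U.
Proof.
move=> h; rewrite /QP mulr_sumr -big_split/=; apply: eq_bigr => p _.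
rewrite mulr_sumr -big_split/=; apply: eq_bigr => q _.
by case: ifP => _; rewrite ?mulr0 ?addr0// h; ring.
Qed.

Lemma QPD K ka V V' U : QP K ka (fun j n => V j n + V' j n) U = QP K ka V U + QP K ka V' U.
Proof.
rewrite /QP -big_split/=; apply: eq_bigr => p _; rewrite -big_split/=; apply: eq_bigr => q _.
case: ifP => _; rewrite ?addr0// -mulrDr -cReD -mulrDl; congr (_ * complex.Re (_ * _)).
by rewrite /rr; ring.
Qed.

Lemma eq_QP K ka V V' U : (forall j n, (`|n| <= K)%N -> V j n = V' j n) ->
  QP K ka V U = QP K ka V' U.
Proof.
move=> h; rewrite /QP big_seq [RHS]big_seq; apply: eq_bigr => p.
by rewrite mem_box => /andP[p1 _]; apply: eq_bigr => q _; rewrite /rr !h.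
Qed.

Lemma rr_phase (ph : int -> R) U V m n :
  rr (fun j n => (0 +i* ph n) * U j n) V m n = (0 +i* ph m) * rr U V m n.
Proof. by rewrite /rr; ring. Qed.

Lemma QP_phase K ka (ph : int -> R) U : QP K ka (fun j n => (0 +i* ph n) * U j n) U =
  QR K (YY U) (fun n1 _ n3 _ => ka (n1 + n3) * ph n1).
Proof.
rewrite /QP /QR; apply: eq_bigr => p _; apply: eq_bigr => q _; case: ifP => // _.
by rewrite rr_phase /YY -!mulrA cReM /=; ring.
Qed.

Lemma is_derive_Re (f : R -> R[i]) t z : cder f t z ->
  is_derive t (1 : R) (fun s => complex.Re (f s) : R) (complex.Re z).
Proof. by case. Qed.

Lemma is_derive_cZ c (f : R -> R) t d : is_derive t (1 : R) f d ->
  is_derive t (1 : R) (fun s => c * f s) (c * d).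
Proof. exact: is_deriveZ. Qed.

Lemma cder_rr (U V : R -> state) (U' V' : state) t m n :
  (forall j n, cder (fun s => U s j n) t (U' j n)) ->
  (forall j n, cder (fun s => V s j n) t (V' j n)) ->
  cder (fun s => rr (U s) (V s) m n) t (rr U' (V t) m n + rr (U t) V' m n).
Proof.
move=> hU hV; rewrite /rr.
apply: cder_eq (cderD (cderM (hU _ _) (cderJ (hV _ _))) (cderM (hU _ _) (cderJ (hV _ _)))) _.
ring.
Qed.

Lemma is_derive_QP K ka (U : R -> state) V t :
  (forall j n, cder (fun s => U s j n) t (V j n)) ->
  is_derive t (1 : R) (fun s => QP K ka (U s) (U s)) (4 * QP K ka V (U t)).
Proof.
move=> hU; pose F p q := rr V (U t) p.1 p.2 * rr (U t) (U t) q.1 q.2.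
pose G p q := rr (U t) V p.1 p.2 * rr (U t) (U t) q.1 q.2.
pose QF (H : int * int -> int * int -> R[i]) := \sum_(p <- box K) \sum_(q <- box K)
  if p.1 + q.1 == p.2 + q.2 then ka (p.1 + q.1) * complex.Re (H p q) else 0.
have fl (f : int * int -> R) : \sum_(p <- box K) f p = \sum_(p <- box K) f (p.2, p.1).
  by rewrite !big_box exchange_big.
have swap H : QF (fun p q => H q p) = QF H.
  rewrite /QF exchange_big; apply: eq_bigr => p _; apply: eq_bigr => q _.
  by rewrite [p.1 + _]addrC [p.2 + _]addrC.
have GF : QF G = QF F.
  rewrite /QF fl; apply: eq_bigr => p _; rewrite fl; apply: eq_bigr => q _ /=.
  rewrite eq_sym; case: eqP => // <-; congr (_ * _).
  by rewrite /G /F/= -(rrJ V) -(rrJ (U t) (U t) q.1) -rmorphM cReJ.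
have -> : 4 * QP K ka V (U t) = QF (fun p q => F p q + G p q + (F q p + G q p)).
  transitivity (QF F + QF G + (QF (fun p q => F q p) + QF (fun p q => G q p))).
    rewrite (swap F) (swap G) GF -[QP _ _ _ _]/(QF F); move: (QF F) => x.
    by ring.
  rewrite /QF -!big_split/=; apply: eq_bigr => p _; rewrite -!big_split/=; apply: eq_bigr => q _.
  by case: ifP => _; rewrite ?addr0// !cReD; ring.
apply: is_derive_sum_seq => p _; apply: is_derive_sum_seq => q _.
case: ifP => _; last exact: is_derive_cst.
have h := is_derive_Re (cderM (cder_rr p.1 p.2 hU hU) (cder_rr q.1 q.2 hU hU)).
apply: is_derive_eq (is_derive_cZ _ h) _; congr (_ * complex.Re _).
by rewrite /F /G; ring.
Qed.

Lemma cReZ (c : R) (z : R[i]) : complex.Re (c%:C * z) = c * complex.Re z.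
Proof. by rewrite cReM /= mul0r subr0. Qed.

(** The squared L^2 norm of the derivative, up to a factor 2 pi. *)
Definition HK K U : R := \sum_(n <- zbox K) n%:~R ^+ 2 * (sqmod (U false n) + sqmod (U true n)).

Lemma HK_ge0 K U : 0 <= HK K U.
Proof. apply: sumr_ge0 => n _; apply: mulr_ge0; first exact: sqr_ge0.
by rewrite addr_ge0 ?sqmod_ge0. Qed.

Variables (alpha beta a b : R) (N : nat).
Local Notation ka0 := (ka0 alpha beta).
Local Notation phi := (phi a b).
Local Notation DD := (DD a b).
Local Notation symb := (symb alpha beta).
Local Notation galF := (galF alpha beta a b N).

Definition galN U j n : R[i] := if (`|n| <= N)%N then cub ka0 U U U j (box N) n else 0.

Lemma galFE U j n : supp N U -> galF U j n = (0 +i* phi n) * U j n + galN U j n.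
Proof.
by move=> hU; rewrite /galF /galN; case: leqP => // h; rewrite hU// mulr0 addr0.
Qed.

Lemma is_derive_HK (U : R -> state) t :
  supp N (U t) -> (forall j n, cder (fun s => U s j n) t (galF (U t) j n)) ->
  is_derive t (1 : R) (fun s => HK N (U s)) (QR N (YY (U t)) (fun n1 n2 n3 n4 =>
    (n1%:~R * n3%:~R - n2%:~R * n4%:~R) * (alpha - beta * (n1 + n3)%:~R / 2))).
Proof.
move=> hS hU.
have -> : QR N (YY (U t)) (fun n1 n2 n3 n4 =>
    (n1%:~R * n3%:~R - n2%:~R * n4%:~R) * (alpha - beta * (n1 + n3)%:~R / 2)) =
  \sum_(n <- zbox N) n%:~R ^+ 2 * (2 * complex.Re (conjc (U t false n) * galF (U t) false n) +
    2 * complex.Re (conjc (U t true n) * galF (U t) true n)).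
  have e := pair_QR alpha beta N (U t) (fun n => 2 * n%:~R ^+ 2).
  rewrite (@QR_sym _ _ _ _ (fun n1 n2 n3 n4 => (n1%:~R * n3%:~R - n2%:~R * n4%:~R) *
    (alpha - beta * (n1 + n3)%:~R / 2))) in e; first last.
  - move=> n1 n2 n3 n4 h; have := congr1 (fun z : int => z%:~R : R) h.
    rewrite !intrD => h'; rewrite (_ : n4%:~R = n1%:~R + n3%:~R - n2%:~R); first by field.
    by rewrite h'; ring.
  - exact: YY_flip.
  - exact: YY_swap.
  rewrite -e cRe_sum big_seq [RHS]big_seq; apply: eq_bigr => n; rewrite mem_zbox => nN.
  rewrite !galFE// /galN nN !(cub_kain _ _ _ _ hS) cReZ -mulrA mulrCA; congr (_ * _).
  rewrite -mulrDr; congr (_ * _); rewrite -cReD; set z := cub _ _ _ _ _ _ _; set z' := cub _ _ _ _ _ _ _.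
  transitivity (complex.Re (conjc (U t false n) * z + conjc (U t true n) * z') + complex.Re
    ((0 +i* phi n) * (U t false n * conjc (U t false n) + U t true n * conjc (U t true n)))).
    by rewrite !sqmod_conjM -rmorphD [X in _ = _ + X]cReM /= mul0r mulr0 subr0 addr0.
  by rewrite -cReD; congr complex.Re; ring.
apply: is_derive_sum_seq => n _.
have h := is_deriveD (is_derive_sqmod (hU false n)) (is_derive_sqmod (hU true n)).
exact: is_derive_cZ h.
Qed.

(** This weight makes the linear evolution of the quartic correction cancel the
    cubic growth of HK, away from the resonant value of s. *)
Definition mu (s : int) : R :=
  if DD s == 0 then 0 else (alpha - beta * s%:~R / 2) / DD s.

(** What [mu] cannot cancel: at most one value of s. *)
Definition resw (s : int) : R := if DD s == 0 then alpha - beta * s%:~R / 2 else 0.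

(** For n1 + n3 = n2 + n4 = s, phi symmetrizes to a multiple of
    (3 b s - 2 a)(n1 n3 - n2 n4), the factor n1 n3 - n2 n4 being also that of
    the growth of HK. *)
Lemma is_derive_energy (U : R -> state) t :
  supp N (U t) -> (forall j n, cder (fun s => U s j n) t (galF (U t) j n)) ->
  is_derive t (1 : R) (fun s => HK N (U s) + QP N mu (U s) (U s))
   (QR N (YY (U t)) (fun n1 n2 n3 n4 =>
     (n1%:~R * n3%:~R - n2%:~R * n4%:~R) * resw (n1 + n3)) + 4 * QP N mu (galN (U t)) (U t)).
Proof.
move=> hS hU.
have h := is_deriveD (is_derive_HK hS hU) (is_derive_QP N mu hU).
apply: is_derive_eq.
rewrite (@eq_QP _ _ _ (fun j n => (0 +i* phi n) * U t j n + galN (U t) j n)); last first.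
  by move=> j n _; exact: galFE.
rewrite QPD QP_phase mulrDr addrA; congr (_ + _); rewrite QRZ.
rewrite [X in _ + X](@QR_sym _ _ _ _ (fun n1 n2 n3 n4 => mu (n1 + n3) * (phi n1 - phi n2 + phi n3 - phi n4))) ?QRD.
- apply: eq_QR => n1 n2 n3 n4 e; rewrite /mu /resw; have := congr1 (fun z : int => z%:~R : R) e.
  case: eqP => [_|/eqP D0 e']; first by rewrite mul0r addr0.
  rewrite mulr0 (_ : phi n1 - _ + _ - _ = - DD (n1 + n3) * (n1%:~R * n3%:~R - n2%:~R * n4%:~R)).
    by field; rewrite D0.
  rewrite /phi /DD e' {D0}; rewrite !intrD in e' *.
  by rewrite (_ : n3%:~R = n2%:~R + n4%:~R - n1%:~R); [ring|rewrite -e'; ring].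
- exact: YY_swap.
- exact: YY_flip.
- by move=> n1 n2 n3 n4 e; rewrite [n3 + n1]addrC [n4 + n2]addrC e; ring.
Qed.

End Energy.

(** * The sextic cancellation *)

Section Sextic.
Context {R : realType}.
Local Notation state := (bool -> int -> R[i]).
Local Notation idx := (int * int)%type.
Implicit Types (U V : state) (K : nat) (f : idx -> idx -> idx -> R).

(** Sextic forms in the products U.conj U, over frequencies of alternating sum
    zero. *)
Definition SX K U f : R := \sum_(p <- box K) \sum_(q <- box K) \sum_(r <- box K)
  if p.1 + q.1 + r.1 == p.2 + q.2 + r.2 then
    f p q r * complex.Im (rr U U p.1 p.2 * rr U U q.1 q.2 * rr U U r.1 r.2) else 0.

Lemma SXD K U f g : SX K U (fun p q r => f p q r + g p q r) = SX K U f + SX K U g.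
Proof.
rewrite /SX -big_split/=; apply: eq_bigr => p _; rewrite -big_split/=; apply: eq_bigr => q _.
rewrite -big_split/=; apply: eq_bigr => r _.
by case: ifP => _; rewrite ?addr0// mulrDl.
Qed.

Lemma SXZ K U c f : SX K U (fun p q r => c * f p q r) = c * SX K U f.
Proof.
rewrite /SX mulr_sumr; apply: eq_bigr => p _; rewrite mulr_sumr; apply: eq_bigr => q _.
rewrite mulr_sumr; apply: eq_bigr => r _.
by case: ifP => _; rewrite ?mulr0// mulrA.
Qed.

Lemma eq_SX K U f g : (forall p q r, p.1 + q.1 + r.1 = p.2 + q.2 + r.2 -> f p q r = g p q r) ->
  SX K U f = SX K U g.
Proof.
move=> h; apply: eq_bigr => p _; apply: eq_bigr => q _; apply: eq_bigr => r _.
by case: eqP => // /h ->.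
Qed.

Lemma SX_flip K U f : SX K U f = - SX K U (fun p q r => f (p.2, p.1) (q.2, q.1) (r.2, r.1)).
Proof.
have fl (F : idx -> R) : \sum_(p <- box K) F p = \sum_(p <- box K) F (p.2, p.1).
  by rewrite !big_box exchange_big.
rewrite /SX fl -sumrN; apply: eq_bigr => p _; rewrite fl -sumrN; apply: eq_bigr => q _.
rewrite fl -sumrN; apply: eq_bigr => r _; rewrite /= eq_sym; case: ifP => _; last by rewrite oppr0.
by rewrite -(rrJ U U p.1) -(rrJ U U q.1) -(rrJ U U r.1) -!rmorphM cImJ mulrN.
Qed.

Lemma SX_rot K U f : SX K U f = SX K U (fun p q r => f q r p).
Proof.
rewrite /SX [RHS]exchange_big; apply: eq_bigr => p _ /=.
rewrite [RHS]exchange_big; apply: eq_bigr => q _ /=; apply: eq_bigr => r _.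
rewrite (_ : r.1 + p.1 + q.1 = p.1 + q.1 + r.1); last by ring.
rewrite (_ : r.2 + p.2 + q.2 = p.2 + q.2 + r.2); last by ring.
by case: ifP => _ //; congr (_ * complex.Im _); ring.
Qed.

(** In physical space this is the integral of rho^2 rho_x, with
    rho = |u|^2 + |w|^2. The three rotations of the weight add up to
    r.1 - r.2 + p.1 - p.2 + q.1 - q.2 = 0. *)
Lemma SX_diff K U : SX K U (fun p q r => r.1%:~R - r.2%:~R) = 0.
Proof.
set x := SX K U _.
have e2 : SX K U (fun p q r => q.1%:~R - q.2%:~R) = x by rewrite SX_rot.
have e1 : SX K U (fun p q r => p.1%:~R - p.2%:~R) = x by rewrite SX_rot e2.
have : 3 * x = SX K U (fun _ _ _ => 0 * 0).
  transitivity (SX K U (fun p q r => p.1%:~R - p.2%:~R) + SX K U (fun p q r => q.1%:~R - q.2%:~R) + x).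
    by rewrite e1 e2; ring.
  rewrite -!SXD; apply: eq_SX => p q r h; have := congr1 (fun z : int => z%:~R : R) h.
  rewrite !intrD mul0r => h'.
  rewrite (_ : r.1%:~R = p.2%:~R + q.2%:~R + r.2%:~R - p.1%:~R - q.1%:~R); first by ring.
  by rewrite -h'; ring.
by rewrite SXZ mul0r => h; lra.
Qed.

Variables (alpha beta : R) (N : nat).
Local Notation ka0 := (ka0 alpha beta).
Local Notation symb := (symb alpha beta).

(** Exchanging entries and conjugates turns r.1 into r.2, so only the
    difference r.1 - r.2 counts. *)
Lemma SX_symb U : SX N U (fun p q r => alpha - beta * r.1%:~R) = 0.
Proof.
set x := SX N U _.
have e : x = - SX N U (fun p q r => alpha - beta * r.2%:~R) by rewrite /x SX_flip.
have : 2 * x = - beta * SX N U (fun p q r => r.1%:~R - r.2%:~R).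
  transitivity (x + -1 * SX N U (fun p q r => alpha - beta * r.2%:~R)); first by rewrite mulN1r -e; ring.
  by rewrite /x -!SXZ -SXD; apply: eq_SX => p q r _; ring.
by rewrite SX_diff mulr0 => h; lra.
Qed.

Definition ka1 (n n1 n2 : int) : R[i] := 1.

(** The coefficients of rho u. *)
Definition rhou U j n : R[i] := cub ka1 U U U j (box N) n.

Definition pairT U n : R :=
  complex.Re (cub ka0 U U U false (box N) n * conjc (rhou U false n) +
              cub ka0 U U U true (box N) n * conjc (rhou U true n)).

Lemma rr_supp U m n : supp N U -> m \notin zbox N -> rr U U m n = 0.
Proof. by move=> hU; rewrite mem_zbox -ltnNge /rr => h; rewrite (hU _ _ h) (hU _ _ h) !mul0r addr0. Qed.

Lemma rr_suppr U m n : supp N U -> n \notin zbox N -> rr U U m n = 0.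
Proof. by move=> hU h; rewrite -(rrJ U U n) rr_supp// rmorph0. Qed.

(** The cutoff at 3N is inactive on a product of three factors supported in
    [-N, N], so all frequencies of rho u enter and [SX_symb] applies. *)
Lemma pairT_sum U : supp N U -> \sum_(n <- zbox (3 * N)) pairT U n = 0.
Proof.
move=> hU; transitivity (- SX N U (fun p q r => alpha - beta * r.1%:~R)); last first.
  by rewrite SX_symb oppr0.
have fl (F : idx -> R) : \sum_(p <- box N) F p = \sum_(p <- box N) F (p.2, p.1).
  by rewrite !big_box exchange_big.
pose G p q n m := complex.Re (symb n * (rr U U p.1 p.2 * rr U U q.1 q.2 * rr U U n m)).
have stepn n : pairT U n = \sum_(p <- box N) \sum_(q <- box N)
    G p q (n - p.1 + p.2) (n - q.2 + q.1).
  transitivity (\sum_(p <- box N) \sum_(q <- box N) G p (q.2, q.1) (n - p.1 + p.2) (n - q.1 + q.2)).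
    rewrite /pairT /rhou !cubE !rmorph_sum/= !mulr_suml -big_split/= cRe_sum.
    apply: eq_bigr => p _; rewrite !mulr_sumr -big_split/= cRe_sum; apply: eq_bigr => q _.
    rewrite /G /= -(rrJ U U q.1); congr complex.Re; rewrite /ka1 !rmorphM rmorph1 mul1r /ka0.
    by rewrite /rr /=; ring.
  by apply: eq_bigr => p _; rewrite fl; apply: eq_bigr => q _ /=.
under eq_bigr do rewrite stepn.
rewrite exchange_big /SX -sumrN big_seq [RHS]big_seq; apply: eq_bigr => p pN.
rewrite exchange_big -sumrN big_seq [RHS]big_seq; apply: eq_bigr => q qN /=.
have [p1 p2 q1 q2] : [/\ (`|p.1| <= N)%N, (`|p.2| <= N)%N, (`|q.1| <= N)%N & (`|q.2| <= N)%N].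
  by move: pN qN; rewrite !mem_box => /andP[? ?] /andP[? ?].
pose m0 m := m + p.1 - p.2 - q.2 + q.1.
have G0 m n : m \notin zbox N -> G p q m n = 0.
  by move=> h; rewrite /G (rr_supp n hU h) !mulr0.
have G0' m n : n \notin zbox N -> G p q m n = 0.
  by move=> h; rewrite /G (rr_suppr m hU h) !mulr0.
transitivity (\sum_(m <- zbox N) G p q m (m0 m)).
  rewrite (eq_bigr (fun n => (fun m => G p q m (m0 m)) (n - p.1 + p.2))); last first.
    by move=> n _ /=; congr (G _ _ _ _); rewrite /m0; ring.
  rewrite -(big_map (fun n => n - p.1 + p.2) xpredT (fun m => G p q m (m0 m))).
  apply/esym/big_uniq_widen.
  - exact: uniq_zbox.
  - by rewrite map_inj_uniq ?uniq_zbox// => n n' /addIr/addIr.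
  - move=> m; rewrite mem_zbox => mN; apply/mapP; exists (m + p.1 - p.2); last by ring.
    by rewrite mem_zbox; lia.
  - by move=> m; exact: G0.
rewrite big_box -sumrN; apply: eq_bigr => m _.
rewrite -sumrN (eq_bigr (fun n => if n == m0 m then G p q m n else 0)); last first.
  move=> n _ /=; rewrite (_ : (_ == _) = (n == m0 m)); last first.
    rewrite /m0; apply/eqP/eqP => [h|->]; last by ring.
    by apply: (addrI (p.2 + q.2)); rewrite -h; ring.
  case: ifP => _; last by rewrite oppr0.
  by rewrite /G cReM /= mul0r sub0r.
by rewrite big_pick ?uniq_zbox//; case: ifP => // /negbT /G0' ->.
Qed.

Lemma QP1E U : supp N U -> QP N (fun=> 1) (galN alpha beta N U) U = \sum_(n <- zbox N) pairT U n.
Proof.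
move=> hU; rewrite /QP big_box big_seq [RHS]big_seq; apply: eq_bigr => n nN.
pose g := galN alpha beta N U.
transitivity (\sum_(q <- box N) complex.Re (rr g U n (n + q.1 - q.2) * rr U U q.1 q.2)).
  rewrite exchange_big/=; apply: eq_bigr => q _.
  rewrite (eq_bigr (fun m => if m == n + q.1 - q.2 then
    complex.Re (rr g U n m * rr U U q.1 q.2) else 0)); last first.
    by move=> m _; rewrite mul1r (_ : (_ == _) = (m == n + q.1 - q.2))//; apply/eqP/eqP; lia.
  rewrite big_pick ?uniq_zbox// mem_zbox; case: leqP => // h.
  by rewrite /rr (hU _ _ h) (hU _ _ h) !conjc0 !mulr0 addr0 mul0r.
have fl (F : idx -> R) : \sum_(p <- box N) F p = \sum_(p <- box N) F (p.2, p.1).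
  by rewrite !big_box exchange_big.
rewrite fl /pairT /rhou !(cubE ka1) !rmorph_sum/= !mulr_sumr -big_split/= cRe_sum.
apply: eq_bigr => q _; congr complex.Re.
rewrite mem_zbox in nN; rewrite /g /galN {1}/rr nN /ka1 /= [n + _ - _]addrAC !mul1r !cJM.
by rewrite rrJ; ring.
Qed.

(** The kernel of the part of rho u beyond the frequency N, which is small on
    bounded sets of H^1. *)
Definition ka1cut (n n1 n2 : int) : R[i] := if (N < `|n|)%N then 1 else 0.

Definition eT : R := Num.sqrt (120 / (N %/ 3).+1%:R).

Lemma eT_ge0 : 0 <= eT. Proof. exact: sqrtr_ge0. Qed.

Lemma ka1cut_bsum n : bsum (fun p : idx => w1 n * sqmod (ka1cut n p.1 p.2) /
    (w p.1 * w p.2 * w (n - p.1 + p.2))) (eT ^+ 2).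
Proof.
set L := (N %/ 3)%N; have L0 : (0 : R) < L.+1%:R by rewrite ltr0n.
rewrite /eT sqr_sqrtr; last by rewrite divr_ge0.
have cL : (0 : R) <= 4 * (2 / L.+1%:R) by rewrite mulr_ge0// divr_ge0.
have h := bsumD (bsumZ cL (@bsum_pair R (fun p => p) (fun _ _ => id)))
  (bsumZ (ler0n R 4) (@bsum_box_tail R L)).
apply: bsumW (bsum_le _ h).
  rewrite le_eqVlt; apply/orP; left; apply/eqP; field.
  by rewrite -/L addrC natr1 gt_eqF.
move=> -[n1 n2] /=; rewrite /w1 mul1r /ka1cut.
have sq0 := sqr_ge0 (@iJ R n1 * iJ n2).
have i12 := @iw2_le R n1 n2.
case: ifP => hP; last first.
  rewrite sqmod0 mul0r; apply: addr_ge0; first exact: mulr_ge0.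
  by case: ifP => _; rewrite ?mulr0//; exact: mulr_ge0.
have -> : sqmod (1 : R[i]) = 1 by rewrite /sqmod/= expr1n expr0n addr0.
rewrite mul1r invfM.
have i3 : 0 <= (w (n - n1 + n2) : R)^-1 by rewrite invr_ge0 w_ge0.
have i31 : (w (n - n1 + n2) : R)^-1 <= 1 by rewrite invf_le1 ?w_gt0 ?w_ge1.
case: ifP => [nb|_]; last first.
  apply: (@le_trans _ _ (4 * (iJ n1 * iJ n2) ^+ 2 * 1)).
    by apply: ler_pM => //; rewrite invr_ge0 mulr_ge0 ?w_ge0.
  by rewrite mulr1 lerDr mulr_ge0.
rewrite mulr0 addr0 mulrAC; apply: ler_pM => //; first by rewrite invr_ge0 mulr_ge0 ?w_ge0.
apply: le_trans (iw_le _) _; apply: ler_wpM2l => //.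
have nL : (L < absz (n - n1 + n2)%R)%N.
  by move: hP nb; rewrite mem_box/= => h3 /andP[h1 h2]; rewrite /L in h1 h2 *; lia.
apply: (@le_trans _ _ (iJ (n - n1 + n2))); first by rewrite expr2 ler_piMl ?iJ_ge0 ?iJ_le1.
by rewrite /iJ lef_pV2 ?posrE ?J_gt0// JE -(natrD _ 1) add1n ler_nat leqW.
Qed.

(** The sum over |n| <= N is opposite to the sum over N < |n| <= 3N by
    [pairT_sum], where the coefficients of rho u are small for H^1 states. *)
Lemma QP1_small U B : supp N U -> hb U B ->
  `|QP N (fun=> 1) (galN alpha beta N U) U| <= 8 * S0 alpha beta * eT * B ^+ 6.
Proof.
move=> hU hB; rewrite QP1E//.
pose r := [seq n <- zbox (3 * N) | (N < `|n|)%N].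
have sp : \sum_(n <- zbox N) pairT U n = - \sum_(n <- r) pairT U n.
  have e : \sum_(n <- zbox (3 * N) | ~~ (N < `|n|)%N) pairT U n = \sum_(n <- zbox N) pairT U n.
    rewrite -big_filter; apply: perm_big; apply: uniq_perm; rewrite ?filter_uniq ?uniq_zbox// => n.
    by rewrite mem_filter !mem_zbox -leqNgt; case: leqP => //= h; rewrite (leq_trans h)//; lia.
  have := pairT_sum hU; rewrite (bigID (fun n : int => (N < `|n|)%N)) /= e -big_filter -/r.
  by rewrite addrC => /eqP; rewrite addr_eq0 => /eqP.
have ur : uniq r by rewrite filter_uniq// uniq_zbox.
have B0 := hb_ge0 hB.
rewrite sp normrN.
pose D j n := cub ka0 U U U j (box N) n.
pose T j n := cub ka1cut U U U j (box N) n.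
have -> : \sum_(n <- r) pairT U n =
    complex.Re (\sum_(n <- r) conjc (T false n) * D false n) +
    complex.Re (\sum_(n <- r) conjc (T true n) * D true n).
  rewrite -cReD -big_split/= cRe_sum big_seq [RHS]big_seq; apply: eq_bigr => n.
  rewrite mem_filter => /andP[nN _]; rewrite /pairT /rhou; congr complex.Re.
  have e j : cub ka1 U U U j (box N) n = T j n.
    by rewrite /T !cubE; apply: eq_bigr => p _; rewrite /ka1cut nN.
  by rewrite !e /D; ring.
have wg0 n : (0 : R) < w n by exact: w_gt0.
have hD j : l2b (fun n => (w1 n)^-1) (D j) (2 * (S0 alpha beta * B * B * B)).
  apply: (l2b_le (om' := w1) (y := D j)); first by move=> n; rewrite /w1 invr1.
  exact: (l2b_cub (uniq_box N) (@w1_ge0 R) wg0 wg0 wg0 (S0_ge0 _ _) (ka0_bsum alpha beta) hB hB (hB j)).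
have hT j : l2b w1 (T j) (2 * (eT * B * B * B)).
  exact: (l2b_cub (uniq_box N) (@w1_ge0 R) wg0 wg0 wg0 eT_ge0 ka1cut_bsum hB hB (hB j)).
have w1p n : (0 : R) < w1 n by rewrite /w1.
have P j := l2b_pairing ur w1p (hT j) (hD j).
apply: le_trans (ler_normD _ _) _; apply: le_trans (lerD (P false) (P true)) _.
by rewrite le_eqVlt; apply/orP; left; apply/eqP; ring.
Qed.

End Sextic.

(** * The a priori bound in H^1 *)

Section Weights.
Context {R : realType} (alpha beta a b : R).
Hypothesis b0 : b != 0.
Local Notation DD := (DD a b).
Local Notation mu := (mu alpha beta a b).
Local Notation resw := (resw alpha beta a b).

(** mu is a Moebius function of s with limit - beta/(6b) at infinity. *)
Lemma mu_decay : exists2 C : R, 0 <= C &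
  forall s, `|mu s - (- beta / (6 * b))| <= C * iJ s.
Proof.
have [c c0 hc] := DD_lower a b0; have [Z Z1 hZ] := DD_zero a b0.
pose k := `|alpha - a * beta / (3 * b)|; pose l := `|- beta / (6 * b)|.
have k0 : 0 <= k by exact: normr_ge0.
have l0 : 0 <= l by exact: normr_ge0.
have Z0 : 0 <= Z by exact: le_trans Z1.
exists (k / c + l * Z); first by posi.
move=> s; rewrite /mu [leRHS]mulrDl; have iJ0 := @iJ_ge0 R s.
case: (eqVneq (DD s) 0) => [D0|D0].
  rewrite sub0r normrN -/l -[leLHS]add0r; apply: lerD.
    by posi.
  rewrite -mulrA ler_peMr// -(iJK s) mulrC [leRHS]mulrC ler_wpM2l//; exact: hZ.
rewrite -[leLHS]addr0; apply: lerD; last by posi.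
rewrite (_ : _ - _ = (alpha - a * beta / (3 * b)) / DD s); last first.
  by move: D0; rewrite /DD => D0; field; rewrite D0 b0.
rewrite normrM -/k -mulrA ler_wpM2l// normfV /iJ -invfM lef_pV2 ?posrE.
- exact: hc.
- by rewrite normr_gt0.
- by rewrite mulr_gt0 ?J_gt0.
Qed.

Lemma resw_bound : exists2 C : R, 0 <= C & forall s, `|resw s| <= C * iJ s ^+ 2.
Proof.
have [Z Z1 hZ] := DD_zero a b0; have Z0 : 0 <= Z by exact: le_trans Z1.
pose k := `|alpha| + `|beta|; have k0 : 0 <= k by rewrite addr_ge0.
exists (k * Z ^+ 3); first by rewrite mulr_ge0// exprn_ge0.
move=> s; rewrite /resw; case: (eqVneq (DD s) 0) => [D0|_]; last first.
  by rewrite normr0; posi; exact: iJ_ge0.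
have h := hZ s D0; have J1 := @J_ge1 R s; have iJ0 := @iJ_ge0 R s.
have e : 1 <= Z * iJ s by rewrite -(iJK s) ler_wpM2r.
apply: (@le_trans _ _ (k * Z)).
  apply: le_trans (ler_normB _ _) _; rewrite /k mulrDl; apply: lerD; first by rewrite ler_peMr.
  rewrite -mulrA normrM ler_wpM2l// normrM normfV (ger0_norm (ler0n R 2)).
  apply: le_trans h; rewrite /J; have := normr_ge0 (s%:~R : R); lra.
rewrite (_ : k * Z ^+ 3 * _ = k * Z * (Z * iJ s) ^+ 2); last by ring.
by rewrite ler_peMr ?mulr_ge0// exprn_ege1.
Qed.

End Weights.

Section StaticBounds.
Context {R : realType}.
Variables (alpha beta : R) (N : nat) (U : bool -> int -> R[i]) (m : R).
Hypotheses (hU : supp N U) (m1 : 1 <= m) (hm : 2 * massK N U <= m).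
Local Notation P := (1 + HK N U).
Local Notation amp := (@amp R).

Let P1 : 1 <= P. Proof. by rewrite lerDl HK_ge0. Qed.
Let P0 : 0 <= P. Proof. exact: le_trans P1. Qed.
Let m0 : 0 <= m. Proof. exact: le_trans m1. Qed.
Let sP1 : 1 <= Num.sqrt P. Proof. by have := P1; rewrite -(ler_sqrt _ P0) sqrtr1. Qed.

Lemma amp_sqr (V : bool -> int -> R[i]) n :
  amp V n ^+ 2 <= 2 * (sqmod (V false n) + sqmod (V true n)).
Proof.
rewrite /amp !sqmod_normc; set x := normc _; set y := normc _.
by have := sqr_ge0 (x - y); nra.
Qed.

Lemma amp_out n : n \notin zbox N -> amp U n = 0.
Proof. by rewrite mem_zbox -ltnNge => h; rewrite /amp (hU _ h) (hU _ h) normc0 addr0. Qed.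

Lemma bsum_amp (y : int -> R) B : (forall n, 0 <= y n) ->
  (\sum_(n <- zbox N) y n * (2 * (sqmod (U false n) + sqmod (U true n))) <= B) ->
  bsum (fun n => y n * amp U n ^+ 2) B.
Proof.
move=> y0 hB; pose z n := y n * (2 * (sqmod (U false n) + sqmod (U true n))).
have z0 n : 0 <= z n by rewrite mulr_ge0// mulr_ge0// addr_ge0 ?sqmod_ge0.
apply: bsumW hB _; apply: bsum_le (bsum_finite (uniq_zbox N) z0) => n.
case: ifP => [_|/negbT h]; first by rewrite ler_wpM2l// amp_sqr.
by rewrite amp_out// expr0n mulr0.
Qed.

Lemma amp_mass : bsum (fun n => amp U n ^+ 2) (Num.sqrt m ^+ 2).
Proof.
rewrite sqr_sqrtr//; have := @bsum_amp (fun=> 1) m (fun=> ler01).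
rewrite (eq_bigr (fun n => 2 * (sqmod (U false n) + sqmod (U true n)))); last by move=> n _; rewrite mul1r.
by rewrite -big_distrr => /(_ hm); apply: bsum_le => n; rewrite mul1r.
Qed.

Lemma amp_HK : bsum (fun n => n%:~R ^+ 2 * amp U n ^+ 2) (2 * P).
Proof.
apply: bsum_amp => [n|]; first exact: sqr_ge0.
rewrite (eq_bigr (fun n => 2 * (n%:~R ^+ 2 * (sqmod (U false n) + sqmod (U true n))))); last first.
  by move=> n _; ring.
by rewrite -big_distrr ler_wpM2l// lerDr.
Qed.

Lemma amp_HKr : bsum (fun n => (`|n%:~R| * amp U n) ^+ 2) (Num.sqrt (2 * P) ^+ 2).
Proof.
rewrite sqr_sqrtr ?mulr_ge0//; apply: bsum_le amp_HK => n.
by rewrite exprMn real_normK ?num_real.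
Qed.

(** [sum_interp] at the scale A of the order of the square root of P. *)
Lemma sum_amp_sqr : (\sum_(n <- zbox N) amp U n) ^+ 2 <= 40 * m * Num.sqrt P.
Proof.
have := amp_mass; rewrite (sqr_sqrtr m0) => h.
have /andP[L1 L2] := truncn_itv (sqrtr_ge0 P); set A := Num.truncn _ in L1 L2.
apply: le_trans (sum_interp N A (amp_ge0 U) h amp_HK) _.
have A0 : (0 : R) < A.+1%:R by rewrite ltr0n.
have q : 2 * P / A.+1%:R <= 2 * Num.sqrt P.
  rewrite -mulrA ler_wpM2l// ler_pdivrMr// -{1}(sqr_sqrtr P0) expr2 ler_wpM2l ?sqrtr_ge0//.
  exact: ltW.
have q' : A.+1%:R <= Num.sqrt P + 1 by rewrite -natr1 lerD2r.
have sP := sP1; move: q q' sP; set s := Num.sqrt P; set x := 2 * P / _ => q q' sP.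
have : A.+1%:R * m <= (s + 1) * m by rewrite ler_wpM2r.
have : 1 * 1 <= s * m by rewrite ler_pM.
have : m <= s * m by rewrite ler_peMl.
have : s <= s * m by rewrite ler_peMr// (le_trans ler01).
by move=> *; lra.
Qed.

Lemma bsum_ampl : bsum (amp U) (\sum_(n <- zbox N) amp U n).
Proof.
apply: bsum_le (bsum_finite (uniq_zbox N) (amp_ge0 U)) => n.
by case: ifP => [//|/negbT h]; rewrite amp_out.
Qed.

Lemma zconv_amp s : zconv N (amp U) (amp U) s <= m.
Proof.
rewrite -[leRHS](sqr_sqrtr m0) expr2.
by apply: zconv_CS (amp_mass) (amp_mass); rewrite sqrtr_ge0.
Qed.

Lemma bsum_zconv_amp : bsum (zconv N (amp U) (amp U)) (40 * m * Num.sqrt P).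
Proof.
apply: bsumW sum_amp_sqr _; rewrite expr2.
exact: bsum_zconv (amp_ge0 U) bsum_ampl.
Qed.

Definition Cgal : R := 40 * m * Num.sqrt (3 * cm alpha beta * m).

Lemma Cgal_ge0 : 0 <= Cgal. Proof. by rewrite mulr_ge0 ?sqrtr_ge0// mulr_ge0. Qed.

Lemma l2b_galN j : l2b w1 (galN alpha beta N U j) (Cgal * P).
Proof.
pose y n := symb alpha beta n * U j n.
have cm0 := cm_ge0 alpha beta.
have hy : l2b w1 y (Num.sqrt (3 * cm alpha beta * m * P)).
  split; rewrite ?sqrtr_ge0// sqr_sqrtr; last by posi.
  have h := bsumZ cm0 (bsumD amp_mass amp_HK); rewrite (sqr_sqrtr m0) in h.
  apply: bsumW (bsum_le _ h); last first.
    move=> n; rewrite /w1 mul1r /y sqmodM.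
    have h1 := sqmod_symb alpha beta n; have h2 : sqmod (U j n) <= amp U n ^+ 2.
      rewrite /amp !sqmod_normc ler_sqr_nneg ?normc_ge0//.
      by case: (j); rewrite ?lerDl ?lerDr normc_ge0.
    apply: le_trans (ler_pM (sqmod_ge0 _) (sqmod_ge0 _) h1 h2) _.
    by rewrite /w -mulrA mulrDl mul1r.
  have : m * 1 <= m * P by rewrite ler_wpM2l.
  have : 1 * P <= m * P by rewrite ler_wpM2r.
  move=> h1 h2; rewrite (_ : 3 * _ * m * P = cm alpha beta * (3 * (m * P))); last by ring.
  by rewrite ler_wpM2l//; lra.
pose x (p : int * int) n := rr U U p.1 p.2 * y (n - p.1 + p.2).
have hx p : l2b w1 (x p) (amp U p.1 * amp U p.2 * Num.sqrt (3 * cm alpha beta * m * P)).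
  apply: l2bM => //; rewrite ?mulr_ge0 ?amp_ge0//; first by move=> n; exact: normc_rr.
  split; first by case: hy.
  have [_] := hy; rewrite /w1; apply: (@bsum_inj _ _ _ (fun n => n - p.1 + p.2)).
  by move=> n n' /addIr/addIr.
have := l2b_sum (box N) (@w1_ge0 R) hx.
have -> : \sum_(p <- box N) amp U p.1 * amp U p.2 * Num.sqrt (3 * cm alpha beta * m * P) =
    (\sum_(n <- zbox N) amp U n) ^+ 2 * Num.sqrt (3 * cm alpha beta * m * P).
  rewrite -mulr_suml; congr (_ * _); rewrite big_box expr2 mulr_suml; apply: eq_bigr => n _.
  by rewrite mulr_sumr.
move=> h; apply: l2bW (l2b_le _ h).
  apply: le_trans (ler_wpM2r (sqrtr_ge0 _) sum_amp_sqr) _.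
  rewrite /Cgal (@sqrtrM _ (3 * cm alpha beta * m)); last by posi.
  rewrite -[in leRHS](sqr_sqrtr P0) le_eqVlt; apply/orP; left; apply/eqP; ring.
move=> n; rewrite /galN; case: ifP => _; last by rewrite sqmod0 mulr0 mulr_ge0 ?sqmod_ge0.
rewrite cubE /x /y le_eqVlt; apply/orP; left; apply/eqP; congr (_ * sqmod _).
by apply: eq_bigr => p _; rewrite /ka0; ring.
Qed.

Lemma amp_galN : bsum (fun n => amp (galN alpha beta N U) n ^+ 2) ((2 * Cgal * P) ^+ 2).
Proof.
have [_ h1] := l2b_galN false; have [_ h2] := l2b_galN true.
apply: bsumW (bsum_le _ (bsumZ (ler0n R 2) (bsumD h1 h2))).
  by rewrite le_eqVlt; apply/orP; left; apply/eqP; ring.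
by move=> n; rewrite /w1 !mul1r; exact: amp_sqr.
Qed.

(** One entry is the cubic term, of size P in L^2, one is measured by the
    mass, and the two others form a convolution that is bounded and summable:
    [bsum_log] applies to it. *)
Lemma QP_galN_le (nu : int -> R) C : 0 <= C -> (forall s, `|nu s| <= C * iJ s) ->
  `|QP N nu (galN alpha beta N U) U| <= 2 * Cgal * P * Num.sqrt m *
     (C * (m * (1 + 2 * ln (1 + 40 * m * Num.sqrt P)) + 1)).
Proof.
move=> C0 hnu; apply: le_trans (QP_le _ _ _ _) _; apply: BQ_le => //.
- exact: amp_ge0.
- exact: amp_ge0.
- exact: amp_ge0.
- exact: amp_ge0.
- by posi; exact: Cgal_ge0.
- exact: amp_galN.
- exact: amp_mass.
have := bsumZ C0 (bsum_log m0 (fun s => zconv_ge0 N s (amp_ge0 U) (amp_ge0 U)) zconv_amp bsum_zconv_amp).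
apply: bsum_le => s; rewrite mulrA ler_wpM2r ?zconv_ge0//; exact: amp_ge0.
Qed.

Lemma QP_le_sqrt (nu : int -> R) C : 0 <= C -> (forall s, `|nu s| <= C) ->
  `|QP N nu U U| <= 40 * m ^+ 2 * C * Num.sqrt P.
Proof.
move=> C0 hnu; apply: le_trans (QP_le _ _ _ _) _.
rewrite (_ : 40 * m ^+ 2 * C * Num.sqrt P = Num.sqrt m * Num.sqrt m * (C * (40 * m * Num.sqrt P))).
  apply: BQ_le => //; try exact: amp_ge0; try exact: sqrtr_ge0; try exact: amp_mass.
  apply: bsum_le (bsumZ C0 bsum_zconv_amp) => s; rewrite ler_wpM2r ?zconv_ge0//; exact: amp_ge0.
by rewrite -expr2 sqr_sqrtr//; ring.
Qed.

Lemma QR_res_le (nu : int -> R) C : 0 <= C -> (forall s, `|nu s| <= C * iJ s ^+ 2) ->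
  `|QR N (YY U) (fun n1 n2 n3 n4 => (n1%:~R * n3%:~R - n2%:~R * n4%:~R) * nu (n1 + n3))| <=
  12 * C * m * P.
Proof.
move=> C0 hnu; pose z n := `|n%:~R| * amp U n; pose k s := `|nu s|.
have z0 n : 0 <= z n by rewrite mulr_ge0// amp_ge0.
apply: (@le_trans _ _ (BQ N k z (amp U) z (amp U) + BQ N k (amp U) z (amp U) z)).
  rewrite /BQ -big_split; apply: le_trans (ler_norm_sum _ _ _) _; apply: ler_sum => p _.
  rewrite -big_split; apply: le_trans (ler_norm_sum _ _ _) _; apply: ler_sum => q _ /=.
  case: ifP => _; last by rewrite normr0 addr0.
  rewrite -mulrDr !normrM -/(k _) mulrAC mulrC ler_wpM2l ?normr_ge0// mulrC.
  have hY : `|YY U p.1 p.2 q.1 q.2| <= amp U p.1 * amp U p.2 * (amp U q.1 * amp U q.2).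
    rewrite /YY normrN; apply: le_trans (normc_Im _) _; rewrite normcM.
    by rewrite ler_pM ?normc_ge0 ?normc_rr.
  rewrite mulrC; apply: le_trans (ler_pM _ _ (ler_normB _ _) hY) _; rewrite ?normr_ge0//.
  by rewrite !normrM /z le_eqVlt; apply/orP; left; apply/eqP; ring.
have S : bsum (fun s => k s * zconv N (amp U) (amp U) s) (C * m * 3).
  have := bsumZ (mulr_ge0 C0 m0) (@bsum_iJ R); apply: bsum_le => s.
  rewrite [leRHS]mulrAC; apply: ler_pM; [exact: normr_ge0| |exact: hnu|exact: zconv_amp].
  by apply: zconv_ge0; exact: amp_ge0.
have h : BQ N k z (amp U) z (amp U) <= Num.sqrt (2 * P) * Num.sqrt (2 * P) * (C * m * 3).
  apply: BQ_le S; rewrite ?sqrtr_ge0//; try exact: amp_ge0; try exact: amp_HKr.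
  by move=> s; exact: normr_ge0.
rewrite [X in _ + X]BQ_flip; apply: le_trans (lerD h h) _.
rewrite -!expr2 sqr_sqrtr ?mulr_ge0// le_eqVlt; apply/orP; left; apply/eqP; ring.
Qed.

End StaticBounds.


(** The correction is of the order of the square root of P = 1 + HK, hence is
    absorbed. For the growth, [mu] is split into its constant limit, which
    gives the term of [QP1_small], and a part decaying like 1/|s|, to which
    [QP_galN_le] applies; the resonant remainder is summable in s. *)
Lemma energy_bounds {R : realType} (alpha beta a b : R) (m : R) : b != 0 -> 1 <= m ->
  exists C0 C1 : R, [/\ 0 <= C0, 0 <= C1 &
  forall (N : nat) (U : bool -> int -> R[i]), supp N U -> 2 * massK N U <= m ->
    `|QP N (mu alpha beta a b) U U| <= (1 + HK N U) / 2 + C0 /\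
    `|QR N (YY U) (fun n1 n2 n3 n4 =>
       (n1%:~R * n3%:~R - n2%:~R * n4%:~R) * resw alpha beta a b (n1 + n3)) +
      4 * QP N (mu alpha beta a b) (galN alpha beta N U) U| <=
    C1 * ((1 + HK N U) * (1 + ln (1 + HK N U)) + `|QP N (fun=> 1) (galN alpha beta N U) U|)].
Proof.
move=> b0 m1; have m0 : 0 <= m by exact: le_trans m1.
have [Cn Cn0 hn] := mu_decay alpha beta a b0.
have [Cr Cr0 hr] := resw_bound alpha beta a b0.
set c := - beta / (6 * b) in hn.
pose D := 40 * m ^+ 2 * (Cn + `|c|).
have D0 : 0 <= D by rewrite !mulr_ge0 ?sqr_ge0 ?addr_ge0.
have l41 : 0 <= ln (41 * m) by apply: ln_ge0; lra.
pose K := m * (1 + 2 * ln (41 * m)) + 2 * m + 1.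
have K0 : 0 <= K by rewrite !addr_ge0// !mulr_ge0// addr_ge0// mulr_ge0.
pose G := Cgal alpha beta m; have G0 : 0 <= G by rewrite /G; apply: Cgal_ge0.
pose F := 8 * G * Num.sqrt m * Cn * K.
have F0 : 0 <= F by rewrite !mulr_ge0// sqrtr_ge0.
(* D s <= s^2 / 2 + D^2 absorbs the correction, s being the square root of P. *)
exists (D ^+ 2), (F + 12 * Cr * m + 4 * `|c|); split; first exact: sqr_ge0.
  by rewrite !addr_ge0// !mulr_ge0.
move=> N U hU hm; set P := 1 + HK N U.
have P1 : 1 <= P by rewrite lerDl HK_ge0.
have P0 : 0 <= P by exact: le_trans P1.
have lP : 0 <= ln P by exact: ln_ge0.
have muB s : `|mu alpha beta a b s| <= Cn + `|c|.
  rewrite -[mu _ _ _ _ s](subrK c); apply: le_trans (ler_normD _ _) _; rewrite lerD2r.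
  by apply: le_trans (hn s) _; rewrite ler_piMr// iJ_le1.
split.
  have hD := QP_le_sqrt hU m1 hm (addr_ge0 Cn0 (normr_ge0 c)) muB.
  apply: le_trans hD _; rewrite -/D -/P -[P in P / 2](sqr_sqrtr P0); set s := Num.sqrt P.
  by have := sqr_ge0 (s - D); have := sqr_ge0 D; have := sqr_ge0 s; nra.
have hs : forall s, mu alpha beta a b s = (mu alpha beta a b s - c) + c by move=> s; rewrite subrK.
rewrite (QP_split N (galN alpha beta N U) U hs) mulrDr addrA.
have h1 := QR_res_le hU m1 hm Cr0 hr.
have h2 := QP_galN_le alpha beta hU m1 hm Cn0 hn.
rewrite -/P -/G in h1 h2.
set q := QP N (fun=> 1) _ _; set y := QR _ _ _; set z := QP N _ _ _ in h2 *.
have hl : 1 + 2 * ln (1 + 40 * m * Num.sqrt P) <= 1 + 2 * (ln (41 * m) + ln P).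
  rewrite lerD2l ler_wpM2l// -lnM ?posrE//; last 2 first.
  - by rewrite mulr_gt0//; lra.
  - exact: lt_le_trans P1.
  have sP : Num.sqrt P <= P by rewrite -[leRHS](sqr_sqrtr P0) expr2 ler_peMl ?sqrtr_ge0// -sqrtr1 ler_sqrt.
  have mP : 1 * 1 <= m * P by rewrite ler_pM.
  rewrite ler_ln ?posrE.
  - have := ler_wpM2l m0 sP; lra.
  - have := mulr_ge0 m0 (sqrtr_ge0 P); lra.
  - lra.
have hz : `|4 * z| <= F * (P * (1 + ln P)).
  rewrite normrM ger0_norm//; apply: le_trans (ler_wpM2l _ h2) _ => //.
  have hk : m * (1 + 2 * ln (1 + 40 * m * Num.sqrt P)) + 1 <= K * (1 + ln P).
    have := ler_wpM2l m0 hl; have := mulr_ge0 m0 lP; have := mulr_ge0 (mulr_ge0 m0 l41) lP.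
    rewrite /K; nra.
  rewrite (_ : F * _ = 4 * (2 * G * P * Num.sqrt m * (Cn * (K * (1 + ln P))))); last first.
    by rewrite /F; ring.
  rewrite ler_wpM2l// ler_wpM2l ?ler_wpM2l// !mulr_ge0// sqrtr_ge0//.
have hq : `|4 * (c * q)| = 4 * `|c| * `|q| by rewrite !normrM ger0_norm// mulrA.
apply: le_trans (ler_normD _ _) _; apply: le_trans (lerD (ler_normD _ _) (lexx _)) _.
rewrite hq; have hP : P <= P * (1 + ln P) by rewrite ler_peMr// lerDl.
have := ler_wpM2l (mulr_ge0 (mulr_ge0 (ler0n R 12) Cr0) m0) hP.
have := mulr_ge0 (addr_ge0 F0 (mulr_ge0 (mulr_ge0 (ler0n R 12) Cr0) m0)) (normr_ge0 q).
have := mulr_ge0 (mulr_ge0 (ler0n R 4) (normr_ge0 c)) (mulr_ge0 P0 (addr_ge0 ler01 lP)).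
move: h1 hz; set A := 12 * Cr * m; set x := P * (1 + ln P); set c4 := 4 * `|c|; move: (`|q|) => qq.
rewrite !(mulrDl, mulrDr); lra.
Qed.

Section Bootstrap.
Context {R : realType}.

Lemma is_derive_lnc (F : R -> R) s d : is_derive s (1 : R) F d -> 0 < F s ->
  is_derive s (1 : R) (fun t => ln (F t)) (d / F s).
Proof.
move=> h F0; have := is_derive1_comp (is_derive1_ln F0) h.
by rewrite /GRing.scale/= mulrC.
Qed.

(** As long as F stays below F1, log(1 + F) is Lipschitz with constant C, so F
    stays below a level strictly smaller than F1, and by continuity the set of
    such times is open as well as closed. *)
Lemma bootstrap (F dF : R -> R) (C F1 T : R) : 0 <= C -> 0 <= T ->
  (forall s, is_derive s (1 : R) F (dF s)) -> (forall s, 0 <= F s) ->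
  (forall s, `|s| <= T -> F s <= F1 -> `|dF s| <= C * (1 + F s)) ->
  (1 + F 0) * expR (C * T) < 1 + F1 -> forall t, `|t| <= T -> F t <= F1.
Proof.
move=> C0 T0 hd F0 hC hF1.
have Fc s e : 0 < e -> exists2 d : R, 0 < d & forall r, `|r - s| <= d -> `|F r - F s| < e.
  move=> e0; have : {for s, continuous F}.
    by apply: differentiable_continuous; apply/derivable1_diffP; exact: (@ex_derive _ _ _ _ _ _ _ (hd s)).
  move=> /cvgrPdist_lt/(_ _ e0)/nbhs_ballP[d /= d0 hd']; exists (d / 2); first by rewrite divr_gt0.
  move=> r rs; rewrite distrC; apply: hd'; rewrite /ball/= distrC.
  by apply: le_lt_trans rs _; rewrite ltr_pdivrMr// ltr_pMr// ltr1n.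
set F2 := (1 + F 0) * expR (C * T) - 1; have F21 : F2 < F1 by rewrite /F2; lra.
have F02 : F 0 <= F2.
  rewrite /F2 lerBrDl [_ + _]addrC addrC ler_peMr ?addr_ge0//.
  by rewrite -expR0 ler_expR mulr_ge0.
have F1p s : 0 < 1 + F s by rewrite ltr_pwDl.
have inner rho : rho <= T -> (forall s, `|s| < rho -> F s <= F1) -> forall s, `|s| < rho -> F s <= F2.
  move=> rT hr s sr; pose G x := ln (1 + F x); pose dG x := dF x / (1 + F x).
  have hG x : is_derive x (1 : R) G (dG x).
    apply: is_derive_lnc => //; apply: is_derive_eq (is_deriveD (is_derive_cst _ _ _) (hd x)) _.
    by rewrite add0r.
  have : `|G s - G 0| <= `|s - 0| * C.
    apply: (@mean_value_le _ G dG) => x.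
    rewrite !subr0 => xs; have xr : `|x| < rho by exact: le_lt_trans sr.
    rewrite /dG normrM normfV (gtr0_norm (F1p x)) ler_pdivrMr//.
    by apply: hC (hr _ xr); apply: le_trans rT; exact: ltW.
  rewrite subr0 => h; have h1 : G s <= G 0 + C * T.
    rewrite -lerBlDl; apply: le_trans (ler_norm _) _; apply: le_trans h _.
    by rewrite mulrC ler_wpM2l// (le_trans (ltW sr)).
  rewrite -(lerD2l 1) /F2 [leRHS]addrC subrK -[leLHS](lnK (F1p s)) -[X in X * _](lnK (F1p 0)) -expRD.
  by rewrite ler_expR.
have step rho : 0 <= rho -> rho <= T -> (forall s, `|s| < rho -> F s <= F1) ->
    exists2 d : R, 0 < d & forall s, `|s| <= rho + d -> F s <= F1.
  move=> r0 rT hr; have hi := inner rho rT hr.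
  have e0 : 0 < (F1 - F2) / 2 by rewrite divr_gt0// subr_gt0.
  have near (s0 : R) : `|s0| = rho -> exists2 d : R, 0 < d & forall s, `|s - s0| <= d -> F s <= F1.
    move=> s0r; have [d d0 hd'] := Fc s0 _ e0; exists d => // s /hd' hs.
    suff h : F s0 <= F2 + (F1 - F2) / 2.
      have := ler_norm (F s - F s0); move: hs h; lra.
    have [r00|rp] := eqVneq rho 0.
      have -> : s0 = 0 by apply/eqP; rewrite -normr_eq0 s0r r00.
      by move: F02 e0; lra.
    pose k := Num.min 2^-1 (d / rho); have rp' : 0 < rho by rewrite lt_def rp r0.
    have k0 : 0 < k by rewrite /k lt_min invr_gt0 divr_gt0// ltr0n.
    have k1 : k <= 2^-1 by rewrite /k ge_min lexx.
    have kd : k * rho <= d by rewrite -ler_pdivlMr// /k ge_min lexx orbT.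
    have hs1 : `|(1 - k) * s0| < rho.
      rewrite normrM s0r ger0_norm; last lra.
      by rewrite gtr_pMl//; lra.
    have hs2 : `|(1 - k) * s0 - s0| <= d.
      by rewrite mulrBl mul1r addrAC subrr sub0r normrN normrM s0r gtr0_norm.
    have := hi _ hs1; have := hd' _ hs2; have := ler_norm (F s0 - F ((1 - k) * s0)).
    by rewrite distrC; lra.
  have [d1 d10 h1] := near rho (ger0_norm r0).
  have [d2 d20 h2] := near (- rho) (etrans (normrN _) (ger0_norm r0)).
  exists (Num.min d1 d2); first by rewrite lt_min d10.
  move=> s hs; have [sr|sr] := ltP `|s| rho; first exact: hr.
  have [s0|/ltW s0] := leP 0 s.
    apply: h1; rewrite ger0_norm// in hs sr; rewrite ger0_norm ?subr_ge0//.
    by rewrite lerBlDl; apply: le_trans hs _; rewrite lerD2l ge_min lexx.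
  apply: h2; rewrite ler0_norm// in hs sr; rewrite opprK ler0_norm; last by rewrite -lerBrDr; lra.
  have : Num.min d1 d2 <= d2 by rewrite ge_min lexx orbT.
  by lra.
move=> t tT; rewrite leNgt; apply/negP => tF.
pose A := [set rho : R | 0 <= rho /\ forall s, `|s| <= rho -> F s <= F1].
have A0 : A 0.
  split=> // s; rewrite normr_le0 => /eqP ->; exact: le_trans F02 (ltW F21).
have Aub : ubound A `|t|.
  move=> rho [r0 hr]; rewrite leNgt; apply/negP => /ltW/hr; lra.
have hs : has_sup A by split; [exists 0|exists `|t|].
have s0 : 0 <= sup A by apply: (ub_le_sup hs.2) A0.
have st : sup A <= `|t| by apply: ge_sup => //; exists 0.
have [s sr|d d0 hd'] := step (sup A) s0 (le_trans st tT).
  have e0 : 0 < sup A - `|s| by rewrite subr_gt0.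
  have [rho [r0 hr] h] := sup_adherent e0 hs.
  by apply: hr; apply: ltW; move: h; lra.
have : A (sup A + d) by split=> //; rewrite addr_ge0// ltW.
move=> /(ub_le_sup (hs.2)); lra.
Qed.

End Bootstrap.

Section Apriori.
Context {R : realType}.
Variables (alpha beta a b : R).
Hypothesis b0 : b != 0.
Local Notation state := (bool -> int -> R[i]).

Lemma eT_cvg0 (c : R) : c * eT N @[N --> \oo] --> (0 : R).
Proof.
rewrite -(mulr0 c); apply: cvgMr.
apply: (@cvg_comp _ _ _ (fun N : nat => (N %/ 3)%N)
  (fun L : nat => Num.sqrt (120 / L.+1%:R)) \oo \oo); last exact: sqrt_div_cvg0.
move=> P [K _ hK]; exists (3 * K)%N => // N /= h; apply: hK => /=.
by rewrite leq_divRL// mulnC.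
Qed.

Lemma hb_supp N (U : state) m : supp N U -> 0 <= m -> massK N U + HK N U <= m -> hb U (Num.sqrt m).
Proof.
move=> hU m0 hm k; split; first exact: sqrtr_ge0.
rewrite sqr_sqrtr//; pose z n := w n * (sqmod (U false n) + sqmod (U true n)).
have z0 n : 0 <= z n by apply: mulr_ge0; [exact: w_ge0|rewrite addr_ge0 ?sqmod_ge0].
have e : \sum_(n <- zbox N) z n <= m.
  apply: le_trans hm; rewrite /massK /HK -big_split/= le_eqVlt; apply/orP; left; apply/eqP.
  by apply: eq_bigr => n _; rewrite /z /w mulrDl mul1r.
apply: bsumW e _; apply: bsum_le (bsum_finite (uniq_zbox N) z0) => n.
case: ifP => [_|/negbT h].
  by rewrite /z ler_wpM2l ?w_ge0//; case: (k); rewrite ?lerDl ?lerDr sqmod_ge0.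
by rewrite mem_zbox -ltnNge in h; rewrite (hU _ _ h) sqmod0 mulr0.
Qed.

Lemma HK_hb N (U : state) B : hb U B -> HK N U + massK N U <= 2 * B ^+ 2.
Proof.
move=> hU; have [_ h1] := hU false; have [_ h2] := hU true.
rewrite /HK /massK -big_split/= mulr_natl mulr2n.
apply: le_trans (lerD (h1 _ (uniq_zbox N)) (h2 _ (uniq_zbox N))).
rewrite -big_split/= le_eqVlt; apply/orP; left; apply/eqP; apply: eq_bigr => n _.
by rewrite /w; ring.
Qed.

(** [bootstrap] is applied to F = log Z, where Z is the modified energy shifted
    so as to dominate 1 + HK. The derivative of Z is at most of the order of
    Z (1 + log Z): while F <= F1 there is a bound in H^1, so the truncation
    error of [QP1_small] is at most 1 for N large. *)
Theorem galerkin_apriori (B0 T : R) : 0 <= B0 -> 0 <= T -> exists (B : R) (N0 : nat), 0 <= B /\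
  forall (N : nat) (U : R -> state), (N0 <= N)%N ->
    (forall t, supp N (U t)) -> (forall t, massK N (U t) = massK N (U 0)) ->
    (forall t j n, cder (fun s => U s j n) t (galF alpha beta a b N (U t) j n)) ->
    hb (U 0) B0 -> forall t, `|t| <= T -> hb (U t) B.
Proof.
move=> B00 T0; pose m := 1 + 4 * B0 ^+ 2.
have B2 := sqr_ge0 B0.
have m1 : 1 <= m by rewrite lerDl mulr_ge0.
have [C0 [C1 [C00 C10 hE]]] := energy_bounds alpha beta a b0 m1.
(* Z0 bounds Z at time 0, F1 bounds log Z, and B the norm in H^1. *)
pose Z0 := 3 / 2 * (1 + 2 * B0 ^+ 2) + 2 * C0 + 1.
have Z01 : 1 <= Z0 by rewrite /Z0; lra.
pose C := 5 * C1; have CC0 : 0 <= C by rewrite mulr_ge0.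
pose F1 := (1 + ln Z0) * expR (C * T).
pose M := m + 2 * expR F1; have M0 : 0 <= M.
  by apply: addr_ge0; [exact: le_trans m1|rewrite mulr_ge0 ?expR_ge0].
pose B := Num.sqrt M; have Bp : 0 <= B by exact: sqrtr_ge0.
have [N0 hN0] : exists N0, forall N, (N0 <= N)%N -> 8 * S0 alpha beta * eT N * B ^+ 6 <= 1.
  have := @eT_cvg0 (8 * S0 alpha beta * B ^+ 6); move=> /cvgrPdist_le/(_ 1 ltr01)[K _ hK].
  exists K => N KN; have := hK N KN; rewrite /= sub0r normrN; apply: le_trans.
  by apply: le_trans (ler_norm _); rewrite le_eqVlt; apply/orP; left; apply/eqP; ring.
exists B, N0; split=> // N U NN hS hmass hU hb0.
have hm t : 2 * massK N (U t) <= m.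
  rewrite hmass /m; have := HK_hb N hb0; have := HK_ge0 N (U 0); lra.
pose P s := 1 + HK N (U s); pose Q s := QP N (mu alpha beta a b) (U s) (U s).
have P1 s : 1 <= P s by rewrite lerDl HK_ge0.
pose Z s := P s + Q s + C0 + 1.
have hQ s : `|Q s| <= P s / 2 + C0 by have [] := hE N (U s) (hS s) (hm s).
have ZP s : P s / 2 + 1 <= Z s.
  have := hQ s; rewrite ler_norml => /andP[h _]; rewrite /Z; lra.
have Z1 s : 1 <= Z s by have := ZP s; have := P1 s; lra.
have Zp s : 0 < Z s by exact: lt_le_trans (Z1 s).
pose dZ s := QR N (YY (U s)) (fun n1 n2 n3 n4 =>
     (n1%:~R * n3%:~R - n2%:~R * n4%:~R) * resw alpha beta a b (n1 + n3)) +
  4 * QP N (mu alpha beta a b) (galN alpha beta N (U s)) (U s).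
have hZ s : is_derive s (1 : R) Z (dZ s).
  have h := is_derive_energy (hS s) (hU s).
  rewrite (_ : Z = fun t => (HK N (U t) + QP N (mu alpha beta a b) (U t) (U t)) + (2 + C0)); last first.
    by apply/funext => t; rewrite /Z /P /Q; ring.
  by apply: is_derive_eq (is_deriveD h (is_derive_cst _ _ _)) _; rewrite addr0.
pose F s := ln (Z s).
have hF s : is_derive s (1 : R) F (dZ s / Z s) by exact: is_derive_lnc.
have F0 s : 0 <= F s by exact: ln_ge0.
have hbF s : F s <= F1 -> hb (U s) B.
  move=> h; apply: hb_supp => //.
  have : Z s <= expR F1 by rewrite -(lnK (Zp s)) ler_expR.
  have := hm s; have := ZP s; have := HK_ge0 N (U s); rewrite /M /P.
  have : 0 <= massK N (U s) by apply: sumr_ge0 => n _; rewrite addr_ge0 ?sqmod_ge0.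
  lra.
suff hh t : `|t| <= T -> F t <= F1 by move=> t /hh; exact: hbF.
move: t; apply: (bootstrap CC0 T0 hF F0).
  move=> s _ hs; have [_ h] := hE N (U s) (hS s) (hm s).
  have q1 := le_trans (QP1_small alpha beta (hS s) (hbF s hs)) (hN0 N NN).
  rewrite -/(P s) -/(dZ s) in h; move: h q1; move: (`|QP _ _ _ _|) => q h q1.
  rewrite normrM normfV (gtr0_norm (Zp s)) ler_pdivrMr//; apply: le_trans h _.
  have lP : ln (P s) <= 1 + F s.
    have P2 : P s <= 2 * Z s by have := ZP s; lra.
    apply: (@le_trans _ _ (ln (2 * Z s))).
      by rewrite ler_ln ?posrE ?mulr_gt0//; exact: lt_le_trans (P1 s).
    rewrite lnM ?posrE// lerD2r.
    have h11 : (-1 : R) < 1 by rewrite (lt_trans _ (ltr01)) ?ltrN10.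
    exact: (le_ln1Dx h11).
  rewrite (_ : C * _ * Z s = C1 * (5 * ((1 + F s) * Z s))); last by rewrite /C; ring.
  apply: ler_wpM2l => //.
  have := F0 s; have := Z1 s; have := ZP s; have := P1 s; have : 0 <= ln (P s) by exact: ln_ge0.
  move: lP q1; move: (P s) (Z s) (F s) (ln (P s)) => p z f l lP q1 l0 p1 zp z1 f0.
  have : p * (1 + l) <= (2 * z) * (2 + f) by apply: ler_pM; lra.
  have : 0 <= z * f by apply: mulr_ge0; lra.
  nra.
rewrite /F1 [ltRHS]addrC; apply: (@le_lt_trans _ _ ((1 + ln Z0) * expR (C * T))); last by rewrite ltrDl.
apply: ler_wpM2r; first exact: expR_ge0.
rewrite lerD2l /F ler_ln ?posrE ?(lt_le_trans ltr01)//.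
have := hQ 0; rewrite ler_norml => /andP[_ h].
have := HK_hb N hb0; have : 0 <= massK N (U 0) by apply: sumr_ge0 => n _; rewrite addr_ge0 ?sqmod_ge0.
rewrite /Z /Z0 /P in h *; lra.
Qed.

End Apriori.

(** * Global existence on the Fourier side *)

Section Existence.
Context {R : realType}.
Variables (alpha beta a b : R).
Hypothesis b0 : b != 0.
Local Notation state := (bool -> int -> R[i]).
Local Notation ka0 := (ka0 alpha beta).
Local Notation phi := (phi a b).
Local Notation Ncub := (Ncub alpha beta).
Local Notation etail := (etail alpha beta).
Local Notation galF := (galF alpha beta a b).

Lemma cmean_value (f g : R -> R[i]) (t s B : R) : 0 <= B ->
  (forall r, `|r - t| <= `|s - t| -> cder f r (g r)) ->
  (forall r, `|r - t| <= `|s - t| -> normc (g r) <= B) ->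
  normc (f s - f t) <= `|s - t| * B.
Proof.
move=> B0 hd hB.
have : l2b (trunc (@w1 R) [:: 0]) (fun n => f s - f t) (`|s - t| * B).
  apply: (@l2b_mean_value _ _ _ (fun r _ => f r) (fun r _ => g r)) => //.
    by move=> r _ hr _; exact: hd.
  move=> r hr; split=> // l ul; rewrite (eq_bigr (fun n => if n == 0 then sqmod (g r) else 0)); last first.
    by move=> n _; rewrite /trunc inE /w1; case: eqP => _; rewrite ?mul1r ?mul0r.
  rewrite big_pick//; case: ifP => _; last exact: sqr_ge0.
  by rewrite sqmod_normc ler_sqr_nneg ?normc_ge0// hB.
by move=> /(@l2b_term1 _ _ _ _ 0); apply; rewrite /trunc mem_head.
Qed.

Lemma Tr_lip (ka : int -> int -> int -> R[i]) (x y z x' y' z' : int -> R[i]) r n B d :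
  0 <= B -> 0 <= d ->
  (forall k, normc (y k) <= B) -> (forall k, normc (z k) <= B) ->
  (forall k, normc (x' k) <= B) -> (forall k, normc (y' k) <= B) ->
  (forall p, p \in r -> [/\ normc (x p.1 - x' p.1) <= d, normc (y p.2 - y' p.2) <= d &
     normc (z (n - p.1 + p.2) - z' (n - p.1 + p.2)) <= d]) ->
  normc (Tr ka x y z r n - Tr ka x' y' z' r n) <=
  (\sum_(p <- r) normc (ka n p.1 p.2)) * (3 * B ^+ 2 * d).
Proof.
move=> B0 d0 hy hz hx' hy' h.
rewrite Tr_sub /Tr -!big_split/= big_seq; apply: le_trans (normc_sum _ _ _) _.
rewrite mulr_suml [leRHS]big_seq; apply: ler_sum => p pr; have [h1 h2 h3] := h p pr.
rewrite (_ : _ + _ + _ = ka n p.1 p.2 * ((x p.1 - x' p.1) * conjc (y p.2) * z (n - p.1 + p.2) +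
  x' p.1 * conjc (y p.2 - y' p.2) * z (n - p.1 + p.2) +
  x' p.1 * conjc (y' p.2) * (z (n - p.1 + p.2) - z' (n - p.1 + p.2)))); last by ring.
rewrite normcM ler_wpM2l ?normc_ge0//.
rewrite (_ : 3 * B ^+ 2 * d = d * B * B + B * d * B + B * B * d); last by ring.
apply: le_trans (le_normcD _ _) _; apply: lerD; first (apply: le_trans (le_normcD _ _) _; apply: lerD).
- by rewrite !normcM normcJ' !ler_pM ?mulr_ge0 ?normc_ge0.
- by rewrite !normcM normcJ' !ler_pM ?mulr_ge0 ?normc_ge0.
- by rewrite !normcM normcJ' !ler_pM ?mulr_ge0 ?normc_ge0.
Qed.

Lemma hb_normc (U : state) B j n : hb U B -> normc (U j n) <= B.
Proof. by move=> h; apply: (l2b_term1 _ (h j)); exact: w_ge1. Qed.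

Lemma phi_le (n : int) : `|phi n| <= (`|a| + `|b|) * J n ^+ 3.
Proof.
have J1 := @J_ge1 R n; have J0 : (0 : R) <= J n by exact: le_trans J1.
have nJ : `|n%:~R| <= J n :> R by rewrite /J lerDr.
rewrite /phi addrC; apply: le_trans (ler_normD _ _) _; rewrite normrN (normrM a) (normrM b) !normrX mulrDl.
apply: lerD; apply: ler_wpM2l => //.
  apply: (@le_trans _ _ (J n ^+ 2)); first by rewrite ler_pXn2r ?nnegrE.
  by rewrite [leRHS]exprSr ler_peMr ?exprn_ge0.
by rewrite ler_pXn2r ?nnegrE.
Qed.

Lemma galF_bound N (V : state) B j n : hb V B ->
  normc (galF N V j n) <= (`|a| + `|b|) * J n ^+ 3 * B + 2 * (S0 alpha beta * B * B * B).
Proof.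
move=> hV; have B0 := hb_ge0 hV; have S00 := S0_ge0 alpha beta.
have J0 : 0 <= J n :> R by rewrite (le_trans ler01) ?J_ge1.
rewrite /galF; case: ifP => _; last first.
  by rewrite normc0; posi.
apply: le_trans (le_normcD _ _) _; apply: lerD.
  rewrite normcM; apply: ler_pM; rewrite ?normc_ge0//; last exact: hb_normc.
  apply: le_trans (normc_ReIm _) _; rewrite /= normr0 add0r; exact: phi_le.
have wg0 n' : (0 : R) < w n' by exact: w_gt0.
have h := l2b_cub (uniq_box N) (@w1_ge0 R) wg0 wg0 wg0 S00 (ka0_bsum alpha beta) hV hV (hV j).
exact: (l2b_term1 _ h).
Qed.

Lemma cub_lip K (V V' : state) B d j n : 0 <= B -> 0 <= d -> hb V B -> hb V' B ->
  (forall k l, (`|l| <= `|n| + 2 * K)%N -> normc (V k l - V' k l) <= d) ->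
  normc (cub ka0 V V V j (box K) n - cub ka0 V' V' V' j (box K) n) <=
  2 * (\sum_(p <- box K) normc (ka0 n p.1 p.2)) * (3 * B ^+ 2 * d).
Proof.
move=> B0 d0 hV hV' h; rewrite /cub opprD addrACA.
have H k : normc (Tr ka0 (V k) (V k) (V j) (box K) n - Tr ka0 (V' k) (V' k) (V' j) (box K) n) <=
    (\sum_(p <- box K) normc (ka0 n p.1 p.2)) * (3 * B ^+ 2 * d).
  apply: Tr_lip => //; try by move=> ?; exact: hb_normc.
  by move=> [p q]; rewrite mem_box /= => /andP[p1 p2]; split; apply: h; lia.
apply: le_trans (le_normcD _ _) _; apply: le_trans (lerD (H false) (H true)) _.
by rewrite le_eqVlt; apply/orP; left; apply/eqP; ring.
Qed.

Lemma cub_box_tail K N (V : state) B j n : hb V B -> (K <= N)%N ->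
  normc (cub ka0 V V V j (box N) n - cub ka0 V V V j (box K) n) <= 2 * B ^+ 3 * etail K.
Proof.
move=> hV KN; have h := l2b_cub_tail alpha beta j hV KN.
apply: le_trans (l2b_term1 _ h) _ => //.
by rewrite le_eqVlt; apply/orP; left; apply/eqP; ring.
Qed.

(** Up to a small error the cubic term only involves frequencies in a fixed
    box, and there each coefficient is Lipschitz in time uniformly in N. *)
Lemma galerkin_equidiff (B : R) t j n e : 0 <= B -> 0 < e -> exists2 d : R, 0 < d &
  exists N0, forall (N : nat) (U : R -> state), (N0 <= N)%N ->
    (forall s k l, cder (fun r => U r k l) s (galF N (U s) k l)) ->
    (forall s, `|s - t| <= 1 -> hb (U s) B) ->
    forall s, `|s - t| <= d ->
      normc (U s j n - U t j n - (s - t)%:C * galF N (U t) j n) <= e * `|s - t|.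
Proof.
move=> B0 e0; have S00 := S0_ge0 alpha beta.
have e4 : 0 < e / 4 by rewrite divr_gt0.
have [K hK] : exists K, 2 * B ^+ 3 * etail K <= e / 4.
  have := etail_cvg0 alpha beta (2 * B ^+ 3); move=> /cvgrPdist_le/(_ _ e4)[K _ hK].
  exists K; have := hK K (leqnn K); rewrite /= sub0r normrN; apply: le_trans; exact: ler_norm.
pose L : R := (`|a| + `|b|) * (1 + (`|n| + 2 * K)%:R) ^+ 3 * B + 2 * (S0 alpha beta * B * B * B).
have L0 : 0 <= L by rewrite /L; posi.
pose c := normc (0 +i* phi n : R[i]); have c0 : 0 <= c by exact: normc_ge0.
pose S := 2 * (\sum_(p <- box K) normc (ka0 n p.1 p.2)) * (3 * B ^+ 2).
have SS0 : 0 <= S.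
  by rewrite /S; apply: mulr_ge0; posi; apply: sumr_ge0 => p _; exact: normc_ge0.
pose d := Num.min 1 (e / 4 / ((c + S) * L + 1)).
have q0 : 0 < (c + S) * L + 1 by rewrite ltr_wpDl// mulr_ge0// addr_ge0.
have d0 : 0 < d by rewrite lt_min ltr01 divr_gt0.
have d1 : d <= 1 by rewrite ge_min lexx.
have dq : (c + S) * (L * d) <= e / 4.
  have : d * ((c + S) * L + 1) <= e / 4 by rewrite -ler_pdivlMr// ge_min lexx orbT.
  by move: d0; lra.
exists d => //; exists (maxn K `|n|%N) => N U; rewrite geq_max => /andP[KN nN] hU hB s sd.
have t1 : `|t - t| <= 1 by rewrite subrr normr0.
have coord r k l : `|r - t| <= d -> (`|l| <= `|n| + 2 * K)%N -> normc (U r k l - U t k l) <= L * d.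
  move=> rd hl; apply: (@le_trans _ _ (`|r - t| * L)); last by rewrite mulrC ler_wpM2l.
  apply: (@cmean_value (fun r => U r k l) (fun r => galF N (U r) k l)) => // r' hr.
  have hr1 : `|r' - t| <= 1 by exact: le_trans hr (le_trans rd d1).
  apply: le_trans (galF_bound N k l (hB _ hr1)) _; rewrite /L lerD2r ler_wpM2r// ler_wpM2l ?addr_ge0//.
  rewrite ler_pXn2r ?nnegrE ?(le_trans ler01 (J_ge1 _)) ?addr_ge0//.
  by rewrite JE lerD2l ler_nat.
have osc r : `|r - t| <= d -> normc (galF N (U r) j n - galF N (U t) j n) <= e.
  move=> rd; have hr := hB r (le_trans rd d1); have ht := hB t t1.
  rewrite /galF nN.
  rewrite (_ : _ - _ = (0 +i* phi n) * (U r j n - U t j n) +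
    (cub ka0 (U r) (U r) (U r) j (box N) n - cub ka0 (U r) (U r) (U r) j (box K) n) -
    (cub ka0 (U t) (U t) (U t) j (box N) n - cub ka0 (U t) (U t) (U t) j (box K) n) +
    (cub ka0 (U r) (U r) (U r) j (box K) n - cub ka0 (U t) (U t) (U t) j (box K) n)); last by ring.
  have Ld0 : 0 <= L * d by rewrite mulr_ge0// ltW.
  have h1 : normc ((0 +i* phi n) * (U r j n - U t j n)) <= c * (L * d).
    by rewrite normcM; apply: (ler_wpM2l c0); apply: (coord r j n rd); exact: leq_addr.
  have h2 := cub_box_tail j n hr KN; have h3 := cub_box_tail j n ht KN.
  have h4 := cub_lip j B0 Ld0 hr ht (fun k l hl => coord r k l rd hl).
  rewrite mulrA -/S in h4.
  apply: le_trans (le_normcD _ _) _; apply: le_trans (lerD (le_normcB _ _) h4) _.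
  apply: le_trans (lerD (lerD (le_normcD _ _) h3) (lexx _)) _.
  apply: le_trans (lerD (lerD (lerD h1 h2) (lexx _)) (lexx _)) _.
  by move: hK dq; rewrite (mulrDl c S); lra.
rewrite [leRHS]mulrC.
have hd r : cder (fun r => U r j n - r%:C * galF N (U t) j n) r (galF N (U r) j n - galF N (U t) j n).
  apply: cderB; first exact: hU.
  apply: cder_eq (cderM (y := 1) _ (cder_cst _ _)) _; last by rewrite mulr0 addr0 mul1r.
  by split=> /=; [exact: is_derive_id|exact: is_derive_cst].
have := cmean_value (ltW e0) (t := t) (s := s) (fun r _ => hd r) (fun r hr => osc r (le_trans hr sd)).
by congr (normc _ <= _); rewrite rmorphB/=; ring.
Qed.

Lemma cub_ccvg (F : set_system nat) {FF : Filter F} (V : nat -> state) (V' : state) K j n :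
  (forall j n, ccvg F (fun N => V N j n) (V' j n)) ->
  ccvg F (fun N => cub ka0 (V N) (V N) (V N) j (box K) n) (cub ka0 V' V' V' j (box K) n).
Proof.
move=> h; rewrite /cub /Tr; apply: ccvgD; apply: ccvg_sum => p;
  by apply: ccvgM => //; apply: ccvgM; [apply: ccvgM => //; exact: ccvg_cst|exact: ccvgJ].
Qed.

Lemma ccvgN (T : Type) (F : set_system T) {FF : Filter F} (f : T -> R[i]) z :
  ccvg F f z -> ccvg F (fun t => - f t) (- z).
Proof.
move=> h; rewrite -mulN1r; under eq_fun do rewrite -mulN1r.
by apply: ccvgM => //; exact: ccvg_cst.
Qed.

(** The tails of the cubic sums are uniformly small on bounded sets of H^1,
    so convergence of each coefficient is enough. *)
Lemma galF_ccvg (F : set_system nat) {FF : ProperFilter F} (V : nat -> state) (V' : state) B j n :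
  \oo `<=` F -> (\forall N \near F, hb (V N) B) -> hb V' B ->
  (forall j n, ccvg F (fun N => V N j n) (V' j n)) ->
  ccvg F (fun N => galF N (V N) j n) ((0 +i* phi n) * V' j n + Ncub V' j n).
Proof.
move=> sub hV hV' h; apply: ccvgP => e e0; have e3 : 0 < e / 4 by rewrite divr_gt0.
have B0 := hb_ge0 hV'; have FF' : Filter F by exact: filter_filter.
have [K hK] : exists K, 2 * B ^+ 3 * etail K <= e / 4.
  have := etail_cvg0 alpha beta (2 * B ^+ 3); move=> /cvgrPdist_le/(_ _ e3)[K _ hK].
  exists K; have := hK K (leqnn K); rewrite /= sub0r normrN; apply: le_trans; exact: ler_norm.
have c1 : \forall N \near F, normc ((0 +i* phi n) * V N j n - (0 +i* phi n) * V' j n) <= e / 4.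
  by apply: (ccvg_near _ e3); apply: ccvgM => //; exact: ccvg_cst.
have c2 : \forall N \near F, normc (cub ka0 (V N) (V N) (V N) j (box K) n -
    cub ka0 V' V' V' j (box K) n) <= e / 4.
  by apply: (ccvg_near _ e3); exact: cub_ccvg.
have big : \forall N \near F, (maxn K `|n| <= N)%N by apply: sub; exists (maxn K `|n|%N).
near=> N.
have /andP[KN nN] : (K <= N)%N && (`|n| <= N)%N by rewrite -geq_max; near: N.
have hN : hb (V N) B by near: N.
have h1 : normc ((0 +i* phi n) * V N j n - (0 +i* phi n) * V' j n) <= e / 4 by near: N.
have h2 : normc (cub ka0 (V N) (V N) (V N) j (box K) n - cub ka0 V' V' V' j (box K) n) <= e / 4 by near: N.
have h3 := cub_box_tail j n hN KN.
have h4 : normc (Ncub V' j n - cub ka0 V' V' V' j (box K) n) <= 2 * B ^+ 3 * etail K.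
  exact: (l2b_term1 _ (Ncub_tail alpha beta j K hV')).
rewrite /galF nN.
rewrite (_ : _ - _ = ((0 +i* phi n) * V N j n - (0 +i* phi n) * V' j n) +
  (cub ka0 (V N) (V N) (V N) j (box N) n - cub ka0 (V N) (V N) (V N) j (box K) n) +
  (cub ka0 (V N) (V N) (V N) j (box K) n - cub ka0 V' V' V' j (box K) n) -
  (Ncub V' j n - cub ka0 V' V' V' j (box K) n)); last by ring.
apply: le_trans (le_normcB _ _) _; apply: le_trans (lerD (le_normcD _ _) h4) _.
apply: le_trans (lerD (lerD (le_normcD _ _) h2) (lexx _)) _.
apply: le_trans (lerD (lerD (lerD h1 h3) (lexx _)) (lexx _)) _.
by move: hK; lra.
Unshelve. all: by end_near. Qed.

(** The Galerkin trajectories of the truncated data are bounded in H^1 and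
    equidifferentiable, frequency by frequency; the coefficientwise limit along
    an ultrafilter exists without extraction, and the expansion of
    [galerkin_equidiff] passes to the limit. *)
Theorem wsol_exists (U0 : state) B0 : hb U0 B0 -> exists U : R -> state,
  [/\ U 0 = U0, wsol alpha beta a b U & forall T, exists B, forall t, `|t| <= T -> hb (U t) B].
Proof.
move=> hU0; have B00 := hb_ge0 hU0.
pose D N : state := fun j n => if (`|n| <= N)%N then U0 j n else 0.
have sD N : supp N (D N) by move=> j n h; rewrite /D leqNgt h.
have hD N : hb (D N) B0.
  move=> k; apply: l2b_le (hU0 k) => n; rewrite /D; case: ifP => _ //.
  by rewrite sqmod0 mulr0 mulr_ge0 ?w_ge0 ?sqmod_ge0.
have /choice[G hG] : forall N, exists U : R -> state, [/\ U 0 = D N,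
    forall t, supp N (U t), forall t, massK N (U t) = massK N (D N) &
    forall t j n, cder (fun s => U s j n) t (galF N (U t) j n)].
  by move=> N; exact: (galerkin_exists alpha beta a b (sD N)).
have bnd T : 0 <= T -> exists (B : R) (N0 : nat), 0 <= B /\
    forall N, (N0 <= N)%N -> forall t, `|t| <= T -> hb (G N t) B.
  move=> T0; have [B [N0 [B1 h]]] := galerkin_apriori alpha beta a b0 B00 T0.
  exists B, N0; split=> // N NN; have [h0 h1 h2 h3] := hG N.
  by apply: (h N) => //; rewrite h0.
have [F UF sub] := ex_ultra; have PF : ProperFilter F by exact: ultra_proper.
have FF : Filter F by exact: filter_filter.
pose U t j n := ulim F (fun N => G N t j n).
have nearB t : exists2 B, 0 <= B & \forall N \near F, hb (G N t) B.
  have [B [N0 [B1 h]]] := bnd `|t| (normr_ge0 t).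
  by exists B => //; apply: sub; exists N0 => // N NN; exact: h.
have Ucvg t j n : ccvg F (fun N => G N t j n) (U t j n).
  have [B B1 h] := nearB t; apply: (@ulimP _ F _ B).
  by apply: filterS h => N h; exact: hb_normc.
have hbU T : 0 <= T -> exists2 B, 0 <= B & forall t, `|t| <= T -> hb (U t) B.
  move=> T0; have [B [N0 [B1 h]]] := bnd T T0; exists B => // t tT k.
  apply: (@l2b_ccvg _ _ F _ _ (fun N => G N t k)) => //.
  by apply: sub; exists N0 => // N NN; exact: h.
exists U; split.
- apply/funext => j; apply/funext => n; apply: (ccvg_unique (Ucvg 0 j n)).
  apply: ccvgP => e e0; apply: sub; exists `|n|%N => // N /= nN.
  by have [-> _ _ _] := hG N; rewrite /D nN subrr normc0 ltW.
- move=> t j n; apply: cder_expansion => e e0.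
  have T0 : 0 <= `|t| + 1 by rewrite addr_ge0.
  have [B [N1 [B1 hB]]] := bnd _ T0; have [B' B1' hB'] := hbU _ T0.
  have [d d0 [N0 hN]] := galerkin_equidiff t j n B1 e0.
  exists d => // s sd.
  pose BB := B + B'.
  have hbBB : hb (U t) BB by move=> k; apply: l2bW (hB' t _ k); rewrite ?lerDl ?lerDr.
  have hbN : \forall N \near F, hb (G N t) BB.
    by apply: sub; exists N1 => // N NN k; apply: l2bW (hB N NN t _ k); rewrite ?lerDl.
  have lim := @galF_ccvg F PF (fun N => G N t) (U t) BB j n sub hbN hbBB (Ucvg t).
  have : ccvg F (fun N => G N s j n - G N t j n - (s - t)%:C * galF N (G N t) j n)
      (U s j n - U t j n - (s - t)%:C * ((0 +i* phi n) * U t j n + Ncub (U t) j n)).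
    apply: ccvgD; first by apply: ccvgD => //; exact: ccvgN.
    apply: ccvgN; apply: (@ccvgM _ _ F FF (fun=> (s - t)%:C) (fun N => galF N (G N t) j n)) => //.
    exact: ccvg_cst.
  move=> /ccvg_normc_le; apply.
  apply: sub; exists (maxn N0 N1) => // N /=; rewrite geq_max => /andP[NN0 NN1].
  have [_ _ _ h3] := hG N; apply: hN => // r hr.
  apply: hB => //; have := ler_normD (r - t) t; rewrite subrK => h; apply: le_trans h _.
  by rewrite addrC lerD2l.
- move=> T; have [T0|T0] := leP 0 T; first by have [B _ h] := hbU T T0; exists B.
  by exists 0 => t tT; have := normr_ge0 t; lra.
Qed.

End Existence.

(** * Integration of complex valued functions *)

Section ComplexIntegration.
Context {R : realType}.
Local Notation mu := (@lebesgue_measure R).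
Local Notation T := (measurableTypeR R).
Implicit Types (A B : set T) (f g : R -> R[i]) (x y : T -> R).

Lemma aeS (P Q : T -> Prop) : (forall t, P t -> Q t) ->
  {ae mu, forall t, P t} -> {ae mu, forall t, Q t}.
Proof. by move=> PQ; exact: (@filterS _ _ (ae_filter_ringOfSetsType mu) _ _ PQ). Qed.

Lemma aeI (P Q : T -> Prop) : {ae mu, forall t, P t} -> {ae mu, forall t, Q t} ->
  {ae mu, forall t, P t /\ Q t}.
Proof. by move=> hP hQ; exact: (@filterI _ _ (ae_filter_ringOfSetsType mu) _ _ hP hQ). Qed.

Lemma aeW (P : T -> Prop) : (forall t, P t) -> {ae mu, forall t, P t}.
Proof. by move=> h; exact: (@filterE _ _ (ae_filter_ringOfSetsType mu) _ h). Qed.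

Definition rI A x : Prop := mu.-integrable A (EFin \o x).

Definition cmeas A f : Prop :=
  measurable_fun A (fun t : T => complex.Re (f t)) /\
  measurable_fun A (fun t : T => complex.Im (f t)).

Lemma rID A x y : measurable A -> rI A x -> rI A y -> rI A (fun t => x t + y t).
Proof. by move=> mA hx hy; have := integrableD mA hx hy. Qed.

Lemma rIZ A c x : measurable A -> rI A x -> rI A (fun t => c * x t).
Proof. by move=> mA hx; have := integrableZl mA c hx. Qed.

Lemma rIN A x : measurable A -> rI A x -> rI A (fun t => - x t).
Proof. by move=> mA /(rIZ (-1) mA); congr (_.-integrable _ _); apply/funext => t /=; rewrite mulN1r. Qed.

Lemma rI_meas A x : rI A x -> measurable_fun A x.
Proof. by move=> h; apply/measurable_EFinP; exact: (measurable_int _ h). Qed.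

Lemma rI_dom A x y : measurable A -> measurable_fun A x ->
  (forall t, A t -> `|x t| <= y t) -> rI A y -> rI A x.
Proof.
move=> mA mx h hy; apply: (le_integrable mA _ _ hy); first exact/measurable_EFinP.
by move=> t At /=; rewrite lee_fin; apply: le_trans (h t At) (ler_norm _).
Qed.

Lemma rIS A B x : measurable A -> measurable B -> B `<=` A -> rI A x -> rI B x.
Proof. exact: integrableS. Qed.

Lemma rint_ae A x y : measurable A -> measurable_fun A x -> measurable_fun A y ->
  {ae mu, forall t, A t -> x t = y t} ->
  \int[mu]_(t in A) x t = \int[mu]_(t in A) y t.
Proof.
move=> mA mx my h; congr fine; apply: ae_eq_integral => //; try exact/measurable_EFinP.
by apply: aeS h => t h At; rewrite h.
Qed.

Lemma cmeasS A B f : measurable A -> B `<=` A -> cmeas A f -> cmeas B f.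
Proof. by move=> mA BA [h1 h2]; split; exact: measurable_funS BA _. Qed.

Lemma cmeasD A f g : cmeas A f -> cmeas A g -> cmeas A (fun t => f t + g t).
Proof.
move=> [h1 h2] [h3 h4]; split.
  by under eq_fun do rewrite cReD; exact: measurable_funD.
by under eq_fun do rewrite cImD; exact: measurable_funD.
Qed.

Lemma cmeasM A f g : cmeas A f -> cmeas A g -> cmeas A (fun t => f t * g t).
Proof.
move=> [h1 h2] [h3 h4]; split.
  by under eq_fun do rewrite cReM; apply: measurable_funB; exact: measurable_funM.
by under eq_fun do rewrite cImM; apply: measurable_funD; exact: measurable_funM.
Qed.

Lemma cmeas_cst A z : cmeas A (fun=> z).
Proof. by split; exact: measurable_cst. Qed.

Lemma cmeasN A f : cmeas A f -> cmeas A (fun t => - f t).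
Proof. by move=> h; under eq_fun do rewrite -mulN1r; apply: cmeasM => //; exact: cmeas_cst. Qed.

Lemma cmeasB A f g : cmeas A f -> cmeas A g -> cmeas A (fun t => f t - g t).
Proof. by move=> hf hg; apply: cmeasD => //; exact: cmeasN. Qed.

Lemma cmeasJ A f : cmeas A f -> cmeas A (fun t => conjc (f t)).
Proof.
move=> [h1 h2]; split; first by under eq_fun do rewrite cReJ.
by under eq_fun do rewrite cImJ; exact: measurable_funN.
Qed.

Lemma cmeas_real A x : measurable_fun A x -> cmeas A (fun t => (x t)%:C).
Proof. by move=> h; split => //; exact: measurable_cst. Qed.

Lemma meas_sqmod A f : cmeas A f -> measurable_fun A (fun t : T => sqmod (f t)).
Proof. by move=> [h1 h2]; apply: measurable_funD; exact: measurable_funX. Qed.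

Lemma cI_dom A f y : measurable A -> cmeas A f ->
  (forall t, A t -> normc (f t) <= y t) -> rI A y -> cintegrable A f.
Proof.
move=> mA [h1 h2] h hy; split; apply: (rI_dom mA _ _ hy) => // t At.
  exact: le_trans (normc_Re _) (h t At).
exact: le_trans (normc_Im _) (h t At).
Qed.

Lemma cID A f g : measurable A -> cintegrable A f -> cintegrable A g ->
  cintegrable A (fun t => f t + g t).
Proof.
move=> mA [h1 h2] [h3 h4]; split.
  by under eq_fun do rewrite cReD; exact: rID.
by under eq_fun do rewrite cImD; exact: rID.
Qed.

Lemma cintD A f g : measurable A -> cintegrable A f -> cintegrable A g ->
  cintegral A (fun t => f t + g t) = cintegral A f + cintegral A g.
Proof.
move=> mA [h1 h2] [h3 h4]; apply/eqP; rewrite eq_complex /=; apply/andP; split; apply/eqP.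
  by under eq_Rintegral do rewrite cReD; exact: RintegralD.
by under eq_Rintegral do rewrite cImD; exact: RintegralD.
Qed.

Lemma cIZ A c f : measurable A -> cintegrable A f -> cintegrable A (fun t => c * f t).
Proof.
move=> mA [h1 h2]; split.
  by under eq_fun do rewrite cReM; apply: rID => //; [|apply: rIN => //]; exact: rIZ.
by under eq_fun do rewrite cImM; apply: rID => //; exact: rIZ.
Qed.

Lemma cintZ A c f : measurable A -> cintegrable A f ->
  cintegral A (fun t => c * f t) = c * cintegral A f.
Proof.
move=> mA [h1 h2]; apply/eqP; rewrite eq_complex; apply/andP; split; apply/eqP.
  rewrite cReM /=; under eq_Rintegral do rewrite cReM.
  by rewrite RintegralB ?RintegralZl//; exact: rIZ.
rewrite cImM /=; under eq_Rintegral do rewrite cImM.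
by rewrite RintegralD ?RintegralZl//; exact: rIZ.
Qed.

Lemma cIN A f : measurable A -> cintegrable A f -> cintegrable A (fun t => - f t).
Proof. by move=> mA h; under eq_fun do rewrite -mulN1r; exact: cIZ. Qed.

Lemma cIB A f g : measurable A -> cintegrable A f -> cintegrable A g ->
  cintegrable A (fun t => f t - g t).
Proof. by move=> mA hf hg; apply: cID => //; exact: cIN. Qed.

Lemma cintB A f g : measurable A -> cintegrable A f -> cintegrable A g ->
  cintegral A (fun t => f t - g t) = cintegral A f - cintegral A g.
Proof.
move=> mA hf hg; rewrite cintD//; last exact: cIN.
congr (_ + _); rewrite -mulN1r -cintZ//; congr (cintegral _ _).
by apply/funext => t; rewrite mulN1r.
Qed.

Lemma cint0 A : cintegral A (fun=> 0) = 0.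
Proof. by rewrite /cintegral /= /Rintegral integral0. Qed.

Lemma cI0 A : measurable A -> cintegrable A (fun=> 0).
Proof. by move=> mA; split; exact: integrable0. Qed.

Lemma cI_sum A (I : Type) (r : seq I) (F : I -> R -> R[i]) : measurable A ->
  (forall i, cintegrable A (F i)) -> cintegrable A (fun t => \sum_(i <- r) F i t).
Proof.
move=> mA h; elim: r => [|i r ih]; first by under eq_fun do rewrite big_nil; exact: cI0.
by under eq_fun do rewrite big_cons; exact: cID.
Qed.

Lemma cint_sum A (I : Type) (r : seq I) (F : I -> R -> R[i]) : measurable A ->
  (forall i, cintegrable A (F i)) ->
  cintegral A (fun t => \sum_(i <- r) F i t) = \sum_(i <- r) cintegral A (F i).
Proof.
move=> mA h; elim: r => [|i r ih].
  by rewrite big_nil -[RHS](cint0 A); congr cintegral; apply/funext => t; rewrite big_nil.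
rewrite big_cons -ih -cintD//; last exact: cI_sum.
by congr cintegral; apply/funext => t; rewrite big_cons.
Qed.

(** The factor two spares a polar decomposition. *)
Lemma cint_le A f y : measurable A -> cintegrable A f -> rI A y ->
  (forall t, A t -> normc (f t) <= y t) ->
  normc (cintegral A f) <= 2 * \int[mu]_(t in A) y t.
Proof.
move=> mA [h1 h2] hy h; apply: le_trans (normc_ReIm _) _; rewrite mulr_natl mulr2n.
have bnd x : rI A x -> (forall t, A t -> `|x t| <= y t) ->
    `|\int[mu]_(t in A) x t| <= \int[mu]_(t in A) y t.
  move=> hx xy; apply: le_trans (le_normr_Rintegral mA hx) _; apply: le_Rintegral => //.
  apply: (rI_dom mA _ _ hy); last by move=> t At; rewrite normr_id xy.
  by apply: measurableT_comp => //; exact: rI_meas.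
by apply: lerD => /=; apply: bnd => // t At; apply: le_trans (h t At);
  [exact: normc_Re|exact: normc_Im].
Qed.

Lemma cint_ae A f g : measurable A -> cmeas A f -> cmeas A g ->
  {ae mu, forall t, A t -> f t = g t} -> cintegral A f = cintegral A g.
Proof.
move=> mA [h1 h2] [h3 h4] h; rewrite /cintegral; congr (_ +i* _); apply: rint_ae => //.
  by apply: aeS h => t h At; rewrite h.
by apply: aeS h => t h At; rewrite h.
Qed.


Definition ccont f : Prop := continuous (fun t => complex.Re (f t) : R) /\
  continuous (fun t => complex.Im (f t) : R).

Lemma ccontP f : (forall t, ccvg (nbhs t) f (f t)) -> ccont f.
Proof. by move=> h; split => t; have [] := h t. Qed.

Lemma ccont_cvg f t : ccont f -> ccvg (nbhs t) f (f t).
Proof. by move=> [h1 h2]; split; [exact: h1|exact: h2]. Qed.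

Lemma cder_ccont f f' : (forall t, cder f t (f' t)) -> ccont f.
Proof. by move=> h; apply: ccontP => t; exact: cder_ccvg (h t). Qed.

Lemma ccontD f g : ccont f -> ccont g -> ccont (fun t => f t + g t).
Proof. by move=> hf hg; apply: ccontP => t; apply: ccvgD; exact: ccont_cvg. Qed.

Lemma ccontM f g : ccont f -> ccont g -> ccont (fun t => f t * g t).
Proof. by move=> hf hg; apply: ccontP => t; apply: ccvgM; exact: ccont_cvg. Qed.

Lemma ccontJ f : ccont f -> ccont (fun t => conjc (f t)).
Proof. by move=> hf; apply: ccontP => t; apply: ccvgJ; exact: ccont_cvg. Qed.

Lemma ccont_cst z : ccont (fun=> z).
Proof. by apply: ccontP => t; exact: ccvg_cst. Qed.

Lemma ccont_sum (I : Type) (r : seq I) (F : I -> R -> R[i]) : (forall i, ccont (F i)) ->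
  ccont (fun t => \sum_(i <- r) F i t).
Proof. by move=> h; apply: ccontP => t; apply: ccvg_sum => i; exact: ccont_cvg. Qed.

Lemma ccont_cis (c : R) : ccont (fun t => cis (c * t)).
Proof. by apply: cder_ccont => t; exact: cder_cis. Qed.

Lemma ccont_meas A f : measurable A -> ccont f -> cmeas A f.
Proof.
move=> mA [h1 h2]; split; apply: (measurable_funS measurableT) => //;
  exact: continuous_measurable_fun.
Qed.

Lemma ccont_I a b f : ccont f -> cintegrable `[a, b] f.
Proof.
by move=> [h1 h2]; split; apply: continuous_compact_integrable;
  [exact: segment_compact|exact: continuous_subspaceT|exact: segment_compact|exact: continuous_subspaceT].
Qed.

Lemma rI_cst a b c : rI `[a, b] (fun=> c).
Proof. by apply: continuous_compact_integrable; [exact: segment_compact|apply: continuous_subspaceT => t; exact: cvg_cst]. Qed.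

Lemma rint_cst a b c : a <= b -> \int[mu]_(t in `[a, b]) c = c * (b - a).
Proof.
move=> ab; have e : mu `[a, b] = (b - a)%:E.
  rewrite (lebesgue_measure_itv `[a, b]) /= lte_fin.
  by case: ltgtP ab => // -> _; rewrite subrr.
by rewrite Rintegral_cst// [X in fine X]e.
Qed.

Lemma cint_point a f : cintegral `[a, a] f = 0.
Proof. by rewrite set_itv1 /cintegral !Rintegral_set1. Qed.

Lemma FTC2_real (a b : R) (F F' : R -> R) : a < b ->
  (forall t : R, a <= t <= b -> is_derive t (1 : R) F (F' t)) ->
  continuous F' -> \int[mu]_(t in `[a, b]) F' t = F b - F a.
Proof.
move=> ab hd hc; rewrite /Rintegral (@continuous_FTC2 _ F' F)//.
- exact: continuous_subspaceT.
- have dF t : a <= t <= b -> derivable F t (1 : R).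
    by move=> h; exact: (@ex_derive _ _ _ _ _ _ _ (hd t h)).
  have cF t : a <= t <= b -> F s @[s --> t] --> F t.
    by move=> h; apply: differentiable_continuous; apply/derivable1_diffP; exact: dF.
  split; last 2 first.
  + by apply: cvg_at_right_filter; apply: cF; rewrite lexx ltW.
  + by apply: cvg_at_left_filter; apply: cF; rewrite lexx ltW.
  by move=> t /=; rewrite in_itv/= => /andP[/ltW h1 /ltW h2]; apply: dF; rewrite h1 h2.
- move=> t /=; rewrite in_itv/= => /andP[/ltW h1 /ltW h2]; rewrite derive1E.
  have h : a <= t <= b by rewrite h1.
  exact: (@derive_val _ _ _ _ _ _ _ (hd t h)).
Qed.

Lemma cFTC2 a b f f' : a <= b -> (forall t, a <= t <= b -> cder f t (f' t)) -> ccont f' ->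
  cintegral `[a, b] f' = f b - f a.
Proof.
rewrite le_eqVlt => /predU1P[->|ab] hd [c1 c2]; first by rewrite cint_point subrr.
rewrite /cintegral (FTC2_real ab (fun t h => (hd t h).1) c1) (FTC2_real ab (fun t h => (hd t h).2) c2).
by case: (f b) (f a) => ? ? [? ?].
Qed.

Lemma oriented_FTC2 a b f f' : (forall t, Num.min a b <= t <= Num.max a b -> cder f t (f' t)) ->
  ccont f' -> oriented_cintegral a b f' = f b - f a.
Proof.
move=> hd hc; rewrite /oriented_cintegral; case: leP hd => [ab|/ltW ba] hd; first exact: cFTC2.
by rewrite (cFTC2 ba hd hc) opprB.
Qed.

Lemma FTC1_real (g : R -> R) T : continuous g -> exists G : R -> R,
  forall t, `|t| < T -> is_derive t (1 : R) G (g t).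
Proof.
move=> hg; exists (fun t => \int[mu]_(s in `[- T, t]) g s) => t.
rewrite ltr_norml => /andP[t1 t2].
have gi : mu.-integrable `[- T, T] (EFin \o g).
  by apply: continuous_compact_integrable; [exact: segment_compact|exact: continuous_subspaceT].
have [h1 h2] := continuous_FTC1_closed t2 gi t1 (hg t).
by rewrite derive1E in h2; exact: DeriveDef h1 h2.
Qed.

Lemma cFTC1 g : ccont g -> forall t, cder (fun t => oriented_cintegral 0 t g) t (g t).
Proof.
move=> hg t; have [g1 g2] := hg; pose T := `|t| + 1.
have [G1 hG1] := FTC1_real T g1; have [G2 hG2] := FTC1_real T g2.
pose G s := G1 s +i* G2 s.
have hG s : `|s| < T -> cder G s (g s) by move=> hs; split; [exact: hG1|exact: hG2].
have T0 : 0 < T by rewrite ltr_wpDl.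
have E s : `|s| < T -> oriented_cintegral 0 s g = G s - G 0.
  move=> hs; apply: oriented_FTC2 hg => r /andP[h1 h2]; apply: hG.
  move: hs; rewrite !ltr_norml => /andP[k1 k2]; apply/andP; split.
    by apply: lt_le_trans h1; rewrite lt_min k1 oppr_lt0 T0.
  by apply: le_lt_trans h2 _; rewrite gt_max T0 k2.
have tT : `|t| < T by rewrite ltrDl.
have nT : \forall s \near t, oriented_cintegral 0 s g = G s - G 0.
  have : \forall s \near t, `|s| < T.
    by have := @norm_continuous _ R t; move=> /cvgr_lt/(_ _ tT).
  by apply: filterS => s; exact: E.
have [k1 k2] := cderD (hG t tT) (cder_cst (- G 0) t); rewrite addr0 in k1 k2.
split; [apply: (near_eq_is_derive _ k1)|apply: (near_eq_is_derive _ k2)] => //.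
  by apply: filterS nT => s ->.
by apply: filterS nT => s ->.
Qed.

End ComplexIntegration.

(** * Fourier coefficients and their completeness *)

Section SquareIntegrable.
Context {R : realType}.
Local Notation mu := (@lebesgue_measure R).
Local Notation T := (measurableTypeR R).
Local Notation D := (@period R : set T).
Implicit Types (f g h : R -> R[i]) (k : int).

Lemma pi2_gt0 : 0 < 2 * pi :> R. Proof. by rewrite mulr_gt0// pi_gt0. Qed.

Lemma mD : measurable D. Proof. exact: measurable_itv. Qed.

Definition L2D f : Prop := cmeas D f /\ rI D (fun t => sqmod (f t)).

Lemma L2T_L2D f : L2T f -> L2D f.
Proof.
move=> [_ h1 h2 h3].
have m : cmeas D f by split; exact: (measurable_funS measurableT (@subsetT _ _)).
split=> //; apply/integrableP; split.
  by apply/measurable_EFinP; exact: meas_sqmod.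
apply: le_lt_trans h3; rewrite le_eqVlt; apply/orP; left; apply/eqP.
by apply: eq_integral => t _ /=; rewrite ger0_norm ?sqmod_ge0.
Qed.

Lemma L2T_ofL2D f : (forall x, f (x + 2 * pi) = f x) -> cmeas setT f -> L2D f -> L2T f.
Proof. by move=> hp [h1 h2] [_ h3]; split=> //; exact: (integrable_lty mD h3). Qed.

Lemma L2D_mul f g : L2D f -> L2D g -> cintegrable D (fun t => f t * g t).
Proof.
move=> [mf hf] [mg hg]; apply: (@cI_dom _ _ _ (fun t => sqmod (f t) + sqmod (g t)) mD).
- exact: cmeasM.
- move=> t _; rewrite normcM !sqmod_normc.
  by have := sqr_ge0 (normc (f t) - normc (g t)); have := sqr_ge0 (normc (f t) + normc (g t)); nra.
- exact: rID mD hf hg.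
Qed.

Lemma L2D_dom f (y : T -> R) : cmeas D f -> rI D y -> (forall t, D t -> sqmod (f t) <= y t) -> L2D f.
Proof.
move=> mf hy h; split=> //; apply: (rI_dom mD (meas_sqmod mf) _ hy) => t Dt.
by rewrite ger0_norm ?sqmod_ge0// h.
Qed.

Lemma L2DD f g : L2D f -> L2D g -> L2D (fun t => f t + g t).
Proof.
move=> [mf hf] [mg hg]; apply: (@L2D_dom _ (fun t => 2 * (sqmod (f t) + sqmod (g t)))).
- exact: cmeasD.
- exact: rIZ mD (rID mD hf hg).
- move=> t _; rewrite /sqmod cReD cImD.
  have := sqr_ge0 (complex.Re (f t) - complex.Re (g t)).
  have := sqr_ge0 (complex.Im (f t) - complex.Im (g t)); nra.
Qed.

Lemma L2DM f g M : cmeas D g -> (forall t, D t -> normc (g t) <= M) -> L2D f ->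
  L2D (fun t => g t * f t).
Proof.
move=> mg hg [mf hf]; apply: (@L2D_dom _ (fun t => M ^+ 2 * sqmod (f t))).
- exact: cmeasM.
- exact: rIZ mD hf.
- move=> t Dt; rewrite sqmodM ler_wpM2r ?sqmod_ge0// sqmod_normc ler_sqr_nneg ?normc_ge0//.
  exact: hg.
Qed.

Lemma L2DZ c f : L2D f -> L2D (fun t => c * f t).
Proof. by move=> h; apply: (@L2DM _ (fun=> c) (normc c)) => //; exact: cmeas_cst. Qed.

Lemma L2DN f : L2D f -> L2D (fun t => - f t).
Proof. by move=> h; under eq_fun do rewrite -mulN1r; exact: L2DZ. Qed.

Lemma L2DB f g : L2D f -> L2D g -> L2D (fun t => f t - g t).
Proof. by move=> hf hg; apply: L2DD => //; exact: L2DN. Qed.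

Lemma L2DJ f : L2D f -> L2D (fun t => conjc (f t)).
Proof.
by move=> [mf hf]; split; [exact: cmeasJ|under eq_fun do rewrite sqmodJ].
Qed.

Lemma ccont_L2D f : ccont f -> L2D f.
Proof.
move=> hf; split; first exact: ccont_meas mD hf.
have [h1 h2] := ccont_I 0 (2 * pi) (ccontM hf (ccontJ hf)).
have -> : (fun t : T => sqmod (f t)) = (fun t => complex.Re (f t * conjc (f t))).
  by apply/funext => t; rewrite sqmod_conjM.
exact: h1.
Qed.

Lemma L2D_cst z : L2D (fun=> z). Proof. by apply: ccont_L2D; exact: ccont_cst. Qed.

Lemma L2D_int f : L2D f -> cintegrable D f.
Proof. by move=> h; have := L2D_mul h (L2D_cst 1); under eq_fun do rewrite mulr1. Qed.

Definition ee k (x : R) : R[i] := cis (k%:~R * x).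

Lemma ee_L2D k : L2D (ee k). Proof. by apply: ccont_L2D; exact: ccont_cis. Qed.

Lemma eeD k l x : ee (k + l) x = ee k x * ee l x.
Proof. by rewrite /ee -cisD intrD mulrDl. Qed.

Lemma eeN k x : ee (- k) x = conjc (ee k x).
Proof. by rewrite /ee -cisN intrN mulNr. Qed.

Lemma ee0 x : ee 0 x = 1. Proof. by rewrite /ee mul0r cis0. Qed.

Lemma normc_ee k x : normc (ee k x) = 1. Proof. exact: normc_cis. Qed.

Lemma ee_periodic k x : ee k (x + 2 * pi) = ee k x.
Proof.
suff e n : ee n%:Z (x + 2 * pi) = ee n%:Z x.
  case: (intP k) => [|n|n]; first exact: e.
    exact: e.
  by rewrite !eeN e.
elim: n => [|n ih]; first by rewrite !ee0.
rewrite (_ : n.+1%:Z = n%:Z + 1); last by lia.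
rewrite !eeD ih; congr (_ * _); rewrite /ee !mul1r.
by rewrite /cis (_ : 2 * pi = pi *+ 2) ?mulr_natl// cosD2pi sinD2pi.
Qed.

Lemma cint_ee k : cintegral D (ee k) = if k == 0 then (2 * pi)%:C else 0.
Proof.
have p2 := ltW pi2_gt0.
case: eqP => [->|/eqP k0].
  rewrite /cintegral; under eq_Rintegral do rewrite ee0 /=.
  rewrite (rint_cst 1 p2); under eq_Rintegral do rewrite ee0 /=.
  by rewrite (rint_cst 0 p2) mul0r mul1r subr0.
have kR : (k%:~R : R) != 0 by rewrite intr_eq0.
rewrite (@cFTC2 _ 0 (2 * pi) (fun t => (0 +i* - (k%:~R)^-1) * ee k t) (ee k) p2).
- by rewrite -[2 * pi]add0r ee_periodic subrr.
- move=> t ?; apply: cder_eq (cderZ _ (cder_cis _ _)) _; rewrite mulrA -[RHS]mul1r; congr (_ * _).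
  by apply/eqP; rewrite eq_complex /= !mul0r ?mulr0 !add0r mulNr mulVf// opprK; apply/andP.
- exact: ccont_cis.
Qed.

Lemma fourierE f k : fourier f k = ((2 * pi)^-1)%:C * cintegral D (fun t => f t * ee (- k) t).
Proof. by rewrite /fourier; congr (_ * _); congr cintegral; apply/funext => t; rewrite /ee intrN mulNr. Qed.

Lemma cint_fourier f k : cintegral D (fun t => f t * ee k t) = (2 * pi)%:C * fourier f (- k).
Proof.
rewrite fourierE opprK mulrA -rmorphM mulfV ?mul1r//.
by rewrite gt_eqF// pi2_gt0.
Qed.

Lemma L2D_ee f k : L2D f -> cintegrable D (fun t => f t * ee k t).
Proof. by move=> h; exact: L2D_mul h (ee_L2D k). Qed.

Lemma fourierD f g k : L2D f -> L2D g ->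
  fourier (fun t => f t + g t) k = fourier f k + fourier g k.
Proof.
move=> hf hg; rewrite !fourierE -mulrDr; congr (_ * _).
rewrite -(cintD mD (L2D_ee _ hf) (L2D_ee _ hg)); congr cintegral.
by apply/funext => t; rewrite mulrDl.
Qed.

Lemma fourierZ c f k : L2D f -> fourier (fun t => c * f t) k = c * fourier f k.
Proof.
move=> hf; rewrite !fourierE mulrCA; congr (_ * _).
rewrite -(cintZ _ mD (L2D_ee _ hf)); congr cintegral.
by apply/funext => t; rewrite mulrA.
Qed.

Lemma fourierB f g k : L2D f -> L2D g ->
  fourier (fun t => f t - g t) k = fourier f k - fourier g k.
Proof.
move=> hf hg; rewrite fourierD//; last exact: L2DN.
have -> : (fun t => - g t) = (fun t => -1 * g t) by apply/funext => t; rewrite mulN1r.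
by rewrite fourierZ// mulN1r.
Qed.

Lemma fourier_ae f g k : cmeas D f -> cmeas D g -> {ae mu, forall t, D t -> f t = g t} ->
  fourier f k = fourier g k.
Proof.
move=> mf mg h; rewrite !fourierE; congr (_ * _).
have me : cmeas D (ee (- k)) by apply: ccont_meas mD _; exact: ccont_cis.
by apply: cint_ae mD _ _ _; [exact: cmeasM|exact: cmeasM|apply: aeS h => t h Dt; rewrite h].
Qed.

Lemma fourier_ee k l : fourier (ee k) l = if l == k then 1 else 0.
Proof.
rewrite fourierE (_ : (fun t => _) = ee (k - l)); last by apply/funext => t; rewrite -eeD.
rewrite cint_ee subr_eq0 eq_sym; case: eqP => _; last by rewrite mulr0.
by rewrite -rmorphM mulVf// gt_eqF// pi2_gt0.
Qed.

Lemma fourier_shift f k l : fourier (fun t => ee k t * f t) l = fourier f (l - k).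
Proof.
rewrite !fourierE; congr (_ * _); congr cintegral; apply/funext => t.
by rewrite opprB eeD; ring.
Qed.

End SquareIntegrable.

Section Fejer.
Context {R : realType}.
Local Notation mu := (@lebesgue_measure R).
Local Notation T := (measurableTypeR R).
Local Notation D := (@period R : set T).

Definition dir (n : nat) (x : R) : R[i] := \sum_(k < n.+1) ee k x.

(** The Fejer kernel, written as a square to be visibly nonnegative. *)
Definition fej (n : nat) (x : R) : R := n.+1%:R^-1 * sqmod (dir n x).

Lemma fej_ge0 n x : 0 <= fej n x.
Proof. by rewrite mulr_ge0 ?invr_ge0 ?sqmod_ge0. Qed.

Lemma dir_geom n x : (1 - ee 1 x) * dir n x = 1 - ee n.+1 x.
Proof.
rewrite /dir; elim: n => [|n ih]; first by rewrite big_ord_recr big_ord0 /= ee0 add0r mulr1.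
rewrite big_ord_recr /= mulrDr ih mulrBl mul1r -eeD.
by rewrite (_ : 1 + n.+1%:Z = n.+2); [ring|lia].
Qed.

Lemma fej_le n x kappa : 0 < kappa -> kappa <= 1 - cos x -> fej n x <= n.+1%:R^-1 * (2 / kappa).
Proof.
move=> k0 hk; rewrite /fej ler_wpM2l ?invr_ge0// ler_pdivlMr//.
have h := congr1 sqmod (dir_geom n x); rewrite sqmodM in h.
have e1 : sqmod (1 - ee 1 x) = 2 * (1 - cos x).
  by rewrite /sqmod /ee /= mul1r; have := cos2Dsin2 x; nra.
have e2 : sqmod (1 - ee n.+1 x) <= 4.
  rewrite sqmod_normc (_ : 4 = 2 ^+ 2); last by ring.
  rewrite ler_sqr_nneg ?normc_ge0//; apply: le_trans (le_normcB _ _) _.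
  by rewrite normc_ee normc1.
have := ler_wpM2r (sqmod_ge0 (dir n x)) hk; rewrite e1 in h; lra.
Qed.

Lemma fejE n x : (fej n x)%:C =
  (n.+1%:R^-1)%:C * \sum_(k < n.+1) \sum_(l < n.+1) ee (k%:Z - l%:Z) x.
Proof.
rewrite /fej rmorphM/= -sqmod_conjM /dir rmorph_sum/=; congr (_ * _).
rewrite mulr_suml; apply: eq_bigr => k _; rewrite mulr_sumr; apply: eq_bigr => l _.
by rewrite eeD eeN.
Qed.

Lemma cos_lt1 (x : R) : 0 < `|x| < 2 * pi -> cos x < 1.
Proof.
move=> /andP[x0 x2]; have -> : cos x = cos `|x| by case: (ger0P x) => _; rewrite ?cosN.
move: (`|x|) x0 x2 => y y0 y2.
have s0 : 0 < sin (y / 2) by apply: sin_gt0_pi; rewrite divr_gt0//= ltr_pdivrMr// mulrC.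
rewrite (_ : y = (y / 2) *+ 2); last by rewrite -mulr_natr mulfVK.
have := cos_mulr2n (y / 2); have := cos2Dsin2 (y / 2); have := exprn_gt0 2 s0.
by move=> h1 h2 ->; rewrite mulr2n; move: h1 h2; move: (cos _ ^+ 2) (sin _ ^+ 2) => p q; lra.
Qed.

Section Window.
Variables (c d : R).
Hypotheses (c0 : 0 <= c) (cd : c <= d) (d2 : d <= 2 * pi).

(** The Fejer mean of the indicator function of [c, d], up to a factor 2 pi. *)
Definition win n (x : R) : R := \int[mu]_(y in `[c, d]) fej n (x - y).

Lemma fej_cont n x : ccont (fun y => (fej n (x - y))%:C).
Proof.
under eq_fun do rewrite fejE.
apply: ccontM; first exact: ccont_cst.
apply: ccont_sum => k; apply: ccont_sum => l.
have -> : (fun y => ee (k%:Z - l%:Z) (x - y)) =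
    (fun y => ee (k%:Z - l%:Z) x * cis ((- (k%:Z - l%:Z)%:~R) * y)).
  by apply/funext => y; rewrite /ee mulrBr -mulNr cisD.
by apply: ccontM; [exact: ccont_cst|exact: ccont_cis].
Qed.

Lemma fej_I n x a b : rI `[a, b] (fun y => fej n (x - y)).
Proof. by have [] := ccont_I a b (fej_cont n x). Qed.

Lemma win_ge0 n x : 0 <= win n x.
Proof. by apply: Rintegral_ge0 => y _; exact: fej_ge0. Qed.

Definition winc (m : int) : R[i] := cintegral `[c, d] (fun y => ee (- m) y).

Lemma winE n x : (win n x)%:C = (n.+1%:R^-1)%:C *
  \sum_(k < n.+1) \sum_(l < n.+1) winc (k%:Z - l%:Z) * ee (k%:Z - l%:Z) x.
Proof.
have mcd : measurable (`[c, d] : set T) by exact: measurable_itv.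
have -> : (win n x)%:C = cintegral `[c, d] (fun y => (fej n (x - y))%:C).
  by rewrite /cintegral /= /win (rint_cst 0 cd) mul0r.
have Ie (m : int) : cintegrable `[c, d] (fun y => ee m x * ee (- m) y).
  by apply: ccont_I; apply: ccontM; [exact: ccont_cst|exact: ccont_cis].
have I1 (k : 'I_n.+1) : cintegrable `[c, d] (fun y => \sum_(l < n.+1)
    ee (k%:Z - l%:Z) x * ee (- (k%:Z - l%:Z)) y).
  by apply: cI_sum mcd _ => l.
rewrite (_ : (fun y => _) = fun y => (n.+1%:R^-1)%:C * \sum_(k < n.+1) \sum_(l < n.+1)
    ee (k%:Z - l%:Z) x * ee (- (k%:Z - l%:Z)) y); last first.
  apply/funext => y; rewrite fejE; congr (_ * _); apply: eq_bigr => k _; apply: eq_bigr => l _.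
  by rewrite /ee mulrBr cisD intrN mulNr.
rewrite (cintZ _ mcd); last exact: cI_sum mcd I1.
congr (_ * _); rewrite (cint_sum _ mcd I1); apply: eq_bigr => k _.
rewrite (cint_sum _ mcd (fun l => Ie _)); apply: eq_bigr => l _.
rewrite (cintZ _ mcd) 1?mulrC//.
by apply: ccont_I; exact: ccont_cis.
Qed.

Lemma win_le_far x : 0 < x < 2 * pi -> ~ (c <= x <= d) ->
  exists2 C : R, 0 <= C & forall n, win n x <= n.+1%:R^-1 * C.
Proof.
move=> /andP[x0 x2] xcd.
have cont : {within `[c, d], continuous (fun y => 1 - cos (x - y))}.
  apply: continuous_subspaceT => y; apply: cvgB; first exact: cvg_cst.
  apply: (@cvg_comp _ _ _ (fun y => x - y) cos); last exact: continuous_cos.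
  by apply: cvgB; [exact: cvg_cst|exact: cvg_id].
have [y ycd hy] := EVT_min cd cont.
set kappa := 1 - cos (x - y) in hy.
have k0 : 0 < kappa.
  rewrite subr_gt0; apply: cos_lt1; move: ycd; rewrite in_itv /= => /andP[y1 y2].
  have : x != y by apply/eqP => e; apply: xcd; rewrite e y1 y2.
  rewrite -subr_eq0 -normr_gt0 => ->/=.
  rewrite ltr_norml; apply/andP; split.
    rewrite ltrNl opprB ltrBlDr; apply: le_lt_trans (le_trans y2 d2) _.
    by rewrite ltrDl.
  by rewrite ltrBlDr (lt_le_trans x2)// lerDl (le_trans c0).
exists (2 / kappa * (d - c)); first by rewrite mulr_ge0 ?subr_ge0// divr_ge0// ltW.
move=> n; rewrite mulrA -(rint_cst _ cd); apply: le_Rintegral => //.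
- exact: fej_I.
- exact: rI_cst.
- by move=> z zcd; apply: fej_le => //; apply: hy; rewrite inE.
Qed.

End Window.

Lemma win_total n x : win 0 (2 * pi) n x = 2 * pi.
Proof.
have p2 := ltW (@pi2_gt0 R).
suff : (win 0 (2 * pi) n x)%:C = (2 * pi)%:C by case.
rewrite (winE p2) (eq_bigr (fun k : 'I_n.+1 => (2 * pi)%:C)); last first.
  move=> k _; rewrite (bigD1 k)//= /winc subrr oppr0 -/(@period R) cint_ee eqxx ee0 mulr1.
  rewrite big1 ?addr0// => l lk; rewrite cint_ee oppr_eq0 subr_eq0.
  by rewrite (_ : (_ == _) = false) ?mul0r//; apply/eqP => -[] h; move/eqP: lk; apply; apply/val_inj.
rewrite sumr_const card_ord -rmorphMn -rmorphM; congr (_%:C).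
by rewrite -(mulr_natl (2 * pi)) mulKf ?pnatr_eq0.
Qed.

Lemma win_split c d n x : 0 <= c -> c <= d -> d <= 2 * pi ->
  win 0 c n x + win c d n x + win d (2 * pi) n x = 2 * pi.
Proof.
move=> c0 cd d2; rewrite -[RHS](win_total n x) /win.
have add a b e : a <= b -> b <= e -> \int[mu]_(y in `[a, b]) fej n (x - y) +
    \int[mu]_(y in `[b, e]) fej n (x - y) = \int[mu]_(y in `[a, e]) fej n (x - y).
  move=> ab be; have h := @Rintegral_itvB _ (fun y => fej n (x - y)) (BLeft a) (BRight e) b.
  rewrite -(@Rintegral_itv_obnd_cbnd _ b (BRight e)); last first.
    by apply: rIS (fej_I n x a e) => // y /=; rewrite !in_itv /= => /andP[/ltW h1 ->]; rewrite (le_trans ab).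
  by rewrite -h ?bnd_simp//; [ring|exact: fej_I].
by rewrite (add _ _ _ c0 cd) (add _ _ _ (le_trans c0 cd) d2).
Qed.

Lemma invn_cvg0 (C : R) : n.+1%:R^-1 * C @[n --> \oo] --> (0 : R).
Proof.
rewrite -[X in _ --> X](mul0r C); apply: cvgMl.
have := @cvg_harmonic R; exact.
Qed.

Lemma win_far_cvg c d x : 0 <= c -> c <= d -> d <= 2 * pi -> 0 < x < 2 * pi -> ~ (c <= x <= d) ->
  win c d n x @[n --> \oo] --> (0 : R).
Proof.
move=> c0 cd d2 hx hcd; have [C C0 hC] := win_le_far c0 cd d2 hx hcd.
apply: (@squeeze_cvgr _ _ _ _ (fun=> 0) (fun n => n.+1%:R^-1 * C)).
- by near=> n; rewrite win_ge0 hC.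
- exact: cvg_cst.
- exact: invn_cvg0.
Unshelve. all: by end_near. Qed.

(** The windows of the two complementary intervals tend to 0, and the total is
    2 pi. *)
Lemma win_near_cvg c d x : 0 <= c -> d <= 2 * pi -> c < x < d ->
  win c d n x @[n --> \oo] --> (2 * pi : R).
Proof.
move=> c0 d2 /andP[cx xd]; have cd : c <= d by rewrite (le_trans (ltW cx))// ltW.
have -> : (fun n => win c d n x) = fun n => 2 * pi - win 0 c n x - win d (2 * pi) n x.
  by apply/funext => n; rewrite -[X in X - _ - _](win_split n x c0 cd d2); ring.
have x02 : 0 < x < 2 * pi by rewrite (le_lt_trans c0)//= (lt_le_trans xd).
rewrite -[X in _ --> X]subr0 -[X in _ --> X - _]subr0.
apply: cvgB; first apply: cvgB; first exact: cvg_cst.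
- apply: win_far_cvg => //; first by rewrite (le_trans cd).
  by move=> /andP[_ h]; move: (lt_le_trans cx h); rewrite ltxx.
- apply: win_far_cvg => //; first by rewrite (le_trans c0).
  by move=> /andP[h _]; move: (lt_le_trans xd h); rewrite ltxx.
Qed.

Lemma win_bound c d n x : 0 <= c -> c <= d -> d <= 2 * pi -> win c d n x <= 2 * pi.
Proof.
move=> c0 cd d2; rewrite -[leRHS](win_split n x c0 cd d2).
by have := win_ge0 0 c n x; have := win_ge0 d (2 * pi) n x; lra.
Qed.

End Fejer.

Section Completeness.
Context {R : realType}.
Local Notation mu := (@lebesgue_measure R).
Local Notation T := (measurableTypeR R).
Local Notation D := (@period R : set T).
Implicit Types (f g : R -> R[i]).

Lemma ae_neq (a : R) : {ae mu, forall t, t != a}.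
Proof.
exists [set a]; split; first exact: measurable_set1.
  exact: lebesgue_measure_set1.
by move=> t /= /negP; rewrite negbK => /eqP.
Qed.

Lemma rint_EFin (A : set T) (x : T -> R) : measurable A -> rI A x ->
  (\int[mu]_(t in A) (x t)%:E = (\int[mu]_(t in A) x t)%:E)%E.
Proof. by move=> mA h; rewrite /Rintegral fineK//; exact: integrable_fin_num. Qed.

Lemma win_meas c d n : c <= d -> measurable_fun D (fun t : T => win c d n t).
Proof.
move=> cd; have h : ccont (fun t => (win c d n t)%:C).
  under eq_fun do rewrite winE//.
  apply: ccontM; first exact: ccont_cst.
  apply: ccont_sum => k; apply: ccont_sum => l.
  by apply: ccontM; [exact: ccont_cst|exact: ccont_cis].
by have [] := ccont_meas mD h.
Qed.

Lemma rDCT (A : set T) (x_ : nat -> T -> R) (x y : T -> R) : measurable A ->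
  (forall n, measurable_fun A (x_ n)) -> measurable_fun A x ->
  {ae mu, forall t, A t -> x_ n t @[n --> \oo] --> x t} -> rI A y ->
  (forall n t, A t -> `|x_ n t| <= y t) ->
  rI A x /\ \int[mu]_(t in A) x_ n t @[n --> \oo] --> \int[mu]_(t in A) x t.
Proof.
move=> mA mx_ mx hc hy hb.
have Ix n : rI A (x_ n) by apply: rI_dom mA _ (hb n) hy.
have [] := @dominated_convergence _ _ _ mu A mA (fun n t => (x_ n t)%:E) (fun t => (x t)%:E)
  (fun t => (y t)%:E).
- by move=> n; apply/measurable_EFinP; exact: mx_.
- exact/measurable_EFinP.
- by apply: aeS hc => t h At; apply: cvg_EFin; [near=> n => //|exact: h].
- exact: hy.
- by apply: aeW => t n At; rewrite lee_fin; exact: hb.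
move=> Ix0 _ h; split=> //.
have e : [sequence (\int[mu]_(t in A) (x_ n t)%:E)%E]_n = (fun n => (\int[mu]_(t in A) x_ n t)%:E).
  by apply/funext => n /=; rewrite rint_EFin.
rewrite e (rint_EFin mA Ix0) in h; exact: (fine_cvg h).
Unshelve. all: by end_near. Qed.

(** The windows tend boundedly to 2 pi times the indicator function. *)
Lemma window_limit (g : T -> R) c d : rI D g -> 0 <= c -> c < d -> d <= 2 * pi ->
  (forall n, \int[mu]_(t in D) (g t * win c d n t) = 0) -> \int[mu]_(t in `[c, d]) g t = 0.
Proof.
move=> hg c0 cd d2 h0; have cd' := ltW cd.
have mg := rI_meas hg.
have mcd : measurable (`]c, d[%classic : set T) by exact: measurable_itv.
pose h := (fun t : T => g t * (2 * pi)) \_ (`]c, d[%classic : set T).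
have mh : measurable_fun D h.
  apply/(measurable_restrict _ mcd mD); apply: measurable_funM; last exact: measurable_cst.
  by apply: (measurable_funS mD _ mg); exact: subIsetl.
have [|||||_] := @rDCT D (fun n t => g t * win c d n t) h (fun t => 2 * pi * `|g t|) mD.
- by move=> n; apply: measurable_funM => //; exact: win_meas.
- exact: mh.
- have := aeI (aeI (ae_neq 0) (ae_neq (2 * pi))) (aeI (ae_neq c) (ae_neq d)).
  apply: aeS => t [[t0 t2] [tc td]]; rewrite /period /= in_itv /= => /andP[t0' t2'].
  have ht : 0 < t < 2 * pi by rewrite lt_neqAle eq_sym t0 t0' lt_neqAle t2 t2'.
  rewrite /h patchE; case: ifPn => [|/negP hcd].
    rewrite inE /= in_itv /= => tcd; apply: cvgMr; exact: win_near_cvg.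
  (* Restricted functions take the default value of R, which is 0. *)
  rewrite (_ : point = g t * 0); last by rewrite mulr0.
  apply: cvgMr; apply: win_far_cvg => // /andP[h1 h2].
  by apply: hcd; rewrite inE /= in_itv /= lt_neqAle eq_sym tc h1 lt_neqAle td h2.
- by apply: (rIZ _ mD); exact: integrable_norm.
- move=> n t _; rewrite normrM mulrC ler_wpM2r// ger0_norm ?win_ge0//.
  exact: win_bound.
under eq_fun do rewrite h0.
move=> /(cvg_unique (@Rhausdorff R) (cvg_cst _))/esym; rewrite /h -Rintegral_mkcondr.
rewrite (_ : D `&` _ = `]c, d[%classic); last first.
  rewrite setIidr// => t /=; rewrite !in_itv /= => /andP[h1 h2].
  by apply/andP; split; [exact: le_trans c0 (ltW h1)|exact: le_trans (ltW h2) d2].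
have gcd : rI (`[c, d] : set T) g.
  apply: rIS hg; [exact: mD|exact: measurable_itv|].
  move=> t /=; rewrite !in_itv /= => /andP[h1 h2].
  by apply/andP; split; [exact: le_trans c0 h1|exact: le_trans h2 d2].
have gco : rI (`]c, d[%classic : set T) g.
  by apply: rIS gcd; [exact: measurable_itv|exact: mcd|exact: subset_itv_oo_cc].
rewrite RintegralZr// => /eqP; rewrite mulf_eq0 (gt_eqF pi2_gt0) orbF => /eqP e.
have gcc : rI (`[c, d[%classic : set T) g.
  apply: rIS gcd; [exact: measurable_itv|exact: measurable_itv|].
  by move=> t /=; rewrite !in_itv /= => /andP[-> /ltW ->].
by rewrite -Rintegral_itv_bndo_bndc// -Rintegral_itv_obnd_cbnd.
Qed.

Lemma fourier0_window f c d : L2D f -> (forall k, fourier f k = 0) ->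
  0 <= c -> c < d -> d <= 2 * pi -> cintegral `[c, d] f = 0.
Proof.
move=> hf hk c0 cd d2; have cd' := ltW cd.
have h n : cintegral D (fun t => f t * (win c d n t)%:C) = 0.
  have If (m : int) : cintegrable D (fun t => winc c d m * (f t * ee m t)).
    by apply: cIZ mD _; exact: L2D_ee.
  have I1 (k : 'I_n.+1) : cintegrable D (fun t => \sum_(l < n.+1)
      winc c d (k%:Z - l%:Z) * (f t * ee (k%:Z - l%:Z) t)).
    by apply: cI_sum mD _ => l.
  rewrite (_ : (fun t => _) = fun t => (n.+1%:R^-1)%:C * \sum_(k < n.+1) \sum_(l < n.+1)
      winc c d (k%:Z - l%:Z) * (f t * ee (k%:Z - l%:Z) t)); last first.
    apply/funext => t; rewrite winE// mulrCA; congr (_ * _); rewrite mulr_sumr.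
    apply: eq_bigr => k _; rewrite mulr_sumr; apply: eq_bigr => l _; by rewrite mulrCA.
  rewrite (cintZ _ mD); last exact: cI_sum mD I1.
  rewrite (cint_sum _ mD I1) big1 ?mulr0// => k _.
  rewrite (cint_sum _ mD (fun l => If _)) big1// => l _.
  by rewrite (cintZ _ mD (L2D_ee _ hf)) cint_fourier hk !mulr0.
have [h1 h2] := L2D_int hf.
rewrite /cintegral (@window_limit (fun t => complex.Re (f t)))//.
  rewrite (@window_limit (fun t => complex.Im (f t)))// => n.
  transitivity (complex.Im (cintegral D (fun t => f t * (win c d n t)%:C))); last by rewrite h.
  by rewrite /cintegral; apply: eq_Rintegral => t _; rewrite cImM /= mulr0 add0r.
move=> n; transitivity (complex.Re (cintegral D (fun t => f t * (win c d n t)%:C))); last by rewrite h.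
by rewrite /cintegral; apply: eq_Rintegral => t _; rewrite cReM /= mulr0 subr0.
Qed.

(** By Lebesgue's differentiation theorem. *)
Lemma ae_zero (g : T -> R) : rI D g ->
  (forall d, 0 < d -> d <= 2 * pi -> \int[mu]_(t in `[0, d]) g t = 0) ->
  {ae mu, forall t, D t -> g t = 0}.
Proof.
move=> hg h0; pose gD := g \_ D.
have gi y : mu.-integrable [set` Interval (BLeft 0) (BRight y)] (EFin \o gD).
  have : mu.-integrable setT (EFin \o gD).
    by rewrite -restrict_EFin; apply/(integrable_mkcond _ mD).
  by apply: integrableS => //; exact: measurable_itv.
have := FTC1 gi (integrable_locally mD hg).
move=> h; have := aeI h (aeI (ae_neq 0) (ae_neq (2 * pi))).
apply: aeS => t [ht [t0 t2]] Dt; move: (Dt); rewrite /period /= in_itv /= => /andP[t0' t2'].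
have tp : 0 < t by rewrite lt_neqAle eq_sym t0 t0'.
have tl : t < 2 * pi by rewrite lt_neqAle t2 t2'.
have [_] := ht (tp : (0%:E < t%:E)%E).
rewrite /gD patchE mem_set// => <-.
rewrite derive1E (@near_eq_derive _ _ _ _ (fun=> 0)) ?derive_cst//.
near=> s; have s0 : 0 < s by near: s; exact: lt_nbhsr.
have s2 : s < 2 * pi by near: s; exact: lt_nbhsl.
rewrite -[RHS](h0 s s0 (ltW s2)); apply: eq_Rintegral => r; rewrite inE /= in_itv /= => /andP[r0 rs].
by rewrite patchE mem_set//= /period /= in_itv /= r0 (le_trans rs (ltW s2)).
Unshelve. all: by end_near. Qed.

Lemma negligible_shift (A : set T) (s : R) : mu.-negligible A ->
  mu.-negligible ((fun t : T => t + s : T) @^-1` A).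
Proof.
move=> [B [mB B0 AB]].
have ms : measurable_fun setT (fun t : T => t + s : T).
  apply: continuous_measurable_fun => t; apply: cvgD; [exact: cvg_id|exact: cvg_cst].
exists ((fun t : T => t + s : T) @^-1` B); split.
- by rewrite -[X in measurable X]setTI; exact: ms.
- have e : pushforward mu (fun t : T => t + s : T) B = mu B.
    apply/esym/lebesgue_measure_unique => //= _ [[a b]] _ <-.
    rewrite /pushforward.
    have -> : (fun t : T => t + s : T) @^-1` `]a, b]%classic = `]a - s, b - s]%classic.
      by apply/seteqP; split => t /=; rewrite !in_itv /= ltrBlDr lerBrDr.
    rewrite !lebesgue_measure_itv /= !lte_fin ltrD2r -!EFinD; case: ifP => // _.
    by congr (_%:E); ring.
  by rewrite -[LHS]/(pushforward mu (fun t : T => t + s : T) B) e.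
- by move=> t /= /AB.
Qed.

(** The line is covered by countably many translates of a period. *)
Lemma ae_periodic (P : R -> Prop) : (forall t, P (t + 2 * pi) <-> P t) ->
  {ae mu, forall t : T, D t -> P t} -> {ae mu, forall t : T, P t}.
Proof.
move=> hP h.
have Pn n t : P (t + n%:R * (2 * pi)) <-> P t.
  elim: n => [|n ih]; first by rewrite mul0r addr0.
  by rewrite -natr1 mulrDl mul1r addrA hP.
have hs (s : R) : {ae mu, forall t : T, D (t + s) -> P (t + s)}.
  exact: (negligible_shift s h).
have h1 := ae_foralln (fun n : nat => hs (n%:R * (2 * pi))).
have h2 := ae_foralln (fun n : nat => hs (- (n%:R * (2 * pi)))).
have := aeI h1 h2; apply: aeS => t [g1 g2].
have p2 := @pi2_gt0 R; have pn0 := gt_eqF p2.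
pose k := Num.floor (t / (2 * pi)).
have /andP[k1 k2] : k%:~R <= t / (2 * pi) < (k + 1)%:~R by exact: floor_itv.
have Dk : D (t - k%:~R * (2 * pi)).
  rewrite /period /= in_itv /= subr_ge0 -ler_pdivlMr// k1 /=.
  rewrite lerBlDl -[X in _ + X]mul1r -mulrDl -ler_pdivrMr//.
  by move: k2; rewrite intrD => /ltW.
case: (intP k) Dk => [|n|n] Dk.
- by move: (g1 0%N); rewrite mul0r addr0; apply; move: Dk; rewrite mul0r subr0.
- have := g2 n.+1 Dk; rewrite -(Pn n.+1) subrK; exact.
- have := g1 n.+1; rewrite Pn; apply; move: Dk.
  by rewrite intrN mulNr opprK.
Qed.

(** The difference is orthogonal to the exponentials, hence to the windows, so
    its integrals over intervals vanish. *)
Theorem fourier_complete f g : L2T f -> L2T g -> (forall k, fourier f k = fourier g k) -> eqae f g.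
Proof.
move=> hf hg h; have Lf := L2T_L2D hf; have Lg := L2T_L2D hg.
have Lfg := L2DB Lf Lg; have [h1 h2] := L2D_int Lfg.
have h0 k : fourier (fun t => f t - g t) k = 0 by rewrite fourierB// h subrr.
have c0 d : 0 < d -> d <= 2 * pi -> cintegral `[0, d] (fun t => f t - g t) = 0.
  exact: fourier0_window.
apply: ae_periodic.
  by move=> t; have [-> _ _ _] := hf; have [-> _ _ _] := hg.
have z1 : {ae mu, forall t : T, D t -> complex.Re (f t - g t) = 0}.
  apply: (@ae_zero (fun t => complex.Re (f t - g t)) h1) => d d0 d2.
  exact: (congr1 (fun z : R[i] => complex.Re z) (c0 d d0 d2)).
have z2 : {ae mu, forall t : T, D t -> complex.Im (f t - g t) = 0}.
  apply: (@ae_zero (fun t => complex.Im (f t - g t)) h2) => d d0 d2.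
  exact: (congr1 (fun z : R[i] => complex.Im z) (c0 d d0 d2)).
have := aeI z1 z2; apply: aeS => t [a1 a2] Dt.
apply/eqP; rewrite -subr_eq0 eq_complex; apply/andP; split; apply/eqP; [exact: a1|exact: a2].
Qed.

End Completeness.

(** * Fourier series *)

Section Series.
Context {R : realType}.
Local Notation mu := (@lebesgue_measure R).
Local Notation T := (measurableTypeR R).
Local Notation D := (@period R : set T).
Implicit Types (f g : R -> R[i]) (c : int -> R[i]) (K L : nat).

Definition trig (r : seq int) c (x : R) : R[i] := \sum_(n <- r) c n * ee n x.

Lemma trig_cont r c : ccont (trig r c).
Proof. by apply: ccont_sum => n; apply: ccontM; [exact: ccont_cst|exact: ccont_cis]. Qed.

Lemma trig_L2D r c : L2D (trig r c). Proof. exact: ccont_L2D (trig_cont r c). Qed.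

Lemma trig_periodic r c x : trig r c (x + 2 * pi) = trig r c x.
Proof. by apply: eq_bigr => n _; rewrite ee_periodic. Qed.

Lemma fourier_trig r c k : uniq r -> fourier (trig r c) k = if k \in r then c k else 0.
Proof.
move=> ur; rewrite fourierE.
have Ie n : cintegrable D (fun t => c n * (ee n t * ee (- k) t)).
  by apply: (cIZ _ mD); apply: L2D_ee; exact: ee_L2D.
rewrite (_ : (fun t => _) = fun t => \sum_(n <- r) c n * (ee n t * ee (- k) t)); last first.
  by apply/funext => t; rewrite /trig mulr_suml; apply: eq_bigr => n _; rewrite mulrA.
rewrite (cint_sum _ mD Ie) mulr_sumr -big_pick//; apply: eq_bigr => n _.
rewrite (cintZ _ mD (L2D_ee _ (ee_L2D n))) cint_fourier opprK fourier_ee mulrCA.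
have p0 : ((2 * pi)^-1)%:C * (2 * pi)%:C = 1 :> R[i] by rewrite -rmorphM/= mulVf ?gt_eqF ?pi2_gt0.
rewrite [((2 * pi)^-1)%:C * (_ * _)]mulrA p0 mul1r eq_sym.
by case: eqP => [->|_]; rewrite ?mulr1 ?mulr0.
Qed.

Lemma L2D_conj f g : L2D f -> L2D g -> cintegrable D (fun t => f t * conjc (g t)).
Proof. by move=> hf hg; apply: L2D_mul => //; exact: L2DJ. Qed.

Lemma cint_trig f r c : L2D f ->
  cintegral D (fun t => f t * conjc (trig r c t)) = (2 * pi)%:C * \sum_(n <- r) fourier f n * conjc (c n).
Proof.
move=> hf; have Ie n : cintegrable D (fun t => conjc (c n) * (f t * ee (- n) t)).
  by apply: (cIZ _ mD); exact: L2D_ee.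
rewrite (_ : (fun t => _) = fun t => \sum_(n <- r) conjc (c n) * (f t * ee (- n) t)); last first.
  apply/funext => t; rewrite /trig rmorph_sum/= mulr_sumr; apply: eq_bigr => n _.
  by rewrite cJM eeN mulrCA.
rewrite (cint_sum _ mD Ie) mulr_sumr; apply: eq_bigr => n _.
by rewrite (cintZ _ mD (L2D_ee _ hf)) cint_fourier opprK; ring.
Qed.

Lemma rint_sqmod f : \int[mu]_(t in D) sqmod (f t) =
  complex.Re (cintegral D (fun t => f t * conjc (f t))).
Proof. by rewrite /cintegral /=; apply: eq_Rintegral => t _; rewrite sqmod_conjM. Qed.

Lemma rint_trig r c : uniq r ->
  \int[mu]_(t in D) sqmod (trig r c t) = 2 * pi * \sum_(n <- r) sqmod (c n).
Proof.
move=> ur; rewrite rint_sqmod (cint_trig _ _ (trig_L2D r c)) big_seq.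
rewrite (eq_bigr (fun n => (sqmod (c n))%:C)); last first.
  by move=> n nr; rewrite fourier_trig// nr sqmod_conjM.
by rewrite -big_seq -rmorph_sum -rmorphM.
Qed.

Lemma rint_ge0 f : 0 <= \int[mu]_(t in D) sqmod (f t).
Proof. by apply: Rintegral_ge0 => t _; exact: sqmod_ge0. Qed.

(** Bessel's inequality: the distance to a partial sum is nonnegative. *)
Lemma bessel f : L2D f ->
  l2b w1 (fourier f) (Num.sqrt ((2 * pi)^-1 * \int[mu]_(t in D) sqmod (f t))).
Proof.
move=> hf; have p2 := @pi2_gt0 R; split; first exact: sqrtr_ge0.
rewrite sqr_sqrtr; last by rewrite mulr_ge0 ?rint_ge0// invr_ge0 ltW.
move=> r ur; rewrite (eq_bigr (fun n => sqmod (fourier f n))); last by move=> n _; rewrite /w1 mul1r.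
rewrite mulrC ler_pdivlMr// mulrC; set s := \sum_(n <- r) _.
pose g := trig r (fourier f); have hg : L2D g by exact: trig_L2D.
have e1 : complex.Re (cintegral D (fun t => f t * conjc (g t))) = 2 * pi * s.
  rewrite cint_trig// (eq_bigr (fun n => (sqmod (fourier f n))%:C)) => [|n _]; last by rewrite sqmod_conjM.
  by rewrite -rmorph_sum -rmorphM.
have e2 : \int[mu]_(t in D) sqmod (g t) = 2 * pi * s by rewrite rint_trig.
have := rint_ge0 (fun t => f t - g t).
have [_ I1] := hf; have [_ I2] := hg; have [I3 _] := L2D_conj hf hg.
have -> : \int[mu]_(t in D) sqmod (f t - g t) = \int[mu]_(t in D) sqmod (f t) +
    (-2) * (2 * pi * s) + 2 * pi * s.
  rewrite -{1}e1 -{1}e2 /cintegral /= -(RintegralZl (-2) mD I3).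
  rewrite -RintegralD//; [|exact: mD|exact: (rIZ _ mD)].
  rewrite -RintegralD//; [|exact: mD|by apply: rID mD _ _ => //; exact: (rIZ _ mD)].
  apply: eq_Rintegral => t _; rewrite /sqmod cReD cImD cReN cImN cReM cReJ cImJ; ring.
lra.
Qed.

Definition tailb c K (eps : R) : Prop :=
  bsum (fun n => if (K < `|n|)%N then sqmod (c n) else 0) eps.

Lemma tailb_ex c B eps : l2b w1 c B -> 0 < eps -> exists K, tailb c K eps.
Proof.
move=> [_ hc] e0; have [r ur hr] := bsum_small_tail hc e0.
have [K hK] := sub_zbox r; exists K => s us.
rewrite -big_mkcond -big_filter; apply: le_trans (hr [seq n <- s | (K < `|n|)%N] _ _).
- by apply: ler_sum => n _; rewrite /w1 mul1r.
- exact: filter_uniq.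
- by move=> n; rewrite mem_filter => /andP[nK _]; apply/negP => /hK; rewrite mem_zbox leqNgt nK.
Qed.

Lemma tailb_mono c K L eps : (K <= L)%N -> tailb c K eps -> tailb c L eps.
Proof.
move=> KL; apply: bsum_le => n; case: ifP => h; last by case: ifP => _; rewrite ?sqmod_ge0.
by rewrite (leq_ltn_trans KL h).
Qed.

Lemma tailb_l2 c B K : l2b w1 c B -> tailb c K (B ^+ 2).
Proof.
by move=> [_ h]; apply: bsum_le h => n; rewrite /w1 mul1r; case: ifP => _; rewrite ?sqmod_ge0.
Qed.

Lemma trig_diff c K L x : (K <= L)%N -> trig (zbox L) c x - trig (zbox K) c x =
  trig (zbox L) (fun n => if (K < `|n|)%N then c n else 0) x.
Proof.
move=> KL; rewrite /trig.
have -> : \sum_(n <- zbox K) c n * ee n x = \sum_(n <- zbox L) if (K < `|n|)%N then 0 else c n * ee n x.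
  rewrite -(@big_uniq_widen _ _ (zbox K) (zbox L)) ?uniq_zbox//.
  - by rewrite big_seq [RHS]big_seq; apply: eq_bigr => n; rewrite mem_zbox ltnNge => ->.
  - by move=> n; rewrite !mem_zbox => h; exact: leq_trans KL.
  - by move=> n; rewrite mem_zbox -ltnNge => ->.
rewrite -sumrB; apply: eq_bigr => n _; case: ifP => _; first by rewrite subr0.
by rewrite subrr mul0r.
Qed.

Lemma rint_trig_diff c K L eps : (K <= L)%N -> tailb c K eps ->
  \int[mu]_(t in D) sqmod (trig (zbox L) c t - trig (zbox K) c t) <= 2 * pi * eps.
Proof.
move=> KL hc; under eq_Rintegral do rewrite trig_diff//.
rewrite rint_trig ?uniq_zbox// ler_wpM2l ?(ltW pi2_gt0)//.
apply: le_trans (hc _ (uniq_zbox L)); apply: ler_sum => n _.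
by case: ifP => _; rewrite ?sqmod0.
Qed.

(** Monotone convergence. *)
Lemma series_majorant (x_ : nat -> T -> R) B : (forall j, rI D (x_ j)) ->
  (forall j t, 0 <= x_ j t) -> (forall m, \sum_(0 <= j < m) \int[mu]_(t in D) x_ j t <= B) ->
  exists2 h : T -> R, rI D h &
    {ae mu, forall t, D t -> forall m, \sum_(0 <= j < m) x_ j t <= h t}.
Proof.
move=> Ix x0 hB; pose H (t : T) : \bar R := (\sum_(0 <= j <oo) (x_ j t)%:E)%E.
have H0 t : (0 <= H t)%E by apply: nneseries_ge0 => j _ _; rewrite lee_fin.
have mx j : measurable_fun D (EFin \o x_ j) by apply/measurable_EFinP; exact: rI_meas.
have mH : measurable_fun D H.
  apply: (emeasurable_fun_cvg (fun m t => (\sum_(0 <= j < m) (x_ j t)%:E)%E)).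
    by move=> m; apply: emeasurable_sum => j; exact: mx.
  by move=> t _; apply: is_cvg_ereal_nneg_natsum => j _; rewrite lee_fin.
have IH : mu.-integrable D H.
  apply/integrableP; split=> //.
  under eq_integral do rewrite gee0_abs//.
  rewrite /H integral_nneseries//; [|exact: mD|by move=> j t _; rewrite lee_fin].
  apply: (@le_lt_trans _ _ B%:E); last exact: ltry.
  apply: lime_le; first by apply: is_cvg_ereal_nneg_natsum => j _; apply: integral_ge0 => t _; rewrite lee_fin.
  near=> m; rewrite (eq_bigr (fun j => (\int[mu]_(t in D) x_ j t)%:E)) => [|j _]; last first.
    by rewrite rint_EFin//; exact: mD.
  by rewrite sumEFin lee_fin.
exists (fun t => fine (H t)).
  apply: (le_integrable mD _ _ IH).
    apply/measurable_EFinP; apply: (@measurableT_comp _ _ _ _ _ _ fine _ H) => //.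
  by move=> t _ /=; case: (H t) => [r| |] //=; rewrite ?normr0 ?leey.
have := integrable_ae mD IH; apply: aeS => t hf Dt m.
have := @nneseries_lim_ge R (fun j => (x_ j t)%:E) xpredT 0 m (fun j _ _ => x0 j t : (0%:E <= (x_ j t)%:E)%E).
rewrite -/(H t) -(fineK (hf Dt)) /= sumEFin lee_fin; exact.
Unshelve. all: by end_near. Qed.

End Series.

Section SeriesLimits.
Context {R : realType}.
Local Notation mu := (@lebesgue_measure R).
Local Notation T := (measurableTypeR R).
Local Notation D := (@period R : set T).
Implicit Types (f g : R -> R[i]) (c : int -> R[i]) (K L : nat) (B : R).

Definition serr B K : R := B * Num.sqrt (4 / K.+1%:R).

Lemma serr_ge0 B K : 0 <= B -> 0 <= serr B K.
Proof. by move=> B0; rewrite mulr_ge0// sqrtr_ge0. Qed.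

Lemma serr_cvg0 B : serr B K @[K --> \oo] --> (0 : R).
Proof. by rewrite -(mulr0 B); apply: cvgMr; exact: sqrt_div_cvg0. Qed.

(** Cauchy--Schwarz against the inverse weights. *)
Lemma sum_normc_tail c B K : l2b w c B ->
  bsum (fun n => if (K < `|n|)%N then normc (c n) else 0) (serr B K).
Proof.
move=> [B0 hc] r ur.
pose x n := Num.sqrt (w n) * normc (c n).
pose y (n : int) := if (K < `|n|)%N then (Num.sqrt (w n))^-1 else 0 : R.
have w0 n : 0 < Num.sqrt (w n : R) by rewrite sqrtr_gt0 w_gt0.
have -> : \sum_(n <- r) (if (K < `|n|)%N then normc (c n) else 0) = \sum_(n <- r) x n * y n.
  apply: eq_bigr => n _; rewrite /x /y; case: ifP => _; last by rewrite mulr0.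
  by rewrite mulrAC mulfV ?gt_eqF// mul1r.
apply: le_trans (ler_norm _) _; rewrite -sqrtr_sqr -[leRHS]ger0_norm ?serr_ge0// -sqrtr_sqr ler_wsqrtr//.
rewrite /serr exprMn sqr_sqrtr ?divr_ge0//; apply: CauchySchwarz_bsum => //.
  by apply: bsum_le hc => n; rewrite /x exprMn sqr_sqrtr ?w_ge0// sqmod_normc.
rewrite (_ : 4 / _ = 2 * (2 / K.+1%:R)); last by rewrite mulrA -natrM.
apply: bsum_le (bsumZ _ (bsum_iJ_tail K)) => // n; rewrite /y.
case: ifP => _; last by rewrite expr0n/= mulr0.
by rewrite exprVn sqr_sqrtr ?w_ge0// iw_le.
Qed.

Lemma trig_diff_le c B K L x : l2b w c B -> (K <= L)%N ->
  normc (trig (zbox L) c x - trig (zbox K) c x) <= serr B K.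
Proof.
move=> hc KL; rewrite trig_diff//; apply: le_trans (normc_sum _ _ _) _.
apply: le_trans (sum_normc_tail K hc (uniq_zbox L)); apply: ler_sum => n _.
by rewrite normcM normc_ee mulr1; case: ifP => _; rewrite ?normc0.
Qed.

(** The continuous representative of an element of H^1: its Fourier series,
    which converges uniformly. *)
Definition ser c (x : R) : R[i] := climn (fun K => trig (zbox K) c x).

Lemma ser_ccvg c B x : l2b w c B -> ccvg \oo (fun K => trig (zbox K) c x) (ser c x).
Proof.
move=> hc; apply: (@climnP _ _ (serr B)); last exact: serr_cvg0.
by move=> K L KL; exact: trig_diff_le.
Qed.

Lemma ser_err c B K x : l2b w c B -> normc (ser c x - trig (zbox K) c x) <= serr B K.
Proof.
move=> hc; apply: (@ccvg_normc_le _ _ \oo _ (fun L => trig (zbox L) c x - trig (zbox K) c x)).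
  by apply: ccvgD; [exact: ser_ccvg hc|exact: ccvg_cst].
by exists K => // L; exact: trig_diff_le.
Qed.

Lemma ser_le c B x : l2b w c B -> normc (ser c x) <= 3 * B.
Proof.
move=> hc; have B0 := l2b_ge0 hc.
rewrite -(subrK (trig (zbox 0) c x) (ser c x)).
apply: le_trans (le_normcD _ _) _.
have h1 := ser_err 0 x hc; have h2 : normc (trig (zbox 0) c x) <= B.
  rewrite /trig /= big_seq1 normcM normc_ee mulr1.
  by apply: l2b_term1 hc; rewrite lerDl sqr_ge0.
move: h1; rewrite /serr divr1 (_ : 4 = 2 ^+ 2 :> R); last by rewrite -natrX.
by rewrite sqrtr_sqr ger0_norm//; lra.
Qed.

Lemma ser_cont c B : l2b w c B -> ccont (ser c).
Proof.
move=> hc; apply: ccontP => t; apply: ccvgP => e e0.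
have /cvgr0Pnorm_le/(_ _ (divr_gt0 e0 (ltr0n _ 3))) [K _ hK] := serr_cvg0 B.
have {}hK : serr B K <= e / 3 by apply: le_trans (ler_norm _) _; exact: hK (leqnn K).
have : \forall s \near nbhs t, normc (trig (zbox K) c s - trig (zbox K) c t) <= e / 3.
  by apply: ccvg_near; [exact: ccont_cvg (trig_cont _ _)|exact: divr_gt0].
apply: filterS => s hs.
rewrite (_ : ser c s - ser c t = (ser c s - trig (zbox K) c s) - (ser c t - trig (zbox K) c t) +
   (trig (zbox K) c s - trig (zbox K) c t)); last by ring.
apply: le_trans (le_normcD _ _) _; apply: le_trans (lerD (le_normcB _ _) hs) _.
have h1 := ser_err K s hc; have h2 := ser_err K t hc; lra.
Qed.

Lemma ser_periodic c x : ser c (x + 2 * pi) = ser c x.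
Proof. by rewrite /ser; congr climn; apply/funext => K; exact: trig_periodic. Qed.

Lemma L2T_cont f : (forall x, f (x + 2 * pi) = f x) -> ccont f -> L2T f.
Proof.
move=> hp hf; apply: L2T_ofL2D => //; [exact: ccont_meas measurableT hf|exact: ccont_L2D].
Qed.

Lemma ser_L2T c B : l2b w c B -> L2T (ser c).
Proof. by move=> hc; apply: L2T_cont; [exact: ser_periodic|exact: ser_cont hc]. Qed.

Lemma rint_D_cst (a : R) : \int[mu]_(t in D) a = 2 * pi * a.
Proof. by rewrite rint_cst ?(ltW pi2_gt0)// subr0 mulrC. Qed.

Lemma rI_D_cst (a : R) : rI D (fun=> a). Proof. exact: rI_cst. Qed.

Lemma fourier_close f g e k : L2D f -> L2D g -> 0 <= e ->
  \int[mu]_(t in D) sqmod (f t - g t) <= 2 * pi * e ^+ 2 ->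
  normc (fourier f k - fourier g k) <= e.
Proof.
move=> hf hg e0 h; rewrite -fourierB//.
apply: le_trans (l2b_term1 (lexx _) (bessel (L2DB hf hg)) : _ <= _) _.
rewrite -(ger0_norm e0) -sqrtr_sqr ler_wsqrtr// ler_pdivrMl ?pi2_gt0//.
Qed.

Lemma fourier_ser c B k : l2b w c B -> fourier (ser c) k = c k.
Proof.
move=> hc; have B0 := l2b_ge0 hc; apply/eqP; rewrite -subr_eq0; apply/eqP; apply: normc_eps => e e0.
have /cvgr0Pnorm_le/(_ _ e0) [K0 _ hK] := serr_cvg0 B.
pose K := maxn K0 `|k|%N.
have {}hK : serr B K <= e by apply: le_trans (ler_norm _) _; apply: hK; exact: leq_maxl.
rewrite (_ : c k = fourier (trig (zbox K) c) k); last by rewrite fourier_trig ?uniq_zbox// mem_zbox leq_maxr.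
have hs := L2T_L2D (ser_L2T hc).
apply: le_trans hK; apply: fourier_close => //; [exact: trig_L2D|exact: serr_ge0|].
rewrite -rint_D_cst; apply: le_Rintegral mD _ (rI_D_cst _) _.
  by have [] := L2DB hs (trig_L2D (zbox K) c).
by move=> t _; rewrite sqmod_normc ler_sqr_nneg ?normc_ge0//; exact: ser_err.
Qed.

Lemma rI_dom_ae (x y : T -> R) : measurable_fun D x -> rI D y ->
  (forall t, 0 <= x t) -> {ae mu, forall t, D t -> x t <= y t} ->
  rI D x /\ \int[mu]_(t in D) x t <= \int[mu]_(t in D) y t.
Proof.
move=> mx hy x0 h.
have ha : rI D (fun t => `|y t|).
  by have := integrable_abse hy; congr (_.-integrable _ _).
have hI : (\int[mu]_(t in D) (x t)%:E <= \int[mu]_(t in D) (`|y t|)%:E)%E.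
  apply: ae_ge0_le_integral => //.
  - exact: mD.
  - by move=> t _; rewrite lee_fin.
  - exact/measurable_EFinP.
  - by apply/measurable_EFinP; exact: rI_meas ha.
  - by apply: aeS h => t h Dt; rewrite lee_fin; apply: le_trans (h Dt) (ler_norm _).
have hx : rI D x.
  apply/integrableP; split; first exact/measurable_EFinP.
  under eq_integral do rewrite /= ger0_norm//.
  by apply: le_lt_trans hI _; rewrite (rint_EFin mD ha) ltry.
split=> //; rewrite -lee_fin -(rint_EFin mD hx) -(rint_EFin mD hy).
have e : (\int[mu]_(t in D) (`|y t|)%:E = \int[mu]_(t in D) (y t)%:E)%E.
  apply: ae_eq_integral => //; try exact: mD; try by apply/measurable_EFinP; apply: rI_meas.
  by apply: aeS h => t h Dt; rewrite ger0_norm// (le_trans _ (h Dt)).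
by rewrite -e.
Qed.

Lemma sqmodD_le (y z : R[i]) : sqmod (y + z) <= 2 * sqmod y + 2 * sqmod z.
Proof.
rewrite /sqmod cReD cImD; have := sqr_ge0 (complex.Re y - complex.Re z).
have := sqr_ge0 (complex.Im y - complex.Im z); nra.
Qed.

Lemma fine_limn_esup (u : nat -> R) l : u j @[j --> \oo] --> l ->
  fine (limn_esup (fun j => (u j)%:E)) = l.
Proof.
move=> h; have hE : (u j)%:E @[j --> \oo] --> l%:E.
  by apply: cvg_EFin; [near=> j => //|exact: h].
by rewrite is_cvg_limn_esupE; [rewrite (cvg_lim _ hE)|exact: cvgP hE].
Unshelve. all: by end_near. Qed.

Lemma lacunary c B : l2b w1 c B -> exists K_ : nat -> nat,
  [/\ forall i j, (i <= j)%N -> (K_ i <= K_ j)%N, forall j, (j <= K_ j)%N &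
      forall j, tailb c (K_ j) (16^-1 ^+ j)].
Proof.
move=> hc; have /choice[k hk] : forall j : nat, exists K, tailb c K (16^-1 ^+ j).
  by move=> j; apply: tailb_ex hc _; rewrite exprn_gt0// invr_gt0.
exists (fun j => \sum_(i < j.+1) k i + j)%N; split=> [i j ij|j|j].
- apply: leq_add => //; rewrite -!(big_mkord xpredT k) /index_iota !subn0.
  by rewrite -(subnKC ij) -addSn iotaD big_cat /= leq_addr.
- exact: leq_addl.
- by apply: tailb_mono (hk j); rewrite big_ord_recr /= addnAC leq_addl.
Qed.

(** Along a lacunary sequence of partial sums, 4^j times the squared increments
    have summable integrals, hence an integrable sum h; so the increments are
    at most 2^-j sqrt(h) almost everywhere, and the limit g is approached at
    the same rate, which gives the convergence in L^2 as well. The upper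
    limit provides a measurable and periodic representative. *)
Lemma riesz_fischer c B : l2b w1 c B -> exists g, [/\ L2T g, forall k, fourier g k = c k &
  forall K eps, tailb c K eps -> \int[mu]_(t in D) sqmod (g t - trig (zbox K) c t) <= 4 * pi * eps].
Proof.
move=> hc; have [K_ [Kmono Kj Kt]] := lacunary hc; have p2 := @pi2_gt0 R.
pose P j := trig (zbox (K_ j)) c.
pose x_ j (t : T) := 4 ^+ j * sqmod (P j.+1 t - P j t).
have PL j : L2D (P j) by exact: trig_L2D.
have Ix j : rI D (x_ j) by apply: rIZ mD _; have [] := L2DB (PL j.+1) (PL j).
have [h hI hx] : exists2 h : T -> R, rI D h &
    {ae mu, forall t, D t -> forall m, \sum_(0 <= j < m) x_ j t <= h t}.
  apply: (series_majorant (B := 2 * pi * 2)) => // [j t|m].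
    by rewrite mulr_ge0 ?sqmod_ge0// exprn_ge0.
  have q m' : \sum_(0 <= j < m') (4^-1 : R) ^+ j = 4 / 3 * (1 - 4^-1 ^+ m').
    elim: m' => [|m' ih]; first by rewrite big_geq// expr0 subrr mulr0.
    by rewrite big_nat_recr//= ih exprS; field.
  apply: (@le_trans _ _ (\sum_(0 <= j < m) 2 * pi * 4^-1 ^+ j)).
    apply: ler_sum => j _; rewrite /x_ (RintegralZl _ mD); last by have [] := L2DB (PL j.+1) (PL j).
    apply: le_trans (ler_wpM2l (exprn_ge0 _ _) (rint_trig_diff (Kmono _ _ (leqnSn j)) (Kt j))) _ => //.
    by rewrite mulrCA -exprMn (_ : 4 * 16^-1 = 4^-1)//; field.
  rewrite -mulr_sumr q ler_wpM2l ?ltW//.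
  have : 0 <= (4^-1 : R) ^+ m by rewrite exprn_ge0// invr_ge0.
  lra.
have h0 : {ae mu, forall t, D t -> 0 <= h t}.
  by apply: aeS hx => t hx Dt; have := hx Dt 0%N; rewrite big_geq.
have hP : {ae mu, forall t, D t -> forall i m, (i <= m)%N ->
    normc (P m t - P i t) <= 2 * Num.sqrt (h t) * (2^-1 ^+ i - 2^-1 ^+ m)}.
  apply: aeS (aeI hx h0) => t [hx' h0'] Dt i m im; have {}hx' := hx' Dt; have {}h0' := h0' Dt.
  have step j : normc (P j.+1 t - P j t) <= Num.sqrt (h t) * 2^-1 ^+ j.
    apply: normc_le_sqmod; first by rewrite mulr_ge0 ?sqrtr_ge0// exprn_ge0// invr_ge0.
    rewrite exprMn sqr_sqrtr// -exprM mulnC exprM.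
    have -> : ((2^-1 : R) ^+ 2) = 4^-1 by rewrite exprVn -natrX.
    rewrite exprVn ler_pdivlMr ?exprn_gt0// mulrC.
    apply: le_trans (hx' j.+1); rewrite big_nat_recr//= lerDr sumr_ge0// => k _.
    by rewrite mulr_ge0 ?sqmod_ge0// exprn_ge0.
  elim: m im => [|m ih]; first by rewrite leqn0 => /eqP->; rewrite !subrr mulr0 normc0.
  rewrite leq_eqVlt => /predU1P[->|]; first by rewrite !subrr mulr0 normc0.
  rewrite ltnS => im; rewrite -(subrKA (P m t)).
  apply: le_trans (le_normcD _ _) _; apply: le_trans (lerD (step m) (ih im)) _ .
  have -> : (2^-1 : R) ^+ m.+1 = 2^-1 * 2^-1 ^+ m by rewrite exprS.
  lra.
pose g x := fine (limn_esup (fun j => (complex.Re (P j x))%:E)) +i*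
            fine (limn_esup (fun j => (complex.Im (P j x))%:E)).
have gP : {ae mu, forall t, D t -> forall i,
    normc (g t - P i t) <= 2 * Num.sqrt (h t) * 2^-1 ^+ i}.
  apply: aeS (aeI hP h0) => t [hP' h0'] Dt i; have {}hP' := hP' Dt; have {}h0' := h0' Dt.
  have s0 := sqrtr_ge0 (h t).
  have hb' i' m : (i' <= m)%N -> normc (P m t - P i' t) <= 2 * Num.sqrt (h t) * 2^-1 ^+ i'.
    move=> im; apply: le_trans (hP' _ _ im) _; rewrite ler_wpM2l ?mulr_ge0//.
    by rewrite gerBl exprn_ge0// invr_ge0.
  have hc' : ccvg \oo (fun j => P j t) (climn (fun j => P j t)).
    apply: (climnP hb'); rewrite -(mulr0 (2 * Num.sqrt (h t))); apply: cvgMr.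
    by apply: cvg_expr; rewrite ger0_norm ?invr_ge0// invf_lt1// ltr1n.
  have -> : g t = climn (fun j => P j t).
    rewrite /g; congr (_ +i* _).
      exact: fine_limn_esup hc'.1.
    exact: fine_limn_esup hc'.2.
  apply: (@ccvg_normc_le _ _ \oo _ (fun m => P m t - P i t)).
    by apply: ccvgD; [exact: hc'|exact: ccvg_cst].
  by exists i => // m; exact: hb'.
have mg : cmeas setT g.
  split; apply: (@measurableT_comp _ _ _ _ _ _ fine) => //; apply: measurable_fun_limn_esup => j;
    apply/measurable_EFinP; have [] := ccont_meas measurableT (trig_cont (zbox (K_ j)) c) => //.
have mgD : cmeas D g := cmeasS measurableT (@subsetT _ _) mg.
pose e j := 4 * 4^-1 ^+ j * \int[mu]_(t in D) h t.
have gI j : rI D (fun t => sqmod (g t - P j t)) /\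
    \int[mu]_(t in D) sqmod (g t - P j t) <= e j.
  rewrite /e -(RintegralZl _ mD hI); apply: rI_dom_ae.
  - by apply: meas_sqmod; apply: cmeasB => //; have [] := PL j.
  - exact: rIZ mD hI.
  - by move=> t; exact: sqmod_ge0.
  apply: aeS (aeI gP h0) => t [gP' h0'] Dt; rewrite sqmod_normc.
  apply: le_trans (_ : (2 * Num.sqrt (h t) * 2^-1 ^+ j) ^+ 2 <= _).
    by rewrite ler_sqr_nneg ?normc_ge0//; exact: gP'.
  rewrite !exprMn sqr_sqrtr ?h0'// -exprM mulnC exprM.
  have -> : ((2^-1 : R) ^+ 2) = 4^-1 by rewrite exprVn -natrX.
  by rewrite -natrX mulrAC lexx.
have e0 : e j @[j --> \oo] --> (0 : R).
  rewrite -(mul0r (\int[mu]_(t in D) h t)); apply: cvgMl; rewrite -(mulr0 4); apply: cvgMr.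
  by apply: cvg_expr; rewrite ger0_norm ?invr_ge0// invf_lt1// ltr1n.
have gL : L2D g.
  have hB : L2D (fun t => g t - P 0%N t).
    by split; [apply: cmeasB => //; have [] := PL 0%N|have [] := gI 0%N].
  have := L2DD hB (PL 0%N); by under eq_fun do rewrite subrK.
have gT : L2T g.
  apply: L2T_ofL2D => // x; rewrite /g.
  by congr (fine _ +i* fine _); congr limn_esup; apply/funext => j; rewrite /P trig_periodic.
exists g; split=> // [k|K eps hK].
- apply/eqP; rewrite -subr_eq0; apply/eqP; apply: normc_eps => d d0.
  have d1 : 0 < 2 * pi * d ^+ 2 by rewrite mulr_gt0// exprn_gt0.
  have /cvgr0Pnorm_le/(_ _ d1) [j0 _ hj] := e0.
  pose j := maxn j0 `|k|%N.
  have {}hj : e j <= 2 * pi * d ^+ 2 by apply: le_trans (ler_norm _) _; apply: hj; exact: leq_maxl.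
  rewrite (_ : c k = fourier (P j) k); last first.
    rewrite fourier_trig ?uniq_zbox// mem_zbox (leq_trans (leq_maxr j0 _) (Kj j))//.
  apply: fourier_close => //; [exact: ltW|by apply: le_trans hj; have [] := gI j].
- apply/ler_addgt0Pr => d d0.
  have d1 : 0 < d / 2 by rewrite divr_gt0.
  have /cvgr0Pnorm_le/(_ _ d1) [j0 _ hj] := e0.
  pose j := maxn j0 K.
  have {}hj : e j <= d / 2 by apply: le_trans (ler_norm _) _; apply: hj; exact: leq_maxl.
  have KK : (K <= K_ j)%N by apply: leq_trans (Kj j); exact: leq_maxr.
  have [i1 i2] := gI j; have i3 := rint_trig_diff KK hK.
  have [_ i4] := L2DB (PL j) (trig_L2D (zbox K) c).
  apply: (@le_trans _ _ (\int[mu]_(t in D) (2 * sqmod (g t - P j t) + 2 * sqmod (P j t - trig (zbox K) c t)))).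
    apply: le_Rintegral mD _ _ _.
    - by have [] := L2DB gL (trig_L2D (zbox K) c).
    - by apply: rID mD _ _; exact: rIZ mD _.
    by move=> t _; rewrite -(subrKA (P j t)) sqmodD_le.
  rewrite RintegralD//; [|exact: mD|exact: rIZ mD i1|exact: rIZ mD i4].
  rewrite !RintegralZl//; try exact: mD.
  apply: le_trans (lerD (ler_wpM2l (ler0n _ 2) (le_trans i2 hj)) (ler_wpM2l (ler0n _ 2) i3)) _.
  by rewrite le_eqVlt (_ : 2 * (d / 2) + _ = 4 * pi * eps + d) ?eqxx//; field.
Qed.

End SeriesLimits.

(** * The Sobolev norm, Fourier multipliers and the nonlinearity *)

Section Interface.
Context {R : realType}.
Local Notation mu := (@lebesgue_measure R).
Local Notation T := (measurableTypeR R).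
Local Notation D := (@period R : set T).
Implicit Types (f g u v : R -> R[i]) (c : int -> R[i]) (K L : nat) (B : R).

Lemma fsbig_EFin (r : seq int) (x : int -> R) : uniq r ->
  (\sum_(k \in [set` r]) (x k)%:E = (\sum_(k <- r) x k)%:E)%E.
Proof. by move=> ur; rewrite -fsbig_seq// sumEFin. Qed.

Lemma H1_l2b f : (H1sqnorm f < +oo)%E -> l2b w (fourier f) (H1norm f).
Proof.
move=> h; have h0 : (0 <= H1sqnorm f)%E.
  by apply: esum_ge0 => k _; rewrite lee_fin mulr_ge0 ?sqmod_ge0//; exact: w_ge0.
split; first exact: sqrtr_ge0.
rewrite /H1norm sqr_sqrtr ?fine_ge0// => r ur.
rewrite -lee_fin fineK; last by rewrite ge0_fin_numE.
rewrite -(fsbig_EFin _ ur); apply: esum_ge; exists [set` r] => //.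
by split=> //; exact: finite_seq.
Qed.

Lemma l2b_H1 f B : l2b w (fourier f) B -> (H1sqnorm f < +oo)%E /\ H1norm f <= B.
Proof.
move=> [B0 h].
have hE : (H1sqnorm f <= (B ^+ 2)%:E)%E.
  apply: ge_ereal_sup => _ /= [A [fA _]] <-; have [r e] := (finite_seqP _).1 fA.
  have {e} -> : A = [set` undup r] by rewrite e; apply/seteqP; split=> k /=; rewrite mem_undup.
  by rewrite (fsbig_EFin _ (undup_uniq _)) lee_fin; apply: h; exact: undup_uniq.
have hl : (H1sqnorm f < +oo)%E by apply: le_lt_trans hE (ltry _).
have h0 : (0 <= H1sqnorm f)%E.
  by apply: esum_ge0 => k _; rewrite lee_fin mulr_ge0 ?sqmod_ge0//; exact: w_ge0.
split=> //; rewrite /H1norm -(ger0_norm B0) -sqrtr_sqr ler_wsqrtr//.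
by rewrite -lee_fin fineK// ge0_fin_numE.
Qed.

Lemma H1norm_ge0 f : 0 <= H1norm f. Proof. exact: sqrtr_ge0. Qed.

Lemma multiplier_spec m f B : l2b w1 (fun k => m k * fourier f k) B ->
  L2T (fourier_multiplier m f) /\
  forall k, fourier (fourier_multiplier m f) k = m k * fourier f k.
Proof.
move=> h; have [g [g1 g2 _]] := riesz_fischer h.
exact: (xgetPex (fun=> 0) (ex_intro (fun g => L2T g /\ forall k, fourier g k = m k * fourier f k) g (conj g1 g2))).
Qed.

Lemma deriv_spec f B : l2b w (fourier f) B -> L2T (deriv_x f) /\
  forall k, fourier (deriv_x f) k = (0 +i* k%:~R) * fourier f k.
Proof.
move=> h; apply: (multiplier_spec (B := B)); apply: l2b_le h => n.
rewrite /w1 mul1r sqmodM ler_wpM2r ?sqmod_ge0// /sqmod/= expr0n/= add0r /w lerDr//.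
Qed.

Lemma linear_group_spec q gamma t f : L2T f -> L2T (linear_group q gamma t f) /\
  forall k, fourier (linear_group q gamma t f) k =
    cis (t * phi (q / 2) (gamma / 2) k) * fourier f k.
Proof.
move=> hf; have hb := bessel (L2T_L2D hf).
have [h1 h2] : L2T (linear_group q gamma t f) /\
    forall k, fourier (linear_group q gamma t f) k =
    cis (t * ((gamma * k%:~R ^+ 3 - q * k%:~R ^+ 2) / 2)) * fourier f k.
  apply: (multiplier_spec (B := Num.sqrt ((2 * pi)^-1 * \int[mu]_(t in D) sqmod (f t)))).
  by apply: l2b_le hb => n; rewrite /w1 !mul1r sqmodM sqmod_cis mul1r.
split=> // k; rewrite h2; congr (cis (t * _) * _); by rewrite /phi; field.
Qed.

Lemma cmeas_L2T f : L2T f -> cmeas setT f. Proof. by case. Qed.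

Lemma ser_ae f B : L2T f -> l2b w (fourier f) B -> eqae f (ser (fourier f)).
Proof.
move=> hf h; apply: fourier_complete => //; first exact: ser_L2T h.
by move=> k; rewrite (fourier_ser _ h).
Qed.

Lemma L2D_ae f g : cmeas D f -> L2D g -> {ae mu, forall t : T, f t = g t} -> L2D f.
Proof.
move=> mf [mg hg] h; split=> //.
have [] := @rI_dom_ae R (fun t => sqmod (f t)) _ (meas_sqmod mf) hg; last by [].
  by move=> t; exact: sqmod_ge0.
by apply: aeS h => t -> _.
Qed.

(** By completeness, any function agrees with the one of [riesz_fischer]. *)
Lemma L2_rate f K eps : L2T f -> tailb (fourier f) K eps ->
  \int[mu]_(t in D) sqmod (f t - trig (zbox K) (fourier f) t) <= 4 * pi * eps.
Proof.
move=> hf hK; have [g [g1 g2 g3]] := riesz_fischer (bessel (L2T_L2D hf)).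
have fg : eqae f g by apply: fourier_complete => // k; rewrite g2.
have Lt := trig_L2D (zbox K) (fourier f).
rewrite (@rint_ae _ _ _ (fun t => sqmod (g t - trig (zbox K) (fourier f) t)) mD).
- exact: g3.
- by have [_ /rI_meas] := L2DB (L2T_L2D hf) Lt.
- by have [_ /rI_meas] := L2DB (L2T_L2D g1) Lt.
- by apply: aeS fg => t ->.
Qed.

Lemma L2_energy f B : L2T f -> l2b w1 (fourier f) B ->
  \int[mu]_(t in D) sqmod (f t) <= 12 * pi * B ^+ 2.
Proof.
move=> hf hB; have B0 := l2b_ge0 hB; have Lf := L2T_L2D hf.
have Lt := trig_L2D (zbox 0) (fourier f); have [_ i1] := L2DB Lf Lt; have [_ i2] := Lt.
have h1 := L2_rate hf (tailb_l2 0 hB).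
have h2 : \int[mu]_(t in D) sqmod (trig (zbox 0) (fourier f) t) <= 2 * pi * B ^+ 2.
  rewrite rint_trig ?uniq_zbox// ler_wpM2l ?(ltW pi2_gt0)//.
  have [_ hb] := hB; apply: le_trans (hb _ (uniq_zbox 0)); apply: ler_sum => n _.
  by rewrite /w1 mul1r.
apply: (@le_trans _ _ (\int[mu]_(t in D) (2 * sqmod (f t - trig (zbox 0) (fourier f) t) +
    2 * sqmod (trig (zbox 0) (fourier f) t)))).
  apply: le_Rintegral mD _ _ _.
  - by have [] := Lf.
  - by apply: rID mD _ _; exact: rIZ mD _.
  by move=> t _; rewrite -{1}(subrK (trig (zbox 0) (fourier f) t) (f t)) sqmodD_le.
rewrite RintegralD//; [|exact: mD|exact: rIZ mD i1|exact: rIZ mD i2].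
rewrite !RintegralZl//; try exact: mD.
apply: le_trans (lerD (ler_wpM2l (ler0n _ 2) h1) (ler_wpM2l (ler0n _ 2) h2)) _.
by rewrite le_eqVlt (_ : _ + _ = 12 * pi * B ^+ 2) ?eqxx//; ring.
Qed.

(** Cauchy--Schwarz up to a constant, by 2 x y <= (e/a) x^2 + (a/e) y^2. *)
Lemma L2inner_le f g a e : L2D f -> L2D g -> 0 < a -> 0 < e ->
  \int[mu]_(t in D) sqmod (f t) <= a ^+ 2 -> \int[mu]_(t in D) sqmod (g t) <= e ^+ 2 ->
  normc (L2inner f g) <= 2 * a * e.
Proof.
move=> hf hg a0 e0 ha he; have [_ i1] := hf; have [_ i2] := hg.
apply: (le_trans (cint_le mD (L2D_conj hf hg) (y := fun t => e / a / 2 * sqmod (f t) + a / e / 2 * sqmod (g t)) _ _)).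
- by apply: rID mD _ _; exact: rIZ mD _.
- move=> t _; rewrite normcM normcJ' !sqmod_normc.
  set x := normc (f t); set y := normc (g t).
  have -> : x * y = e / a / 2 * x ^+ 2 + a / e / 2 * y ^+ 2 - (2 * a * e)^-1 * (e * x - a * y) ^+ 2.
    by field; rewrite !gt_eqF.
  by rewrite gerBl mulr_ge0 ?sqr_ge0// invr_ge0 !mulr_ge0// ltW.
rewrite RintegralD//; [|exact: mD|exact: rIZ mD i1|exact: rIZ mD i2].
rewrite !RintegralZl//; try exact: mD.
have p1 : 0 <= e / a / 2 by rewrite !divr_ge0// ltW.
have p2 : 0 <= a / e / 2 by rewrite !divr_ge0// ltW.
apply: le_trans (ler_wpM2l (ler0n _ 2) (lerD (ler_wpM2l p1 ha) (ler_wpM2l p2 he))) _.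
rewrite [leLHS](_ : _ = 2 * a * e)//; field; by rewrite !gt_eqF.
Qed.

End Interface.

Section NonlinearTerm.
Context {R : realType}.
Local Notation mu := (@lebesgue_measure R).
Local Notation T := (measurableTypeR R).
Local Notation D := (@period R : set T).
Local Notation state := (bool -> int -> R[i]).
Variables (alpha beta : R).
Implicit Types (c : int -> R[i]) (K : nat).

Definition coefs (f g : R -> R[i]) : state := fun j => if j then fourier g else fourier f.

(** Exchanging the two components exchanges the two equations. *)
Lemma Ncub_swap (U : state) n :
  Ncub alpha beta (fun j => U (~~ j)) false n = Ncub alpha beta U true n.
Proof. by rewrite /Ncub; congr climn; apply/funext => K; rewrite /cub addrC. Qed.

Lemma fourier_sum (I : Type) (r : seq I) (F : I -> R -> R[i]) k : (forall i, L2D (F i)) ->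
  fourier (fun t => \sum_(i <- r) F i t) k = \sum_(i <- r) fourier (F i) k.
Proof.
move=> h; rewrite fourierE; under [X in cintegral _ X]eq_fun do rewrite mulr_suml.
rewrite (cint_sum _ mD) => [|i]; last exact: L2D_ee.
by rewrite mulr_sumr; apply: eq_bigr => i _; rewrite fourierE.
Qed.

Definition dens (p q : R -> R[i]) x : R := sqmod (p x) + sqmod (q x).

Lemma densE p q x : (dens p q x)%:C = p x * conjc (p x) + q x * conjc (q x).
Proof. by rewrite /dens rmorphD/= !sqmod_conjM. Qed.

Lemma dens_le p q x M : normc (p x) <= M -> normc (q x) <= M ->
  normc (dens p q x)%:C <= 2 * M ^+ 2.
Proof.
move=> h1 h2; have M0 := le_trans (normc_ge0 _) h1.
rewrite normc_real ger0_norm; last by rewrite addr_ge0 ?sqmod_ge0.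
rewrite /dens !sqmod_normc mulr_natl mulr2n.
by apply: lerD; rewrite ler_sqr_nneg ?normc_ge0.
Qed.

Lemma dens_trig (U : state) K x :
  (dens (trig (zbox K) (U false)) (trig (zbox K) (U true)) x)%:C =
  \sum_(p <- box K) rr U U p.1 p.2 * ee (p.1 - p.2) x.
Proof.
have e c : (sqmod (trig (zbox K) c x))%:C =
    \sum_(p <- box K) c p.1 * conjc (c p.2) * ee (p.1 - p.2) x.
  rewrite -sqmod_conjM {2}/trig rmorph_sum /trig big_box mulr_suml; apply: eq_bigr => m _.
  by rewrite mulr_sumr; apply: eq_bigr => n _ /=; rewrite cJM eeD eeN; ring.
rewrite /dens rmorphD/= !e -big_split/=; apply: eq_bigr => p _; rewrite /rr; ring.
Qed.

Lemma sqmod_diff (y z : R[i]) M e : normc y <= M -> normc z <= M -> normc (y - z) <= e ->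
  `|sqmod y - sqmod z| <= 2 * M * e.
Proof.
move=> hy hz he; rewrite !sqmod_normc subr_sqr normrM mulrC; apply: ler_pM => //.
  rewrite ger0_norm ?addr_ge0 ?normc_ge0//; lra.
apply: le_trans he; rewrite ler_norml; apply/andP; split.
  have := le_normcD (z - y) y; rewrite subrK normcB; lra.
have := le_normcD (y - z) z; rewrite subrK; lra.
Qed.

Lemma trig_le c B K x : l2b w c B -> normc (trig (zbox K) c x) <= 5 * B.
Proof.
move=> hc; have B0 := l2b_ge0 hc; rewrite -[trig _ _ _](subKr (ser c x)).
apply: le_trans (le_normcB _ _) _; have h1 := ser_le x hc; have h2 := ser_err K x hc.
have h3 : serr B K <= 2 * B.
  rewrite /serr mulrC ler_wpM2r// -[leRHS]ger0_norm// -sqrtr_sqr ler_wsqrtr//.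
  rewrite ler_pdivrMr// -natrX ler_peMr// ler1n//.
lra.
Qed.

Variables (u z : R -> R[i]) (B : R).
Hypotheses (Lu : L2T u) (Lz : L2T z).
Hypotheses (hu : l2b w (fourier u) B) (hz : l2b w (fourier z) B).
Let U := coefs u z.
Let v x : R[i] := (0 +i* alpha) * u x + (- beta%:C) * deriv_x u x.
Let rho := dens (ser (U false)) (ser (U true)).

Let hbU : hb U B. Proof. by case. Qed.

Let Lv : L2D v.
Proof. by have [/L2T_L2D h _] := deriv_spec hu; apply: L2DD; apply: L2DZ => //; exact: L2T_L2D. Qed.

Let fv k : fourier v k = symb alpha beta k * fourier u k.
Proof.
have [/L2T_L2D h1 h2] := deriv_spec hu; have h3 := L2T_L2D Lu.
rewrite fourierD; [|exact: L2DZ|exact: L2DZ].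
rewrite !fourierZ// h2 mulrA -mulrDl; congr (_ * _).
by apply/eqP; rewrite eq_complex /=; apply/andP; split; apply/eqP; ring.
Qed.

Let fdens K k : fourier (fun x => (dens (trig (zbox K) (U false)) (trig (zbox K) (U true)) x)%:C * v x) k =
  cub (ka0 alpha beta) U U U false (box K) k.
Proof.
under [X in fourier X]eq_fun do rewrite dens_trig mulr_suml.
have Lp (p : int * int) : L2D (fun x => ee (p.1 - p.2) x * v x).
  by apply: (@L2DM _ _ _ 1) => [|x _|//]; [exact: ccont_meas mD (ccont_cis _)|rewrite normc_ee].
rewrite fourier_sum => [|p]; last by under eq_fun do rewrite -mulrA; exact: L2DZ.
rewrite cubE; apply: eq_bigr => p _.
under [X in fourier X]eq_fun do rewrite -mulrA.
rewrite fourierZ// fourier_shift fv /ka0 opprB addrA (addrAC k).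
by rewrite /U /coefs; ring.
Qed.

Let rho_err K x : `|rho x - dens (trig (zbox K) (U false)) (trig (zbox K) (U true)) x| <= 20 * B * serr B K.
Proof.
have B0 := l2b_ge0 hu.
have h j : `|sqmod (ser (U j) x) - sqmod (trig (zbox K) (U j) x)| <= 2 * (5 * B) * serr B K.
  apply: sqmod_diff; [|exact: trig_le (hbU j)|exact: ser_err (hbU j)].
  by apply: le_trans (ser_le x (hbU j)) _; lra.
rewrite /rho /dens opprD addrACA; apply: le_trans (ler_normD _ _) _.
apply: le_trans (lerD (h false) (h true)) _; lra.
Qed.

Let rho_cont : ccont (fun x => (rho x)%:C).
Proof.
have c j : ccont (ser (U j)) by exact: ser_cont (hbU j).
rewrite /rho; under eq_fun do rewrite densE.
by apply: ccontD; apply: ccontM => //; exact: ccontJ.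
Qed.

Let rho_le x : normc (rho x)%:C <= 18 * B ^+ 2.
Proof.
rewrite (_ : 18 * B ^+ 2 = 2 * (3 * B) ^+ 2); last by ring.
by apply: dens_le; [exact: ser_le (hbU false)|exact: ser_le (hbU true)].
Qed.

Let Lrv : L2D (fun x => (rho x)%:C * v x).
Proof. by apply: L2DM Lv; [exact: ccont_meas mD rho_cont|move=> x _; exact: rho_le]. Qed.

Let frv k : fourier (fun x => (rho x)%:C * v x) k = Ncub alpha beta U false k.
Proof.
have B0 := l2b_ge0 hu; have p2 := @pi2_gt0 R.
apply: (ccvg_unique (F := \oo) _ (Ncub_cvg alpha beta false k hbU)).
under eq_fun do rewrite -fdens.
have [_ iv] := Lv; set A := \int[mu]_(t in D) sqmod (v t).
have A0 : 0 <= A by exact: rint_ge0.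
pose M := Num.sqrt ((2 * pi)^-1 * A).
pose e K := M * (20 * B * serr B K).
have e0 K : 0 <= e K by rewrite mulr_ge0 ?sqrtr_ge0// !mulr_ge0// serr_ge0.
have hK K : normc (fourier (fun x => (dens (trig (zbox K) (U false)) (trig (zbox K) (U true)) x)%:C * v x) k -
    fourier (fun x => (rho x)%:C * v x) k) <= e K.
  have cd : ccont (fun x => (dens (trig (zbox K) (U false)) (trig (zbox K) (U true)) x)%:C).
    under eq_fun do rewrite dens_trig; apply: ccont_sum => p.
    by apply: ccontM; [exact: ccont_cst|exact: ccont_cis].
  have Ld : L2D (fun x => (dens (trig (zbox K) (U false)) (trig (zbox K) (U true)) x)%:C * v x).
    apply: (L2DM (M := 50 * B ^+ 2)) Lv; first exact: ccont_meas mD cd.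
    move=> x _; rewrite (_ : 50 * B ^+ 2 = 2 * (5 * B) ^+ 2); last by ring.
    by apply: dens_le; [exact: trig_le (hbU false)|exact: trig_le (hbU true)].
  rewrite normcB; apply: fourier_close => //.
  rewrite /e exprMn sqr_sqrtr; last by rewrite mulr_ge0// invr_ge0 ltW.
  rewrite mulrA (mulrA (2 * pi)) mulfV ?gt_eqF// mul1r mulrC -(RintegralZl _ mD iv).
  apply: le_Rintegral mD _ (rIZ _ mD iv) _.
    by have [] := L2DB Lrv Ld.
  move=> x _; rewrite -mulrBl sqmodM ler_wpM2r ?sqmod_ge0// -rmorphB sqmod_real -real_normK ?num_real//.
  by rewrite ler_sqr_nneg ?normr_ge0//; exact: rho_err.
apply: ccvgP => d d0.
have h0 : e K @[K --> \oo] --> (0 : R).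
  rewrite -(mulr0 M); apply: cvgMr; rewrite -(mulr0 (20 * B)); apply: cvgMr; exact: serr_cvg0.
have /cvgr0Pnorm_le/(_ _ d0) := h0; apply: filterS => K.
by move=> h; apply: le_trans (hK K) (le_trans (ler_norm _) h).
Qed.

(** The nonlinearity is 2i rho v, with v of coefficients symb(k) times those
    of u, and rho = |u|^2 + |w|^2. The density of the partial sums is a
    trigonometric polynomial, and its product with v has the truncated cubic
    sums as coefficients; it tends uniformly to rho. *)
Lemma nonlinearity_spec : L2T (nonlinearity alpha beta u z) /\
  forall k, fourier (nonlinearity alpha beta u z) k = (0 +i* 2) * Ncub alpha beta U false k.
Proof.
set F := nonlinearity _ _ _ _; have [Lx _] := deriv_spec hu.
pose F' x := (0 +i* 2) * ((rho x)%:C * v x).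
have FE x : F x = (0 +i* 2) * ((dens u z x)%:C * v x).
  rewrite /F /nonlinearity /v /dens; set r := (_ + _)%:C.
  have e1 : (0 +i* 2 : R[i]) = 2 * (0 +i* 1).
    by apply/eqP; rewrite eq_complex /=; apply/andP; split; apply/eqP; ring.
  have e2 : (0 +i* alpha : R[i]) = (0 +i* 1) * alpha%:C.
    by apply/eqP; rewrite eq_complex /=; apply/andP; split; apply/eqP; ring.
  have e3 : (0 +i* 1 : R[i]) * (0 +i* 1) = -1.
    by apply/eqP; rewrite eq_complex /=; apply/andP; split; apply/eqP; ring.
  rewrite e1 e2; transitivity (- 2 * (0 +i* 1) * beta%:C * r * deriv_x u x +
    2 * ((0 +i* 1) * (0 +i* 1)) * alpha%:C * u x * r); last by ring.
  by rewrite e3; ring.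
have FF' : eqae F F'.
  have hu' := ser_ae Lu hu; have hz' := ser_ae Lz hz.
  by apply: aeS (aeI hu' hz') => x [e1 e2]; rewrite FE /F' /rho /dens e1 e2.
have LF' : L2D F' by exact: L2DZ.
have mF : cmeas setT F.
  rewrite (_ : F = fun x => (0 +i* 2) * ((dens u z x)%:C * v x)); last by apply/funext.
  have [mu' mz mx] := And3 (cmeas_L2T Lu) (cmeas_L2T Lz) (cmeas_L2T Lx).
  apply: cmeasM; first exact: cmeas_cst.
  apply: cmeasM.
    apply: cmeas_real => //; apply: measurable_funD => //; exact: meas_sqmod.
  by apply: cmeasD; apply: cmeasM => //; exact: cmeas_cst.
have mFD : cmeas D F := cmeasS measurableT (@subsetT _ _) mF.
have LF : L2D F := L2D_ae mFD LF' FF'.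
split=> [|k].
  apply: L2T_ofL2D => // x; rewrite /F /nonlinearity.
  by have [-> _ _ _] := Lu; have [-> _ _ _] := Lz; have [-> _ _ _] := Lx.
rewrite (@fourier_ae _ F F')//; [|by have [] := LF'|by apply: aeS FF' => x ->].
by rewrite fourierZ// frv.
Qed.

End NonlinearTerm.

(** * The Duhamel formula and the equations of the coefficients *)

Section Duhamel.
Context {R : realType}.
Local Notation mu := (@lebesgue_measure R).
Local Notation T := (measurableTypeR R).
Local Notation D := (@period R : set T).
Implicit Types (f g h : R -> R[i]) (c : int -> R[i]) (K : nat).

Lemma L2TZ (c : R[i]) f : L2T f -> L2T (fun x => c * f x).
Proof.
move=> hf; apply: L2T_ofL2D; first by move=> x; have [-> _ _ _] := hf.
  by apply: cmeasM; [exact: cmeas_cst|exact: cmeas_L2T].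
by apply: L2DZ; exact: L2T_L2D.
Qed.

Lemma L2TB f g : L2T f -> L2T g -> L2T (fun x => f x - g x).
Proof.
move=> hf hg; apply: L2T_ofL2D; first by move=> x; have [-> _ _ _] := hf; have [-> _ _ _] := hg.
  by apply: cmeasB; exact: cmeas_L2T.
by apply: L2DB; exact: L2T_L2D.
Qed.

Lemma normc_close (x x' y y' : R[i]) (a b d : R) : normc (x - y) <= a -> normc (x' - y') <= b ->
  normc (y - y') <= d -> normc (x - x') <= a + b + d.
Proof.
move=> h1 h2 h3; have -> : x - x' = (x - y) - (x' - y') + (y - y') by ring.
apply: le_trans (le_normcD _ _) _; apply: lerD h3.
by apply: le_trans (le_normcB _ _) _; exact: lerD.
Qed.

Lemma L2inner_trig f r c : L2T f -> L2inner f (trig r c) =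
  (2 * pi)%:C * \sum_(n <- r) fourier f n * conjc (c n).
Proof. by move=> /L2T_L2D; exact: cint_trig. Qed.

Lemma L2inner_approx h e : L2T h -> 0 < e -> exists K, forall f a, L2T f -> 0 < a ->
  \int[mu]_(t in D) sqmod (f t) <= a ^+ 2 ->
  normc (L2inner f h - L2inner f (trig (zbox K) (fourier h))) <= 2 * a * e.
Proof.
move=> Lh e0; have p0 : 0 < 4 * pi :> R by rewrite mulr_gt0// pi_gt0.
have d0 : 0 < e ^+ 2 / (4 * pi) by rewrite divr_gt0// exprn_gt0.
have [K hK] := tailb_ex (bessel (L2T_L2D Lh)) d0; exists K => f a Lf a0 ha.
have Lt := trig_L2D (zbox K) (fourier h); have Lf' := L2T_L2D Lf; have Lh' := L2T_L2D Lh.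
have -> : L2inner f h - L2inner f (trig (zbox K) (fourier h)) =
    L2inner f (fun t => h t - trig (zbox K) (fourier h) t).
  rewrite /L2inner -(cintB mD)//; try exact: L2D_conj.
  by congr cintegral; apply/funext => t; rewrite -mulrBr -rmorphB.
apply: L2inner_le => //; first exact: L2DB.
by apply: le_trans (L2_rate Lh hK) _; rewrite mulrC divfK// gt_eqF.
Qed.

Lemma oriented_le f g (t m : R) : ccont f -> ccont g ->
  (forall s, `|s| <= `|t| -> normc (f s - g s) <= m) ->
  normc (oriented_cintegral 0 t f - oriented_cintegral 0 t g) <= 2 * (m * `|t|).
Proof.
move=> hf hg h.
have aux a b : a <= b -> (forall s, a <= s <= b -> normc (f s - g s) <= m) ->
    normc (cintegral `[a, b] f - cintegral `[a, b] g) <= 2 * (m * (b - a)).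
  move=> ab hs; have mab : measurable (`[a, b]%classic : set T) by exact: measurable_itv.
  rewrite -(cintB mab (ccont_I _ _ hf) (ccont_I _ _ hg)) -(rint_cst m ab).
  apply: (cint_le mab); [by apply: cIB => //; exact: ccont_I|exact: rI_cst|].
  by move=> s /=; rewrite in_itv; exact: hs.
rewrite /oriented_cintegral; case: (leP 0 t) => [t0|/ltW t0].
  have := aux 0 t t0; rewrite subr0 (ger0_norm t0); apply => s /andP[s0 st].
  by apply: h; rewrite !ger0_norm.
have := aux t 0 t0; rewrite sub0r (ler0_norm t0) normcB.
rewrite (_ : - _ - - _ = cintegral `[t, 0] g - cintegral `[t, 0] f); last by rewrite opprK addrC.
apply => s /andP[s0 st].
by apply: h; rewrite !ler0_norm// lerN2.
Qed.

Lemma oriented_Z (c : R[i]) f t : ccont f ->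
  oriented_cintegral 0 t (fun s => c * f s) = c * oriented_cintegral 0 t f.
Proof.
move=> hf; rewrite /oriented_cintegral; case: leP => _.
  by rewrite (cintZ _ (measurable_itv _) (ccont_I _ _ hf)).
by rewrite (cintZ _ (measurable_itv _) (ccont_I _ _ hf)) mulrN.
Qed.

Variables (q gamma : R).
Local Notation ph := (phi (q / 2) (gamma / 2)).
Variables (v0 : R -> R[i]) (v F : R -> R -> R[i]) (N : R -> int -> R[i]).
Hypotheses (Lv0 : L2T v0) (Lv : forall t, L2T (v t)) (LF : forall t, L2T (F t)).
Hypothesis FN : forall t k, fourier (F t) k = (0 +i* 2) * N t k.
Hypothesis Ncont : forall k, ccont (fun t => N t k).

Let cis_split t s k : cis ((t - s) * ph k) = cis (t * ph k) * cis (- ph k * s).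
Proof. by rewrite -cisD; congr cis; ring. Qed.

Let GL t s : L2T (linear_group q gamma (t - s) (F s)).
Proof. by have [] := linear_group_spec q gamma (t - s) (LF s). Qed.

Let Gf t s k : fourier (linear_group q gamma (t - s) (F s)) k =
  (0 +i* 2) * cis (t * ph k) * (cis (- ph k * s) * N s k).
Proof.
have [_ ->] := linear_group_spec q gamma (t - s) (LF s).
by rewrite FN cis_split; ring.
Qed.

Let gcont k : ccont (fun s => cis (- ph k * s) * N s k).
Proof. by apply: ccontM => //; exact: ccont_cis. Qed.

Let i2 : (2 * (0 +i* 1) : R[i]) = 0 +i* 2.
Proof. by apply/eqP; rewrite eq_complex /=; apply/andP; split; apply/eqP; ring. Qed.

Let i2_neq0 : (0 +i* 2 : R[i]) != 0.
Proof. by rewrite eq_complex /= negb_and pnatr_eq0 orbT. Qed.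

(** Tested against an exponential, the Duhamel formula is the integrated
    equation for the coefficient multiplied by an integrating factor. *)
Lemma ode_of_duhamel : duhamel q gamma v0 F v ->
  (forall k, fourier (v 0) k = fourier v0 k) /\
  forall t k, cder (fun s => fourier (v s) k) t ((0 +i* ph k) * fourier (v t) k + N t k).
Proof.
move=> hd; pose A k t := oriented_cintegral 0 t (fun s => cis (- ph k * s) * N s k).
have E t k : fourier (v t) k = cis (ph k * t) * (fourier v0 k + A k t).
  have [I [[LI hI] hv]] := hd t.
  have Le : L2T (ee k : R -> R[i]) by apply: L2T_cont; [exact: ee_periodic|exact: ccont_cis].
  have inn f : L2inner f (ee k) = (2 * pi)%:C * fourier f k.
    by rewrite /L2inner; under [X in cintegral _ X]eq_fun do rewrite -eeN; rewrite cint_fourier opprK.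
  have [Lw hw] := linear_group_spec q gamma t Lv0.
  have [_] := hI _ Le; rewrite inn.
  rewrite (_ : (fun s => L2inner _ _) = fun s => ((2 * pi)%:C * ((0 +i* 2) * cis (t * ph k))) *
    (cis (- ph k * s) * N s k)); last by apply/funext => s; rewrite inn Gf; ring.
  rewrite oriented_Z// -/(A k t) -mulrA => /mulfI.
  have -> : (2 * pi)%:C != 0 :> R[i] by rewrite eq_complex /= eqxx andbT gt_eqF// pi2_gt0.
  move=> /(_ isT) hIk.
  have Li := L2T_L2D (L2TZ (0 +i* 2)^-1 LI).
  rewrite (@fourier_ae _ (v t) (fun x => linear_group q gamma t v0 x + (0 +i* 2)^-1 * I x)).
  - rewrite fourierD//; [|exact: L2T_L2D].
    rewrite fourierZ ?hw ?hIk; last exact: L2T_L2D.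
    by rewrite -[(0 +i* 2) * _ * _]mulrA mulKf// -mulrDr (mulrC t).
  - by have [] := L2T_L2D (Lv t).
  - by have [] := L2DD (L2T_L2D Lw) Li.
  - by apply: aeS hv => x -> _; rewrite i2 mulrC.
have A0 k : A k 0 = 0 by rewrite /A /oriented_cintegral lexx cint_point.
split=> [k|t k]; first by rewrite E A0 addr0 mulr0 cis0 mul1r.
rewrite (_ : (fun s => fourier (v s) k) = fun s => cis (ph k * s) * (fourier v0 k + A k s)); last first.
  by apply/funext => s; exact: E.
have hA : cder (A k) t (cis (- ph k * t) * N t k) := cFTC1 (gcont k) t.
apply: cder_eq (cderM (cder_cis (ph k) t) (cderD (cder_cst (fourier v0 k) t) hA)) _.
by rewrite add0r E mulNr cisVK mulrA.
Qed.

Hypothesis Nbound : forall t0, exists M, forall t, `|t| <= t0 -> l2b w1 (N t) M.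
Hypothesis v00 : forall k, fourier (v 0) k = fourier v0 k.
Hypothesis ode : forall t k,
  cder (fun s => fourier (v s) k) t ((0 +i* ph k) * fourier (v t) k + N t k).

Let energy t t0 : exists2 a, 0 < a & forall s, `|s| <= t0 ->
  \int[mu]_(x in D) sqmod (linear_group q gamma (t - s) (F s) x) <= a ^+ 2.
Proof.
have [M hM] := Nbound t0; exists (1 + `|12 * pi * (2 * M) ^+ 2|) => [|s hs].
  by rewrite ltr_wpDr.
have hs' : l2b w1 (fourier (linear_group q gamma (t - s) (F s))) (2 * M).
  have [M0 hb] := hM s hs; split; first by rewrite mulr_ge0.
  rewrite exprMn; apply: bsum_le (bsumZ (exprn_ge0 2 (ler0n _ 2)) hb) => n.
  rewrite /w1 !mul1r Gf !sqmodM !sqmod_cis mulr1 mul1r.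
  by rewrite {1}/sqmod /= expr0n/= add0r.
apply: le_trans (L2_energy (GL t s) hs') _; apply: le_trans (ler_norm _) _.
move: `|_| (normr_ge0 (12 * pi * (2 * M) ^+ 2)) => x x0; nra.
Qed.

(** Paired with a trigonometric polynomial, the integrand is the derivative of
    a finite sum, and the fundamental theorem of calculus applies. By
    [L2inner_approx] the error for general h is uniform in time, which also
    gives the continuity of the integrand. *)
Lemma duhamel_of_ode : duhamel q gamma v0 F v.
Proof.
move=> t; have [Lw hw] := linear_group_spec q gamma t Lv0.
pose I x := (0 +i* 2) * (v t x - linear_group q gamma t v0 x).
have LI : L2T I by apply: L2TZ; exact: L2TB.
have fI k : fourier I k = (0 +i* 2) * (fourier (v t) k - cis (t * ph k) * fourier v0 k).
  by rewrite fourierZ ?fourierB ?hw//; [exact: L2T_L2D|exact: L2T_L2D|apply: L2DB; exact: L2T_L2D].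
exists I; split; last first.
  apply: aeW => x; rewrite /I i2 [_ * (_ - _)]mulrC mulfK//.
  by rewrite addrC subrK.
split=> // h Lh; pose G s := linear_group q gamma (t - s) (F s).
pose S K s := L2inner (G s) (trig (zbox K) (fourier h)).
pose Q K s := (2 * pi)%:C * \sum_(n <- zbox K)
  (conjc (fourier h n) * ((0 +i* 2) * cis (t * ph n))) * (cis (- ph n * s) * fourier (v s) n).
have SE K : S K = fun s => (2 * pi)%:C * \sum_(n <- zbox K)
    (conjc (fourier h n) * ((0 +i* 2) * cis (t * ph n))) * (cis (- ph n * s) * N s n).
  apply/funext => s; rewrite /S (L2inner_trig _ _ (GL t s)); congr ((2 * pi)%:C * _); apply: eq_bigr => n _.
  by rewrite Gf mulrC [LHS]mulrA.
have Sc K : ccont (S K).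
  rewrite SE; apply: ccontM; first exact: ccont_cst.
  by apply: ccont_sum => n; apply: ccontM => //; exact: ccont_cst.
have dQ K s : cder (Q K) s (S K s).
  rewrite SE; apply: cderZ; apply: cder_sum => n; apply: cderZ.
  apply: cder_eq (cderM (cder_cis (- ph n) s) (ode s n)) _.
  have -> : (0 +i* - ph n : R[i]) = - (0 +i* ph n) by apply/eqP; rewrite eq_complex /= oppr0 !eqxx.
  by ring.
have SI K : oriented_cintegral 0 t (S K) = L2inner I (trig (zbox K) (fourier h)).
  rewrite (@oriented_FTC2 _ 0 t (Q K))// L2inner_trig// /Q -mulrBr -sumrB; congr (_ * _).
  apply: eq_bigr => n _; rewrite fI mulr0 cis0 mul1r v00 -mulrBr mulNr.
  rewrite (mulrC t) -!mulrA mulrCA; congr (_ * _).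
  rewrite [RHS]mulrC; congr (_ * _); rewrite mulrBr cisVK//.
pose fi s := L2inner (G s) h.
have fic : ccont fi.
  apply: ccontP => s0; apply: ccvgP => e e0.
  have [a a0 ha] := energy t (`|s0| + 1).
  have e1 : 0 < e / (8 * a) by rewrite divr_gt0// mulr_gt0.
  have [K hK] := L2inner_approx Lh e1.
  have n1 : \forall s \near nbhs s0, `|s| <= `|s0| + 1.
    have : \forall s \near s0, `|s| < `|s0| + 1.
      by have := @norm_continuous _ R s0; move=> /cvgr_lt; apply; rewrite ltrDl.
    by apply: filterS => s /ltW.
  have n2 : \forall s \near nbhs s0, normc (S K s - S K s0) <= e / 2.
    by apply: ccvg_near; [exact: ccont_cvg|exact: divr_gt0].
  apply: filterS2 n1 n2 => s hs hS.
  have b s' : `|s'| <= `|s0| + 1 -> normc (fi s' - S K s') <= e / 4.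
    move=> hs'; apply: le_trans (hK _ _ (GL t s') a0 (ha _ hs')) _.
    by rewrite [leLHS](_ : _ = e / 4)//; field; rewrite gt_eqF.
  have b1 := b s hs; have b2 : normc (fi s0 - S K s0) <= e / 4 by apply: b; rewrite lerDl.
  have eE : e = e / 4 + e / 4 + e / 2 by field.
  rewrite eE; exact: normc_close b1 b2 hS.
split; first exact: ccont_I.
apply/eqP; rewrite -subr_eq0; apply/eqP; apply: normc_eps => e e0.
have [a a0 ha] := energy t `|t|.
have [aI aI0 haI] : exists2 a', 0 < a' & \int[mu]_(x in D) sqmod (I x) <= a' ^+ 2.
  exists (1 + `|\int[mu]_(x in D) sqmod (I x)|); first by rewrite ltr_wpDr.
  apply: le_trans (ler_norm _) _.
  move: `|_| (normr_ge0 (\int[mu]_(x in D) sqmod (I x))) => x x0; nra.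
have C0 : 0 < 2 * aI + 4 * a * `|t|.
  by rewrite ltr_pwDl ?mulr_gt0// !mulr_ge0// ltW.
have [K hK] := L2inner_approx Lh (divr_gt0 e0 C0).
set e' := e / _ in hK.
have h1 := hK _ _ LI aI0 haI.
have h2 : normc (oriented_cintegral 0 t fi - oriented_cintegral 0 t (S K)) <= 2 * (2 * a * e' * `|t|).
  by apply: oriented_le => // s hs; exact: hK (GL t s) a0 (ha _ hs).
have h3 : normc (L2inner I (trig (zbox K) (fourier h)) - oriented_cintegral 0 t (S K)) <= 0.
  by rewrite SI subrr normc0.
apply: le_trans (normc_close h1 h2 h3) _; rewrite addr0.
rewrite [leLHS](_ : _ = (2 * aI + 4 * a * `|t|) * e'); last by ring.
by rewrite mulrC divfK// gt_eqF.
Qed.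

End Duhamel.

(** * Well-posedness *)

Section WellPosedness.
Context {R : realType}.
Local Notation state := (bool -> int -> R[i]).
Implicit Types (u z : R -> R -> R[i]).

Lemma l2b_diff (f g : R -> R[i]) B : L2T f -> L2T g ->
  l2b w (fun k => fourier f k - fourier g k) B ->
  (H1sqnorm (fun x => (f x - g x)%R) < +oo)%E /\ H1norm (fun x => f x - g x) <= B.
Proof.
move=> hf hg h; apply: l2b_H1; apply: eq_l2b h => k.
by rewrite fourierB//; exact: L2T_L2D.
Qed.

Lemma diff_l2b (f g : R -> R[i]) : H1T f -> H1T g ->
  l2b w (fun k => fourier f k - fourier g k) (H1norm (fun x => f x - g x)).
Proof.
move=> [Lf hf] [Lg hg].
have [h _] := l2b_diff Lf Lg (l2bB (@w_ge0 R) (H1_l2b hf) (H1_l2b hg)).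
apply: eq_l2b (H1_l2b h) => k.
by rewrite fourierB//; exact: L2T_L2D.
Qed.

Lemma H1norm_le (f g : R -> R[i]) : H1T f -> H1T g ->
  H1norm f <= H1norm g + H1norm (fun x => f x - g x).
Proof.
move=> hf hg; apply: (l2b_H1 _).2.
apply: eq_l2b (l2bD (@w_ge0 R) (H1_l2b hg.2) (diff_l2b hf hg)) => k.
by rewrite addrC subrK.
Qed.

Lemma H1norm_sym (f g : R -> R[i]) : H1T f -> H1T g ->
  H1norm (fun x => f x - g x) <= H1norm (fun x => g x - f x).
Proof.
move=> hf hg; apply: (l2b_diff hf.1 hg.1 _).2.
by apply: eq_l2b (l2bN (diff_l2b hg hf)) => k; rewrite opprB.
Qed.

Lemma abs_dist_le (a b d1 d2 e : R) : a <= b + d1 -> b <= a + d2 -> d1 <= e -> d2 <= e ->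
  `|b - a| <= e.
Proof. by move=> *; rewrite ler_norml; apply/andP; split; lra. Qed.

(** The H^1 norm is a continuous function of time. *)
Lemma H1_bounded u : continuous_H1 u ->
  forall t0, exists B, forall t, `|t| <= t0 -> l2b w (fourier (u t)) B.
Proof.
move=> [hu hc] t0; pose n t := H1norm (u t).
have nc : continuous n.
  move=> t; apply/cvgrPdist_le => e e0.
  have /cvgr0Pnorm_le/(_ _ e0) := hc t; apply: filterS => s hs.
  have {}hs : H1norm (fun x => u s x - u t x) <= e by apply: le_trans (ler_norm _) hs.
  have h1 := H1norm_le (hu s) (hu t); have h2 := H1norm_le (hu t) (hu s).
  have h3 := H1norm_sym (hu t) (hu s).
  exact: abs_dist_le h1 h2 hs (le_trans h3 hs).
have [h0|h0] := leP 0 t0; last by exists 0 => t ht; have := le_trans (normr_ge0 t) ht; rewrite leNgt h0.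
have h1 : - t0 <= t0 by lra.
have [c _ hcm] := EVT_max h1 (continuous_subspaceT nc).
exists (n c) => t ht; apply: l2bW (H1_l2b (hu t).2).
by apply: hcm; rewrite in_itv /= -ler_norml.
Qed.

Variables (alpha beta : R).

(** By [Ncub_sub]. *)
Lemma Ncub_ccont (U : R -> state) :
  (forall T, exists B, forall t, `|t| <= T -> hb (U t) B) ->
  (forall t0 e, 0 < e -> \forall t \near t0, hb (fun j n => U t j n - U t0 j n) e) ->
  forall j n, ccont (fun t => Ncub alpha beta (U t) j n).
Proof.
move=> hB hc j n; apply: ccontP => t; apply: ccvgP => e e0.
have [B hB'] := hB (`|t| + 1).
have ht : hb (U t) B by apply: hB'; rewrite lerDl.
have B0 := hb_ge0 ht; have S00 : 0 <= S0 alpha beta by exact: sqrtr_ge0.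
pose C := 6 * S0 alpha beta * B ^+ 2 + 1.
have C0 : 0 < C by rewrite ltr_wpDl// !mulr_ge0// sqr_ge0.
have n1 : \forall s \near t, `|s| <= `|t| + 1.
  have : \forall s \near t, `|s| < `|t| + 1.
    by have := @norm_continuous _ R t; move=> /cvgr_lt; apply; rewrite ltrDl.
  by apply: filterS => s /ltW.
apply: filterS2 n1 (hc t _ (divr_gt0 e0 C0)) => s hs hd.
apply: le_trans (l2b_term1 (lexx _) (Ncub_sub alpha beta j (hB' s hs) ht hd)) _.
rewrite mulrA ler_pdivrMr// mulrC ler_wpM2l ?(ltW e0)//.
by rewrite /C lerDl.
Qed.

Variables (q gamma : R).
Local Notation wsolu := (wsol alpha beta (q / 2) (gamma / 2)).

Definition traj u z (t : R) : state := coefs (u t) (z t).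

Lemma traj_bounded u z :
  (forall T, exists B, forall t, `|t| <= T -> l2b w (fourier (u t)) B) ->
  (forall T, exists B, forall t, `|t| <= T -> l2b w (fourier (z t)) B) ->
  forall T, exists B, forall t, `|t| <= T -> hb (traj u z t) B.
Proof.
move=> hu hz T; have [B1 h1] := hu T; have [B2 h2] := hz T.
exists (Num.max B1 B2) => t ht [] /=.
  by apply: l2bW (h2 t ht); rewrite le_max lexx orbT.
by apply: l2bW (h1 t ht); rewrite le_max lexx.
Qed.

Section Trajectory.
Variables (u0 z0 : R -> R[i]) (u z : R -> R -> R[i]).
Hypotheses (Lu0 : L2T u0) (Lz0 : L2T z0).
Hypotheses (Lu : forall t, L2T (u t)) (Lz : forall t, L2T (z t)).
Hypothesis bnd : forall T, exists B, forall t, `|t| <= T -> hb (traj u z t) B.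
Hypothesis cont : forall t0 e, 0 < e ->
  \forall t \near t0, hb (fun j n => traj u z t j n - traj u z t0 j n) e.
Let N j t := Ncub alpha beta (traj u z t) j.

Let Ncont j k : ccont (fun t => N j t k).
Proof. exact: Ncub_ccont. Qed.

Let Nbound j t0 : exists M, forall t, `|t| <= t0 -> l2b w1 (N j t) M.
Proof.
have [B hB] := bnd t0; exists (2 * S0 alpha beta * B ^+ 3) => t ht.
by apply: Ncub_bound; exact: hB.
Qed.

Let F1 t : L2T (nonlinearity alpha beta (u t) (z t)) /\
  forall k, fourier (nonlinearity alpha beta (u t) (z t)) k = (0 +i* 2) * N false t k.
Proof.
have [B hB] := bnd `|t|; have h := hB t (lexx _).
exact: nonlinearity_spec (Lu t) (Lz t) (h false) (h true).
Qed.

Let F2 t : L2T (nonlinearity alpha beta (z t) (u t)) /\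
  forall k, fourier (nonlinearity alpha beta (z t) (u t)) k = (0 +i* 2) * N true t k.
Proof.
have [B hB] := bnd `|t|; have h := hB t (lexx _).
have [h1 h2] := nonlinearity_spec alpha beta (Lz t) (Lu t) (h true) (h false).
split; first exact: h1.
have e : coefs (z t) (u t) = fun j => traj u z t (~~ j) by apply/funext => -[].
by move=> k; rewrite h2 e Ncub_swap.
Qed.

Lemma wsol_of_solution : is_solution q gamma beta alpha u0 z0 u z ->
  traj u z 0 = coefs u0 z0 /\ wsolu (traj u z).
Proof.
move=> [d1 d2].
have [e1 o1] := ode_of_duhamel Lu0 Lu (fun t => (F1 t).1) (fun t => (F1 t).2) (Ncont false) d1.
have [e2 o2] := ode_of_duhamel Lz0 Lz (fun t => (F2 t).1) (fun t => (F2 t).2) (Ncont true) d2.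
split; first by apply/funext => -[]; apply/funext => k /=; rewrite ?e1 ?e2.
by move=> t [] n; [exact: o2|exact: o1].
Qed.

Lemma solution_of_wsol : traj u z 0 = coefs u0 z0 -> wsolu (traj u z) ->
  is_solution q gamma beta alpha u0 z0 u z.
Proof.
move=> h0 hs; split.
  apply: (duhamel_of_ode Lu0 Lu (fun t => (F1 t).1) (fun t => (F1 t).2) (Ncont false) (Nbound false)).
    by move=> k; exact: (congr1 (fun V : state => V false k) h0).
  by move=> t k; exact: hs t false k.
apply: (duhamel_of_ode Lz0 Lz (fun t => (F2 t).1) (fun t => (F2 t).2) (Ncont true) (Nbound true)).
  by move=> k; exact: (congr1 (fun V : state => V true k) h0).
by move=> t k; exact: hs t true k.
Qed.

End Trajectory.

End WellPosedness.

Theorem theorem1p13 (R : realType) (q gamma beta alpha : R)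
    (hgamma : gamma <> 0) (u0 w0 : R -> R[i])
    (hu0 : H1T u0) (hw0 : H1T w0) :
  exists u w : R -> R -> R[i],
    [/\ continuous_H1 u, continuous_H1 w,
        is_solution q gamma beta alpha u0 w0 u w &
        forall u' w' : R -> R -> R[i],
          continuous_H1 u' -> continuous_H1 w' ->
          is_solution q gamma beta alpha u0 w0 u' w' ->
          forall t : R, eqae (u' t) (u t) /\ eqae (w' t) (w t)].
Proof.
have b0 : gamma / 2 != 0 by rewrite mulf_neq0 ?invr_eq0 ?pnatr_eq0//; exact/eqP.
have hU0 : hb (coefs u0 w0) (Num.max (H1norm u0) (H1norm w0)).
  case; [apply: l2bW (H1_l2b hw0.2)|apply: l2bW (H1_l2b hu0.2)]; rewrite le_max; apply/orP.
    by right; exact: lexx.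
  by left; exact: lexx.
have [U [U00 Us Ub]] := wsol_exists alpha beta (q / 2) b0 hU0.
pose u t := ser (U t false); pose z t := ser (U t true).
have Ubt t : exists B, hb (U t) B by have [B hB] := Ub `|t|; exists B; exact: hB.
have hL j t : L2T (ser (U t j)) by have [B hB] := Ubt t; exact: ser_L2T (hB j).
have hf j t : fourier (ser (U t j)) = U t j.
  by have [B hB] := Ubt t; apply/funext => k; exact: fourier_ser (hB j).
have trE : traj u z = U by apply/funext => t; apply/funext => -[]; rewrite /traj /= hf.
have hH j t : H1T (ser (U t j)).
  split; first exact: hL.
  by have [B hB] := Ubt t; apply: (l2b_H1 (B := B) _).1; rewrite hf; exact: hB.
have near_hb t0 e : 0 < e -> \forall t \near t0, hb (fun j n => U t j n - U t0 j n) e.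
  move=> e0; have [d d0 hd] := wsol_continuous b0 Us Ub t0 e0.
  exists d => // t /= ht; apply: hd; rewrite distrC; exact: ltW.
have hc j : continuous_H1 (fun t => ser (U t j)).
  split=> [t|t0]; first exact: hH.
  apply/cvgr0Pnorm_le => e e0.
  apply: filterS (near_hb t0 e e0) => t ht; rewrite ger0_norm ?H1norm_ge0//.
  by apply: (l2b_diff (hL j t) (hL j t0) _).2; rewrite !hf; exact: ht.
exists u, z; split; [exact: hc|exact: hc| |].
  by apply: (solution_of_wsol hu0.1 hw0.1 (hL false) (hL true)); rewrite trE.
move=> u' z' hu' hz' hs t.
have bnd := traj_bounded (H1_bounded hu') (H1_bounded hz').
have cont t0 e : 0 < e -> \forall s \near t0, hb (fun j n => traj u' z' s j n - traj u' z' t0 j n) e.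
  move=> e0.
  have /cvgr0Pnorm_le/(_ _ e0) h1 := hu'.2 t0; have /cvgr0Pnorm_le/(_ _ e0) h2 := hz'.2 t0.
  apply: filterS2 h1 h2 => s h1 h2 [].
    by apply: l2bW (diff_l2b (hz'.1 s) (hz'.1 t0)); exact: le_trans (ler_norm _) h2.
  by apply: l2bW (diff_l2b (hu'.1 s) (hu'.1 t0)); exact: le_trans (ler_norm _) h1.
have [i0 ws] := wsol_of_solution hu0.1 hw0.1 (fun t => (hu'.1 t).1) (fun t => (hz'.1 t).1) bnd cont hs.
have E : traj u' z' t = U t.
  by apply: (wsol_unique b0 ws Us bnd Ub); rewrite i0.
split; apply: fourier_complete => [||k]; try exact: hL.
- exact: (hu'.1 t).1.
- by rewrite hf -E.
- exact: (hz'.1 t).1.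
- by rewrite hf -E.
Qed.
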